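(* Let $m,\lambda,\beta,k_BT>0$ be constants, let $K$ satisfy the kernel assumptions (I), (II) and (III) listed in the context, and let $F$ and $\dot W$ be the uncorrelated stationary random distributions described in the context. Let $V$ be a weak stationary solution (in the sense defined in the context) of the free-particle generalized Langevin equation $$m\dot v(t)=-\lambda v(t)-\beta\int_{-\infty}^tK(t-s)v(s)\,ds+\sqrt{\beta k_BT}\,F(t)+\sqrt{2\lambda k_BT}\,\dot W(t),$$ and let $v(t)=\langle V,\delta_t\rangle$ be the associated process. Then $$\mathbb E[m\,v(0)^2]=k_BT.$$
   Context: Fourier conventions. $\widehat f(\omega)=\int_{\mathbb R}f(t)e^{-\mathrm{i}t\omega}dt$. $\mathcal S$ is the Schwartz space on $\mathbb R$ and $\mathcal S'$ its dual; the Fourier transform $\mathcal F[g]$ of $g\in\mathcal S'$ is defined by $\langle\mathcal F[g],\varphi\rangle=\langle g,\widehat\varphi\rangle$, $\varphi\in\mathcal S$. $L^2(\Omega)$ is the space of square-integrable complex-valued random variables; $\delta_t$ is the Dirac distribution at $t$. Completely monotonic functions. $f:(0,\infty)\to[0,\infty)$ belongs to $\mathcal{CM}$ if $f\in C^\infty(0,\infty)$ and $(-1)^nf^{(n)}(t)\ge0$ for all $n\ge0$, $t>0$. Kernel assumptions. $K:\mathbb R\to\mathbb R\cup\{\infty\}$ is real-valued for $t\ne0$ (possibly infinite at $t=0$). (I) (a) $K\in L^1_{loc}(\mathbb R)$ is symmetric around zero and positive for all nonzero $t$; (b) $K(t)\to0$ as $t\to\infty$ and $K$ is eventually decreasing;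 (c) the improper integral $\mathcal K_{\cos}(\omega)=\int_0^\infty K(t)\cos(\omega t)\,dt$ is positive for all nonzero $\omega$. (II) Either (a) $K\in L^1(\mathbb R)$; or (b) $K(t)\sim t^{-1}$ as $t\to\infty$; or (c) there is $\alpha\in(0,1)$ with $K(t)\sim t^{-\alpha}$ as $t\to\infty$. Here $f(t)\sim g(t)$ means $\lim_{t\to\infty}f(t)/g(t)=c$ for some $c\in(0,\infty)$. (III) Either (a) $K\in\mathcal{CM}$ (i.e. its restriction to $(0,\infty)$ is); or (b) $K(t)=\varphi(t^2)$ (for $t\neq 0$) with $\varphi\in\mathcal{CM}$. Noise. $F,\dot W:\mathcal S\to L^2(\Omega)$ are stationary random distributions (linear functionals on $\mathcal S$ whose first and second moments are invariant under translation of test functions) with, for $\varphi_1,\varphi_2\in\mathcal S$, $$\mathbb E[\langle\dot W,\varphi_1\rangle\overline{\langle\dot W,\varphi_2\rangle}]=\frac1{2\pi}\int_{\mathbb R}\widehat{\varphi_1}\,\overline{\widehat{\varphi_2}}\,d\omega,\quad \mathbb E[\langle F,\varphi_1\rangle\overline{\langle F,\varphi_2\rangle}]=\frac1{2\pi}\int_{\mathbb R}2\mathcal K_{\cos}(\omega)\widehat{\varphi_1}(\omega)\overline{\widehat{\varphi_2}(\omega)}\,d\omega,\quad \mathbb E[\langle\dot W,\varphi_1\rangle\overline{\langle F,\varphi_2\rangle}]=0.$$ Stationary operators ($d=1$). Let $\nu$ be a nonnegative Borel measure on $\mathbb R$, absolutely continuous with respect to Lebesgue measure, with $\int_{\mathbb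 R}\frac{\nu(d\omega)}{(1+\omega^2)^p}<\infty$ for some $p\in\mathbb R$. A random measure with respect to $\nu$ is a map $Z$ from the Borel sets of finite $\nu$-measure to $L^2(\Omega)$ with $\mathbb E[Z(E_1)\overline{Z(E_2)}]=\nu(E_1\cap E_2)$. The associated stationary operator $V$, with spectral measure $\nu$, is $\langle V,g\rangle=\int_{\mathbb R}\mathcal F[g](\omega)\,Z(d\omega)$, defined for those $g\in\mathcal S'$ whose Fourier transform is a function in $L^2(\nu)$. As throughout for solutions of the Langevin equation, $V$ is real (real-valued on real-valued test functions). Weak stationary solution. For $\varphi\in\mathcal S$ let $$\Psi(\varphi)(t)=-m\varphi'(t)+\lambda\varphi(t)+\beta\int_0^\infty K(s)\varphi(t+s)\,ds .$$ A stationary operator $V$ is a weak stationary solution if $\mathbb E|\langle V,\Psi(\varphi)\rangle|^2<\infty$ for all $\varphi\in\mathcal S$ (in particular $\langle V,\Psi(\varphi)\rangle$ is defined) and, for all $\varphi_1,\varphi_2\in\mathcal S$, $$\mathbb E\big[\langle V,\Psi(\varphi_1)\rangle\overline{\langle V,\Psi(\varphi_2)\rangle}\big]=k_BT\Big(\beta\,\mathbb E[\langle F,\varphi_1\rangle\overline{\langle F,\varphi_2\rangle}]+2\lambda\,\mathbb E[\langle\dot W,\varphi_1\rangle\overline{\langle\dot W,\varphi_2\rangle}]\Big).$$ *)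

(* Defs.v *)
From HB Require Import structures.
From mathcomp Require Import all_boot all_order all_algebra.
From mathcomp Require Import complex.
From mathcomp Require Import all_classical all_reals all_analysis.

Set Implicit Arguments.
Unset Strict Implicit.
Unset Printing Implicit Defensive.

Import Order.TTheory GRing.Theory Num.Theory.
Import numFieldNormedType.Exports.
Import ComplexField.Normc.

Local Open Scope classical_set_scope.
Local Open Scope complex_scope.
Local Open Scope ring_scope.

Section complex_integration.
Context {d : measure_display} {T : measurableType d} {R : realType}.
Implicit Types (mu : {measure set T -> \bar R}) (f : T -> R[i]).

Definition cmeasurable f : Prop :=
  measurable_fun setT (fun x => complex.Re (f x)) /\
  measurable_fun setT (fun x => complex.Im (f x)).

Definition cintegrable mu f : Prop :=
  mu.-integrable setT (fun x => (complex.Re (f x))%:E) /\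
  mu.-integrable setT (fun x => (complex.Im (f x))%:E).

Definition cintegral mu (D : set T) f : R[i] :=
  (\int[mu]_(x in D) complex.Re (f x)) +i* (\int[mu]_(x in D) complex.Im (f x)).

(* Squared L^2 seminorm, with values in [0, +oo]. *)
Definition sqnorm mu f : \bar R := (\int[mu]_x ((normc (f x)) ^+ 2)%:E)%E.

Definition L2 mu f : Prop := cmeasurable f /\ (sqnorm mu f < +oo)%E.

End complex_integration.

Section expectation.
Context {d : measure_display} {T : measurableType d} {R : realType}.
Variable P : probability T R.

Definition cexpect (X : T -> R[i]) : R[i] := cintegral P setT X.

Definition correl (X Y : T -> R[i]) : R[i] := cexpect (fun w => X w * (Y w)^*).

End expectation.

Section schwartz_distributions.
Context {R : realType}.
Implicit Types (f h phi psi : R -> R[i]).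

Notation leb := (@lebesgue_measure R).

Definition cderive f : R -> R[i] := fun t =>
  derive1 (fun s => complex.Re (f s)) t +i*
  derive1 (fun s => complex.Im (f s)) t.

Definition cderiven (n : nat) f : R -> R[i] := iter n cderive f.

Definition csmooth f : Prop := forall (n : nat) (t : R),
  derivable (fun s => complex.Re (cderiven n f s)) t 1 /\
  derivable (fun s => complex.Im (cderiven n f s)) t 1.

Definition schwartz phi : Prop := csmooth phi /\
  forall k n : nat, exists M : R, forall t : R,
    `|t| ^+ k * normc (cderiven n phi t) <= M.

Definition cexpi (x : R) : R[i] := cos x +i* sin x.

Definition fourier f : R -> R[i] := fun w =>
  cintegral leb setT (fun t => f t * cexpi (- (t * w))).

(* Distributions are functionals on all functions R -> R[i]; only their values
   on Schwartz functions matter. *)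
Definition functional := (R -> R[i]) -> R[i].

(* S': continuity is stated with the seminorms sup_t |t|^k |phi^(n)(t)|,
   k, n <= N, a bound M on all of them standing for their maximum. *)
Definition tempered (g : functional) : Prop :=
  (forall (a : R[i]) phi psi, schwartz phi -> schwartz psi ->
     g (fun t => a * phi t + psi t) = a * g phi + g psi) /\
  exists (N : nat) (C : R), forall phi (M : R), schwartz phi ->
    (forall k n : nat, (k <= N)%N -> (n <= N)%N -> forall t : R,
       `|t| ^+ k * normc (cderiven n phi t) <= M) ->
    normc (g phi) <= C * M.

Definition fourier_dist (g : functional) : functional :=
  fun phi => g (fourier phi).

Definition regular_dist h : functional :=
  fun psi => cintegral leb setT (fun t => h t * psi t).

Definition is_function (g : functional) h : Prop :=
  cmeasurable h /\
  forall psi, schwartz psi ->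
    cintegrable leb (fun t => h t * psi t) /\ g psi = regular_dist h psi.

Definition delta_dist (t : R) : functional := fun phi => phi t.

End schwartz_distributions.

Section kernel.
Context {R : realType}.
Implicit Types (f g phi : R -> R) (K : R -> \bar R).

Notation leb := (@lebesgue_measure R).

(* Only the values of f on (0, +oo) matter. *)
Definition completely_monotone f : Prop := forall (n : nat) (t : R), 0 < t ->
  derivable (derive1n n f) t 1 /\ 0 <= (-1) ^+ n * derive1n n f t.

(* f ~ g at +oo, up to a positive constant. *)
Definition asymp_equiv f g : Prop :=
  exists2 c : R, 0 < c & f t / g t @[t --> +oo] --> c.

(* The real-valued version of a kernel: K may be +oo at the null set {0},
   where [fine] returns 0. *)
Definition rker K : R -> R := fun t => fine (K t).

Definition Kcos_trunc K (w N : R) : R :=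
  \int[leb]_(t in `[0, N]) (rker K t * cos (w * t)).

Definition Kcos K (w : R) : R := lim (Kcos_trunc K w N @[N --> +oo]).

Definition kernel_range K : Prop :=
  (forall t : R, t != 0 -> K t \is a fin_num) /\ K 0 != -oo%E.

Definition kernel_I K : Prop :=
  [/\ [/\ locally_integrable setT (rker K),
          forall t : R, K (- t) = K t &
          forall t : R, t != 0 -> (0 < K t)%E],
      rker K t @[t --> +oo] --> (0 : R) /\
      (exists t0 : R, forall s t : R, t0 <= s -> s <= t -> (K t <= K s)%E) &
      forall w : R, w != 0 ->
        cvg (Kcos_trunc K w N @[N --> +oo]) /\ 0 < Kcos K w].

Definition kernel_II K : Prop :=
  [\/ leb.-integrable setT K,
      asymp_equiv (rker K) (fun t => t^-1) |
      exists2 alpha : R, 0 < alpha < 1 &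
        asymp_equiv (rker K) (fun t => t `^ (- alpha))].

Definition kernel_III K : Prop :=
  completely_monotone (rker K) \/
  exists2 phi, completely_monotone phi &
    forall t : R, t != 0 -> K t = (phi (t ^+ 2))%:E.

End kernel.

Section noise.
Context {d : measure_display} {Omega : measurableType d} {R : realType}.
Variable P : probability Omega R.

Notation leb := (@lebesgue_measure R).

(* As for tempered distributions, only the values on Schwartz functions
   matter. *)
Definition random_functional := (R -> R[i]) -> Omega -> R[i].

Definition translate (h : R) (phi : R -> R[i]) : R -> R[i] :=
  fun t => phi (t + h).

Definition stationary_random_distribution (X : random_functional) : Prop :=
  [/\ forall phi, schwartz phi -> L2 P (X phi),
      forall (a : R[i]) phi psi, schwartz phi -> schwartz psi ->
        {ae P, forall w,
           X (fun t => a * phi t + psi t) w = a * X phi w + X psi w},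
      forall (h : R) phi, schwartz phi ->
        cexpect P (X (translate h phi)) = cexpect P (X phi) &
      forall (h : R) phi psi, schwartz phi -> schwartz psi ->
        correl P (X (translate h phi)) (X (translate h psi)) =
        correl P (X phi) (X psi)].

Definition has_spectral_density (X : random_functional) (s : R -> R) : Prop :=
  forall phi psi, schwartz phi -> schwartz psi ->
    correl P (X phi) (X psi) =
    ((2 * pi)^-1)%:C *
      cintegral leb setT
        (fun w => (s w)%:C * (fourier phi w * (fourier psi w)^*)).

Definition uncorrelated (X Y : random_functional) : Prop :=
  forall phi psi, schwartz phi -> schwartz psi -> correl P (X phi) (Y psi) = 0.

End noise.

Section stationary_operators.
Context {d : measure_display} {Omega : measurableType d} {R : realType}.
Variable P : probability Omega R.

Definition finite_Borel (nu : {measure set R -> \bar R}) (E : set R) : Prop :=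
  measurable E /\ (nu E < +oo)%E.

Definition is_random_measure (nu : {measure set R -> \bar R})
    (Z : set R -> Omega -> R[i]) : Prop :=
  (forall E, finite_Borel nu E -> L2 P (Z E)) /\
  (forall E1 E2, finite_Borel nu E1 -> finite_Borel nu E2 ->
     correl P (Z E1) (Z E2) = (fine (nu (E1 `&` E2)))%:C).

(* A list s of pairs (c, E) stands for the simple function
   \sum_i c_i 1_{E_i}. *)
Definition simple (s : seq (R[i] * set R)) : R -> R[i] :=
  fun x => \sum_(p <- s) p.1 * (\1_(p.2) x : R)%:C.

Definition simple_int (Z : set R -> Omega -> R[i]) (s : seq (R[i] * set R)) :
    Omega -> R[i] :=
  fun w => \sum_(p <- s) p.1 * Z p.2 w.

(* X = \int h(w) Z(dw): the L^2 limit of the integrals of simple functions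
   that converge to h in L^2(nu). *)
Definition is_stochastic_integral (nu : {measure set R -> \bar R})
    (Z : set R -> Omega -> R[i]) (h : R -> R[i]) (X : Omega -> R[i]) : Prop :=
  L2 P X /\
  exists s : nat -> seq (R[i] * set R),
    [/\ forall n i, (i < size (s n))%N ->
          finite_Borel nu (nth (0, set0) (s n) i).2,
        sqnorm nu (fun x => h x - simple (s n) x) @[n --> \oo] --> 0%E &
        sqnorm P (fun w => X w - simple_int Z (s n) w) @[n --> \oo] --> 0%E].

Record stationary_operator := StationaryOperator {
  spectral_measure : {measure set R -> \bar R} ;
  random_measure : set R -> Omega -> R[i] ;
  spectral_measure_ac : spectral_measure `<< @lebesgue_measure R ;
  spectral_measure_growth : exists p : R,
    (\int[spectral_measure]_w ((1 + w ^+ 2) `^ (- p))%:E < +oo)%E ;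
  random_measureP : is_random_measure spectral_measure random_measure
}.

Definition fourier_L2 (V : stationary_operator) (g : functional)
    (h : R -> R[i]) : Prop :=
  is_function (fourier_dist g) h /\ L2 (spectral_measure V) h.

Definition domain (V : stationary_operator) (g : @functional R) : Prop :=
  tempered g /\ exists h, fourier_L2 V g h.

(* <V, g>; it is determined almost surely by g, and is 0 by convention
   outside of the domain of V. *)
Definition pairing (V : stationary_operator) (g : functional) :
    Omega -> R[i] :=
  xget (fun=> 0) [set X | domain V g /\ exists2 h, fourier_L2 V g h &
    is_stochastic_integral (spectral_measure V) (random_measure V) h X].

Definition real_operator (V : stationary_operator) : Prop :=
  forall phi : R -> R[i], schwartz phi -> (forall t, complex.Im (phi t) = 0) ->
    {ae P, forall w, complex.Im (pairing V (regular_dist phi) w) = 0}.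

End stationary_operators.

Section langevin.
Context {d : measure_display} {Omega : measurableType d} {R : realType}.
Variable P : probability Omega R.

Notation leb := (@lebesgue_measure R).

Definition Psi (m lambda beta : R) (K : R -> \bar R) (phi : R -> R[i]) :
    R -> R[i] := fun t =>
  - m%:C * cderive phi t + lambda%:C * phi t +
  beta%:C * cintegral leb `[0, +oo[ (fun s => (rker K s)%:C * phi (t + s)).

Definition Psi_dist (m lambda beta : R) (K : R -> \bar R) (phi : R -> R[i]) :
    functional := regular_dist (Psi m lambda beta K phi).

Definition weak_stationary_solution (m lambda beta kBT : R) (K : R -> \bar R)
    (F Wdot : @random_functional _ Omega R) (V : stationary_operator P) :
    Prop :=
  (forall phi, schwartz phi ->
     domain V (Psi_dist m lambda beta K phi) /\
     (sqnorm P (pairing V (Psi_dist m lambda beta K phi)) < +oo)%E) /\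
  (forall phi1 phi2, schwartz phi1 -> schwartz phi2 ->
     correl P (pairing V (Psi_dist m lambda beta K phi1))
              (pairing V (Psi_dist m lambda beta K phi2)) =
     kBT%:C * (beta%:C * correl P (F phi1) (F phi2) +
               (2 * lambda)%:C * correl P (Wdot phi1) (Wdot phi2))).

Definition velocity (V : stationary_operator P) (t : R) : Omega -> R[i] :=
  pairing V (delta_dist t).

End langevin.

(* Main.v *)
Require Import Defs.
From HB Require Import structures.
From mathcomp Require Import all_boot all_order all_algebra.
From mathcomp Require Import complex.
From mathcomp Require Import all_classical all_reals all_analysis.
From mathcomp Require Import measurable_realfun.
From mathcomp Require Import ring lra.

Set Implicit Arguments.
Unset Strict Implicit.
Unset Printing Implicit Defensive.

Import Order.TTheory GRing.Theory Num.Theory.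
Import numFieldNormedType.Exports.

Local Open Scope classical_set_scope.
Local Open Scope complex_scope.
Local Open Scope ring_scope.

(** The velocity process has variance [nu R], where [nu] is the spectral measure
    of [V], and the proof computes this mass. Let [D (w) = r (w) + i x (w)] be
    the impedance of the equation on the imaginary axis, with resistance
    [r = lambda + beta Kcos] and reactance [x = m w - beta Ksin], where [Ksin] is
    the sine transform of the kernel. On the Fourier side [Psi] is
    multiplication by the conjugate of [D] ([Psi_symbol]). Therefore the weak
    equation says that [|D|^2 nu] and [(kBT / pi) r (w) dw] have the same
    integrals against the squared transforms of Schwartz functions, and formally
    [nu (dw) = (kBT / pi) r (w) / |D (w)|^2 dw]. Since [r / |D|^2 = Re (1 / D)],
    equipartition is the identity [int Re (1 / D) dw = pi / m].

    This identity is the analytic core ([integral_response]). The function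
    [1 / D] is a boundary value of
    [1 / (m z + lambda + beta L (z))], where [L] is the Laplace transform of the
    kernel. Its denominator has positive real part in the right half-plane,
    because [Re L] is a Poisson average of [Kcos > 0] ([laplace_cos_ge0]; the
    Poisson kernel and its transform are in [cauchy_cos]). Subtracting the same
    function without memory, [1 / (m z + lambda)], leaves a holomorphic function
    which is [O (1 / (1 + w^2))] uniformly on vertical lines, so that its integral
    over them vanishes ([contour_shift]); the remaining integral is elementary.
    The passage to the imaginary axis rests on a bound of the transforms by
    [C (1 + |w| ^ (a - 1))] with [0 < a < 1] ([trunc_transform_dominated]). This
    bound needs a kernel which is integrable at the origin, decreases to zero
    with continuous derivative, and is [O (t ^ - a)] at infinity: the record
    [slow_kernel], to which the kernel assumptions reduce
    ([slow_causal_kernel]).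

    To make the formula for [nu] rigorous without regularity of [nu], the weak
    equation is tested on Gaussian wave packets only. The Fourier transform of
    [Psi phi] is determined almost everywhere by its integrals against Gaussians
    ([gaussian_separation_complex]), and the isometry of the stochastic integral
    ([stochastic_integral_norm]) gives the equality of the two measures against
    all normal densities ([weak_solution_packet]). Integrating over the centers
    and letting the width tend to zero gives [nu R] ([spectral_mass]).

    Finally, [nu R] being finite, the Dirac mass belongs to the domain with
    density a character of modulus one, so that [E |v(0)|^2 = nu R]; and [v(0)]
    is real as a mean-square limit of pairings with real Gaussians
    ([velocity_real]). That pairings are stochastic integrals at all requires
    their existence, by density of simple functions and completeness of the
    space of square-integrable random variables
    ([stochastic_integral_exists]). *)

(** * Complex integrals in coordinates *)

Section complex_coordinates.
Context {R : realType}.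
Implicit Types (x y z : R[i]).

Lemma ReD x y : complex.Re (x + y) = complex.Re x + complex.Re y.
Proof. by case: x y => [a b] [c d]. Qed.

Lemma ImD x y : complex.Im (x + y) = complex.Im x + complex.Im y.
Proof. by case: x y => [a b] [c d]. Qed.

Lemma ReN x : complex.Re (- x) = - complex.Re x.
Proof. by case: x. Qed.

Lemma ImN x : complex.Im (- x) = - complex.Im x.
Proof. by case: x. Qed.

Lemma cReM x y : complex.Re (x * y) =
  complex.Re x * complex.Re y - complex.Im x * complex.Im y.
Proof. by case: x y => [a b] [c d]. Qed.

Lemma cImM x y : complex.Im (x * y) =
  complex.Re x * complex.Im y + complex.Im x * complex.Re y.
Proof. by case: x y => [a b] [c d]. Qed.

Lemma ReJ x : complex.Re x^* = complex.Re x.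
Proof. by case: x. Qed.

Lemma ImJ x : complex.Im x^* = - complex.Im x.
Proof. by case: x. Qed.

(** One rule for the coordinates of ring expressions: identities between
    complex numbers become real identities. *)
Definition ReImE := (ReD, ImD, ReN, ImN, cReM, cImM, ReJ, ImJ).

Lemma eq_ReIm x y : complex.Re x = complex.Re y -> complex.Im x = complex.Im y ->
  x = y.
Proof. by case: x y => [a b] [c d] /= -> ->. Qed.

Lemma normc_sqrE x :
  Normc.normc x ^+ 2 = complex.Re x ^+ 2 + complex.Im x ^+ 2.
Proof. by case: x => a b /=; rewrite sqr_sqrtr// addr_ge0// sqr_ge0. Qed.

Lemma normc_ge0 x : 0 <= Normc.normc x.
Proof. by case: x => a b; exact: sqrtr_ge0. Qed.

Lemma normr_Re_le x : `|complex.Re x| <= Normc.normc x.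
Proof.
rewrite -[leRHS]ger0_norm ?normc_ge0// -ler_sqr ?nnegrE ?normr_ge0//.
by rewrite !real_normK ?num_real// normc_sqrE lerDl sqr_ge0.
Qed.

Lemma normr_Im_le x : `|complex.Im x| <= Normc.normc x.
Proof.
rewrite -[leRHS]ger0_norm ?normc_ge0// -ler_sqr ?nnegrE ?normr_ge0//.
by rewrite !real_normK ?num_real// normc_sqrE lerDr sqr_ge0.
Qed.

Lemma normc_le_ReIm x : Normc.normc x <= `|complex.Re x| + `|complex.Im x|.
Proof.
rewrite -ler_sqr ?nnegrE ?normc_ge0 ?addr_ge0//.
rewrite normc_sqrE sqrrD !real_normK ?num_real//.
by rewrite -addrA [_ *+ 2 + _]addrC addrA lerDl mulrn_wge0// mulr_ge0.
Qed.

Lemma normc_real (r : R) : Normc.normc r%:C = `|r|.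
Proof. by rewrite /= expr0n addr0 sqrtr_sqr. Qed.

Lemma normc_conj x : Normc.normc x^* = Normc.normc x.
Proof. by case: x => a b /=; rewrite sqrrN. Qed.

Lemma normc_expi (t : R) : Normc.normc (cexpi t) = 1.
Proof. by rewrite /cexpi /= cos2Dsin2 sqrtr1. Qed.

Lemma cexpiD (s t : R) : cexpi (s + t) = cexpi s * cexpi t.
Proof.
apply: eq_ReIm; rewrite !ReImE /cexpi /= ?cosD ?sinD; last by rewrite addrC.
by [].
Qed.

Lemma cexpi0 : cexpi (0 : R) = 1.
Proof. by rewrite /cexpi cos0 sin0. Qed.

End complex_coordinates.

Section complex_integrals.
Context {d : measure_display} {T : measurableType d} {R : realType}.
Variable mu : {measure set T -> \bar R}.
Implicit Types (f g : T -> R[i]).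

Lemma integrable_dom (f g : T -> R) : measurable_fun setT f ->
  mu.-integrable setT (EFin \o g) -> (forall x, `|f x| <= g x) ->
  mu.-integrable setT (EFin \o f).
Proof.
move=> mf ig fg; apply: le_integrable ig => //; first exact/measurable_EFinP.
by move=> x _ /=; rewrite lee_fin (le_trans (fg x))// ler_norm.
Qed.

Lemma integrable_measurable (f : T -> R) :
  mu.-integrable setT (EFin \o f) -> measurable_fun setT f.
Proof. by move=> /measurable_int/measurable_EFinP. Qed.

Lemma cmeasurableD f g : cmeasurable f -> cmeasurable g ->
  cmeasurable (fun x => f x + g x).
Proof.
move=> [f1 f2] [g1 g2]; split.
  under eq_fun do rewrite ReD.
  exact: measurable_funD.
under eq_fun do rewrite ImD.
exact: measurable_funD.
Qed.

Lemma cmeasurableM f g : cmeasurable f -> cmeasurable g ->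
  cmeasurable (fun x => f x * g x).
Proof.
move=> [f1 f2] [g1 g2]; split.
  under eq_fun do rewrite cReM.
  by apply: measurable_funB; exact: measurable_funM.
under eq_fun do rewrite cImM.
by apply: measurable_funD; exact: measurable_funM.
Qed.

Lemma cmeasurable_cst (z : R[i]) : cmeasurable (fun _ : T => z).
Proof. by split; exact: measurable_cst. Qed.

Lemma cmeasurableN f : cmeasurable f -> cmeasurable (fun x => - f x).
Proof.
move=> [f1 f2]; split.
  by under eq_fun do rewrite ReN; exact: measurableT_comp.
by under eq_fun do rewrite ImN; exact: measurableT_comp.
Qed.

Lemma cmeasurableB f g : cmeasurable f -> cmeasurable g ->
  cmeasurable (fun x => f x - g x).
Proof. by move=> mf mg; apply: cmeasurableD => //; exact: cmeasurableN. Qed.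

Lemma cmeasurableJ f : cmeasurable f -> cmeasurable (fun x => (f x)^*).
Proof.
move=> [f1 f2]; split.
  by under eq_fun do rewrite ReJ.
by under eq_fun do rewrite ImJ; exact: measurableT_comp.
Qed.

Lemma cmeasurable_real (f : T -> R) : measurable_fun setT f ->
  cmeasurable (fun x => (f x)%:C).
Proof. by move=> mf; split => //=; exact: measurable_cst. Qed.

Lemma cmeasurable_expi (f : T -> R) : measurable_fun setT f ->
  cmeasurable (fun x => cexpi (f x)).
Proof.
move=> mf; split => /=.
  by apply: measurableT_comp => //; apply: continuous_measurable_fun;
    exact: continuous_cos.
by apply: measurableT_comp => //; apply: continuous_measurable_fun;
  exact: continuous_sin.
Qed.

Lemma measurable_normc f : cmeasurable f ->
  measurable_fun setT (fun x => Normc.normc (f x)).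
Proof.
move=> [f1 f2].
rewrite (_ : (fun x => _) =
  fun x => Num.sqrt (complex.Re (f x) ^+ 2 + complex.Im (f x) ^+ 2)); last first.
  by apply/funext => x; case: (f x).
apply: (@measurableT_comp _ _ _ _ _ _ (@Num.sqrt R)).
  by apply: continuous_measurable_fun; exact: sqrt_continuous.
by apply: measurable_funD; exact: measurable_funX.
Qed.

Lemma cintegrable_cmeasurable f : cintegrable mu f -> cmeasurable f.
Proof. by case=> f1 f2; split; exact: integrable_measurable. Qed.

Lemma cintegrable_dom f (g : T -> R) : cmeasurable f ->
  mu.-integrable setT (EFin \o g) -> (forall x, Normc.normc (f x) <= g x) ->
  cintegrable mu f.
Proof.
move=> [f1 f2] ig fg; split; apply: integrable_dom ig _ => // x.
  exact: le_trans (normr_Re_le _) (fg x).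
exact: le_trans (normr_Im_le _) (fg x).
Qed.

Lemma integrable_normc f : cintegrable mu f ->
  mu.-integrable setT (EFin \o (fun x => Normc.normc (f x))).
Proof.
move=> cf; have [f1 f2] := cf.
apply: (@integrable_dom _ (fun x => `|complex.Re (f x)| + `|complex.Im (f x)|)).
- by apply: measurable_normc; exact: cintegrable_cmeasurable.
- rewrite (_ : _ \o _ = (fun x => `|(complex.Re (f x))%:E| + `|(complex.Im (f x))%:E|)%E) //.
  by apply: integrableD => //; exact: integrable_abse.
- by move=> x; rewrite ger0_norm ?normc_ge0// normc_le_ReIm.
Qed.

Lemma cintegrableD f g : cintegrable mu f -> cintegrable mu g ->
  cintegrable mu (fun x => f x + g x).
Proof.
move=> [f1 f2] [g1 g2]; split.
  by under eq_fun do rewrite ReD EFinD; exact: integrableD.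
by under eq_fun do rewrite ImD EFinD; exact: integrableD.
Qed.

Lemma cintegrableZl (z : R[i]) f : cintegrable mu f ->
  cintegrable mu (fun x => z * f x).
Proof.
move=> cf; have mf := cintegrable_cmeasurable cf.
apply: (@cintegrable_dom _ (fun x => Normc.normc z * Normc.normc (f x))).
- by apply: cmeasurableM => //; exact: cmeasurable_cst.
- rewrite (_ : _ \o _ = (fun x => (Normc.normc z)%:E * (EFin \o (fun x => Normc.normc (f x))) x)%E)//.
  by apply: integrableZl => //; exact: integrable_normc.
- by move=> x; rewrite Normc.normcM.
Qed.

Lemma cintegralD f g : cintegrable mu f -> cintegrable mu g ->
  cintegral mu setT (fun x => f x + g x) =
  cintegral mu setT f + cintegral mu setT g.
Proof.
move=> [f1 f2] [g1 g2]; apply: eq_ReIm; rewrite !ReImE /cintegral /=.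
  by under eq_Rintegral do rewrite ReD; rewrite RintegralD.
by under eq_Rintegral do rewrite ImD; rewrite RintegralD.
Qed.

Lemma cintegralZl (z : R[i]) f : cintegrable mu f ->
  cintegral mu setT (fun x => z * f x) = z * cintegral mu setT f.
Proof.
move=> [f1 f2].
have Z (r : R) (h : T -> R) : mu.-integrable setT (EFin \o h) ->
    mu.-integrable setT (EFin \o (fun x => r * h x)).
  by move=> ih; rewrite /comp; under eq_fun do rewrite EFinM; exact: integrableZl.
apply: eq_ReIm; rewrite !ReImE /cintegral /=.
  under eq_Rintegral do rewrite cReM.
  by rewrite RintegralB ?RintegralZl//; exact: Z.
under eq_Rintegral do rewrite cImM.
by rewrite RintegralD ?RintegralZl//; exact: Z.
Qed.

Lemma eq_cintegral f g : f =1 g -> cintegral mu setT f = cintegral mu setT g.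
Proof. by move=> /funext ->. Qed.

Lemma ae_eq_cintegral f g : cmeasurable f -> cmeasurable g ->
  {ae mu, forall x, f x = g x} -> cintegral mu setT f = cintegral mu setT g.
Proof.
move=> [f1 f2] [g1 g2] fg; rewrite /cintegral /Rintegral.
congr (fine _ +i* fine _); apply: ae_eq_integral => //;
  [exact/measurable_EFinP..| |exact/measurable_EFinP|exact/measurable_EFinP|];
  by apply: filterS fg => x /= ->.
Qed.

(** The factor [2] comes from bounding the two coordinates separately; absolute
    constants do not matter in the uses of this bound. *)
Lemma normc_cintegral f : cintegrable mu f ->
  Normc.normc (cintegral mu setT f) <= 2 * \int[mu]_x Normc.normc (f x).
Proof.
move=> cf; have [f1 f2] := cf; have nf := integrable_normc cf.
rewrite (le_trans (normc_le_ReIm _))// mulr2n mulrDl mul1r /cintegral /=.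
apply: lerD.
  apply: le_trans (le_normr_Rintegral measurableT f1) _.
  apply: le_Rintegral => //; first exact: (integrable_norm f1).
  by move=> x _; exact: normr_Re_le.
apply: le_trans (le_normr_Rintegral measurableT f2) _.
apply: le_Rintegral => //; first exact: (integrable_norm f2).
by move=> x _; exact: normr_Im_le.
Qed.

End complex_integrals.

(** * Dominated convergence and Fubini for finite integrals *)

Section dominated_convergence_finite.
Context {d : measure_display} {T : measurableType d} {R : realType}.
Variable mu : {measure set T -> \bar R}.

Lemma dominated_Rintegral (f_ : nat -> T -> R) (f g : T -> R) :
  (forall n, measurable_fun setT (f_ n)) -> measurable_fun setT f ->
  mu.-integrable setT (EFin \o g) ->
  {ae mu, forall x, (forall n, `|f_ n x| <= g x) /\
                    (f_ n x @[n --> \oo] --> f x)} ->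
  mu.-integrable setT (EFin \o f) /\
  \int[mu]_x f_ n x @[n --> \oo] --> \int[mu]_x f x.
Proof.
move=> mf_ mf ig fg.
have [//|//||//||i1 i2 i3] := @dominated_convergence _ _ _ mu setT measurableT
  (fun n => EFin \o f_ n) (EFin \o f) (EFin \o g).
- by move=> n; exact/measurable_EFinP.
- exact/measurable_EFinP.
- apply: filterS fg => x [_ fx] _.
  by apply/fine_cvgP; split; [exact: nearW|exact: fx].
- by apply: filterS fg => x [fx _] n _; rewrite lee_fin.
split=> //; apply: fine_cvg.
rewrite [X in _ --> X](_ : _ = (\int[mu]_x (f x)%:E)%E); first exact: i3.
by rewrite fineK//; exact: integrable_fin_num.
Qed.

End dominated_convergence_finite.

Section fubini_finite.
Context {d1 d2 : measure_display} {T1 : measurableType d1}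
  {T2 : measurableType d2} {R : realType}.
Variables (m1 : {sigma_finite_measure set T1 -> \bar R})
  (m2 : {sigma_finite_measure set T2 -> \bar R}).
Implicit Types (A : T1 -> R) (B : T2 -> R).

Section real_valued.
Variables (f : T1 * T2 -> R) (A : T1 -> R) (B : T2 -> R).
Hypotheses (mf : measurable_fun setT f)
  (iA : m1.-integrable setT (EFin \o A)) (iB : m2.-integrable setT (EFin \o B))
  (fAB : forall x y, `|f (x, y)| <= A x * B y).

Let A1 x := `|A x|.
Let B1 x := `|B x|.
Let fAB1 x y : `|f (x, y)| <= A1 x * B1 y.
Proof. by rewrite -normrM (le_trans (fAB x y))// ler_norm. Qed.

Let iA1 : m1.-integrable setT (EFin \o A1).
Proof. exact: integrable_norm. Qed.

Let iB1 : m2.-integrable setT (EFin \o B1).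
Proof. exact: integrable_norm. Qed.

Lemma integrable_section1 x : m2.-integrable setT (fun y => (f (x, y))%:E).
Proof.
apply: (@integrable_dom _ _ _ m2 (fun y => f (x, y)) (fun y => A1 x * B1 y)).
- exact: measurableT_comp.
- rewrite (_ : _ \o _ = (fun y => (A1 x)%:E * (EFin \o B1) y)%E)//.
  exact: integrableZl.
- by move=> y; exact: fAB1.
Qed.

Lemma integrable_section2 y : m1.-integrable setT (fun x => (f (x, y))%:E).
Proof.
apply: (@integrable_dom _ _ _ m1 (fun x => f (x, y)) (fun x => B1 y * A1 x)).
- exact: measurableT_comp.
- rewrite (_ : _ \o _ = (fun x => (B1 y)%:E * (EFin \o A1) x)%E)//.
  exact: integrableZl.
- by move=> x; rewrite mulrC; exact: fAB1.
Qed.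

Lemma integrable_prod_dom : (m1 \x m2)%E.-integrable setT (EFin \o f).
Proof.
have mA1 : measurable_fun setT (fun x => (A1 x)%:E) by case/integrableP: iA1.
have mB1 : measurable_fun setT (fun x => (B1 x)%:E) by case/integrableP: iB1.
have pA1 x : (0 <= (A1 x)%:E)%E by rewrite lee_fin; exact: normr_ge0.
have pB1 x : (0 <= (B1 x)%:E)%E by rewrite lee_fin; exact: normr_ge0.
have pB : 0 <= \int[m2]_y B1 y by apply: Rintegral_ge0 => x _; exact: normr_ge0.
apply/integrable12ltyP; first exact/measurable_EFinP.
apply: (@le_lt_trans _ _ (\int[m1]_x ((\int[m2]_y B1 y)%:E * (A1 x)%:E))%E).
  apply: ge0_le_integral => //=.
  - by move=> x _; exact: integral_ge0.
  - apply: (measurable_fun_fubini_tonelli_F (fun z => `|(f z)%:E|%E)) => //.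
    by apply: measurableT_comp => //; exact/measurable_EFinP.
  - exact: emeasurable_funM.
  - move=> x _; rewrite /Rintegral fineK; last exact: integrable_fin_num.
    rewrite muleC -ge0_integralZl//; apply: ge0_le_integral => //=.
    + by apply/measurable_EFinP; do 2 apply: measurableT_comp => //.
    + exact: emeasurable_funM.
    + by move=> y _; rewrite lee_fin fAB1.
rewrite ge0_integralZl// ?lee_fin//.
apply: lte_mul_pinfty; rewrite ?lee_fin//; exact: integrable_lty iA1.
Qed.

(** Domination by a product [A x * B y] of integrable functions suffices for
    every exchange of integrals below, and can be checked one factor at a time. *)
Lemma Fubini_Rintegral :
  \int[m1]_x \int[m2]_y f (x, y) = \int[m2]_y \int[m1]_x f (x, y).
Proof.
rewrite /Rintegral; congr fine.
transitivity (\int[m1]_x \int[m2]_y (f (x, y))%:E)%E.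
  apply: eq_integral => x _; rewrite fineK//.
  exact: integrable_fin_num (integrable_section1 x).
transitivity (\int[m2]_y \int[m1]_x (f (x, y))%:E)%E; last first.
  apply: eq_integral => y _; rewrite fineK//.
  exact: integrable_fin_num (integrable_section2 y).
exact: (Fubini integrable_prod_dom).
Qed.

Lemma integrable_Rintegral1 :
  m1.-integrable setT (EFin \o (fun x => \int[m2]_y f (x, y))).
Proof.
rewrite (_ : _ \o _ = fun x => (\int[m2]_y (f (x, y))%:E)%E); last first.
  apply/funext => x /=; rewrite fineK//.
  exact: integrable_fin_num (integrable_section1 x).
exact: (integrable_fubini_F integrable_prod_dom).
Qed.

End real_valued.

Lemma cintegrable_cintegral1 (f : T1 * T2 -> R[i]) A B : cmeasurable f ->
  m1.-integrable setT (EFin \o A) -> m2.-integrable setT (EFin \o B) ->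
  (forall x y, Normc.normc (f (x, y)) <= A x * B y) ->
  cintegrable m1 (fun x => cintegral m2 setT (fun y => f (x, y))).
Proof.
move=> [f1 f2] iA iB fAB; split.
  apply: (@integrable_Rintegral1 (fun z => complex.Re (f z)) A B) => // u v.
  exact: le_trans (normr_Re_le _) (fAB u v).
apply: (@integrable_Rintegral1 (fun z => complex.Im (f z)) A B) => // u v.
exact: le_trans (normr_Im_le _) (fAB u v).
Qed.

Lemma Fubini_cintegral (f : T1 * T2 -> R[i]) A B : cmeasurable f ->
  m1.-integrable setT (EFin \o A) -> m2.-integrable setT (EFin \o B) ->
  (forall x y, Normc.normc (f (x, y)) <= A x * B y) ->
  cintegral m1 setT (fun x => cintegral m2 setT (fun y => f (x, y))) =
  cintegral m2 setT (fun y => cintegral m1 setT (fun x => f (x, y))).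
Proof.
move=> [f1 f2] iA iB fAB; apply: eq_ReIm => /=.
  apply: (@Fubini_Rintegral (fun z => complex.Re (f z)) A B) => // u v.
  exact: le_trans (normr_Re_le _) (fAB u v).
apply: (@Fubini_Rintegral (fun z => complex.Im (f z)) A B) => // u v.
exact: le_trans (normr_Im_le _) (fAB u v).
Qed.

End fubini_finite.

(** * Square-integrable functions *)

Section square_integrable.
Context {d : measure_display} {T : measurableType d} {R : realType}.
Variable mu : {measure set T -> \bar R}.
Implicit Types (f g : T -> R[i]).

Definition inner f g : R[i] := cintegral mu setT (fun x => f x * (g x)^*).

Lemma measurable_sqr_normc f : cmeasurable f ->
  measurable_fun setT (fun x => Normc.normc (f x) ^+ 2).
Proof. by move=> mf; apply: measurable_funX; exact: measurable_normc. Qed.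

Lemma L2P f : L2 mu f <->
  cmeasurable f /\ mu.-integrable setT (EFin \o (fun x => Normc.normc (f x) ^+ 2)).
Proof.
split=> -[mf h]; split=> //.
  apply/integrableP; split; first exact/measurable_EFinP/measurable_sqr_normc.
  by under eq_integral do rewrite /= ger0_norm ?sqr_ge0//.
exact: integrable_lty h.
Qed.

Lemma sqnorm_ge0 f : (0 <= sqnorm mu f)%E.
Proof. by apply: integral_ge0 => x _; rewrite lee_fin sqr_ge0. Qed.

Lemma L2_sqnormE f : L2 mu f ->
  sqnorm mu f = (\int[mu]_x Normc.normc (f x) ^+ 2)%:E.
Proof.
by move=> /L2P[_ h]; rewrite /Rintegral fineK//; exact: integrable_fin_num h.
Qed.

Lemma L2_dom f (g : T -> R) : cmeasurable f ->
  mu.-integrable setT (EFin \o g) ->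
  (forall x, Normc.normc (f x) ^+ 2 <= g x) -> L2 mu f.
Proof.
move=> mf ig fg; apply/L2P; split=> //; apply: integrable_dom ig _.
  exact: measurable_sqr_normc.
by move=> x; rewrite ger0_norm ?sqr_ge0.
Qed.

(** The convexity bound that makes square-integrable functions a vector space. *)
Lemma normc_addr_sqr (x y : R[i]) :
  Normc.normc (x + y) ^+ 2 <= 2 * (Normc.normc x ^+ 2 + Normc.normc y ^+ 2).
Proof.
rewrite !normc_sqrE ReD ImD.
move: (complex.Re x) (complex.Im x) (complex.Re y) (complex.Im y) => a b c e.
by have := sqr_ge0 (a - c); have := sqr_ge0 (b - e); nra.
Qed.

Lemma integrable_EFinD (f g : T -> R) : mu.-integrable setT (EFin \o f) ->
  mu.-integrable setT (EFin \o g) ->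
  mu.-integrable setT (EFin \o (fun x => f x + g x)).
Proof.
move=> mf mg; rewrite (_ : _ \o _ = (EFin \o f) \+ (EFin \o g))%E//.
exact: integrableD.
Qed.

Lemma integrable_EFinZ (k : R) (f : T -> R) : mu.-integrable setT (EFin \o f) ->
  mu.-integrable setT (EFin \o (fun x => k * f x)).
Proof.
move=> mf; rewrite (_ : _ \o _ = (fun x => k%:E * (EFin \o f) x))%E//.
exact: integrableZl.
Qed.

Lemma L2D f g : L2 mu f -> L2 mu g -> L2 mu (fun x => f x + g x).
Proof.
move=> /L2P[mf if_] /L2P[mg ig].
apply: (@L2_dom _ (fun x => 2 * (Normc.normc (f x) ^+ 2 + Normc.normc (g x) ^+ 2))).
- exact: cmeasurableD.
- by apply: integrable_EFinZ; exact: integrable_EFinD.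
- by move=> x; exact: normc_addr_sqr.
Qed.

Lemma L2Zl z f : L2 mu f -> L2 mu (fun x => z * f x).
Proof.
move=> /L2P[mf if_].
apply: (@L2_dom _ (fun x => Normc.normc z ^+ 2 * Normc.normc (f x) ^+ 2)).
- by apply: cmeasurableM => //; exact: cmeasurable_cst.
- exact: integrable_EFinZ.
- by move=> x; rewrite Normc.normcM exprMn.
Qed.

Lemma L2B f g : L2 mu f -> L2 mu g -> L2 mu (fun x => f x - g x).
Proof.
move=> lf lg; rewrite (_ : (fun x => _) = fun x => f x + (-1) * g x).
  by apply: L2D => //; exact: L2Zl.
by apply/funext => x; rewrite mulN1r.
Qed.

Lemma L2_0 : L2 mu (fun=> 0).
Proof.
split; first exact: cmeasurable_cst.
rewrite /sqnorm; under eq_integral do rewrite Normc.normc0 expr0n/=.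
by rewrite integral0.
Qed.

Lemma L2_inner f g : L2 mu f -> L2 mu g ->
  cintegrable mu (fun x => f x * (g x)^*).
Proof.
move=> /L2P[mf if_] /L2P[mg ig].
apply: (@cintegrable_dom _ _ _ _ _
  (fun x => Normc.normc (f x) ^+ 2 + Normc.normc (g x) ^+ 2)).
- by apply: cmeasurableM => //; exact: cmeasurableJ.
- exact: integrable_EFinD.
- move=> x; rewrite Normc.normcM normc_conj.
  by move: (Normc.normc (f x)) (Normc.normc (g x)) => a b; nra.
Qed.

Lemma innerDl f1 f2 g : L2 mu f1 -> L2 mu f2 -> L2 mu g ->
  inner (fun x => f1 x + f2 x) g = inner f1 g + inner f2 g.
Proof.
move=> l1 l2 lg; rewrite /inner -cintegralD//; try exact: L2_inner.
by apply: eq_cintegral => x; rewrite mulrDl.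
Qed.

Lemma innerZl z f g : L2 mu f -> L2 mu g ->
  inner (fun x => z * f x) g = z * inner f g.
Proof.
move=> lf lg; rewrite /inner -cintegralZl//; last exact: L2_inner.
by apply: eq_cintegral => x; rewrite mulrA.
Qed.

Lemma innerC f g : L2 mu f -> L2 mu g -> inner g f = (inner f g)^*.
Proof.
move=> lf lg; have [i1 i2] := L2_inner lf lg.
apply: eq_ReIm; rewrite ?ReJ ?ImJ /inner /cintegral /=.
  by apply: eq_Rintegral => x _; rewrite !ReImE; ring.
rewrite -mulN1r -RintegralZl//; apply: eq_Rintegral => x _.
by rewrite !ReImE; ring.
Qed.

Lemma inner_sqnorm f : L2 mu f ->
  inner f f = (\int[mu]_x Normc.normc (f x) ^+ 2)%:C.
Proof.
move=> lf; apply: eq_ReIm; rewrite /inner /cintegral /=.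
  by apply: eq_Rintegral => x _; rewrite normc_sqrE !ReImE; ring.
rewrite (_ : (fun x => _) = fun=> 0); first by rewrite /Rintegral integral0.
by apply/funext => x; rewrite !ReImE; ring.
Qed.

(** The square of the norm is continuous for the norm: this is
    [2 u v <= dl u^2 + v^2 / dl], applied to [u = |f|] and [v = |f - g|]. *)
Lemma sqnorm_perturb f g (dl : R) : L2 mu f -> L2 mu g -> 0 < dl ->
  `|\int[mu]_x Normc.normc (g x) ^+ 2 - \int[mu]_x Normc.normc (f x) ^+ 2| <=
  dl * \int[mu]_x Normc.normc (f x) ^+ 2 +
  (dl^-1 + 1) * \int[mu]_x Normc.normc (f x - g x) ^+ 2.
Proof.
move=> lf lg dl0.
have /L2P[_ i1] := lf; have /L2P[_ i2] := lg.
have /L2P[_ i3] := L2B lf lg.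
rewrite -RintegralB// -!RintegralZl// -RintegralD//; try exact: integrable_EFinZ.
have iB : mu.-integrable setT
    (EFin \o (fun x => Normc.normc (g x) ^+ 2 - Normc.normc (f x) ^+ 2)).
  rewrite (_ : (fun x => _) = fun x => Normc.normc (g x) ^+ 2 +
    (-1) * Normc.normc (f x) ^+ 2); first by apply: integrable_EFinD => //; exact: integrable_EFinZ.
  by apply/funext => x; rewrite mulN1r.
apply: le_trans (le_normr_Rintegral measurableT iB) _.
apply: le_Rintegral => //; first exact: (integrable_norm iB).
  by apply: integrable_EFinD; exact: integrable_EFinZ.
move=> x _; rewrite !normc_sqrE !ReImE.
move: (complex.Re (f x)) (complex.Im (f x)) (complex.Re (g x)) (complex.Im (g x)) => a b c e.
have E (u v : R) : `|2 * (u * v)| <= dl * u ^+ 2 + dl^-1 * v ^+ 2.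
  rewrite -(ler_pM2l dl0) mulrDr mulVKf ?gt_eqF//.
  rewrite -{1}(gtr0_norm dl0) -normrM ler_norml; apply/andP; split.
    by have := sqr_ge0 (dl * u + v); nra.
  by have := sqr_ge0 (dl * u - v); nra.
rewrite (_ : _ - _ = (a - c) ^+ 2 + (b - e) ^+ 2 -
  2 * (a * (a - c)) - 2 * (b * (b - e))); last by ring.
have := E a (a - c); have := E b (b - e); rewrite !ler_norml.
move=> /andP[h1 h2] /andP[h3 h4].
have h5 := sqr_ge0 (a - c); have h6 := sqr_ge0 (b - e).
by apply/andP; split; lra.
Qed.

Lemma sqnorm_cvg f (f_ : nat -> T -> R[i]) : L2 mu f -> (forall n, L2 mu (f_ n)) ->
  sqnorm mu (fun x => f x - f_ n x) @[n --> \oo] --> 0%E ->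
  \int[mu]_x Normc.normc (f_ n x) ^+ 2 @[n --> \oo] -->
  \int[mu]_x Normc.normc (f x) ^+ 2.
Proof.
move=> lf lf_ fcv.
have {}fcv : \int[mu]_x Normc.normc (f x - f_ n x) ^+ 2 @[n --> \oo] --> (0 : R).
  by apply: fine_cvg; exact: fcv.
apply/cvgrPdist_le => e e0.
set A := \int[mu]_x Normc.normc (f x) ^+ 2.
have A0 : 0 <= A by apply: Rintegral_ge0 => x _; exact: sqr_ge0.
pose dl := e / (2 * (A + 1)).
have dl0 : 0 < dl by rewrite divr_gt0// mulr_gt0// ltr_wpDl.
have k0 : 0 < dl^-1 + 1 by rewrite addr_gt0// invr_gt0.
have e2 : 0 < e / 2 / (dl^-1 + 1) by rewrite !divr_gt0.
move/cvgrPdist_le : fcv => /(_ _ e2); apply: filterS => n.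
rewrite sub0r normrN ger0_norm; last by apply: Rintegral_ge0 => x _; exact: sqr_ge0.
rewrite ler_pdivlMr// => h.
rewrite distrC (le_trans (sqnorm_perturb lf (lf_ n) dl0))//.
rewrite [leRHS]splitr lerD//; last by rewrite mulrC.
rewrite /dl -/A -[leRHS]mulr1 -2!mulrA ler_pM2l// invfM -mulrA ler_pM2l ?invr_gt0//.
by rewrite mulrC ler_pdivrMr ?mul1r ?ltr_wpDl// lerDl.
Qed.

End square_integrable.

(** * Completeness *)

Section geometric_sequences.
Context {R : realType}.

Lemma cvg_dist_le {T : Type} (F : set_system T) (FF : ProperFilter F)
    (u : T -> R) (l c B : R) :
  u x @[x --> F] --> l -> (\forall x \near F, `|u x - c| <= B) -> `|l - c| <= B.
Proof.
move=> ul uB.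
have h : `|u x - c| @[x --> F] --> `|l - c|.
  by apply: cvg_norm; apply: cvgB => //; exact: cvg_cst.
by rewrite -(cvg_lim _ h)//; apply: limr_le => //; exact: cvgP h.
Qed.

Lemma geometric_increments (u : nat -> R) (C : R) :
  (forall n, `|u n.+1 - u n| <= C * 2^-1 ^+ n) ->
  forall n k, `|u (n + k)%N - u n| <= 2 * C * 2^-1 ^+ n * (1 - 2^-1 ^+ k).
Proof.
move=> uC n; elim=> [|k IH]; first by rewrite addn0 subrr normr0 expr0 subrr mulr0.
rewrite addnS -(subrK (u (n + k)%N) (u _.+1)) -addrA.
rewrite (le_trans (ler_normD _ _))//.
apply: le_trans (lerD (uC _) IH) _.
by rewrite le_eqVlt; apply/orP; left; apply/eqP; rewrite exprD exprS; field.
Qed.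

(** A sequence with geometrically small increments converges, at the rate of
    the increments; this is the source of the pointwise limits below. *)
Lemma geometric_cvg (u : nat -> R) (C : R) :
  (forall n, `|u n.+1 - u n| <= C * 2^-1 ^+ n) ->
  cvgn u /\ forall n, `|limn u - u n| <= 2 * C * 2^-1 ^+ n.
Proof.
move=> uC.
have C0 : 0 <= C by have := uC 0%N; rewrite expr0 mulr1; exact: le_trans.
have uB n k : `|u (n + k)%N - u n| <= 2 * C * 2^-1 ^+ n.
  apply: le_trans (geometric_increments uC n k) _.
  have h : 0 <= 2 * C * 2^-1 ^+ n by rewrite !mulr_ge0// exprn_ge0.
  have h2 : 0 <= 2^-1 ^+ k :> R by rewrite exprn_ge0.
  nra.
have g0 : 2 * C * 2^-1 ^+ n @[n --> \oo] --> 0.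
  by apply: (@cvg_geometric R); rewrite ger0_norm// invf_lt1// ltr1n.
have cu : cvgn u.
  apply/cauchy_cvgP; apply: cauchy_exP => e e0.
  have /cvgrPdist_lt/(_ _ e0)[N _ NP] := g0.
  exists (u N), N => // i /= Ni; rewrite /ball/= distrC -(subnKC Ni).
  have := NP N (leqnn N); rewrite /= sub0r normrN.
  by apply: le_lt_trans; rewrite (le_trans (uB _ _))// ler_norm.
split=> // n.
apply: (@cvg_dist_le _ _ eventually_filter u); first exact: cu.
exists n => // k /= nk.
by rewrite -(subnKC nk).
Qed.

Lemma cvgn0_geometric (C : R) (z : R) : 0 <= z < 1 -> C * z ^+ n @[n --> \oo] --> 0.
Proof.
by move=> /andP[z0 z1]; apply: (@cvg_geometric R); rewrite ger0_norm.
Qed.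

End geometric_sequences.

Section L2_completeness.
Context {d : measure_display} {T : measurableType d} {R : realType}.
Variable mu : {measure set T -> \bar R}.

(** Riesz-Fischer for rapidly converging sequences. The weighted sum [G] of the
    squared increments is integrable, hence finite almost everywhere, and it
    controls both the pointwise convergence and its rate. *)
Lemma L2_complete (X_ : nat -> T -> R[i]) :
  (forall n, L2 mu (X_ n)) ->
  (forall n, (sqnorm mu (fun w => X_ n.+1 w - X_ n w)%R <= (8^-1 ^+ n)%:E)%E) ->
  exists X, L2 mu X /\
    sqnorm mu (fun w => X w - X_ n w) @[n --> \oo] --> 0%E.
Proof.
move=> LX incr.
have mX n : cmeasurable (X_ n) by case: (LX n).
pose D n w := Normc.normc (X_ n.+1 w - X_ n w) ^+ 2.
have mD n : measurable_fun setT (D n).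
  by apply: measurable_sqr_normc; exact: cmeasurableB.
have D0 n w : 0 <= D n w by exact: sqr_ge0.
pose G w : \bar R := (\sum_(0 <= n <oo) (4 ^+ n * D n w)%:E)%E.
have mG : measurable_fun setT G.
  apply: ge0_emeasurable_sum => //.
    by move=> n w _ _; rewrite lee_fin mulr_ge0// exprn_ge0.
  by move=> n _; apply/measurable_EFinP/measurable_funM.
have G0 w : (0 <= G w)%E.
  by apply: nneseries_ge0 => n _ _; rewrite lee_fin mulr_ge0// exprn_ge0.
have IG : (\int[mu]_w G w < +oo)%E.
  rewrite integral_nneseries//; last 2 first.
    by move=> n; apply/measurable_EFinP/measurable_funM.
    by move=> n w _; rewrite lee_fin mulr_ge0// exprn_ge0.
  apply: (@le_lt_trans _ _ (\sum_(0 <= n <oo) (2 / (2 ^ (n + 1))%:R)%:E)%E).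
    apply: lee_nneseries => //.
      by move=> n *; apply: integral_ge0 => w _; rewrite lee_fin mulr_ge0// exprn_ge0.
    move=> n _; under eq_integral do rewrite EFinM.
    have mDE : measurable_fun setT (fun w => (D n w)%:E) by exact/measurable_EFinP.
    rewrite ge0_integralZl// ?lee_fin ?exprn_ge0//; last by move=> w _; rewrite lee_fin.
    apply: (@le_trans _ _ ((4 ^+ n)%:E * (8^-1 ^+ n)%:E)%E).
      by rewrite lee_pmul2l ?lte_fin ?exprn_gt0//; exact: incr.
    rewrite -EFinM lee_fin -exprMn natrX exprD expr1 invfM mulrCA divff// mulr1.
    by rewrite -exprVn (_ : 4 * 8^-1 = 2^-1)//; field.
  rewrite [X in (X < _)%E](_ : _ = (2 / 2 ^+ 0)%:E) ?ltry//.
  by apply: cvg_lim => //; exact: cvg_geometric_eseries_half.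
have fG w : G w \is a fin_num -> forall n, 4 ^+ n * D n w <= fine (G w).
  move=> Gf n; rewrite -lee_fin fineK//.
  apply: le_trans (nneseries_lim_ge n.+1 _); last first.
    by move=> k _ _; rewrite lee_fin mulr_ge0// exprn_ge0.
  rewrite big_nat_recr//= leeDr// sume_ge0// => k _.
  by rewrite lee_fin mulr_ge0// exprn_ge0.
pose A := [set w | G w \is a fin_num].
have mA : measurable A.
  have -> : A = G @^-1` (~` [set +oo%E]).
    apply/seteqP; split => w /=; rewrite /A/= ge0_fin_numE// lt_neqAle leey andbT.
      by move/eqP.
    by move/eqP.
  by rewrite -[X in measurable X]setTI; apply: mG => //; exact: measurableC.
pose Y n w : R[i] := (\1_A w : R)%:C * X_ n w.
have YA w : A w -> forall n, Y n w = X_ n w.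
  by move=> Aw n; rewrite /Y indicE mem_set//= mul1r.
have YnA w : ~ A w -> forall n, Y n w = 0.
  by move=> Aw n; rewrite /Y indicE memNset//= mul0r.
have mY n : cmeasurable (Y n).
  by apply: cmeasurableM => //; apply: cmeasurable_real; exact: measurable_indic.
have incrA w : A w -> forall n,
    Normc.normc (X_ n.+1 w - X_ n w) <= Num.sqrt (fine (G w)) * 2^-1 ^+ n.
  move=> Aw n; rewrite -ler_sqr ?nnegrE ?normc_ge0 ?mulr_ge0 ?exprn_ge0 ?sqrtr_ge0//.
  rewrite exprMn sqr_sqrtr ?fine_ge0// -(ler_pM2l (exprn_gt0 n (ltr0n R 4))).
  apply: le_trans (fG w Aw n) _.
  rewrite mulrCA -exprM mulnC exprM -exprMn (_ : 4 * 2^-1 ^+ 2 = 1) ?expr1n ?mulr1//.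
  by rewrite expr2; field.
have cvA w : A w ->
    (cvgn (fun n => complex.Re (X_ n w)) /\ forall n,
      `|limn (fun n => complex.Re (X_ n w)) - complex.Re (X_ n w)| <=
        2 * Num.sqrt (fine (G w)) * 2^-1 ^+ n) /\
    (cvgn (fun n => complex.Im (X_ n w)) /\ forall n,
      `|limn (fun n => complex.Im (X_ n w)) - complex.Im (X_ n w)| <=
        2 * Num.sqrt (fine (G w)) * 2^-1 ^+ n).
  move=> Aw; split.
    apply: (geometric_cvg (u := fun n => complex.Re (X_ n w))) => n.
    by apply: le_trans (incrA w Aw n); rewrite -ReN -ReD normr_Re_le.
  apply: (geometric_cvg (u := fun n => complex.Im (X_ n w))) => n.
  by apply: le_trans (incrA w Aw n); rewrite -ImN -ImD normr_Im_le.
pose X w : R[i] := limn (fun n => complex.Re (Y n w)) +i* limn (fun n => complex.Im (Y n w)).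
have cY w : cvgn (fun n => complex.Re (Y n w)) /\ cvgn (fun n => complex.Im (Y n w)).
  have [Aw|Aw] := pselect (A w).
    have [[h1 _] [h2 _]] := cvA w Aw.
    by split; under eq_fun do rewrite YA//.
  by split; under eq_fun do rewrite YnA//=; exact: is_cvg_cst.
have mX' : cmeasurable X.
  split => /=.
    apply: (measurable_fun_cvg (h := fun n w => complex.Re (Y n w))).
      by move=> n; case: (mY n).
    by move=> w _; case: (cY w).
  apply: (measurable_fun_cvg (h := fun n w => complex.Im (Y n w))).
    by move=> n; case: (mY n).
  by move=> w _; case: (cY w).
have mXX n : cmeasurable (fun w => X w - X_ n w) by exact: cmeasurableB.
have rate n : (sqnorm mu (fun w => X w - X_ n w)%R <=
    (8 * 4^-1 ^+ n)%:E * \int[mu]_w G w)%E.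
  rewrite -ge0_integralZl// ?lee_fin ?mulr_ge0 ?exprn_ge0//.
  apply: ge0_le_integral => //.
  - by move=> w _; rewrite lee_fin sqr_ge0.
  - exact/measurable_EFinP/measurable_sqr_normc.
  - exact: emeasurable_funM.
  move=> w _; have [Aw|Aw] := pselect (A w); last first.
    have -> : G w = +oo%E.
      by move: Aw; rewrite /A/= ge0_fin_numE//; case: (G w) (G0 w) => //= r _; rewrite ltry.
    by rewrite gt0_muley ?leey// lte_fin mulr_gt0// exprn_gt0.
  have [[_ h1] [_ h2]] := cvA w Aw.
  rewrite -(fineK Aw) -EFinM lee_fin normc_sqrE !ReImE /X /=.
  under eq_fun do rewrite YA//.
  under [X in limn X + - complex.Im _]eq_fun do rewrite YA//.
  have sq (a b : R) : `|a| <= b -> a ^+ 2 <= b ^+ 2.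
    by move=> ab; rewrite -(real_normK (num_real a)) ler_sqr ?nnegrE// (le_trans _ ab).
  apply: le_trans (lerD (sq _ _ (h1 n)) (sq _ _ (h2 n))) _.
  rewrite !exprMn sqr_sqrtr ?fine_ge0// -exprM mulnC exprM.
  rewrite (_ : 2^-1 ^+ 2 = 4^-1 :> R); last by rewrite expr2; field.
  by rewrite le_eqVlt; apply/orP; left; apply/eqP; ring.
have fIG : (\int[mu]_w G w)%E \is a fin_num by rewrite ge0_fin_numE// integral_ge0.
exists X; split.
  rewrite (_ : X = fun w => (X w - X_ 0%N w) + X_ 0%N w); last first.
    by apply/funext => w; rewrite subrK.
  apply: L2D => //; split=> //.
  apply: le_lt_trans (rate 0%N) _.
  by rewrite -(fineK fIG) -EFinM ltry.
apply: (@squeeze_cvge _ _ _ _ (cst 0%E) _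
    (fun n => ((8 * fine (\int[mu]_w G w)%E) * 4^-1 ^+ n)%:E)).
- apply: nearW => n; rewrite /= sqnorm_ge0/=.
  by apply: le_trans (rate n) _; rewrite -{1}(fineK fIG) -EFinM lee_fin mulrAC.
- exact: cvg_cst.
- apply: cvg_EFin; first exact: nearW.
  by apply: cvgn0_geometric; rewrite invr_ge0 ler0n/= invf_lt1// ltr1n.
Qed.

End L2_completeness.

(** * Density of simple functions *)

Section simple_functions_dense.
Context {R : realType}.
Variable nu : {measure set R -> \bar R}.
Implicit Types (s t : seq (R[i] * set R)).

Definition admissible s : Prop :=
  forall i, (i < size s)%N -> finite_Borel nu (nth (0, set0) s i).2.

Lemma admissible_cons p s :
  admissible (p :: s) <-> finite_Borel nu p.2 /\ admissible s.
Proof.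
split=> [h|[hp hs] [|i] //]; first by split=> [|i]; [exact: (h 0%N)|exact: (h i.+1)].
exact: hs.
Qed.

Lemma admissible_cat s t : admissible s -> admissible t -> admissible (s ++ t).
Proof.
elim: s => [//|p s IH] /admissible_cons[hp hs] ht.
by apply/admissible_cons; split=> //; exact: IH.
Qed.

Definition lscale (z : R[i]) s := [seq (z * p.1, p.2) | p <- s].

Lemma admissible_lscale z s : admissible s -> admissible (lscale z s).
Proof.
elim: s => [//|p s IH] /admissible_cons[hp hs].
by apply/admissible_cons; split=> //; exact: IH.
Qed.

Lemma simple_nil : simple (R := R) [::] = fun=> 0.
Proof. by apply/funext => x; rewrite /simple big_nil. Qed.

Lemma simple_cons p s :
  simple (p :: s) = fun x => p.1 * (\1_(p.2) x : R)%:C + simple s x.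
Proof. by apply/funext => x; rewrite /simple big_cons. Qed.

Lemma simple_cat s t x : simple (s ++ t) x = simple s x + simple t x.
Proof. by rewrite /simple big_cat. Qed.

Lemma simple_lscale z s x : simple (lscale z s) x = z * simple s x.
Proof.
rewrite /simple /lscale big_map mulr_sumr.
by apply: eq_bigr => p _; rewrite mulrA.
Qed.

Lemma L2_indic (E : set R) : finite_Borel nu E ->
  L2 nu (fun x => (\1_E x : R)%:C).
Proof.
move=> [mE nE]; split.
  by apply: cmeasurable_real; exact: measurable_indic.
rewrite /sqnorm (eq_integral (fun x => (\1_E x)%:E)); last first.
  move=> x _; rewrite normc_real indicE.
  by case: (_ \in _); rewrite ?normr1 ?normr0 ?expr1n ?expr0n.
by rewrite integral_indic// setIT.
Qed.

Lemma L2_simple s : admissible s -> L2 nu (simple s).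
Proof.
elim: s => [|p s IH]; first by rewrite simple_nil => _; exact: L2_0.
move=> /admissible_cons[hp hs]; rewrite simple_cons; apply: L2D; last exact: IH.
by apply: L2Zl; exact: L2_indic.
Qed.

Import HBNNSimple.

(** The levels of a nonnegative simple function [f <= u] with [u] square
    integrable have finite measure, except for the level [0], which is dropped. *)
Definition levels (f : {nnsfun R >-> R}) : seq (R[i] * set R) :=
  [seq (y%:C, f @^-1` [set y]) |
    y <- [seq y <- finmap.enum_fset (fset_set (range f)) | y != 0]].

Lemma simple_levels (f : {nnsfun R >-> R}) x : simple (levels f) x = (f x)%:C.
Proof.
rewrite /simple /levels big_map big_filter fimfunE fsbig_finite; last exact: fimfunP.
rewrite (raddf_sum (real_complex R)) big_mkcond/=; apply: eq_bigr => y _.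
have [->|y0] /= := eqVneq y 0; first by rewrite mul0r.
by rewrite -rmorphM.
Qed.

Lemma admissible_levels (f : {nnsfun R >-> R}) (u : R -> R) :
  (forall x, f x <= u x) -> nu.-integrable setT (EFin \o (fun x => u x ^+ 2)) ->
  admissible (levels f).
Proof.
move=> fu iu; rewrite /levels.
set l := [seq y <- _ | _].
have : forall y, y \in l -> y != 0 by move=> y; rewrite mem_filter => /andP[].
elim: l => [//|y l IH] yl0; rewrite /=; apply/admissible_cons; split; last first.
  by apply: IH => z zl; apply: yl0; rewrite inE zl orbT.
have y0 : y != 0 by apply: yl0; rewrite inE eqxx.
rewrite /=; split; first by rewrite -[X in measurable X]setTI; exact: measurable_funP.
set E := _ @^-1` _.
have mE : measurable E by rewrite -[X in measurable X]setTI; exact: measurable_funP.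
have h : ((y ^+ 2)%:E * nu E <= \int[nu]_x (u x ^+ 2)%:E)%E.
  rewrite -[E]setIT -integral_indic// -ge0_integralZl//; last 2 first.
  - exact/measurable_EFinP/measurable_indic.
  - by rewrite lee_fin sqr_ge0.
  apply: ge0_le_integral => //.
  - by move=> x _; rewrite -EFinM lee_fin mulr_ge0// sqr_ge0.
  - by apply: emeasurable_funM => //; exact/measurable_EFinP/measurable_indic.
  - by case/integrableP: iu.
  move=> x _; rewrite -EFinM lee_fin indicE.
  have [|] := boolP (x \in E); rewrite ?mulr0 ?sqr_ge0// mulr1 inE => <-.
  by rewrite ler_sqr ?nnegrE// (le_trans _ (fu x)).
have : ((y ^+ 2)%:E * nu E < +oo)%E.
  by apply: le_lt_trans h _; exact: integrable_lty iu.
apply: contraTT; rewrite -!leNgt !leye_eq => /eqP ->.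
by rewrite gt0_muley// lte_fin exprn_even_gt0.
Qed.

(** Monotone approximation from below; the squared error is at most [u ^+ 2],
    so that convergence in norm is dominated convergence. *)
Lemma simple_dense_ge0 (u : R -> R) : measurable_fun setT u -> (forall x, 0 <= u x) ->
  nu.-integrable setT (EFin \o (fun x => u x ^+ 2)) ->
  forall e : R, 0 < e -> exists s, [/\ admissible s,
    forall x, complex.Im (simple s x) = 0 &
    (\int[nu]_x ((u x - complex.Re (simple s x)) ^+ 2) <= e)].
Proof.
move=> mu0 u0 iu e e0.
have mu1 : measurable_fun setT (EFin \o u) by exact/measurable_EFinP.
pose g := nnsfun_approx measurableT mu1.
have u0' x : setT x -> (0 <= (EFin \o u) x)%E by rewrite lee_fin.
have gu x : g n x @[n --> \oo] --> u x.
  have := cvg_nnsfun_approx measurableT mu1 u0' (x := x) I.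
  by move/fine_cvg.
have gle n x : g n x <= u x.
  have nd : nondecreasing_seq (g ^~ x).
    by move=> a b ab; have /lefP := nd_nnsfun_approx measurableT mu1 ab; exact.
  by rewrite -(cvg_lim _ (gu x))//; apply: nondecreasing_cvgn_le => //; exact: cvgP (gu x).
have hm n : measurable_fun setT (fun x => (u x - g n x) ^+ 2).
  by apply: measurable_funX; apply: measurable_funB => //; exact: measurable_funP.
have hz : {ae nu, forall x, (forall n, `|(u x - g n x) ^+ 2| <= u x ^+ 2) /\
    ((u x - g n x) ^+ 2 @[n --> \oo] --> (0 : R))}.
  apply: aeW => x; split=> [n|].
    rewrite ger0_norm ?sqr_ge0// ler_sqr ?nnegrE ?subr_ge0//.
    by rewrite gerBl; exact: fun_ge0.
  have -> : (0 : R) = (u x - u x) * (u x - u x) by rewrite subrr mulr0.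
  under eq_fun do rewrite expr2.
  by apply: cvgM; apply: cvgB => //; exact: cvg_cst.
have hc : measurable_fun setT (fun _ : R => 0 : R) by exact: measurable_cst.
have [_ cv] := dominated_Rintegral hm hc iu hz.
move: cv; rewrite [X in _ --> X](_ : _ = 0); last by rewrite /Rintegral integral0.
move/cvgrPdist_le/(_ _ e0) => [n _ /(_ n (leqnn n))]/=.
rewrite sub0r normrN ger0_norm; last by apply: Rintegral_ge0 => x _; exact: sqr_ge0.
move=> le_e; exists (levels (g n)); split.
- exact: (admissible_levels (gle n) iu).
- by move=> x; rewrite simple_levels.
- by apply: le_trans le_e; under eq_Rintegral do rewrite simple_levels/=.
Qed.

(** The positive and negative parts of the two coordinates are approximated
    separately. *)
Lemma simple_dense (h : R -> R[i]) : L2 nu h -> forall e : R, 0 < e ->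
  exists s, admissible s /\ (sqnorm nu (fun x => h x - simple s x)%R <= e%:E)%E.
Proof.
move=> lh e e0; have [[m1 m2] ih] := (L2P nu h).1 lh.
pose a1 x := Num.max (complex.Re (h x)) 0.
pose a2 x := Num.max (- complex.Re (h x)) 0.
pose a3 x := Num.max (complex.Im (h x)) 0.
pose a4 x := Num.max (- complex.Im (h x)) 0.
have mN (v : R -> R) : measurable_fun setT v -> measurable_fun setT (fun x => - v x).
  by move=> mv; exact: measurableT_comp.
have mM (v : R -> R) : measurable_fun setT v ->
    measurable_fun setT (fun x => Num.max (v x) 0).
  by move=> mv; apply: measurable_maxr => //; exact: measurable_cst.
have sqm (v w : R) : v ^+ 2 <= w -> Num.max v 0 ^+ 2 <= w.
  move=> vw; have [v0|v0] := leP 0 v.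
    by [].
  by rewrite expr0n/= (le_trans _ vw)// sqr_ge0.
have Rei x : complex.Re (h x) ^+ 2 <= Normc.normc (h x) ^+ 2.
  by rewrite normc_sqrE lerDl sqr_ge0.
have Imi x : complex.Im (h x) ^+ 2 <= Normc.normc (h x) ^+ 2.
  by rewrite normc_sqrE lerDr sqr_ge0.
have ia (v : R -> R) : measurable_fun setT v ->
    (forall x, v x ^+ 2 <= Normc.normc (h x) ^+ 2) ->
    nu.-integrable setT (EFin \o (fun x => v x ^+ 2)).
  move=> mv vh; apply: integrable_dom ih _; first exact: measurable_funX.
  by move=> x; rewrite ger0_norm ?sqr_ge0.
have p0 (v : R) : 0 <= Num.max v 0 by rewrite le_max lexx orbT.
have e8 : 0 < e / 8 by rewrite divr_gt0.
have m_ (v : R -> R) : measurable_fun setT v ->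
    (forall x, v x ^+ 2 <= Normc.normc (h x) ^+ 2) ->
    exists s, [/\ admissible s, forall x, complex.Im (simple s x) = 0,
      nu.-integrable setT (EFin \o
        (fun x => (Num.max (v x) 0 - complex.Re (simple s x)) ^+ 2)) &
      (\int[nu]_x ((Num.max (v x) 0 - complex.Re (simple s x)) ^+ 2) <= e / 8)].
  move=> mv vh.
  have iv : nu.-integrable setT (EFin \o (fun x => Num.max (v x) 0 ^+ 2)).
    by apply: ia => [|x]; [exact: mM|exact: sqm].
  have [s [s1 s2 s3]] := simple_dense_ge0 (mM v mv) (fun x => p0 (v x)) iv e8.
  exists s; split=> //.
  have : L2 nu (fun x => (Num.max (v x) 0)%:C - simple s x).
    apply: L2B; last exact: L2_simple.
    apply/L2P; split; first by apply: cmeasurable_real; exact: mM.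
    apply: eq_integrable iv => // x _; apply: (congr1 EFin).
    by rewrite normc_real real_normK// num_real.
  move=> /L2P[_]; apply: eq_integrable => // x _; apply: (congr1 EFin).
  by rewrite normc_sqrE !ReImE s2 subr0 /= expr0n addr0.
have sqN (v : R) : (- v) ^+ 2 = v ^+ 2 by rewrite sqrrN.
have [s1 [A1 I1 J1 L1]] := m_ _ m1 Rei.
have [s2 [A2 I2 J2 L2']] := m_ _ (mN _ m1) (fun x => eq_ind_r (fun z => z <= _) (Rei x) (sqN _)).
have [s3 [A3 I3 J3 L3]] := m_ _ m2 Imi.
have [s4 [A4 I4 J4 L4]] := m_ _ (mN _ m2) (fun x => eq_ind_r (fun z => z <= _) (Imi x) (sqN _)).
pose s := s1 ++ lscale (-1) s2 ++ lscale 'i%C s3 ++ lscale (- 'i%C) s4.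
have As : admissible s by do ?apply: admissible_cat => //; exact: admissible_lscale.
exists s; split=> //.
have lhs : L2 nu (fun x => h x - simple s x) by apply: L2B => //; exact: L2_simple.
rewrite (L2_sqnormE lhs) lee_fin.
have maxD (v : R) : v = Num.max v 0 - Num.max (- v) 0.
  by have [v0|v0] := leP 0 v; have [w0|w0] := leP 0 (- v); lra.
pose b x := 2 * (((Num.max (complex.Re (h x)) 0 - complex.Re (simple s1 x)) ^+ 2 +
    (Num.max (- complex.Re (h x)) 0 - complex.Re (simple s2 x)) ^+ 2) +
   ((Num.max (complex.Im (h x)) 0 - complex.Re (simple s3 x)) ^+ 2 +
    (Num.max (- complex.Im (h x)) 0 - complex.Re (simple s4 x)) ^+ 2)).
have ib : nu.-integrable setT (EFin \o b).
  by apply: integrable_EFinZ; apply: integrable_EFinD; apply: integrable_EFinD.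
apply: (@le_trans _ _ (\int[nu]_x b x)).
  apply: le_Rintegral => //; first by case/L2P: lhs.
  move=> x _; rewrite normc_sqrE !ReImE /s !simple_cat !simple_lscale !ReImE.
  rewrite !(I1, I2, I3, I4) /b /=.
  rewrite {1}(maxD (complex.Re (h x))) {1}(maxD (complex.Im (h x))).
  set r1 := Num.max _ _; set r2 := Num.max _ _; set r3 := Num.max _ _; set r4 := Num.max _ _.
  set q1 := complex.Re _; set q2 := complex.Re _; set q3 := complex.Re _; set q4 := complex.Re _.
  rewrite -subr_ge0; have := sqr_ge0 (r1 - q1 + (r2 - q2)).
  by have := sqr_ge0 (r3 - q3 + (r4 - q4)); nra.
rewrite /b RintegralZl//; last by apply: integrable_EFinD; apply: integrable_EFinD.
rewrite !RintegralD//; try by apply: integrable_EFinD.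
lra.
Qed.

End simple_functions_dense.

(** * The stochastic integral *)

Section stochastic_integral.
Context {d : measure_display} {Omega : measurableType d} {R : realType}.
Variable P : probability Omega R.
Variables (nu : {measure set R -> \bar R}) (Z : set R -> Omega -> R[i]).
Hypothesis rmZ : is_random_measure P nu Z.
Implicit Types (s t : seq (R[i] * set R)).

Lemma simple_int_cons p s :
  simple_int Z (p :: s) = fun w => p.1 * Z p.2 w + simple_int Z s w.
Proof. by apply/funext => x; rewrite /simple_int big_cons. Qed.

Lemma simple_int_nil : simple_int Z [::] = fun=> 0.
Proof. by apply/funext => x; rewrite /simple_int big_nil. Qed.

Lemma simple_int_cat s t w :
  simple_int Z (s ++ t) w = simple_int Z s w + simple_int Z t w.
Proof. by rewrite /simple_int big_cat. Qed.

Lemma simple_int_lscale z s w : simple_int Z (lscale z s) w = z * simple_int Z s w.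
Proof.
rewrite /simple_int /lscale big_map mulr_sumr.
by apply: eq_bigr => p _; rewrite mulrA.
Qed.

Lemma L2_simple_int s : admissible nu s -> L2 P (simple_int Z s).
Proof.
elim: s => [|p s IH]; first by rewrite simple_int_nil => _; exact: L2_0.
move=> /admissible_cons[hp hs]; rewrite simple_int_cons; apply: L2D; last exact: IH.
by apply: L2Zl; exact: (rmZ.1 _ hp).
Qed.

Lemma inner_indic E1 E2 : finite_Borel nu E1 -> finite_Borel nu E2 ->
  inner P (Z E1) (Z E2) =
  inner nu (fun x => (\1_E1 x : R)%:C) (fun x => (\1_E2 x : R)%:C).
Proof.
move=> f1 f2; rewrite [LHS](rmZ.2 _ _ f1 f2); apply: eq_ReIm; rewrite /inner /cintegral /=; last first.
  rewrite (_ : (fun x => _) = fun=> 0); first by rewrite /Rintegral integral0.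
  by apply/funext => x; ring.
case: f1 f2 => [m1 _] [m2 _]; have m12 := measurableI _ _ m1 m2.
rewrite /Rintegral -[in LHS](setIT (E1 `&` E2)) -integral_indic//.
congr fine; apply: eq_integral => x _.
by rewrite oppr0 mulr0 subr0 indicI.
Qed.

Lemma inner_simple_intl s E : admissible nu s -> finite_Borel nu E ->
  inner P (simple_int Z s) (Z E) = inner nu (simple s) (fun x => (\1_E x : R)%:C).
Proof.
elim: s => [|p s IH] As hE.
  rewrite simple_int_nil simple_nil /inner.
  by rewrite /cintegral; congr (_ +i* _); under eq_Rintegral do rewrite mul0r/=;
    under [RHS]eq_Rintegral do rewrite mul0r/=; rewrite /Rintegral !integral0.
move: As => /admissible_cons[hp hs].
rewrite simple_int_cons simple_cons !innerDl//; [|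
  by apply: L2Zl; exact: L2_indic|exact: L2_simple|exact: L2_indic|
  by apply: L2Zl; exact: (rmZ.1 _ hp)|exact: L2_simple_int|exact: (rmZ.1 _ hE)].
rewrite IH// !innerZl//; try exact: L2_indic; try exact: rmZ.1.
by rewrite inner_indic.
Qed.

(** By sesquilinearity, the isometry on indicators extends to simple functions. *)
Lemma inner_simple_int s t : admissible nu s -> admissible nu t ->
  inner P (simple_int Z s) (simple_int Z t) = inner nu (simple s) (simple t).
Proof.
move=> + At; elim: s => [|p s IH] As.
  rewrite simple_int_nil simple_nil /inner.
  by rewrite /cintegral; congr (_ +i* _); under eq_Rintegral do rewrite mul0r/=;
    under [RHS]eq_Rintegral do rewrite mul0r/=; rewrite /Rintegral !integral0.
move: As => /admissible_cons[hp hs].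
have LZ : L2 P (Z p.2) by exact: rmZ.1.
have L1 : L2 nu (fun x => (\1_(p.2) x : R)%:C) by exact: L2_indic.
have Lt := L2_simple At; have LTt := L2_simple_int At.
rewrite simple_int_cons simple_cons !innerDl//; [|by apply: L2Zl|exact: L2_simple|
  by apply: L2Zl|exact: L2_simple_int].
rewrite IH// !innerZl//; congr (_ * _ + _).
by rewrite innerC// inner_simple_intl// -innerC.
Qed.

Lemma norm_simple_int s : admissible nu s ->
  \int[P]_w Normc.normc (simple_int Z s w) ^+ 2 =
  \int[nu]_x Normc.normc (simple s x) ^+ 2.
Proof.
move=> As; have := inner_simple_int As As.
rewrite !inner_sqnorm; [|exact: L2_simple|exact: L2_simple_int].
by move=> /(congr1 (@complex.Re R)).
Qed.

(** The isometry passes to limits by continuity of the squared norm. *)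
Lemma stochastic_integral_norm h X : L2 nu h ->
  is_stochastic_integral P nu Z h X ->
  \int[P]_w Normc.normc (X w) ^+ 2 = \int[nu]_x Normc.normc (h x) ^+ 2.
Proof.
move=> lh [lX [s [As sh sX]]].
have c1 := sqnorm_cvg lh (fun n => L2_simple (As n)) sh.
have c2 := sqnorm_cvg lX (fun n => L2_simple_int (As n)) sX.
have E : (fun n => \int[P]_w Normc.normc (simple_int Z (s n) w) ^+ 2) =
    (fun n => \int[nu]_x Normc.normc (simple (s n) x) ^+ 2).
  by apply/funext => n; exact: (norm_simple_int (As n)).
by move: c2; rewrite E => c2; rewrite -(cvg_lim _ c2)// (cvg_lim _ c1).
Qed.

Lemma sqnorm_addr_cvg0 d' (T : measurableType d') (mu : {measure set T -> \bar R})
    (f g : nat -> T -> R[i]) :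
  (forall n, cmeasurable (f n)) -> (forall n, cmeasurable (g n)) ->
  sqnorm mu (f n) @[n --> \oo] --> 0%E -> sqnorm mu (g n) @[n --> \oo] --> 0%E ->
  sqnorm mu (fun x => f n x + g n x) @[n --> \oo] --> 0%E.
Proof.
move=> mf mg f0 g0.
apply: (@squeeze_cvge _ _ _ _ (cst 0%E) _
    (fun n => 2%:E * (sqnorm mu (f n) + sqnorm mu (g n))))%E.
- apply: nearW => n; rewrite sqnorm_ge0/= /sqnorm.
  have mf2 := measurable_sqr_normc (mf n); have mg2 := measurable_sqr_normc (mg n).
  rewrite -ge0_integralD//; [|by move=> x _; rewrite lee_fin sqr_ge0|
    exact/measurable_EFinP|by move=> x _; rewrite lee_fin sqr_ge0|
    exact/measurable_EFinP].
  have mfg : measurable_fun setT (fun x => ((Normc.normc (f n x) ^+ 2)%:E +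
      (Normc.normc (g n x) ^+ 2)%:E)%E).
    by apply: emeasurable_funD; exact/measurable_EFinP.
  rewrite -ge0_integralZl//; last by move=> x _; rewrite -EFinD lee_fin addr_ge0// sqr_ge0.
  apply: ge0_le_integral => //.
  + by move=> x _; rewrite lee_fin sqr_ge0.
  + by apply/measurable_EFinP; apply: measurable_sqr_normc; exact: cmeasurableD.
  + exact: emeasurable_funM.
  + by move=> x _; rewrite -EFinD -EFinM lee_fin; exact: normc_addr_sqr.
- exact: cvg_cst.
- rewrite (_ : 0%E = 2%:E * (0 + 0))%E; last by rewrite adde0 mule0.
  by apply: cvgeZl => //; apply: cvgeD.
Qed.

Lemma stochastic_integralB h1 h2 X1 X2 : L2 nu h1 -> L2 nu h2 ->
  is_stochastic_integral P nu Z h1 X1 -> is_stochastic_integral P nu Z h2 X2 ->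
  is_stochastic_integral P nu Z (fun x => h1 x - h2 x) (fun w => X1 w - X2 w).
Proof.
move=> lh1 lh2 [lX1 [s1 [As1 sh1 sX1]]] [lX2 [s2 [As2 sh2 sX2]]].
split; first exact: L2B.
exists (fun n => s1 n ++ lscale (-1) (s2 n)); split.
- by move=> n; apply: admissible_cat; [exact: As1|apply: admissible_lscale; exact: As2].
- have -> : (fun n => sqnorm nu (fun x => h1 x - h2 x - simple (s1 n ++ lscale (-1) (s2 n)) x)) =
      fun n => sqnorm nu (fun x => (h1 x - simple (s1 n) x) + (simple (s2 n) x - h2 x)).
    apply/funext => n; congr (sqnorm _ _); apply/funext => x.
    by rewrite simple_cat simple_lscale; ring.
  apply: sqnorm_addr_cvg0 => //.
  + by move=> n; apply: cmeasurableB; [case: lh1|case: (L2_simple (As1 n))].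
  + by move=> n; apply: cmeasurableB; [case: (L2_simple (As2 n))|case: lh2].
  + apply: cvg_trans sh2; apply: near_eq_cvg; apply: nearW => n.
    by apply: eq_integral => x _; congr (_%:E); rewrite !normc_sqrE !ReImE; ring.
- have -> : (fun n => sqnorm P (fun w => X1 w - X2 w - simple_int Z (s1 n ++ lscale (-1) (s2 n)) w)) =
      fun n => sqnorm P (fun w => (X1 w - simple_int Z (s1 n) w) + (simple_int Z (s2 n) w - X2 w)).
    apply/funext => n; congr (sqnorm _ _); apply/funext => x.
    by rewrite simple_int_cat simple_int_lscale; ring.
  apply: sqnorm_addr_cvg0 => //.
  + by move=> n; apply: cmeasurableB; [case: lX1|case: (L2_simple_int (As1 n))].
  + by move=> n; apply: cmeasurableB; [case: (L2_simple_int (As2 n))|case: lX2].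
  + apply: cvg_trans sX2; apply: near_eq_cvg; apply: nearW => n.
    by apply: eq_integral => x _; congr (_%:E); rewrite !normc_sqrE !ReImE; ring.
Qed.

(** Simple approximations with geometrically small errors have, by the
    isometry, integrals with geometrically small increments. *)
Lemma stochastic_integral_exists h : L2 nu h ->
  exists X, is_stochastic_integral P nu Z h X.
Proof.
move=> lh.
(* the factor [1 / 4] compensates the loss in the triangle inequality *)
have e_gt0 n : 0 < 8^-1 ^+ n / 4 :> R by rewrite divr_gt0// exprn_gt0.
have /choice[s sP] n := simple_dense lh (e_gt0 n).
have As n : admissible nu (s n) by case: (sP n).
have sh n : (sqnorm nu (fun x => h x - simple (s n) x)%R <= (8^-1 ^+ n / 4)%:E)%E.
  by case: (sP n).
have Ls n := L2_simple (As n).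
suff incr : forall n, (sqnorm P
    (fun w => simple_int Z (s n.+1) w - simple_int Z (s n) w)%R <= (8^-1 ^+ n)%:E)%E.
  have [X [LX cX]] := L2_complete (fun n => L2_simple_int (As n)) incr.
  exists X; split=> //; exists s; split=> //.
  apply: (@squeeze_cvge _ _ _ _ (cst 0%E) _ (fun n => (8^-1 ^+ n / 4)%:E)).
  - by apply: nearW => n; rewrite sqnorm_ge0 sh.
  - exact: cvg_cst.
  - apply: cvg_EFin; first exact: nearW.
    under eq_fun do rewrite mulrC.
    by apply: cvgn0_geometric; rewrite invr_ge0 ler0n/= invf_lt1// ltr1n.
move=> n.
pose t := s n.+1 ++ lscale (-1) (s n).
have At : admissible nu t by apply: admissible_cat => //; exact: admissible_lscale.
have -> : (fun w => simple_int Z (s n.+1) w - simple_int Z (s n) w) = simple_int Z t.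
  by apply/funext => w; rewrite simple_int_cat simple_int_lscale mulN1r.
rewrite (L2_sqnormE (L2_simple_int At)) norm_simple_int// lee_fin.
have LB k := L2B lh (Ls k).
have sB k : \int[nu]_x Normc.normc (h x - simple (s k) x) ^+ 2 <= 8^-1 ^+ k / 4.
  by rewrite -lee_fin -L2_sqnormE.
have iB k : nu.-integrable setT
    (EFin \o (fun x => Normc.normc (h x - simple (s k) x) ^+ 2)).
  by case/L2P: (LB k).
apply: (@le_trans _ _ (\int[nu]_x (2 * (Normc.normc (h x - simple (s n) x) ^+ 2 +
    Normc.normc (h x - simple (s n.+1) x) ^+ 2)))).
  apply: le_Rintegral => //.
  - by case/L2P: (L2_simple At).
  - by apply: integrable_EFinZ; exact: integrable_EFinD.
  move=> x _.
  rewrite (_ : simple t x = (h x - simple (s n) x) + (simple (s n.+1) x - h x)); last first.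
    by rewrite simple_cat simple_lscale; ring.
  apply: le_trans (normc_addr_sqr _ _) _.
  rewrite ler_pM2l// lerD2l le_eqVlt; apply/orP; left; apply/eqP.
  by rewrite !normc_sqrE !ReImE; ring.
rewrite RintegralZl//; last exact: integrable_EFinD.
rewrite RintegralD//.
have := sB n; have := sB n.+1; rewrite exprS.
have : 0 <= 8^-1 ^+ n :> R by rewrite exprn_ge0.
lra.
Qed.

End stochastic_integral.

Section pairings.
Context {d : measure_display} {Omega : measurableType d} {R : realType}.
Variable P : probability Omega R.
Variable V : stationary_operator P.

(** The chosen value of the pairing has the defining property because every
    square-integrable density has a stochastic integral. *)
Lemma pairingP g : domain V g -> exists2 h, fourier_L2 V g h &
  is_stochastic_integral P (spectral_measure V) (random_measure V) h (pairing V g).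
Proof.
move=> dg; have [_ [h hh]] := dg; have [X XP] := stochastic_integral_exists
  (random_measureP V) hh.2.
have /= : [set X | domain V g /\ exists2 h, fourier_L2 V g h &
    is_stochastic_integral P (spectral_measure V) (random_measure V) h X]
    (pairing V g).
  by apply: (xgetPex (fun=> 0)); exists X; split=> //; exists h.
by case.
Qed.

End pairings.

(** * Calculus on the line *)

Section calculus.
Context {R : realType}.
Notation leb := (@lebesgue_measure R).
Implicit Types (f g : R -> R) (x : R).

(** Differentiation rules with plain function bodies, which unify with goals as
    they are displayed, unlike the rules for pointwise operations. *)
Lemma is_deriveMx f g x a b : is_derive x 1 f a -> is_derive x 1 g b ->
  is_derive x 1 (fun y => f y * g y) (a * g x + f x * b).
Proof.
move=> df dg; have := @is_deriveM _ _ f g x 1 a b df dg.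
by move=> h; apply: is_derive_eq h _; rewrite /GRing.scale/= addrC; ring.
Qed.

Lemma is_deriveDx f g x a b : is_derive x 1 f a -> is_derive x 1 g b ->
  is_derive x 1 (fun y => f y + g y) (a + b).
Proof. by move=> df dg; exact: (@is_deriveD _ _ _ f g x 1 a b df dg). Qed.

Lemma is_deriveNx f x a : is_derive x 1 f a -> is_derive x 1 (fun y => - f y) (- a).
Proof. by move=> df; exact: (@is_deriveN _ _ _ f x 1 a df). Qed.

Lemma is_deriveBx f g x a b : is_derive x 1 f a -> is_derive x 1 g b ->
  is_derive x 1 (fun y => f y - g y) (a - b).
Proof. by move=> df dg; exact: (@is_deriveB _ _ _ f g x 1 a b df dg). Qed.

Lemma is_derive_cstx (c : R) x : is_derive x 1 (fun=> c) 0.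
Proof. exact: is_derive_cst. Qed.

Lemma is_derive_idx x : is_derive x 1 (fun y => y) 1.
Proof. exact: is_derive_id. Qed.

Lemma is_derive_compx f g x a b : is_derive (g x) 1 f a -> is_derive x 1 g b ->
  is_derive x 1 (fun y => f (g y)) (a * b).
Proof.
by move=> df dg; exact: (@is_derive1_comp _ f g x a b df dg).
Qed.

Lemma is_derive_expx g x b : is_derive x 1 g b ->
  is_derive x 1 (fun y => expR (g y)) (expR (g x) * b).
Proof. by move=> dg; apply: is_derive_compx; exact: is_derive_expR. Qed.

Lemma is_derive_cosx g x b : is_derive x 1 g b ->
  is_derive x 1 (fun y => cos (g y)) (- sin (g x) * b).
Proof. by move=> dg; apply: is_derive_compx; exact: is_derive_cos. Qed.

Lemma is_derive_sinx g x b : is_derive x 1 g b ->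
  is_derive x 1 (fun y => sin (g y)) (cos (g x) * b).
Proof. by move=> dg; apply: is_derive_compx; exact: is_derive_sin. Qed.

Lemma is_deriveVx f x a : f x != 0 -> is_derive x 1 f a ->
  is_derive x 1 (fun y => (f y)^-1) (- (f x) ^- 2 * a).
Proof. by move=> fx df; have := @is_deriveV _ f x a 1 fx df; rewrite /GRing.scale. Qed.

Lemma is_deriveZx (c : R) f x a : is_derive x 1 f a ->
  is_derive x 1 (fun y => c * f y) (c * a).
Proof.
move=> df; apply: is_derive_eq (is_deriveMx (is_derive_cstx c x) df) _.
by rewrite mul0r add0r.
Qed.

Lemma is_derive_linear (c b x : R) : is_derive x 1 (fun y => c * (y - b)) c.
Proof.
apply: is_derive_eq (is_deriveZx c (is_deriveBx (is_derive_idx x) (is_derive_cstx b x))) _.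
by rewrite subr0 mulr1.
Qed.

Lemma is_derive_continuous f x a : is_derive x 1 f a -> {for x, continuous f}.
Proof. by move=> [df _]; exact/differentiable_continuous/derivable1_diffP. Qed.

Lemma continuous_is_derive f f' : (forall x, is_derive x 1 f (f' x)) -> continuous f.
Proof. by move=> df x; exact: is_derive_continuous (df x). Qed.

Lemma FTC_is_derive f F (a b : R) : a < b -> (forall x, a <= x <= b -> is_derive x 1 F (f x)) ->
  {within `[a, b], continuous f} ->
  \int[leb]_(x in `[a, b]) f x = F b - F a.
Proof.
move=> ab dF cf; rewrite /Rintegral (@continuous_FTC2 _ f F)//.
- split.
  + move=> x; rewrite in_itv/= => /andP[ax xb].
    by have /dF[] : a <= x <= b by rewrite (ltW ax) (ltW xb).
  + apply: cvg_at_right_filter; apply: (@is_derive_continuous _ _ (f a)).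
    by apply: dF; rewrite lexx ltW.
  + apply: cvg_at_left_filter; apply: (@is_derive_continuous _ _ (f b)).
    by apply: dF; rewrite lexx ltW.
- move=> x; rewrite in_itv/= => /andP[ax xb]; rewrite derive1E.
  by have /dF[_ ->] : a <= x <= b by rewrite (ltW ax) (ltW xb).
Qed.

(** An instance for functions on [R] itself, on which two convertible measurable
    structures coexist. *)
Lemma dominated_leb (f_ : nat -> R -> R) (f g : R -> R) :
  (forall n, measurable_fun setT (f_ n)) -> measurable_fun setT f ->
  leb.-integrable setT (EFin \o g) ->
  {ae leb, forall x, (forall n, `|f_ n x| <= g x) /\
                    (f_ n x @[n --> \oo] --> f x)} ->
  leb.-integrable setT (EFin \o f) /\
  \int[leb]_x f_ n x @[n --> \oo] --> \int[leb]_x f x.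
Proof. exact: (@dominated_Rintegral _ _ _ leb f_ f g). Qed.

Lemma integrable_trunc_cvg (D : nat -> set R) f :
  (forall n, measurable (D n)) ->
  (forall x, \forall n \near \oo, D n x) ->
  leb.-integrable setT (EFin \o f) ->
  \int[leb]_(x in D n) f x @[n --> \oo] --> \int[leb]_x f x.
Proof.
move=> mD Dn if_; have mf := integrable_measurable if_.
have m1 n : measurable_fun setT (f \_ (D n)).
  exact: ((measurable_restrictT _ (mD n)).1 (measurable_funTS mf)).
have h1 : {ae leb, forall x, (forall n, `|(f \_ (D n)) x| <= `|f x|) /\
    ((f \_ (D n)) x @[n --> \oo] --> f x)}.
  apply: aeW => x; split=> [n|].
    by rewrite patchE; case: ifP => // _; rewrite normr0.
  apply: cvg_near_cst; apply: filterS (Dn x) => n Dnx.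
  by rewrite patchE mem_set.
have [_ cv] := dominated_leb m1 mf (integrable_norm if_) h1.
apply: cvg_trans cv; apply: near_eq_cvg; apply: nearW => n.
by rewrite -Rintegral_mkcond.
Qed.

Lemma near_symmetric_itv x : \forall n \near \oo, `[- n%:R, n%:R]%classic x.
Proof.
near=> n; rewrite /= in_itv/= -ler_norml; near: n.
exact: nbhs_infty_ger.
Unshelve. all: by end_near. Qed.

(** No mass escapes: the integral over the line of the derivative of a function
    vanishing at both ends is zero. *)
Lemma integral_derive0 f F : (forall x, is_derive x 1 F (f x)) -> continuous f ->
  leb.-integrable setT (EFin \o f) ->
  F n%:R @[n --> \oo] --> (0 : R) -> F (- n%:R) @[n --> \oo] --> (0 : R) ->
  \int[leb]_x f x = 0.
Proof.
move=> dF cf if_ F1 F2.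
have cv := integrable_trunc_cvg (fun n => measurable_itv `[- n%:R, n%:R])
  near_symmetric_itv if_.
rewrite -(cvg_lim _ cv)//; apply: cvg_lim => //.
rewrite -(subrr 0); apply: cvg_trans (cvgB F1 F2); apply: near_eq_cvg.
exists 1%N => // n /= n1; rewrite (@FTC_is_derive f F)//.
- by rewrite (@lt_trans _ _ 0)// ?oppr_lt0 ltr0n.
- exact: continuous_subspaceT.
Qed.

Lemma is_derive0_cst f : (forall x, is_derive x 1 f 0) -> forall x y, f x = f y.
Proof. by move=> df x y; exact: (@is_derive_0_is_cst _ f x y df). Qed.

(** The quotient by the Gaussian has zero derivative. *)
Lemma gaussian_ode (c : R) f : (forall x, is_derive x 1 f (- (c * x) * f x)) ->
  forall x, f x = f 0 * expR (- (c * x ^+ 2 / 2)).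
Proof.
move=> df.
have E x : is_derive x 1 (fun y => c * y ^+ 2 / 2) (c * x).
  rewrite (_ : (fun y => _) = fun y : R => (c / 2) * (y * y)); last first.
    by apply/funext => y; rewrite expr2; ring.
  apply: is_derive_eq (is_deriveZx _ (is_deriveMx (is_derive_idx x) (is_derive_idx x))) _.
  by field.
have D0 x : is_derive x 1 (fun y => f y * expR (c * y ^+ 2 / 2)) 0.
  apply: is_derive_eq (is_deriveMx (df x) (is_derive_expx (E x))) _.
  by ring.
move=> x; have := is_derive0_cst (f := fun y => f y * expR (c * y ^+ 2 / 2)) D0 x 0.
rewrite expr0n/= mulr0 mul0r expR0 mulr1 => <-.
by rewrite -mulrA -expRD subrr expR0 mulr1.
Qed.

End calculus.

Section derive_integral.
Context {d : measure_display} {T : measurableType d} {R : realType}.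
Variable mu : {measure set T -> \bar R}.

Lemma is_derive_integral (D : set T) (f df : R -> T -> R) (G : T -> R) (a u v : R) :
  measurable D -> u < a < v ->
  (forall x, u < x < v -> mu.-integrable D (EFin \o f x)) ->
  (forall x y, u < x < v -> D y -> is_derive x 1 (f ^~ y) (df x y)) ->
  mu.-integrable D (EFin \o G) ->
  (forall x y, u < x < v -> D y -> `|df x y| <= G y) ->
  is_derive a 1 (fun x => \int[mu]_(y in D) f x y) (\int[mu]_(y in D) df a y).
Proof.
move=> mD uav if_ dff iG dfG.
have Ia : a \in `]u, v[ by rewrite in_itv.
have p1 x y : x \in `]u, v[ -> D y -> partial1of2 f x y = df x y.
  rewrite in_itv/= => xuv Dy; rewrite partial1of2E.
  by have [_ ->] := dff x y xuv Dy.
have h1 x : `]u, v[%classic x -> mu.-integrable D (EFin \o f x).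
  by rewrite /= in_itv/=; exact: if_.
have h2 x y : `]u, v[%classic x -> D y -> derivable (f ^~ y) x 1.
  by rewrite /= in_itv/= => xuv Dy; have [] := dff x y xuv Dy.
have h3 x y : `]u, v[%classic x -> D y -> `|partial1of2 f x y| <= `|G y|.
  move=> xuv Dy; rewrite p1//; move: xuv; rewrite /= in_itv/= => xuv.
  by rewrite (le_trans (dfG x y xuv Dy))// ler_norm.
have iG' : mu.-integrable D (EFin \o (fun y => `|G y|)) by exact: integrable_norm.
split.
  exact: (derivable_under_integral mD Ia h1 h2 (fun y => normr_ge0 (G y)) iG' h3).
rewrite -derive1E (differentiation_under_integral mD Ia h1 h2 (fun y => normr_ge0 (G y)) iG' h3).
by apply: eq_Rintegral => y; rewrite inE => Dy; rewrite p1.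
Qed.

End derive_integral.

Lemma nonincreasing_is_derive {R : realType} (f f' : R -> R) :
  (forall t : R, 0 < t -> is_derive t 1 f (f' t)) -> (forall t, 0 < t -> f' t <= 0) ->
  forall s t, 0 < s -> s <= t -> f t <= f s.
Proof.
move=> df f0 s t s0 st.
apply: (@ler0_derive1_nincry _ f s) => //.
- move=> x; rewrite in_itv/= andbT => sx.
  by have [] := df _ (lt_trans s0 sx).
- move=> x; rewrite in_itv/= andbT => sx; rewrite derive1E.
  have x0 := lt_trans s0 sx; have [_ ->] := df _ x0.
  exact: f0.
- apply: continuous_in_subspaceT => x; rewrite inE/= in_itv/= andbT => sx.
  exact: is_derive_continuous (df _ (lt_le_trans s0 sx)).
Qed.

(** * Gaussian integrals *)

Section gaussians.
Context {R : realType}.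
Notation leb := (@lebesgue_measure R).
Implicit Types (m s t x : R).

Lemma normal_pdfEx m s t : 0 < s ->
  normal_pdf m s t = normal_peak s * expR (- (t - m) ^+ 2 / (s ^+ 2 *+ 2)).
Proof. by move=> s0; rewrite normal_pdfE ?gt_eqF. Qed.

Lemma is_derive_normal m s t : 0 < s ->
  is_derive t 1 (normal_pdf m s) (- (t - m) / s ^+ 2 * normal_pdf m s t).
Proof.
move=> s0.
have -> : normal_pdf m s = fun t => normal_peak s *
    expR (- (2 * s ^+ 2)^-1 * ((t - m) * (t - m))).
  by apply/funext => u; rewrite normal_pdfEx//; congr (_ * expR _); field; rewrite gt_eqF.
have d1 : is_derive t 1 (fun u => u - m) 1.
  apply: is_derive_eq (is_deriveBx (is_derive_idx t) (is_derive_cstx m t)) _.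
  by rewrite subr0.
apply: is_derive_eq (is_deriveZx _ (is_derive_expx (is_deriveZx _ (is_deriveMx d1 d1)))) _.
by field; rewrite gt_eqF.
Qed.

Lemma continuous_normal m s : 0 < s -> continuous (normal_pdf m s).
Proof. by move=> s0; apply: continuous_normal_pdf; rewrite gt_eqF. Qed.

Lemma integrable_normal m s : leb.-integrable setT (EFin \o normal_pdf m s).
Proof. exact: integrable_normal_pdf. Qed.

Lemma Rintegral_normal m s : \int[leb]_x normal_pdf m s x = 1.
Proof. by rewrite /Rintegral integral_normal_pdf. Qed.

Lemma normal_peak2 s : 0 < s -> normal_peak s = 2 * normal_peak (2 * s).
Proof.
move=> s0; rewrite /normal_peak.
have -> : (2 * s) ^+ 2 * pi *+ 2 = 2 ^+ 2 * (s ^+ 2 * pi *+ 2) :> R by ring.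
rewrite sqrtrM ?sqr_ge0// sqrtr_sqr ger0_norm// invfM mulrA divff// mul1r//.
Qed.

Lemma mul_expN_le1 (y : R) : 0 <= y -> y * expR (- y) <= 1.
Proof.
move=> y0; rewrite expRN ler_pdivrMr ?expR_gt0// mul1r.
by apply: le_trans (expR_ge1Dx y); rewrite lerDr.
Qed.

(** Polynomial factors are absorbed by widening the gaussian. *)
Lemma normal_moment2 m s t : 0 < s ->
  (t - m) ^+ 2 * normal_pdf m s t <= 8 * s ^+ 2 * normal_pdf m (2 * s) t.
Proof.
move=> s0; have s20 : 0 < 2 * s by rewrite mulr_gt0.
rewrite !normal_pdfEx// (normal_peak2 s0).
set u := t - m.
set y := 3 * u ^+ 2 / (8 * s ^+ 2).
have sn0 : s != 0 by rewrite gt_eqF.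
have -> : - u ^+ 2 / (s ^+ 2 *+ 2) = - y + - u ^+ 2 / ((2 * s) ^+ 2 *+ 2).
  by rewrite /y; field.
have y0 : 0 <= y by rewrite /y divr_ge0// mulr_ge0// sqr_ge0.
have -> : u ^+ 2 = 8 * s ^+ 2 / 3 * y by rewrite /y; field.
rewrite expRD; set w := normal_peak _; set e := expR (_ / _).
have e0 : 0 <= e by exact: expR_ge0.
have w0 : 0 <= w by exact: normal_peak_ge0.
have := mul_expN_le1 y0; set z := y * expR (- y) => z1.
have -> : 8 * s ^+ 2 / 3 * y * (2 * w * (expR (- y) * e)) =
  (8 * s ^+ 2 / 3 * 2 * (w * e)) * z by rewrite /z; ring.
have h : 0 <= s ^+ 2 * (w * e) by rewrite mulr_ge0 ?sqr_ge0// mulr_ge0.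
by nra.
Qed.

Lemma normal_moment1 m s t : 0 < s ->
  `|t - m| * normal_pdf m s t <= normal_pdf m s t + 8 * s ^+ 2 * normal_pdf m (2 * s) t.
Proof.
move=> s0; have := normal_moment2 m t s0.
have n0 := normal_pdf_ge0 m s t.
rewrite -(real_normK (num_real (t - m))).
move: n0; set p := normal_pdf m s t; set a := `|t - m| => p0.
have : a <= 1 + a ^+ 2 by have := sqr_ge0 (a - 1); have := normr_ge0 (t - m); rewrite -/a; nra.
by move=> h1 h2; have := ler_wpM2r p0 h1; lra.
Qed.

Lemma normal_cvg0 m s (v : nat -> R) : 0 < s ->
  (forall A, \forall n \near \oo, A <= `|v n - m|) ->
  normal_pdf m s (v n) @[n --> \oo] --> (0 : R).
Proof.
move=> s0 vA; apply/cvgrPdist_le => e e0.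
have s20 : 0 < 2 * s by rewrite mulr_gt0.
set B := 8 * s ^+ 2 * normal_peak (2 * s).
have B0 : 0 <= B by rewrite mulr_ge0 ?normal_peak_ge0// mulr_ge0 ?sqr_ge0.
apply: filterS2 (vA 1) (vA (B / e)) => n h1 h2.
rewrite sub0r normrN ger0_norm ?normal_pdf_ge0//.
have h3 : 0 < `|v n - m| by apply: lt_le_trans h1.
have := normal_moment2 m (v n) s0.
rewrite -(real_normK (num_real (v n - m))); set a := `|v n - m| in h1 h2 h3 *.
move=> h4.
have {}h4 : a ^+ 2 * normal_pdf m s (v n) <= B.
  have q0 : 0 <= 8 * s ^+ 2 by apply: mulr_ge0 => //; exact: sqr_ge0.
  apply: le_trans h4 _; apply: ler_wpM2l => //.
  by apply: normal_pdf_ub; rewrite gt_eqF.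
have h5 : B <= a * e by rewrite -ler_pdivrMr.
have a2 : 0 < a ^+ 2 by rewrite exprn_gt0.
rewrite -(ler_pM2l a2) (le_trans h4)// (le_trans h5)//.
by rewrite ler_wpM2r ?(ltW e0)// expr2 ler_peMr// ltW.
Qed.

Lemma near_abs_ge (m A : R) : \forall n \near \oo, A <= `|n%:R - m|.
Proof.
near=> n; rewrite (le_trans _ (ler_norm _))// lerBrDr; near: n.
exact: nbhs_infty_ger.
Unshelve. all: by end_near. Qed.

Lemma near_abs_leN (m A : R) : \forall n \near \oo, A <= `|- n%:R - m|.
Proof.
near=> n; rewrite -opprD normrN (le_trans _ (ler_norm _))// -lerBlDr; near: n.
exact: nbhs_infty_ger.
Unshelve. all: by end_near. Qed.

Section characteristic_function.
Variables (m s : R).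
Hypothesis s0 : 0 < s.
Let N := normal_pdf m s.

Let mN : measurable_fun setT N.
Proof. exact: measurable_normal_pdf. Qed.

Let iN : leb.-integrable setT (EFin \o N).
Proof. exact: integrable_normal. Qed.

Let N0 t : 0 <= N t. Proof. exact: normal_pdf_ge0. Qed.

Let trig_cont (c : R -> R) x : continuous c -> continuous (fun t => c (x * (t - m))).
Proof.
move=> cc t; apply: (@continuous_comp _ _ _ (fun t => x * (t - m)) c); last exact: cc.
exact: is_derive_continuous (is_derive_linear x m t).
Qed.

Lemma integrable_normal_bounded (c : R -> R) : measurable_fun setT c ->
  (forall t, `|c t| <= 1) ->
  leb.-integrable setT (EFin \o (fun t => N t * c t)).
Proof.
move=> mc c1; apply: (@integrable_dom _ _ _ leb _ N) => //.
  exact: measurable_funM.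
by move=> t; rewrite normrM (ger0_norm (N0 t)) ler_piMr.
Qed.

Lemma integrable_normal_moment (c : R -> R) : measurable_fun setT c ->
  (forall t, `|c t| <= 1) ->
  leb.-integrable setT (EFin \o (fun t => (t - m) * N t * c t)).
Proof.
move=> mc c1; apply: (@integrable_dom _ _ _ leb _
    (fun t => N t + 8 * s ^+ 2 * normal_pdf m (2 * s) t)).
- by apply: measurable_funM => //; apply: measurable_funM => //; apply: measurable_funB.
- apply: integrable_EFinD => //; apply: integrable_EFinZ; exact: integrable_normal.
- move=> t; rewrite normrM -[leRHS]mulr1; apply: ler_pM => //.
  by rewrite normrM (ger0_norm (N0 t)); exact: normal_moment1.
Qed.

Let mtrig (c : R -> R) x : continuous c ->
  measurable_fun setT (fun t => c (x * (t - m))).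
Proof. by move=> cc; apply: continuous_measurable_fun; exact: trig_cont. Qed.

Let cos1 (t : R) : `|cos t| <= 1.
Proof. by rewrite ler_norml cos_geN1 cos_le1. Qed.

Let sin1 (t : R) : `|sin t| <= 1.
Proof. by rewrite ler_norml sin_geN1 sin_le1. Qed.

Let moment_trig (c c' : R -> R) x :
  (forall t, is_derive t 1 c (c' t)) -> continuous c' ->
  (forall t, `|c t| <= 1) -> (forall t, `|c' t| <= 1) ->
  \int[leb]_t ((t - m) * N t * c (x * (t - m))) =
  s ^+ 2 * x * \int[leb]_t (N t * c' (x * (t - m))).
Proof.
move=> dc cc' c1 c1'.
have cc : continuous c := continuous_is_derive dc.
pose f t := - (s ^+ 2)^-1 * ((t - m) * N t * c (x * (t - m))) +
   x * (N t * c' (x * (t - m))).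
have i1 := integrable_normal_moment (mtrig x cc) (fun t => c1 _).
have i2 := integrable_normal_bounded (mtrig x cc') (fun t => c1' _).
have i3 := integrable_EFinZ (- (s ^+ 2)^-1) i1.
have i4 := integrable_EFinZ x i2.
suff : \int[leb]_t f t = 0.
  rewrite /f RintegralD// RintegralZl// RintegralZl//.
  set A := Rintegral _ _ _; set B := Rintegral _ _ _ => h.
  have s2 : s ^+ 2 != 0 by rewrite expf_eq0/= gt_eqF.
  by apply: (mulfI (invr_neq0 s2)); rewrite mulrA mulrA mulVf// mul1r; lra.
apply: (@integral_derive0 _ f (fun t => N t * c (x * (t - m)))).
- move=> t; apply: is_derive_eq (is_deriveMx (is_derive_normal m t s0)
    (is_derive_compx (dc _) (is_derive_linear x m t))) _.
  by rewrite /f -/(N t); ring.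
- move=> t; have cN : {for t, continuous N} by exact: continuous_normal.
  apply: cvgD; apply: cvgM => //; try exact: cvg_cst.
    apply: cvgM; last exact: trig_cont.
    by apply: cvgM => //; apply: cvgB; [exact: cvg_id|exact: cvg_cst].
  by apply: cvgM => //; exact: trig_cont.
- exact: integrable_EFinD.
- have h := normal_cvg0 s0 (near_abs_ge m).
  apply: norm_cvg0; apply: (@squeeze_cvgr _ _ _ _ (cst 0) _ _ _ _ _ h); last exact: cvg_cst.
  by apply: nearW => n; rewrite normr_ge0/= normrM (ger0_norm (N0 _)) ler_piMr.
- have h := normal_cvg0 s0 (near_abs_leN m).
  apply: norm_cvg0; apply: (@squeeze_cvgr _ _ _ _ (cst 0) _ _ _ _ _ h); last exact: cvg_cst.
  by apply: nearW => n; rewrite normr_ge0/= normrM (ger0_norm (N0 _)) ler_piMr.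
Qed.

Let derive_trig (c c' : R -> R) x :
  (forall t, is_derive t 1 c (c' t)) -> continuous c' ->
  (forall t, `|c t| <= 1) -> (forall t, `|c' t| <= 1) ->
  is_derive x 1 (fun x => \int[leb]_t (N t * c (x * (t - m))))
    (\int[leb]_t ((t - m) * N t * c' (x * (t - m)))).
Proof.
move=> dc cc' c1 c1'.
apply: (@is_derive_integral _ _ _ leb setT (fun x t => N t * c (x * (t - m)))
  (fun x t => (t - m) * N t * c' (x * (t - m)))
  (fun t => N t + 8 * s ^+ 2 * normal_pdf m (2 * s) t) x (x - 1) (x + 1)) => //.
- by rewrite ltrBlDr ltrDl ltr01.
- by move=> y _; apply: integrable_normal_bounded => //; apply: mtrig;
    exact: continuous_is_derive dc.
- move=> y t _ _.
  apply: is_derive_eq (is_deriveZx (N t) (is_derive_compx (dc _)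
    (is_deriveMx (is_derive_idx y) (is_derive_cstx (t - m) y)))) _.
  by ring.
- apply: integrable_EFinD => //; apply: integrable_EFinZ; exact: integrable_normal.
- move=> y t _ _; rewrite normrM -[leRHS]mulr1; apply: ler_pM => //.
  by rewrite normrM (ger0_norm (N0 t)); exact: normal_moment1.
Qed.

(** The characteristic function solves a linear differential equation in the
    frequency: differentiating it gives a first moment, and integrating by parts
    turns this moment back into the function. *)
Lemma normal_cos x :
  \int[leb]_t (N t * cos (x * (t - m))) = expR (- (s ^+ 2 * x ^+ 2 / 2)).
Proof.
have D (y : R) : is_derive y 1 (fun x => \int[leb]_t (N t * cos (x * (t - m))))
    (- (s ^+ 2 * y) * \int[leb]_t (N t * cos (y * (t - m)))).
  have cNs : continuous (fun t : R => - sin t).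
    by move=> t; apply: cvgN; exact: continuous_sin.
  have Ns1 (t : R) : `|- sin t| <= 1 by rewrite normrN.
  have dN (t : R) : is_derive t 1 (@cos R) (- sin t) by exact: is_derive_cos.
  apply: is_derive_eq (derive_trig y dN cNs cos1 Ns1) _.
  have dNs (t : R) : is_derive t 1 (fun t => - sin t) (- cos t).
    exact: is_deriveNx (is_derive_sin t).
  have cNc : continuous (fun t : R => - cos t).
    by move=> t; apply: cvgN; exact: continuous_cos.
  have Nc1 (t : R) : `|- cos t| <= 1 by rewrite normrN.
  rewrite (moment_trig y dNs cNc Ns1 Nc1).
  under eq_Rintegral do rewrite mulrN -mulN1r.
  rewrite RintegralZl//; first by ring.
  by apply: integrable_normal_bounded => //; apply: mtrig; exact: continuous_cos.
rewrite (gaussian_ode D x).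
under eq_Rintegral do rewrite mul0r cos0 mulr1.
by rewrite Rintegral_normal mul1r.
Qed.

Lemma normal_sin x : \int[leb]_t (N t * sin (x * (t - m))) = 0.
Proof.
have D (y : R) : is_derive y 1 (fun x => \int[leb]_t (N t * sin (x * (t - m))))
    (- (s ^+ 2 * y) * \int[leb]_t (N t * sin (y * (t - m)))).
  have ds (t : R) : is_derive t 1 (@sin R) (cos t) by exact: is_derive_sin.
  apply: is_derive_eq (derive_trig y ds (@continuous_cos R) sin1 cos1) _.
  have dc (t : R) : is_derive t 1 (@cos R) (- sin t) by exact: is_derive_cos.
  have cNs : continuous (fun t : R => - sin t).
    by move=> t; apply: cvgN; exact: continuous_sin.
  have Ns1 (t : R) : `|- sin t| <= 1 by rewrite normrN.
  rewrite (moment_trig y dc cNs cos1 Ns1).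
  under eq_Rintegral do rewrite mulrN -mulN1r.
  rewrite RintegralZl//; first by ring.
  by apply: integrable_normal_bounded => //; apply: mtrig; exact: continuous_sin.
rewrite (gaussian_ode D x).
under eq_Rintegral do rewrite mul0r sin0 mulr0.
by rewrite /Rintegral integral0 mul0r.
Qed.

Lemma normal_moment_cos x : \int[leb]_t ((t - m) * N t * cos (x * (t - m))) = 0.
Proof.
have dc (t : R) : is_derive t 1 (@cos R) (- sin t) by exact: is_derive_cos.
have cNs : continuous (fun t : R => - sin t).
  by move=> t; apply: cvgN; exact: continuous_sin.
have Ns1 (t : R) : `|- sin t| <= 1 by rewrite normrN.
rewrite (moment_trig x dc cNs cos1 Ns1).
under eq_Rintegral do rewrite mulrN -mulN1r.
rewrite RintegralZl//; first by rewrite normal_sin !mulr0.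
by apply: integrable_normal_bounded => //; apply: mtrig; exact: continuous_sin.
Qed.

Lemma normal_moment_sin x : \int[leb]_t ((t - m) * N t * sin (x * (t - m))) =
  s ^+ 2 * x * expR (- (s ^+ 2 * x ^+ 2 / 2)).
Proof.
have ds (t : R) : is_derive t 1 (@sin R) (cos t) by exact: is_derive_sin.
by rewrite (moment_trig x ds (@continuous_cos R) sin1 cos1) normal_cos.
Qed.

End characteristic_function.

End gaussians.

(** * Oscillating integrals of decreasing kernels *)

Section trigonometric_kernels.
Context {R : realType}.

(** The two functions [cos] and [sin] are treated together: only their size
    and the existence of a bounded antiderivative matter. *)
Definition trigonometric (c : R -> R) : Prop :=
  [/\ continuous c, forall t, `|c t| <= 1 &
      exists S : R -> R, (forall t : R, is_derive t 1 S (c t)) /\ forall t, `|S t| <= 1].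

Lemma normr_cos_le1 (t : R) : `|cos t| <= 1.
Proof. by rewrite ler_norml cos_geN1 cos_le1. Qed.

Lemma normr_sin_le1 (t : R) : `|sin t| <= 1.
Proof. by rewrite ler_norml sin_geN1 sin_le1. Qed.

Lemma trigonometric_cos : trigonometric cos.
Proof.
split; [exact: continuous_cos|exact: normr_cos_le1|].
by exists sin; split; [move=> t; exact: is_derive_sin|exact: normr_sin_le1].
Qed.

Lemma trigonometric_sin : trigonometric sin.
Proof.
split; [exact: continuous_sin|exact: normr_sin_le1|].
exists (fun t => - cos t); split.
  by move=> t; apply: is_derive_eq (is_deriveNx (is_derive_cos t)) _; rewrite opprK.
by move=> t; rewrite normrN; exact: normr_cos_le1.
Qed.

End trigonometric_kernels.

(** The part of the kernel assumptions on which the analysis rests: [k]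
    vanishes on the negative half-line, decreases to zero on the positive one,
    is integrable at the origin, and decays at infinity at some algebraic rate
    [t ^ -a] with [0 < a < 1]. *)
Record slow_kernel {R : realType} (k k' : R -> R) (C a : R) : Prop := SlowKernel {
  sk_meas : measurable_fun setT k ;
  sk_neg : forall t, t <= 0 -> k t = 0 ;
  sk_ge0 : forall t, 0 <= k t ;
  sk_derive : forall t : R, 0 < t -> is_derive t 1 k (k' t) ;
  sk_cont : forall t, 0 < t -> {for t, continuous k'} ;
  sk_le0 : forall t, 0 < t -> k' t <= 0 ;
  sk_int : lebesgue_measure.-integrable `[0, 1] (EFin \o k) ;
  sk_lim : k t @[t --> +oo] --> (0 : R) ;
  sk_a : 0 < a < 1 ;
  sk_C : 0 <= C ;
  sk_tail : forall t, 1 <= t -> k t <= C * t `^ (- a) }.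

Section slow_kernels.
Context {R : realType}.
Notation leb := (@lebesgue_measure R).
Variables (k k' : R -> R) (C a : R).
Hypothesis sk : slow_kernel k k' C a.
Implicit Types (s w t N A : R) (c : R -> R).

Lemma kernel_nonincreasing s t : 0 < s -> s <= t -> k t <= k s.
Proof. exact: nonincreasing_is_derive (sk_derive sk) (sk_le0 sk) s t. Qed.

Definition kint N := \int[leb]_(t in `[0, N]) k t.

Lemma integrable_kernel N : leb.-integrable `[0, N] (EFin \o k).
Proof.
have mk := sk_meas sk.
pose g t := (k \_ `[0, 1]%classic) t + k 1 * \1_(`[0, N]%classic) t.
have ig : leb.-integrable setT (EFin \o g).
  apply: integrable_EFinD.
    rewrite -restrict_EFin; apply/integrable_restrict => //.
    by rewrite setTI; exact: (sk_int sk).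
  by apply: integrable_EFinZ; exact: integrable_indic_itv.
apply: le_integrable (integrableS measurableT _ (@subsetT _ _) ig) => //.
  exact/measurable_EFinP/measurable_funTS.
move=> t; rewrite /= in_itv/= => /andP[t0 tN].
rewrite lee_fin !ger0_norm ?(sk_ge0 sk)//; last first.
  by rewrite addr_ge0// ?mulr_ge0 ?(sk_ge0 sk)// patchE; case: ifP => // _; exact: (sk_ge0 sk).
rewrite /g indicE mem_set ?mulr1/=; last by rewrite in_itv/= t0 tN.
rewrite patchE; case: ifPn => [_|]; first by rewrite lerDl (sk_ge0 sk).
rewrite notin_setE/= in_itv/= t0/= => /negP; rewrite -ltNge => t1.
by rewrite add0r; apply: kernel_nonincreasing => //; exact: ltW.
Qed.

Lemma kint_ge0 N : 0 <= kint N.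
Proof. by apply: Rintegral_ge0 => t _; exact: (sk_ge0 sk). Qed.

Section one_trigonometric_function.
Variable c : R -> R.
Hypothesis tc : trigonometric c.

Let cc : continuous c. Proof. by case: tc. Qed.
Let c1 t : `|c t| <= 1. Proof. by case: tc. Qed.

Definition osc s w t := k t * expR (- (s * t)) * c (w * t).

Lemma measurable_osc s w : measurable_fun setT (osc s w).
Proof.
apply: measurable_funM; first apply: measurable_funM.
- exact: (sk_meas sk).
- by apply: measurableT_comp => //; apply: measurableT_comp => //; apply: measurable_funM.
- apply: (@measurableT_comp _ _ _ _ _ _ c); first exact: continuous_measurable_fun.
  by apply: measurable_funM.
Qed.

Lemma osc_le s w t : 0 <= s -> `|osc s w t| <= k t.
Proof.
move=> s0; have [t0|t0] := leP t 0.
  by rewrite /osc (sk_neg sk t0) !mul0r normr0.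
rewrite /osc normrM normrM (ger0_norm (sk_ge0 sk t)) (ger0_norm (expR_ge0 _)).
rewrite -mulrA ler_piMr ?(sk_ge0 sk)// mulr_ile1 ?expR_ge0//.
by rewrite expR_le1 oppr_le0 mulr_ge0// ltW.
Qed.

Lemma integrable_osc s w N : 0 <= s -> leb.-integrable `[0, N] (EFin \o osc s w).
Proof.
move=> s0; apply: le_integrable (integrable_kernel N) => //.
  by apply/measurable_EFinP; apply: measurable_funTS; exact: measurable_osc.
by move=> t _; rewrite lee_fin (le_trans (osc_le w t s0))// ler_norm.
Qed.

(** The truncation makes the integral absolutely convergent at [s = 0] too,
    where the full transform only exists as an improper integral. *)
Definition trunc_transform s w N := \int[leb]_(t in `[0, N]) osc s w t.

Lemma trunc_transform_le s w N : 0 <= s -> `|trunc_transform s w N| <= kint N.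
Proof.
move=> s0; apply: le_trans (le_normr_Rintegral _ (integrable_osc w N s0)) _ => //.
apply: le_Rintegral => //; first exact: integrable_norm (integrable_osc w N s0).
  exact: integrable_kernel.
by move=> t _; exact: osc_le.
Qed.

Lemma trunc_transform_split s w A N : 0 <= s -> 0 <= A -> A <= N ->
  trunc_transform s w N - trunc_transform s w A = \int[leb]_(t in `[A, N]) osc s w t.
Proof.
move=> s0 A0 AN; rewrite /trunc_transform Rintegral_itvB ?bnd_simp//; last first.
  exact: integrable_osc.
rewrite Rintegral_itv_obnd_cbnd//.
apply: integrableS (integrable_osc w N s0) => //.
by move=> t /=; rewrite !in_itv/= => /andP[At ->]; rewrite (le_trans A0)// ltW.
Qed.

(** Second mean value theorem, for a differentiable decreasing weight: an
    oscillation of frequency [w] contributes at most twice the first value of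
    the weight divided by the frequency. *)
Lemma dirichlet_bound s w A N : 0 <= s -> w != 0 -> 0 < A -> A <= N ->
  `|\int[leb]_(t in `[A, N]) osc s w t| <= 2 * k A / `|w|.
Proof.
move=> s0 w0 A0; rewrite le_eqVlt => /predU1P[<-|AN].
  rewrite set_itv1 Rintegral_set1 normr0.
  by rewrite divr_ge0// mulr_ge0// (sk_ge0 sk).
have [S [dS S1]] : exists S : R -> R,
  (forall t, is_derive t 1 S (c t)) /\ forall t, `|S t| <= 1 by case: tc.
pose p t := k t * expR (- (s * t)).
pose p' t := (k' t - s * k t) * expR (- (s * t)).
pose G t := w^-1 * S (w * t).
have dp t : 0 < t -> is_derive t 1 p (p' t).
  move=> t0; apply: is_derive_eq (is_deriveMx (sk_derive sk t0)
    (is_derive_expx (is_deriveNx (is_deriveZx s (is_derive_idx t))))) _.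
  by rewrite /p'; ring.
have dG t : is_derive t 1 G (c (w * t)).
  apply: is_derive_eq (is_deriveZx w^-1 (is_derive_compx (dS _)
    (is_deriveZx w (is_derive_idx t)))) _.
  by field.
have Ip t : A <= t -> 0 < t by move=> At; exact: lt_le_trans At.
have cp' : {within `[A, N], continuous p'}.
  apply: continuous_in_subspaceT => t; rewrite inE/= in_itv/= => /andP[At _].
  have t0 := Ip t At.
  apply: cvgM.
    apply: cvgB; first exact: (sk_cont sk t0).
    apply: cvgM; first exact: cvg_cst.
    exact: is_derive_continuous (sk_derive sk t0).
  exact: is_derive_continuous (is_derive_expx (is_deriveNx (is_deriveZx s (is_derive_idx t)))).
have cg : {within `[A, N], continuous (fun t => c (w * t))}.
  apply: continuous_subspaceT => t.
  apply: (@continuous_comp _ _ _ (fun t => w * t) c); last exact: cc.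
  exact: is_derive_continuous (is_deriveZx w (is_derive_idx t)).
have LR (F f : R -> R) : (forall t, A <= t -> is_derive t 1 F (f t)) ->
    derivable_oo_LRcontinuous F A N /\ {in `]A, N[, derive1 F =1 f}.
  move=> dF; split; first split.
  - by move=> x; rewrite in_itv/= => /andP[Ax _]; have [] := dF x (ltW Ax).
  - by apply: cvg_at_right_filter; exact: is_derive_continuous (dF A (lexx _)).
  - by apply: cvg_at_left_filter; exact: is_derive_continuous (dF N (ltW AN)).
  - move=> x; rewrite in_itv/= => /andP[Ax _]; rewrite derive1E.
    by have [_ ->] := dF x (ltW Ax).
have [LR1 LR2] := LR p p' (fun t At => dp t (Ip t At)).
have [LR3 LR4] := LR G (fun t => c (w * t)) (fun t _ => dG t).
have -> : \int[leb]_(t in `[A, N]) osc s w t = \int[leb]_(t in `[A, N]) (p t * c (w * t)).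
  by [].
rewrite (Rintegration_by_parts AN cp' LR1 LR2 cg LR3 LR4).
have G1 t : `|G t| <= `|w|^-1 by rewrite /G normrM normfV ler_piMr.
have p0 t : 0 <= p t by rewrite mulr_ge0 ?expR_ge0 ?(sk_ge0 sk).
have w1 : 0 < `|w|^-1 by rewrite invr_gt0 normr_gt0.
have p'0 t : 0 < t -> p' t <= 0.
  move=> t0; rewrite mulr_le0_ge0 ?expR_ge0// subr_le0 (le_trans (sk_le0 sk t0))//.
  by rewrite mulr_ge0// (sk_ge0 sk).
have ip' : leb.-integrable `[A, N] (EFin \o p').
  by apply: continuous_compact_integrable => //; exact: segment_compact.
have cp'G : {within `[A, N], continuous (fun t => p' t * G t)}.
  move=> t; apply: cvgM; first exact: cp'.
  by apply: continuous_subspaceT => u; exact: is_derive_continuous (dG u).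
have ip'G : leb.-integrable `[A, N] (EFin \o (fun t => p' t * G t)).
  by apply: continuous_compact_integrable => //; exact: segment_compact.
have Ip' : \int[leb]_(t in `[A, N]) p' t = p N - p A.
  by apply: FTC_is_derive => // t /andP[At _]; exact/dp/Ip.
have h1 : `|\int[leb]_(t in `[A, N]) (p' t * G t)| <= (p A - p N) * `|w|^-1.
  apply: le_trans (le_normr_Rintegral _ ip'G) _ => //.
  have -> : (p A - p N) * `|w|^-1 = - `|w|^-1 * \int[leb]_(t in `[A, N]) p' t.
    by rewrite Ip'; ring.
  rewrite -RintegralZl//; apply: le_Rintegral => //.
  - exact: integrable_norm ip'G.
  - rewrite (_ : _ \o _ = (fun x => (- `|w|^-1)%:E * (EFin \o p') x)%E)//.
    exact: integrableZl.
  move=> t; rewrite /= in_itv/= => /andP[At _]; rewrite normrM.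
  rewrite (ler0_norm (p'0 t (Ip t At))).
  have p'N : 0 <= - p' t by rewrite oppr_ge0; exact: (p'0 t (Ip t At)).
  by have := ler_wpM2l p'N (G1 t); lra.
have pA : p A <= k A.
  by rewrite ler_piMr ?(sk_ge0 sk)// expR_le1 oppr_le0 mulr_ge0// ltW.
have hG (u : R) : `|p u * G u| <= p u * `|w|^-1.
  by rewrite normrM (ger0_norm (p0 u)) ler_wpM2l.
have := ler_normB (p N * G N - p A * G A) (\int[leb]_(t in `[A, N]) (p' t * G t)).
move/le_trans; apply.
apply: le_trans (lerD (le_trans (ler_normB _ _) (lerD (hG N) (hG A))) h1) _.
rewrite [leLHS](_ : _ = 2 * (p A * `|w|^-1)); last by ring.
by rewrite -mulrA ler_pM2l// ler_wpM2r// ltW.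
Qed.

Lemma trunc_transform_tail s w A N : 0 <= s -> w != 0 -> 0 < A -> A <= N ->
  `|trunc_transform s w N - trunc_transform s w A| <= 2 * k A / `|w|.
Proof.
move=> s0 w0 A0 AN; rewrite trunc_transform_split//; last exact: ltW.
exact: dirichlet_bound.
Qed.

Lemma kint_le A N : A <= N -> kint A <= kint N.
Proof.
move=> AN; have [A0|A0] := ltP A 0.
  by rewrite {1}/kint set_itv_ge ?bnd_simp -?ltNge// Rintegral_set0 kint_ge0.
rewrite -subr_ge0 /kint Rintegral_itvB ?bnd_simp//; last exact: integrable_kernel.
by apply: Rintegral_ge0 => t _; exact: (sk_ge0 sk).
Qed.

(** Absolute bound up to the cut [A], oscillation beyond it; the cut is later
    chosen of the order of the period [1 / |w|]. *)
Lemma trunc_transform_split_bound s w A N : 0 <= s -> w != 0 -> 0 < A ->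
  `|trunc_transform s w N| <= kint A + 2 * k A / `|w|.
Proof.
move=> s0 w0 A0.
have q0 : 0 <= 2 * k A / `|w| by rewrite divr_ge0// mulr_ge0// (sk_ge0 sk).
have [AN|NA] := leP A N; last first.
  by apply: le_trans (trunc_transform_le w N s0) _; rewrite ler_wpDr// kint_le// ltW.
rewrite -(subrK (trunc_transform s w A) (trunc_transform s w N)) addrC.
apply: le_trans (ler_normD _ _) _; apply: lerD; first exact: trunc_transform_le.
exact: trunc_transform_tail.
Qed.

End one_trigonometric_function.

End slow_kernels.

(** * Translations and algebraic singularities *)

Section translation_invariance.
Context {R : realType}.
Notation leb := (@lebesgue_measure R).

Lemma lebesgue_measure_translate (c : R) (A : set R) : measurable A ->
  pushforward leb ((fun x => x + c) : _ -> measurableTypeR R) A = leb A.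
Proof.
move=> mA; apply/esym/lebesgue_measure_unique => //=.
  by apply: measurable_funD.
move=> _ _ [[x y]] _ <-; rewrite /pushforward.
have -> : (fun z : R => z + c) @^-1` `]x, y]%classic = `]x - c, y - c]%classic.
  by apply/seteqP; split => z /=; rewrite !in_itv/= ltrBlDr lerBrDr.
rewrite /= !lebesgue_measure_itv/= !lte_fin ltrD2r.
by case: ifP => // _; rewrite -!EFinB; congr (_%:E); ring.
Qed.

Lemma integrable_leb_pushforward (phi : R -> R) (f : R -> R) :
  measurable_fun setT phi ->
  (forall A, measurable A -> pushforward leb (phi : _ -> measurableTypeR R) A = leb A) ->
  leb.-integrable setT (EFin \o f) -> leb.-integrable setT (EFin \o (f \o phi)).
Proof.
move=> mphi inv if_; have mf := integrable_measurable if_.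
apply/integrableP; split.
  by apply/measurable_EFinP; exact: (measurableT_comp mf mphi).
have mf' : measurable_fun [set: measurableTypeR R] (fun x => `|(f x)%:E|%E).
  by apply: measurableT_comp => //; exact/measurable_EFinP.
have mphi' : measurable_fun [set: measurableTypeR R] (phi : _ -> measurableTypeR R).
  exact: mphi.
have := ge0_integral_pushforward mphi' leb measurableT mf'.
rewrite preimage_setT /comp => <-; last by [].
rewrite (eq_measure_integral leb); first by case/integrableP: if_.
by move=> A mA _; exact: inv.
Qed.

Lemma integrable_translate (f : R -> R) (c : R) :
  leb.-integrable setT (EFin \o f) ->
  leb.-integrable setT (EFin \o (fun x => f (x + c))).
Proof.
apply: (@integrable_leb_pushforward (fun x => x + c)).
  by apply: measurable_funD.
exact: lebesgue_measure_translate.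
Qed.

Lemma integrable_reflect (f : R -> R) : leb.-integrable setT (EFin \o f) ->
  leb.-integrable setT (EFin \o (fun x => f (- x))).
Proof.
apply: (@integrable_leb_pushforward -%R); first exact: oppr_measurable.
exact: lebesgue_measureN.
Qed.

End translation_invariance.

Section algebraic_singularity.
Context {R : realType}.
Notation leb := (@lebesgue_measure R).
Variable a : R.
Hypothesis a01 : 0 < a < 1.

Let a0 : 0 < a. Proof. by case/andP: a01. Qed.

Definition half_singularity (t : R) : R :=
  if (0 < t) && (t <= 1) then t `^ (a - 1) else 0.

(** [|w| ^ (a - 1)] near the origin. *)
Definition singularity (w : R) : R := half_singularity w + half_singularity (- w).

Lemma half_singularity_ge0 t : 0 <= half_singularity t.
Proof. by rewrite /half_singularity; case: ifP => // _; exact: powR_ge0. Qed.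

Lemma singularity_ge0 w : 0 <= singularity w.
Proof. by rewrite addr_ge0// half_singularity_ge0. Qed.

Lemma half_singularityE :
  half_singularity = (fun t => t `^ (a - 1)) \_ `]0, 1]%classic.
Proof.
apply/funext => t; rewrite patchE /half_singularity.
have [|] := boolP (t \in _); rewrite ?inE ?notin_setE/= in_itv/=; first by move=> ->.
by move=> /negP/negbTE ->.
Qed.

Lemma measurable_half_singularity : measurable_fun setT half_singularity.
Proof.
rewrite half_singularityE; apply/(measurable_restrictT _ _).1 => //.
by apply: measurable_funTS; exact: measurable_powR.
Qed.

(** Monotone convergence along the intervals [1 / (n + 1), 1], on which the
    antiderivative [t ^ a / a] is bounded. *)
Lemma integrable_half_singularity :
  leb.-integrable setT (EFin \o half_singularity).
Proof.
apply/integrableP; split; first by apply/measurable_EFinP; exact: measurable_half_singularity.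
have -> : (\int[leb]_x `|(EFin \o half_singularity) x| =
    \int[leb]_(x in `]0%R, 1%R]) (x `^ (a - 1))%:E)%E.
  rewrite [RHS]integral_mkcond; apply: eq_integral => x _ /=.
  rewrite ger0_norm ?half_singularity_ge0// half_singularityE restrict_EFin/=.
  by rewrite patchE.
pose F n : set R := `[n.+1%:R^-1 : R, 1]%classic.
have Fnd : {homo F : n m / (n <= m)%N >-> (n <= m)%O}.
  move=> n m nm; apply/subsetPset => x; rewrite /F/= !in_itv/= => /andP[nx ->].
  by rewrite andbT (le_trans _ nx)// lef_pV2 ?posrE ?ltr0n// ler_nat.
have Fx n x : F n x -> 0 < x.
  by rewrite /F/= in_itv/= => /andP[+ _]; apply: lt_le_trans; rewrite invr_gt0.
have UF : \bigcup_n F n = `]0, 1]%classic.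
  apply/seteqP; split => [x [n _ Fnx]|x]/=; rewrite in_itv/=.
    by rewrite (Fx n)//; move: Fnx; rewrite /F/= in_itv/= => /andP[].
  move=> /andP[x0 x1]; have [n _ nx] : \forall n \near \oo, x^-1 <= n%:R.
    exact: nbhs_infty_ger.
  exists n => //; rewrite /F/= in_itv/= x1 andbT.
  rewrite -(invrK x) lef_pV2 ?posrE ?invr_gt0 ?ltr0n//.
  by rewrite (le_trans (nx n (leqnn n)))// ler_nat.
have mp D : measurable_fun D (fun x : R => (x `^ (a - 1))%:E).
  by apply/measurable_EFinP; apply: measurable_funTS; exact: measurable_powR.
have p0 (x : R) : (0 <= (x `^ (a - 1))%:E)%E by rewrite lee_fin powR_ge0.
have cv := ge0_nondecreasing_set_cvg_integral (mu := leb) Fnd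
  (fun n => measurable_itv _) (fun n => mp (F n)) (fun n x _ => p0 x).
rewrite UF in cv.
have le n : (\int[leb]_(x in F n) (x `^ (a - 1))%:E <= (a^-1)%:E)%E.
  have [->|n0] := eqVneq n 0%N.
    by rewrite /F invr1 set_itv1 integral_set1 lee_fin invr_ge0 ltW.
  have l1 : n.+1%:R^-1 < 1 :> R by rewrite invf_lt1// ltr1n ltnS lt0n.
  have dp (x : R) : n.+1%:R^-1 <= x <= 1 ->
      is_derive x 1 (fun y => a^-1 * y `^ a) (x `^ (a - 1)).
    move=> /andP[nx _].
    have x0 : 0 < x by apply: lt_le_trans nx; rewrite invr_gt0.
    apply: is_derive_eq (is_deriveZx _ (is_derive1_powR a x0)) _.
    by rewrite mulrA mulVf ?mul1r// gt_eqF.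
  have cp : {within F n, continuous (fun x : R => x `^ (a - 1))}.
    apply: continuous_in_subspaceT => x; rewrite inE => /Fx x0.
    exact: is_derive_continuous (is_derive1_powR (a - 1) x0).
  have ip : leb.-integrable (F n) (EFin \o (fun x : R => x `^ (a - 1))).
    by apply: continuous_compact_integrable => //; exact: segment_compact.
  have := FTC_is_derive l1 dp cp; rewrite /Rintegral powR1 mulr1 => E.
  have fi : (\int[leb]_(x in F n) (x `^ (a - 1))%:E)%E \is a fin_num.
    by apply: integrable_fin_num => //; exact: measurable_itv.
  rewrite -[leLHS]fineK//.
  by rewrite lee_fin E gerBl mulr_ge0// ?invr_ge0 ?powR_ge0// ltW.
apply: (@le_lt_trans _ _ (a^-1)%:E); last exact: ltry.
rewrite -(cvg_lim _ cv)//; apply: lime_le; first exact: cvgP cv.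
exact: nearW.
Qed.

Lemma integrable_singularity : leb.-integrable setT (EFin \o singularity).
Proof.
apply: integrable_EFinD; first exact: integrable_half_singularity.
exact: integrable_reflect integrable_half_singularity.
Qed.

Lemma singularityE w : 0 < `|w| <= 1 -> (`|w|^-1) `^ (1 - a) = singularity w.
Proof.
move=> /andP[w0 w1].
have -> : (`|w|^-1) `^ (1 - a) = `|w| `^ (a - 1).
  rewrite -powR_inv1 ?normr_ge0// -powRrM; congr (_ `^ _); ring.
rewrite /singularity /half_singularity; have [w0'|w0'|w0'] := ltgtP w 0.
- rewrite ltr0_norm//= oppr_gt0 w0'/= add0r.
  by move: w1; rewrite ltr0_norm// => ->.
- rewrite gtr0_norm// oppr_gt0 (lt_gtF w0')/= addr0.
  by move: w1; rewrite gtr0_norm// => ->.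
- by move: w0; rewrite w0' normr0 ltxx.
Qed.

End algebraic_singularity.

(** * Cosine and sine transforms of the kernel *)

Section kernel_transforms.
Context {R : realType}.
Notation leb := (@lebesgue_measure R).
Variables (k k' : R -> R) (C a : R).
Hypothesis sk : slow_kernel k k' C a.
Implicit Types (s w t N A : R) (c : R -> R).

Let a0 : 0 < a. Proof. by have /andP[] := sk_a sk. Qed.
Let a1 : 0 < 1 - a. Proof. by have /andP[_] := sk_a sk; rewrite subr_gt0. Qed.
Let C0 : 0 <= C := sk_C sk.

Lemma kint_growth A : 1 <= A -> kint k A <= kint k 1 + C / (1 - a) * A `^ (1 - a).
Proof.
rewrite le_eqVlt => /predU1P[<-|A1].
  by rewrite lerDl mulr_ge0 ?powR_ge0// divr_ge0// ltW.
rewrite -lerBlDl /kint Rintegral_itvB ?bnd_simp ?(ltW A1)//; last first.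
  exact: (integrable_kernel sk).
have i1 : leb.-integrable `]1, A] (EFin \o k).
  apply: integrableS (integrable_kernel sk A) => //.
  by move=> t /=; rewrite !in_itv/= => /andP[t1 ->]; rewrite andbT (le_trans ler01)// ltW.
rewrite Rintegral_itv_obnd_cbnd//.
have i2 : leb.-integrable `[1, A] (EFin \o k).
  apply: integrableS (integrable_kernel sk A) => //.
  by move=> t /=; rewrite !in_itv/= => /andP[t1 ->]; rewrite andbT (le_trans ler01).
have dp (x : R) : 1 <= x <= A ->
    is_derive x 1 (fun y => C / (1 - a) * y `^ (1 - a)) (C * x `^ (- a)).
  move=> /andP[x1 _]; have x0 : 0 < x by apply: lt_le_trans x1.
  apply: is_derive_eq (is_deriveZx _ (is_derive1_powR (1 - a) x0)) _.
  rewrite (_ : 1 - a - 1 = - a); last by ring.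
  by rewrite mulrA divfK// gt_eqF.
have cp : {within `[1, A], continuous (fun x : R => C * x `^ (- a))}.
  apply: continuous_in_subspaceT => x; rewrite inE/= in_itv/= => /andP[x1 _].
  have x0 : 0 < x by apply: lt_le_trans x1.
  exact: is_derive_continuous (is_deriveZx C (is_derive1_powR (- a) x0)).
apply: (@le_trans _ _ (\int[leb]_(x in `[1, A]) (C * x `^ (- a)))).
  apply: le_Rintegral => //.
    by apply: continuous_compact_integrable => //; exact: segment_compact.
  by move=> t; rewrite /= in_itv/= => /andP[t1 _]; exact: (sk_tail sk).
rewrite (FTC_is_derive A1 dp cp) gerBl mulr_ge0 ?powR_ge0//.
by rewrite divr_ge0// ltW.
Qed.

Definition transform_const := kint k 1 + C / (1 - a) + 2 * C.

Lemma transform_const_ge0 : 0 <= transform_const.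
Proof.
have h : 0 <= C / (1 - a) := divr_ge0 C0 (ltW a1).
by have := kint_ge0 sk 1; move: C0; rewrite /transform_const; lra.
Qed.

(** The common bound of all truncated and damped transforms; its only
    singularity is the integrable one at the origin. *)
Definition dominator w := transform_const * (1 + singularity a w).

Lemma dominator_ge0 w : 0 <= dominator w.
Proof. by rewrite mulr_ge0 ?transform_const_ge0// addr_ge0// singularity_ge0. Qed.

(** For low frequencies the cut [A = 1 / |w|] makes both parts of the order of
    [|w| ^ (a - 1)]; for high frequencies the cut [A = 1] gives a constant. *)
Lemma trunc_transform_dominated c s w N : trigonometric c -> 0 <= s -> w != 0 ->
  `|trunc_transform k c s w N| <= dominator w.
Proof.
move=> tc s0 w0; have w0' : 0 < `|w| by rewrite normr_gt0.
have Ca : 0 <= C / (1 - a) by rewrite divr_ge0// ltW.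
have S0 := singularity_ge0 a w.
have k0 := kint_ge0 sk 1.
have [w1|w1] := leP 1 `|w|.
  apply: le_trans (trunc_transform_split_bound sk tc N s0 w0 ltr01) _.
  apply: (@le_trans _ _ transform_const); last first.
    by rewrite /dominator ler_peMr ?transform_const_ge0// lerDl.
  apply: (@le_trans _ _ (kint k 1 + 2 * C)); last by rewrite /transform_const; lra.
  rewrite lerD2l ler_pdivrMr//.
  have k1 : k 1 <= C by have := sk_tail sk (lexx 1); rewrite powR1 mulr1.
  by apply: (@le_trans _ _ (2 * C)); [rewrite ler_pM2l|rewrite ler_peMr// mulr_ge0].
have A0 : 0 < `|w|^-1 by rewrite invr_gt0.
have A1 : 1 <= `|w|^-1 by rewrite invf_ge1// ltW.
apply: le_trans (trunc_transform_split_bound sk tc N s0 w0 A0) _.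
set p := (`|w|^-1) `^ (1 - a).
have pE : p = singularity a w by apply: singularityE; rewrite w0' ltW.
have h1 := kint_growth A1.
have h2 : k (`|w|^-1) / `|w| <= C * p.
  apply: le_trans (ler_wpM2r (ltW A0) (sk_tail sk A1)) _.
  have -> : p = `|w|^-1 `^ (- a) * `|w|^-1 `^ 1.
    by rewrite -powRD ?(gt_eqF A0) ?implybT// addrC.
  by rewrite powRr1 ?mulrA// ltW.
rewrite /dominator -pE /transform_const.
have p0 : 0 <= p by exact: powR_ge0.
rewrite -/p in h1; rewrite -mulrA.
apply: le_trans (lerD h1 (ler_wpM2l (ler0n _ 2) h2)) _.
rewrite -subr_ge0.
rewrite (_ : _ - _ = C / (1 - a) + 2 * C + kint k 1 * p); last by ring.
by rewrite !addr_ge0// mulr_ge0.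
Qed.

(** Near its singularity the dominator meets the bound [B] of the weight, and
    elsewhere the integrability of the weight. The shift by [x] serves averages
    over frequencies. *)
Lemma integrable_dominator_weight (g : R -> R) (B x : R) :
  leb.-integrable setT (EFin \o g) -> (forall w, 0 <= g w <= B) ->
  leb.-integrable setT (EFin \o (fun w => g w * dominator (w + x))).
Proof.
move=> ig gB; have mg := integrable_measurable ig.
have is_ := integrable_translate x (integrable_singularity (sk_a sk)).
apply: (@integrable_dom _ _ _ leb _ (fun w => transform_const * (g w + B * singularity a (w + x)))).
- apply: measurable_funM => //; apply: measurable_funM => //; apply: measurable_funD => //.
  exact: integrable_measurable is_.
- by apply: integrable_EFinZ; apply: integrable_EFinD => //; exact: integrable_EFinZ.
- move=> w; have /andP[g0 gB'] := gB w.
  rewrite (ger0_norm (mulr_ge0 g0 (dominator_ge0 (w + x)))) /dominator mulrCA.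
  rewrite ler_wpM2l ?transform_const_ge0// mulrDr mulr1 lerD2l.
  by rewrite ler_wpM2r// singularity_ge0.
Qed.

Lemma kernel_cvgn0 : k n%:R @[n --> \oo] --> (0 : R).
Proof.
apply: ((cvg_pinftyP k 0).1 (sk_lim sk)).
by apply/cvgryPge => A; exact: nbhs_infty_ger.
Qed.

Section one_function.
Variable c : R -> R.
Hypothesis tc : trigonometric c.

Definition transform s w := lim (trunc_transform k c s w N @[N --> +oo]).

Lemma cvg_trunc_transform s w : 0 <= s -> w != 0 ->
  trunc_transform k c s w N @[N --> +oo] --> transform s w.
Proof.
move=> s0 w0; have w0' : 0 < `|w| by rewrite normr_gt0.
apply/cauchy_cvgP; apply: cauchy_exP => e e0.
have e2 : 0 < e * `|w| / 2 by rewrite divr_gt0// mulr_gt0.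
have /cvgrPdist_lt/(_ _ e2)[M [_ MP]] := sk_lim sk.
pose A := Num.max (M + 1) 1.
have A0 : 0 < A by rewrite lt_max ltr01 orbT.
have MA : M < A by rewrite lt_max ltrDl ltr01.
exists (trunc_transform k c s w A), A; split; first exact: num_real.
move=> N AN; rewrite /ball/= distrC.
apply: le_lt_trans (trunc_transform_tail sk tc s0 w0 A0 (ltW AN)) _.
have := MP A MA; rewrite /= sub0r normrN ger0_norm ?(sk_ge0 sk)//.
by rewrite ltr_pdivlMr// ltr_pdivrMr// mulrC.
Qed.

Lemma transform_tail s w A : 0 <= s -> w != 0 -> 0 < A ->
  `|transform s w - trunc_transform k c s w A| <= 2 * k A / `|w|.
Proof.
move=> s0 w0 A0; apply: (cvg_dist_le _ (cvg_trunc_transform s0 w0)).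
exists A; split; first exact: num_real.
by move=> N /ltW AN; exact: (trunc_transform_tail sk tc).
Qed.

Lemma transform_dominated s w : 0 <= s -> w != 0 -> `|transform s w| <= dominator w.
Proof.
move=> s0 w0; rewrite -[transform s w]subr0.
apply: (cvg_dist_le _ (cvg_trunc_transform s0 w0)).
by apply: nearW => N; rewrite subr0; exact: trunc_transform_dominated.
Qed.

Lemma cvgn_trunc_transform s w : 0 <= s -> w != 0 ->
  trunc_transform k c s w n%:R @[n --> \oo] --> transform s w.
Proof.
move=> s0 w0; apply: ((cvg_pinftyP _ _).1 (cvg_trunc_transform s0 w0)).
by apply/cvgryPge => A; exact: nbhs_infty_ger.
Qed.

(** A uniform approximation of a family by continuous ones is continuous: this
    is how regularity passes from the truncated transforms to their limits. *)
Lemma cvg_transform_tail (s_ w_ : nat -> R) s w (dl : R) : 0 < dl ->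
  (forall n, 0 <= s_ n) -> (forall n, dl <= `|w_ n|) -> 0 <= s -> dl <= `|w| ->
  (forall A, 0 < A -> trunc_transform k c (s_ n) (w_ n) A @[n --> \oo] -->
     trunc_transform k c s w A) ->
  transform (s_ n) (w_ n) @[n --> \oo] --> transform s w.
Proof.
move=> dl0 sn wn s0 wn0 cv; apply/cvgrPdist_le => e e0.
have e6 : 0 < e * dl / 6 by rewrite divr_gt0// mulr_gt0.
have [N] : exists N : nat, k N.+1%:R <= e * dl / 6.
  have /cvgrPdist_le/(_ _ e6)[N _ NP] := kernel_cvgn0.
  by exists N; have := NP N.+1 (leqnSn N); rewrite /= sub0r normrN ger0_norm ?(sk_ge0 sk).
set A := N.+1%:R => kA; have A0 : 0 < A by rewrite ltr0n.
have tail s' w' : 0 <= s' -> dl <= `|w'| ->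
    `|transform s' w' - trunc_transform k c s' w' A| <= e / 3.
  move=> s'0 w'0; have w'1 : 0 < `|w'| by apply: lt_le_trans w'0.
  apply: le_trans (transform_tail s'0 _ A0) _; first by rewrite -normr_gt0.
  rewrite ler_pdivrMr//.
  apply: (@le_trans _ _ (e / 3 * dl)); last by rewrite ler_wpM2l// divr_ge0// ltW.
  by have := kA; lra.
have e3 : 0 < e / 3 by rewrite divr_gt0.
have /cvgrPdist_le/(_ _ e3) := cv A A0; apply: filterS => n h1.
have h2 := tail _ _ s0 wn0; have h3 := tail _ _ (sn n) (wn n).
rewrite (_ : _ - _ = (transform s w - trunc_transform k c s w A) +
  (trunc_transform k c s w A - trunc_transform k c (s_ n) (w_ n) A) -
  (transform (s_ n) (w_ n) - trunc_transform k c (s_ n) (w_ n) A)); last by ring.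
apply: le_trans (ler_normB _ _) _; apply: le_trans (lerD (ler_normD _ _) (lexx _)) _.
by apply: le_trans (lerD (lerD h2 h1) h3) _; lra.
Qed.

Lemma trunc_transform_cvg (s_ w_ : nat -> R) s w A :
  (forall n, 0 <= s_ n) -> s_ n @[n --> \oo] --> s -> w_ n @[n --> \oo] --> w ->
  trunc_transform k c (s_ n) (w_ n) A @[n --> \oo] --> trunc_transform k c s w A.
Proof.
move=> sn cs cw; have [cc c1 _] := tc.
have mo s' w' : measurable_fun setT (osc k c s' w' \_ `[0, A]).
  apply/(measurable_restrictT _ _).1 => //; apply: measurable_funTS.
  exact: (measurable_osc sk tc).
have ik : leb.-integrable setT (EFin \o (k \_ `[0, A])).
  rewrite -restrict_EFin; apply/integrable_restrict => //.
  by rewrite setTI; exact: (integrable_kernel sk).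
have h : {ae leb, forall x,
    (forall n, `|(osc k c (s_ n) (w_ n) \_ `[0, A]) x| <= (k \_ `[0, A]) x) /\
    ((osc k c (s_ n) (w_ n) \_ `[0, A]) x @[n --> \oo] --> (osc k c s w \_ `[0, A]) x)}.
  apply: aeW => x; case xA : (x \in `[0, A]%classic); split.
  - by move=> n; rewrite !patchE xA; exact: (osc_le sk tc).
  - rewrite patchE xA; under eq_fun do rewrite patchE xA.
    apply: cvgM; first apply: cvgM; first exact: cvg_cst.
      apply: (cvg_comp _ expR); last exact: continuous_expR.
      by apply: cvgN; apply: cvgM => //; exact: cvg_cst.
    apply: (cvg_comp _ c); last exact: cc.
    by apply: cvgM => //; exact: cvg_cst.
  - by move=> n; rewrite !patchE xA normr0.
  - by rewrite patchE xA; under eq_fun do rewrite patchE xA; exact: cvg_cst.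
have [_ cv] := dominated_leb (fun n => mo (s_ n) (w_ n)) (mo s w) ik h.
rewrite /trunc_transform Rintegral_mkcond.
apply: cvg_trans cv; apply: near_eq_cvg; apply: nearW => n.
by rewrite /= [in RHS]Rintegral_mkcond.
Qed.

Lemma transform_cvg (s_ w_ : nat -> R) s w : w != 0 ->
  (forall n, 0 <= s_ n) -> s_ n @[n --> \oo] --> s -> w_ n @[n --> \oo] --> w ->
  transform (s_ n) (w_ n) @[n --> \oo] --> transform s w.
Proof.
move=> w0 sn cs cw; have w1 : 0 < `|w| by rewrite normr_gt0.
have w2 : 0 < `|w| / 2 by rewrite divr_gt0.
have s0 : 0 <= s by rewrite -(cvg_lim _ cs)//; apply: limr_ge; [exact: cvgP cs|exact: nearW].
have [N _ NP] : \forall n \near \oo, `|w| / 2 <= `|w_ n|.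
  have nw : `|w_ n| @[n --> \oo] --> `|w| by exact: cvg_norm.
  have /cvgrPdist_le/(_ _ w2) := nw; apply: filterS => n.
  by rewrite ler_norml => /andP[_]; lra.
rewrite -(cvg_shiftn N).
apply: (@cvg_transform_tail (fun n => s_ (n + N)%N) (fun n => w_ (n + N)%N) s w (`|w| / 2)) => //.
- by move=> n; apply: NP; exact: leq_addl.
- by lra.
- move=> A _; apply: trunc_transform_cvg => //.
    by rewrite (cvg_shiftn N).
  by rewrite (cvg_shiftn N).
Qed.

End one_function.

End kernel_transforms.

(** * Laplace transform of the kernel *)

Section laplace_transforms.
Context {R : realType}.
Notation leb := (@lebesgue_measure R).
Variables (k k' : R -> R) (C a : R).
Hypothesis sk : slow_kernel k k' C a.
Implicit Types (s w t N A : R) (c : R -> R).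

(** [(1 + t) k (t) exp (- s t)] dominates the damped kernel and the derivative
    of its transforms. *)
Definition damped_kernel s t := (1 + t) * (k t * expR (- (s * t))).

Lemma damped_kernel_ge0 s t : 0 <= damped_kernel s t.
Proof.
have [t0|t0] := leP t 0; first by rewrite /damped_kernel (sk_neg sk t0) mul0r mulr0.
by rewrite mulr_ge0 ?addr_ge0 ?(ltW t0)// mulr_ge0 ?(sk_ge0 sk) ?expR_ge0.
Qed.

Lemma damped_kernel_nonincreasing s s' t : s <= s' ->
  damped_kernel s' t <= damped_kernel s t.
Proof.
move=> ss; have [t0|t0] := leP t 0.
  by rewrite /damped_kernel (sk_neg sk t0) !mul0r !mulr0.
rewrite /damped_kernel ler_wpM2l ?addr_ge0 ?(ltW t0)// ler_wpM2l ?(sk_ge0 sk)//.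
by rewrite ler_expR lerN2 ler_wpM2r// ltW.
Qed.

Lemma measurable_damped_kernel s : measurable_fun setT (damped_kernel s).
Proof.
apply: measurable_funM; first by apply: measurable_funD.
apply: measurable_funM; first exact: (sk_meas sk).
by apply: measurableT_comp => //; apply: measurableT_comp => //; apply: measurable_funM.
Qed.

(** Half of the damping absorbs the factor [1 + t]; the other half is an
    exponential density. *)
Lemma integrable_damped_kernel s : 0 < s ->
  leb.-integrable setT (EFin \o damped_kernel s).
Proof.
move=> s0; have s2 : 0 < s / 2 by rewrite divr_gt0.
pose B := k 1 * (1 + 2 / s) * (2 / s).
have B0 : 0 <= B.
  have q0 : 0 <= 2 / s by rewrite divr_ge0// ltW.
  by rewrite /B mulr_ge0// mulr_ge0 ?(sk_ge0 sk)// addr_ge0.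
apply: (@integrable_dom _ _ _ leb _
  (fun t => 2 * (k \_ `[0, 1]%classic) t + B * exponential_pdf (s / 2) t)).
- exact: measurable_damped_kernel.
- apply: integrable_EFinD; apply: integrable_EFinZ.
    rewrite -restrict_EFin; apply/integrable_restrict => //.
    by rewrite setTI; exact: (sk_int sk).
  exact: integrable_exponential_pdf.
move=> t; rewrite (ger0_norm (damped_kernel_ge0 s t)).
have k0 u : 0 <= (k \_ `[0, 1]%classic) u.
  by rewrite patchE; case: ifP => // _; exact: (sk_ge0 sk).
have e0 u : 0 <= exponential_pdf (s / 2) u.
  by apply: exponential_pdf_ge0; exact: ltW.
have [t0|t0] := leP t 0.
  rewrite /damped_kernel (sk_neg sk t0) mul0r mulr0.
  by rewrite addr_ge0// mulr_ge0.
have et1 : expR (- (s * t)) <= 1 by rewrite expR_le1 oppr_le0 mulr_ge0// ltW.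
have [t1|t1] := leP t 1.
  rewrite -[leLHS]addr0; apply: lerD; last exact: mulr_ge0.
  rewrite patchE mem_set/=; last by rewrite in_itv/= (ltW t0).
  apply: ler_pM; rewrite ?addr_ge0 ?mulr_ge0 ?expR_ge0 ?(sk_ge0 sk) ?(ltW t0)//.
    by lra.
  by rewrite ler_piMr ?(sk_ge0 sk).
rewrite -[leLHS]add0r; apply: lerD; first exact: mulr_ge0.
rewrite /exponential_pdf patchE mem_set/=; last by rewrite in_itv/= andbT ltW.
rewrite mulNr; set e := expR (- (s / 2 * t)).
have ee : expR (- (s * t)) = e * e.
  by rewrite /e -expRD; congr expR; field.
have st0 : 0 <= s / 2 * t by rewrite mulr_ge0// ltW.
have te : t * e <= 2 / s.
  have := mul_expN_le1 st0; rewrite -/e -mulrA -ler_pdivlMl// invf_div.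
  by rewrite mulr1.
have e_0 : 0 <= e by exact: expR_ge0.
have e_1 : e <= 1 by rewrite expR_le1 oppr_le0.
rewrite /damped_kernel ee /B.
have kk : k t <= k 1 by apply: (kernel_nonincreasing sk) => //; exact: ltW.
rewrite (_ : (1 + t) * (k t * (e * e)) = (k t * (e + t * e)) * e); last by ring.
rewrite (_ : k 1 * _ * _ * _ = (k 1 * (1 + 2 / s)) * e); last first.
  by field; rewrite gt_eqF.
rewrite ler_wpM2r// ler_pM ?(sk_ge0 sk)//; first by rewrite addr_ge0// mulr_ge0// ltW.
exact: lerD.
Qed.

Section one_function.
Variable c : R -> R.
Hypothesis tc : trigonometric c.

Lemma osc_damped s w t : `|osc k c s w t| <= damped_kernel s t.
Proof.
have [t0|t0] := leP t 0.
  by rewrite /osc (sk_neg sk t0) !mul0r normr0 damped_kernel_ge0.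
have c1 : `|c (w * t)| <= 1 by case: tc.
rewrite /osc normrM normrM (ger0_norm (sk_ge0 sk t)) (ger0_norm (expR_ge0 _)).
rewrite /damped_kernel mulrDl mul1r -[leLHS]addr0 lerD//.
  by rewrite ler_piMr// mulr_ge0 ?(sk_ge0 sk) ?expR_ge0.
by rewrite mulr_ge0 ?(ltW t0)// mulr_ge0 ?(sk_ge0 sk) ?expR_ge0.
Qed.

Lemma tosc_damped s w t : `|t * osc k c s w t| <= damped_kernel s t.
Proof.
have [t0|t0] := leP t 0.
  by rewrite /osc (sk_neg sk t0) !mul0r mulr0 normr0 damped_kernel_ge0.
have c1 : `|c (w * t)| <= 1 by case: tc.
rewrite /osc !normrM (gtr0_norm t0) (ger0_norm (sk_ge0 sk t)) (ger0_norm (expR_ge0 _)).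
have p0 : 0 <= k t * expR (- (s * t)) by rewrite mulr_ge0 ?(sk_ge0 sk) ?expR_ge0.
rewrite /damped_kernel mulrDl mul1r -[leLHS]add0r lerD//.
by rewrite ler_wpM2l ?(ltW t0)// ler_piMr.
Qed.

Lemma integrable_osc_damped s w : 0 < s -> leb.-integrable setT (EFin \o osc k c s w).
Proof.
move=> s0; apply: (@integrable_dom _ _ _ leb _ (damped_kernel s)).
- exact: (measurable_osc sk tc).
- exact: integrable_damped_kernel.
- by move=> t; exact: osc_damped.
Qed.

Lemma measurable_tosc s w : measurable_fun setT (fun t => t * osc k c s w t).
Proof. by apply: measurable_funM => //; exact: (measurable_osc sk tc). Qed.

Lemma integrable_tosc s w : 0 < s ->
  leb.-integrable setT (EFin \o (fun t => t * osc k c s w t)).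
Proof.
move=> s0; apply: (@integrable_dom _ _ _ leb _ (damped_kernel s)).
- exact: measurable_tosc.
- exact: integrable_damped_kernel.
- by move=> t; exact: tosc_damped.
Qed.

Definition laplace s w := \int[leb]_t osc k c s w t.

(** Minus the derivative of the transform in [s]. *)
Definition laplace1 s w := \int[leb]_t (t * osc k c s w t).

Lemma laplace1_le s s' w : 0 < s' -> s' <= s ->
  `|laplace1 s w| <= \int[leb]_t damped_kernel s' t.
Proof.
move=> s0 ss; have s1 := lt_le_trans s0 ss.
apply: le_trans (le_normr_Rintegral measurableT (integrable_tosc w s1)) _.
apply: le_Rintegral => //; first exact: integrable_norm (integrable_tosc w s1).
  exact: integrable_damped_kernel.
move=> t _; apply: le_trans (tosc_damped s w t) _.
exact: damped_kernel_nonincreasing.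
Qed.

Lemma cvgn_trunc_laplace s w : 0 < s ->
  trunc_transform k c s w n%:R @[n --> \oo] --> laplace s w.
Proof.
move=> s0; have mo := measurable_osc sk tc s w.
have m1 (n : nat) : measurable_fun setT (osc k c s w \_ `[0, n%:R]).
  by apply/(measurable_restrictT _ _).1 => //; exact: measurable_funTS.
have h : {ae leb, forall x,
    (forall n : nat, `|(osc k c s w \_ `[0, n%:R]) x| <= damped_kernel s x) /\
    ((osc k c s w \_ `[0, n%:R]) x @[n --> \oo] --> osc k c s w x)}.
  apply: aeW => x; split.
    move=> n; rewrite patchE; case: ifP => _; first exact: osc_damped.
    by rewrite normr0 damped_kernel_ge0.
  have [x0|x0] := leP x 0.
    have z : osc k c s w x = 0 by rewrite /osc (sk_neg sk x0) !mul0r.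
    rewrite z; under eq_fun do rewrite patchE z if_same.
    exact: cvg_cst.
  apply: cvg_near_cst; near=> n; rewrite patchE mem_set//= in_itv/= (ltW x0)/=.
  by near: n; exact: nbhs_infty_ger.
have [_ cv] := dominated_leb m1 mo (integrable_damped_kernel s0) h.
apply: cvg_trans cv; apply: near_eq_cvg; apply: nearW => n.
by rewrite /= -Rintegral_mkcond.
Unshelve. all: by end_near. Qed.

(** For [s > 0] the absolutely convergent integral and the improper one agree:
    the former is differentiable, the latter extends to the imaginary axis. *)
Lemma laplaceE s w : 0 < s -> w != 0 -> laplace s w = transform k c s w.
Proof.
move=> s0 w0; rewrite -(cvg_lim _ (@cvgn_trunc_laplace s w s0))//.
by apply: cvg_lim => //; apply: (cvgn_trunc_transform sk tc) => //; exact: ltW.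
Qed.

Let half_interval s : 0 < s -> s / 2 < s < s + 1.
Proof. by move=> s0; apply/andP; split; lra. Qed.

Lemma is_derive_laplace_s s w : 0 < s ->
  is_derive s 1 (laplace ^~ w) (- laplace1 s w).
Proof.
move=> s0; have s2 : 0 < s / 2 by rewrite divr_gt0.
have -> : - laplace1 s w = \int[leb]_t (-1 * (t * osc k c s w t)).
  by rewrite RintegralZl ?mulN1r//; exact: integrable_tosc.
apply: (@is_derive_integral _ _ _ leb setT (fun s => osc k c s w)
  (fun s t => -1 * (t * osc k c s w t)) (damped_kernel (s / 2)) s (s / 2) (s + 1)) => //.
- exact: half_interval.
- by move=> x /andP[x0 _]; apply: integrable_osc_damped; exact: lt_trans x0.
- move=> x t _ _; rewrite /osc.
  apply: is_derive_eq (is_deriveMx (is_deriveZx (k t) (is_derive_expx (is_deriveNx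
    (is_deriveMx (is_derive_idx x) (is_derive_cstx t x))))) (is_derive_cstx (c (w * t)) x)) _.
  by ring.
- exact: integrable_damped_kernel.
- move=> x t /andP[x0 _] _; rewrite mulN1r normrN.
  by apply: le_trans (tosc_damped x w t) _; apply: damped_kernel_nonincreasing; exact: ltW.
Qed.

Lemma continuous_laplace1 s : 0 < s -> continuous (laplace1 s).
Proof.
move=> s0 w.
have cc : continuous c by case: tc.
have h := @continuity_under_integral _ _ _ leb (fun w t => t * osc k c s w t) setT
  measurableT (w - 1) (w + 1) (fun x _ => integrable_tosc x s0) _ (damped_kernel s)
  (integrable_damped_kernel s0) _.
apply: h.
- apply: aeW => t _ x _.
  apply: cvgM; first exact: cvg_cst.
  apply: cvgM; first exact: cvg_cst.
  apply: (cvg_comp _ c); last exact: cc.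
  by apply: cvgM; [exact: cvg_id|exact: cvg_cst].
- by move=> x _; apply: aeW => t _; exact: tosc_damped.
- by rewrite inE/= in_itv/= ltrBlDr ltrDl ltr01.
Qed.

End one_function.

Lemma is_derive_laplace_w (c c' : R -> R) s w :
  trigonometric c -> trigonometric c' -> (forall t : R, is_derive t 1 c (c' t)) ->
  0 < s -> is_derive w 1 (laplace c s) (laplace1 c' s w).
Proof.
move=> tc tc' dc s0.
apply: (@is_derive_integral _ _ _ leb setT (fun w => osc k c s w)
  (fun w t => t * osc k c' s w t) (damped_kernel s) w (w - 1) (w + 1)) => //.
- by rewrite ltrBlDr ltrDl ltr01.
- by move=> x _; exact: integrable_osc_damped.
- move=> x t _ _; rewrite /osc.
  apply: is_derive_eq (is_deriveZx (k t * expR (- (s * t))) (is_derive_compx (dc _)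
    (is_deriveMx (is_derive_idx x) (is_derive_cstx t x)))) _.
  by ring.
- exact: integrable_damped_kernel.
- by move=> x t _ _; exact: tosc_damped.
Qed.

End laplace_transforms.

(** * Holomorphic functions and contour shift *)

Section holomorphic.
Context {R : realType}.
Notation leb := (@lebesgue_measure R).
Implicit Types (f g : R -> R -> R[i]) (s w : R).

Lemma ae_leb_imply (P Q : R -> Prop) : (forall x, P x -> Q x) ->
  {ae leb, forall x, P x} -> {ae leb, forall x, Q x}.
Proof. by move=> PQ; apply: (@filterS _ _ (ae_filter_ringOfSetsType _)). Qed.

(** [holo f f' s w]: the function [s + i w |-> f s w] satisfies the
    Cauchy-Riemann equations at the point, with complex derivative [f' s w]. *)
Definition holo f f' s w : Prop :=
  [/\ is_derive s 1 (fun x => complex.Re (f x w)) (complex.Re (f' s w)),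
      is_derive s 1 (fun x => complex.Im (f x w)) (complex.Im (f' s w)),
      is_derive w 1 (fun x => complex.Re (f s x)) (- complex.Im (f' s w)) &
      is_derive w 1 (fun x => complex.Im (f s x)) (complex.Re (f' s w))].

Lemma holoB f f' g g' s w : holo f f' s w -> holo g g' s w ->
  holo (fun x y => f x y - g x y) (fun x y => f' x y - g' x y) s w.
Proof.
move=> [f1 f2 f3 f4] [g1 g2 g3 g4]; split; rewrite !ReImE;
  under eq_fun do rewrite !ReImE.
- exact: is_deriveBx.
- exact: is_deriveBx.
- by apply: is_derive_eq (is_deriveBx f3 g3) _; ring.
- exact: is_deriveBx.
Qed.

Lemma holoM f f' g g' s w : holo f f' s w -> holo g g' s w ->
  holo (fun x y => f x y * g x y) (fun x y => f' x y * g x y + f x y * g' x y) s w.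
Proof.
move=> [f1 f2 f3 f4] [g1 g2 g3 g4]; split; rewrite !ReImE;
  under eq_fun do rewrite !ReImE.
- by apply: is_derive_eq (is_deriveBx (is_deriveMx f1 g1) (is_deriveMx f2 g2)) _; ring.
- by apply: is_derive_eq (is_deriveDx (is_deriveMx f1 g2) (is_deriveMx f2 g1)) _; ring.
- by apply: is_derive_eq (is_deriveBx (is_deriveMx f3 g3) (is_deriveMx f4 g4)) _; ring.
- by apply: is_derive_eq (is_deriveDx (is_deriveMx f3 g4) (is_deriveMx f4 g3)) _; ring.
Qed.

Lemma cReV (z : R[i]) : complex.Re z^-1 =
  complex.Re z * (complex.Re z ^+ 2 + complex.Im z ^+ 2)^-1.
Proof. by case: z. Qed.

Lemma cImV (z : R[i]) : complex.Im z^-1 =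
  - (complex.Im z * (complex.Re z ^+ 2 + complex.Im z ^+ 2)^-1).
Proof. by case: z. Qed.

Lemma normc2_neq0 (z : R[i]) : z != 0 -> complex.Re z ^+ 2 + complex.Im z ^+ 2 != 0.
Proof.
by case: z => x y; rewrite eq_complex/= paddr_eq0 ?sqr_ge0// !expf_eq0/=.
Qed.

Lemma is_derive_sqrx (g : R -> R) (x b : R) : is_derive x 1 g b ->
  is_derive x 1 (fun y => g y ^+ 2) (b * g x + g x * b).
Proof.
by move=> dg; under eq_fun do rewrite expr2; exact: is_deriveMx.
Qed.

Lemma holoV f f' s w : f s w != 0 -> holo f f' s w ->
  holo (fun x y => (f x y)^-1) (fun x y => - (f' x y * ((f x y)^-1 * (f x y)^-1))) s w.
Proof.
move=> f0 [f1 f2 f3 f4]; have n0 := normc2_neq0 f0.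
have V1 := is_deriveVx (f := fun x => complex.Re (f x w) ^+ 2 + complex.Im (f x w) ^+ 2)
  n0 (is_deriveDx (is_derive_sqrx f1) (is_derive_sqrx f2)).
have V2 := is_deriveVx (f := fun x => complex.Re (f s x) ^+ 2 + complex.Im (f s x) ^+ 2)
  n0 (is_deriveDx (is_derive_sqrx f3) (is_derive_sqrx f4)).
split; rewrite !ReImE !cReV !cImV; [under eq_fun do rewrite cReV|
  under eq_fun do rewrite cImV|under eq_fun do rewrite cReV|under eq_fun do rewrite cImV].
- apply: is_derive_eq (is_deriveMx f1 V1) _.
  by field.
- apply: is_derive_eq (is_deriveNx (is_deriveMx f2 V1)) _.
  by field.
- apply: is_derive_eq (is_deriveMx f3 V2) _.
  by field.
- apply: is_derive_eq (is_deriveNx (is_deriveMx f4 V2)) _.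
  by field.
Qed.

(** The affine function [m z + l]. *)
Definition affine (m l : R) s w : R[i] := (m * s + l) +i* (m * w).

Lemma holo_affine (m l : R) s w : holo (affine m l) (fun _ _ => m%:C) s w.
Proof.
split; rewrite /affine /=.
- apply: is_derive_eq (is_deriveDx (is_deriveZx m (is_derive_idx s)) (is_derive_cstx l s)) _.
  by rewrite mulr1 addr0.
- exact: is_derive_cstx.
- by rewrite oppr0; exact: is_derive_cstx.
- by apply: is_derive_eq (is_deriveZx m (is_derive_idx w)) _; rewrite mulr1.
Qed.

(** The exponential [exp (- t z)]. *)
Definition cexpN (t s w : R) : R[i] := (expR (- (t * s)))%:C * cexpi (- (t * w)).

Lemma Re_cexpN t s w : complex.Re (cexpN t s w) = expR (- (t * s)) * cos (- (t * w)).
Proof. by rewrite /cexpN ReImE /= mul0r subr0. Qed.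

Lemma Im_cexpN t s w : complex.Im (cexpN t s w) = expR (- (t * s)) * sin (- (t * w)).
Proof. by rewrite /cexpN ReImE /= mul0r addr0. Qed.

Lemma holo_cexpN t s w : holo (cexpN t) (fun x y => - t%:C * cexpN t x y) s w.
Proof.
have E (u : R) : is_derive u 1 (fun x => expR (- (t * x))) (expR (- (t * u)) * - t).
  by apply: is_derive_eq (is_derive_expx (is_deriveNx (is_deriveZx t (is_derive_idx u)))) _;
    rewrite mulr1.
have L (u : R) : is_derive u 1 (fun x => - (t * x)) (- t).
  by apply: is_derive_eq (is_deriveNx (is_deriveZx t (is_derive_idx u))) _; rewrite mulr1.
split; rewrite !ReImE ?Re_cexpN ?Im_cexpN; [under eq_fun do rewrite Re_cexpN|
  under eq_fun do rewrite Im_cexpN|under eq_fun do rewrite Re_cexpN|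
  under eq_fun do rewrite Im_cexpN]; rewrite /=.
- by apply: is_derive_eq (is_deriveMx (E s) (is_derive_cstx _ s)) _; ring.
- by apply: is_derive_eq (is_deriveMx (E s) (is_derive_cstx _ s)) _; ring.
- by apply: is_derive_eq (is_deriveMx (is_derive_cstx _ w) (is_derive_cosx (L w))) _; ring.
- by apply: is_derive_eq (is_deriveMx (is_derive_cstx _ w) (is_derive_sinx (L w))) _; ring.
Qed.

Lemma holo_continuous f f' s w : holo f f' s w ->
  {for w, continuous (fun x => complex.Re (f s x))} /\
  {for w, continuous (fun x => complex.Im (f s x))}.
Proof. by move=> [_ _ h1 h2]; split; apply: is_derive_continuous. Qed.

(** Shift of the line of integration to infinity. The integral over the
    segment [-N <= w <= N] has derivative [Im f (s, N) - Im f (s, -N)] in [s],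
    by the Cauchy-Riemann equations; the decay of [f] makes it disappear as
    [N] grows, so that the integral over the line does not depend on [s], and
    it tends to zero as [s] grows. *)
Lemma contour_shift f f' (l C : R) :
  (forall s w, l < s -> holo f f' s w) ->
  (forall s, l < s -> continuous (fun w => complex.Re (f' s w))) ->
  (forall s, l < s -> exists u B : R,
     [/\ l <= u, u < s & forall x w, u < x -> `|complex.Re (f' x w)| <= B]) ->
  (forall s w, l < s -> Normc.normc (f s w) <= C / (1 + w ^+ 2)) ->
  {ae leb, forall w, complex.Re (f n%:R w) @[n --> \oo] --> (0 : R)} ->
  leb.-integrable setT (EFin \o (fun w => C / (1 + w ^+ 2))) ->
  forall s, l < s -> \int[leb]_w complex.Re (f s w) = 0.
Proof.
move=> hf cf' bf' Cf f0 iC.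
have cRe s : l < s -> continuous (fun w => complex.Re (f s w)).
  by move=> ls w; have [] := holo_continuous (hf s w ls).
have mRe s : l < s -> measurable_fun setT (fun w => complex.Re (f s w)).
  by move=> ls; apply: continuous_measurable_fun; exact: cRe.
have iRe s : l < s -> leb.-integrable setT (EFin \o (fun w => complex.Re (f s w))).
  move=> ls; apply: (@integrable_dom _ _ _ leb _ (fun w => C / (1 + w ^+ 2))) => //.
    exact: mRe.
  by move=> w; apply: le_trans (normr_Re_le _) (Cf s w ls).
pose I N s := \int[leb]_(w in `[- N, N]) complex.Re (f s w).
have dI N s : 0 < N -> l < s ->
    is_derive s 1 (I N) (complex.Im (f s N) - complex.Im (f s (- N))).
  move=> N0 ls; have [u [B [lu us uB]]] := bf' s ls.
  have NN : - N < N by rewrite (@lt_trans _ _ 0)// oppr_lt0.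
  have <- : \int[leb]_(w in `[- N, N]) complex.Re (f' s w) =
      complex.Im (f s N) - complex.Im (f s (- N)).
    apply: (@FTC_is_derive _ (fun w => complex.Re (f' s w)) (fun w => complex.Im (f s w))) => //.
      by move=> w _; have [_ _ _] := hf s w ls.
    by apply: continuous_subspaceT; exact: cf'.
  apply: (@is_derive_integral _ _ _ leb `[- N, N]%classic (fun s w => complex.Re (f s w))
    (fun s w => complex.Re (f' s w)) (cst B) s u (s + 1)) => //.
  - by rewrite us ltrDl ltr01.
  - move=> x /andP[ux _]; apply: integrableS (iRe x (le_lt_trans lu ux)) => //.
  - by move=> x w /andP[ux _] _; have [] := hf x w (le_lt_trans lu ux).
  - apply: continuous_compact_integrable; first exact: segment_compact.
    by apply: continuous_subspaceT => x; exact: cvg_cst.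
  - by move=> x w /andP[ux _] _; exact: uB.
have const s1 s2 : l < s1 -> s1 < s2 ->
    \int[leb]_w complex.Re (f s1 w) = \int[leb]_w complex.Re (f s2 w).
  move=> ls1 s12; have ls2 := lt_trans ls1 s12.
  have c1 := integrable_trunc_cvg (fun n => measurable_itv `[- n%:R, n%:R])
    (@near_symmetric_itv R) (iRe s1 ls1).
  have c2 := integrable_trunc_cvg (fun n => measurable_itv `[- n%:R, n%:R])
    (@near_symmetric_itv R) (iRe s2 ls2).
  have : `|\int[leb]_w complex.Re (f s2 w) - \int[leb]_w complex.Re (f s1 w)| <= 0.
    apply/ler_addgt0Pr => e e0; rewrite add0r -[_ - _]subr0.
    apply: (cvg_dist_le _ (cvgB c2 c1)).
    have C0 : 0 <= C.
      by have := Cf s1 0 ls1; rewrite expr0n addr0 divr1; apply: le_trans; exact: normc_ge0.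
    near=> n; rewrite subr0.
    have n0 : 0 < n%:R :> R by rewrite ltr0n; near: n; exists 1%N.
    have dIx x : x \in `]s1, s2[ -> is_derive x 1 (I n%:R)
        (complex.Im (f x n%:R) - complex.Im (f x (- n%:R))).
      by rewrite in_itv/= => /andP[sx _]; apply: dI => //; exact: lt_trans sx.
    have cI : {within `[s1, s2], continuous (I n%:R)}.
      apply: continuous_in_subspaceT => x; rewrite inE/= in_itv/= => /andP[sx _].
      exact: is_derive_continuous (dI _ _ n0 (lt_le_trans ls1 sx)).
    have [x + E] := MVT s12 dIx cI; rewrite in_itv/= => /andP[sx _].
    rewrite -/(I _ s2) -/(I _ s1) E normrM.
    have lx := lt_trans ls1 sx.
    have b1 := le_trans (normr_Im_le _) (Cf x n%:R lx).
    have b2 := le_trans (normr_Im_le _) (Cf x (- n%:R) lx).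
    have b3 : `|complex.Im (f x n%:R) - complex.Im (f x (- n%:R))| <= 2 * C / (1 + n%:R ^+ 2).
      apply: le_trans (ler_normB _ _) _; apply: le_trans (lerD b1 b2) _.
      by rewrite sqrrN; lra.
    have s21 : 0 < `|s2 - s1| by rewrite normr_gt0 subr_eq0 gt_eqF.
    apply: le_trans (ler_wpM2r (ltW s21) b3) _.
    have n2 : 0 < 1 + n%:R ^+ 2 :> R by rewrite ltr_pwDl// sqr_ge0.
    rewrite mulrAC ler_pdivrMr//.
    have ne : 2 * C * `|s2 - s1| / e <= n%:R by near: n; exact: nbhs_infty_ger.
    rewrite ler_pdivrMr// in ne; apply: le_trans ne _; rewrite mulrC ler_pM2l//.
    have n1 : 1 <= n%:R :> R by rewrite ler1n; near: n; exists 1%N.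
    by rewrite (@le_trans _ _ (n%:R ^+ 2))// ?lerDr// expr2 ler_peMr// ltW.
  rewrite normr_le0 subr_eq0 => /eqP; exact: esym.
move=> s ls.
pose N := (Num.trunc `|s|).+2.
have sn (n : nat) : s < (n + N)%:R.
  apply: le_lt_trans (ler_norm s) _.
  apply: lt_le_trans (truncnS_gt `|s|) _.
  by rewrite ler_nat /N addnS ltnW// ltnS leq_addl.
have cn n : \int[leb]_w complex.Re (f (n + N)%:R w) = \int[leb]_w complex.Re (f s w).
  by rewrite (const s (n + N)%:R).
have h : {ae leb, forall w,
    (forall n, `|complex.Re (f (n + N)%:R w)| <= C / (1 + w ^+ 2)) /\
    (complex.Re (f (n + N)%:R w) @[n --> \oo] --> (0 : R))}.
  apply: ae_leb_imply f0 => w fw; split.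
    by move=> n; apply: le_trans (normr_Re_le _) (Cf _ w (lt_trans ls (sn n))).
  by rewrite (cvg_shiftn N (fun n => complex.Re (f n%:R w))).
have m0 : measurable_fun setT (fun _ : R => 0 : R) by exact: measurable_cst.
have [_ cv] := dominated_leb (fun n => mRe _ (lt_trans ls (sn n))) m0 iC h.
have E0 : \int[leb]_x (0 : R) = 0 by rewrite /Rintegral integral0.
transitivity (limn (fun n : nat => \int[leb]_w complex.Re (f (n + N)%:R w))).
  have -> : (fun n : nat => \int[leb]_w complex.Re (f (n + N)%:R w)) =
      (fun=> \int[leb]_w complex.Re (f s w)) by apply/funext => n; rewrite cn.
  by rewrite lim_cst.
by rewrite -[RHS]E0; apply: cvg_lim.
Unshelve. all: by end_near. Qed.

End holomorphic.

(** * The Cauchy density *)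

Section complex_continuity.
Context {R : realType}.
Implicit Types (f g : R -> R[i]).

Definition ccontinuous f : Prop :=
  continuous (fun x => complex.Re (f x)) /\ continuous (fun x => complex.Im (f x)).

Lemma ccontinuousD f g : ccontinuous f -> ccontinuous g ->
  ccontinuous (fun x => f x + g x).
Proof.
move=> [f1 f2] [g1 g2]; split; under eq_fun do rewrite !ReImE.
  by move=> x; apply: cvgD; [exact: f1|exact: g1].
by move=> x; apply: cvgD; [exact: f2|exact: g2].
Qed.

Lemma ccontinuousN f : ccontinuous f -> ccontinuous (fun x => - f x).
Proof.
move=> [f1 f2]; split; under eq_fun do rewrite !ReImE.
  by move=> x; apply: cvgN; exact: f1.
by move=> x; apply: cvgN; exact: f2.
Qed.

Lemma ccontinuousM f g : ccontinuous f -> ccontinuous g ->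
  ccontinuous (fun x => f x * g x).
Proof.
move=> [f1 f2] [g1 g2]; split; under eq_fun do rewrite !ReImE.
  by move=> x; apply: cvgB; apply: cvgM; [exact: f1|exact: g1|exact: f2|exact: g2].
by move=> x; apply: cvgD; apply: cvgM; [exact: f1|exact: g2|exact: f2|exact: g1].
Qed.

Lemma ccontinuousV f : (forall x, f x != 0) -> ccontinuous f ->
  ccontinuous (fun x => (f x)^-1).
Proof.
move=> f0 [f1 f2].
have nc : continuous (fun x => (complex.Re (f x) ^+ 2 + complex.Im (f x) ^+ 2)^-1).
  move=> x; apply: cvgV; first exact: normc2_neq0.
  by under eq_fun do rewrite !expr2; apply: cvgD; apply: cvgM;
    [exact: f1|exact: f1|exact: f2|exact: f2].
split; [under eq_fun do rewrite cReV|under eq_fun do rewrite cImV] => x.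
  by apply: cvgM; [exact: f1|exact: nc].
by apply: cvgN; apply: cvgM; [exact: f2|exact: nc].
Qed.

Lemma ccontinuous_cst (z : R[i]) : ccontinuous (fun=> z).
Proof. by split=> x; exact: cvg_cst. Qed.

Lemma ccontinuous_holo (f f' : R -> R -> R[i]) s : (forall w, holo f f' s w) -> ccontinuous (f s).
Proof. by move=> h; split=> w; have [] := holo_continuous (h w). Qed.

Lemma normcD_le (x y : R[i]) :
  Normc.normc (x + y) <= Normc.normc x + Normc.normc y.
Proof. exact: (@le_normcD R x y). Qed.

Lemma normcN_eq (x : R[i]) : Normc.normc (- x) = Normc.normc x.
Proof. by case: x => a b /=; rewrite !sqrrN. Qed.

Lemma Re_gt0_neq0 (x : R[i]) : 0 < complex.Re x -> x != 0.
Proof. by apply: contraTneq => ->; rewrite ltxx. Qed.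

Lemma normcV_le (x : R[i]) (b : R) : 0 < b -> b <= Normc.normc x ->
  Normc.normc x^-1 <= b^-1.
Proof. by move=> b0 bx; rewrite Normc.normcV lef_pV2 ?posrE// (lt_le_trans b0). Qed.

End complex_continuity.

Section cauchy_density.
Context {R : realType}.
Notation leb := (@lebesgue_measure R).
Implicit Types (s w t : R).

Lemma oneDsqr_gt0' w : 0 < 1 + w ^+ 2.
Proof. by rewrite ltr_pwDl// sqr_ge0. Qed.

Lemma integral_cauchy :
  (\int[leb]_w ((1 + w ^+ 2)^-1)%:E)%E = pi%:E.
Proof.
have c1 : continuous (fun w : R => (1 + w ^+ 2)^-1) by exact: continuous_oneDsqrV.
rewrite (@ge0_symfun_integralT _ (fun w => (1 + w ^+ 2)^-1)); last 3 first.
- by move=> x; rewrite invr_ge0 ltW// oneDsqr_gt0'.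
- exact: c1.
- by move=> x /=; rewrite sqrrN.
rewrite -set_itvcy (_ : (\int[leb]_(x in _) _)%E = (pi / 2)%:E).
  by rewrite -EFinM; congr (_%:E); field.
exact: integral0y_oneDsqr.
Qed.

Lemma measurable_cauchy : measurable_fun setT (fun w : R => (1 + w ^+ 2)^-1).
Proof. by apply: continuous_measurable_fun; exact: continuous_oneDsqrV. Qed.

Lemma integrable_cauchy :
  leb.-integrable setT (EFin \o (fun w : R => (1 + w ^+ 2)^-1)).
Proof.
apply/integrableP; split; first by apply/measurable_EFinP; exact: measurable_cauchy.
under eq_integral => w _ do rewrite /= ger0_norm ?invr_ge0 ?(ltW (oneDsqr_gt0' w))//.
by rewrite integral_cauchy ltry.
Qed.

Variable sg : R.
Hypothesis sg0 : 0 < sg.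

(** The Cauchy density up to normalization, that is, the Poisson kernel of the
    half-plane at height [sg]. *)
Definition cauchyd w := (sg ^+ 2 + w ^+ 2)^-1.

Let den_gt0 w : 0 < sg ^+ 2 + w ^+ 2.
Proof. by rewrite ltr_pwDl ?exprn_gt0// sqr_ge0. Qed.

Lemma cauchy_gt0 w : 0 < cauchyd w.
Proof. by rewrite invr_gt0. Qed.

Let B := 1 + (sg ^+ 2)^-1.

Let B0 : 0 < B. Proof. by rewrite addr_gt0// invr_gt0 exprn_gt0. Qed.

Let den_le w : 1 + w ^+ 2 <= B * (sg ^+ 2 + w ^+ 2).
Proof.
have s2 : 0 < sg ^+ 2 by rewrite exprn_gt0.
rewrite /B mulrDl mul1r mulrDr mulVf ?gt_eqF//.
have : 0 <= (sg ^+ 2)^-1 * w ^+ 2 by rewrite mulr_ge0 ?sqr_ge0// invr_ge0 ltW.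
by lra.
Qed.

Let cauchyM w : (1 + w ^+ 2) * cauchyd w <= B.
Proof. by rewrite /cauchyd ler_pdivrMr. Qed.

Lemma cauchy_le w : cauchyd w <= B / (1 + w ^+ 2).
Proof. by rewrite ler_pdivlMr ?oneDsqr_gt0'// mulrC. Qed.

Lemma continuous_cauchy : continuous cauchyd.
Proof.
move=> w; apply: cvgV; first by rewrite gt_eqF.
by apply: cvgD; [exact: cvg_cst|exact: sqr_continuous].
Qed.

Let mb : measurable_fun setT cauchyd.
Proof. by apply: continuous_measurable_fun; exact: continuous_cauchy. Qed.

Lemma integrable_cauchy_sg : leb.-integrable setT (EFin \o cauchyd).
Proof.
apply: (@integrable_dom _ _ _ leb _ (fun w => B * (1 + w ^+ 2)^-1)) => //.
  by apply: integrable_EFinZ; exact: integrable_cauchy.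
by move=> w; rewrite (gtr0_norm (cauchy_gt0 w)); exact: cauchy_le.
Qed.

Lemma Rintegral_cauchy_gt0 : 0 < \int[leb]_w cauchyd w.
Proof.
rewrite lt_neqAle Rintegral_ge0 ?andbT; last by move=> w _; rewrite ltW// cauchy_gt0.
apply/negP => /eqP E.
have i01 : leb.-integrable `[0, 1] (EFin \o cauchyd).
  exact: integrableS integrable_cauchy_sg.
have : \int[leb]_(w in `[0, 1]) cauchyd w <= \int[leb]_w cauchyd w.
  rewrite /Rintegral; apply: fine_le.
  - by apply: integrable_fin_num => //; exact: measurable_itv.
  - by apply: integrable_fin_num => //; exact: integrable_cauchy_sg.
  - apply: ge0_subset_integral => //; first exact/measurable_EFinP.
    by move=> x _; rewrite lee_fin ltW// cauchy_gt0.
apply/negP; rewrite -E -ltNge.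
apply: (@lt_le_trans _ _ (\int[leb]_(w in `[0, 1]) (sg ^+ 2 + 1)^-1)).
  rewrite Rintegral_cst//= lebesgue_measure_itv/= lte01 sube0/= mulr1 invr_gt0.
  by rewrite addr_gt0// exprn_gt0.
apply: le_Rintegral => //.
  apply: continuous_compact_integrable; first exact: segment_compact.
  by apply: continuous_subspaceT => x; exact: cvg_cst.
move=> x; rewrite /= in_itv/= => /andP[x0 x1].
have e0 : 0 < sg ^+ 2 + 1 by rewrite addr_gt0// exprn_gt0.
by rewrite /cauchyd lef_pV2 ?posrE ?den_gt0// lerD2l expr_le1.
Qed.

(** The function [exp (- t z) / (z + sg)^2] is holomorphic to the right of
    [- sg / 2] and decays there for [t >= 0]; the square makes it absolutely
    integrable on vertical lines. Its integral over the imaginary axis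
    vanishes. *)
Let V s w : R[i] := (affine 1 sg s w)^-1.
Let V' s w : R[i] := - (1%:C * (V s w * V s w)).
Let f t s w : R[i] := cexpN t s w * (V s w * V s w).
Let f' t s w : R[i] := (- t%:C * cexpN t s w) * (V s w * V s w) +
  cexpN t s w * (V' s w * V s w + V s w * V' s w).

Let shift_gt0 s : - (sg / 2) < s -> sg / 2 < s + sg.
Proof. by move=> h; have := sg0; lra. Qed.

Let sg20 : 0 < sg / 2. Proof. by rewrite divr_gt0. Qed.

Let aff_neq0 s w : - (sg / 2) < s -> affine 1 sg s w != 0.
Proof.
move=> /shift_gt0 h; apply: Re_gt0_neq0; rewrite /= mul1r.
exact: lt_trans h.
Qed.

Let holoV1 s w : - (sg / 2) < s -> holo V V' s w.
Proof. by move=> h; apply: holoV; [exact: aff_neq0|exact: holo_affine]. Qed.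

Let holof t s w : - (sg / 2) < s -> holo (f t) (f' t) s w.
Proof.
move=> h; apply: holoM; first exact: holo_cexpN.
by apply: holoM; exact: holoV1.
Qed.

Let normV2 s w : - (sg / 2) < s ->
  Normc.normc (V s w) ^+ 2 = ((s + sg) ^+ 2 + w ^+ 2)^-1.
Proof. by move=> _; rewrite Normc.normcV exprVn normc_sqrE /= !mul1r. Qed.

Let normE t s w : 0 <= t -> - (sg / 2) < s ->
  Normc.normc (cexpN t s w) <= expR (t * (sg / 2)).
Proof.
move=> t0 h; rewrite Normc.normcM normc_expi mulr1 normc_real ger0_norm ?expR_ge0//.
by rewrite ler_expR -mulrN ler_wpM2l//; lra.
Qed.

Let Cf t := expR (t * (sg / 2)) * (1 + ((sg / 2) ^+ 2)^-1).

Let normf t s w : 0 <= t -> - (sg / 2) < s ->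
  Normc.normc (f t s w) <= Cf t / (1 + w ^+ 2).
Proof.
move=> t0 h; rewrite /f Normc.normcM [Normc.normc (_ * V s w)]Normc.normcM -expr2 normV2//.
rewrite /Cf -mulrA; apply: ler_pM => //; rewrite ?normc_ge0 ?normE//.
  by rewrite invr_ge0 addr_ge0// sqr_ge0.
have q0 : 0 < (sg / 2) ^+ 2 by rewrite exprn_gt0.
have q1 : (sg / 2) ^+ 2 <= (s + sg) ^+ 2.
  by rewrite ler_sqr ?nnegrE ?(ltW sg20) ?(ltW (lt_trans sg20 (shift_gt0 h)))// ltW// shift_gt0.
have w0 := sqr_ge0 w.
have d0 : 0 < (s + sg) ^+ 2 + w ^+ 2 by rewrite ltr_pwDl// (lt_le_trans q0).
rewrite ler_pdivlMr ?oneDsqr_gt0'// mulrC ler_pdivrMr//.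
rewrite (@le_trans _ _ ((1 + ((sg / 2) ^+ 2)^-1) * ((sg / 2) ^+ 2 + w ^+ 2)))//.
  rewrite mulrDl mul1r mulrDr mulVf ?gt_eqF//.
  have : 0 <= ((sg / 2) ^+ 2)^-1 * w ^+ 2 by rewrite mulr_ge0// invr_ge0 ltW.
  by lra.
by rewrite ler_wpM2l ?lerD2r// addr_ge0// invr_ge0 ltW.
Qed.

Let integral_f0 t : 0 <= t -> \int[leb]_w complex.Re (f t 0 w) = 0.
Proof.
move=> t0; have l0 : - (sg / 2) < 0 by rewrite oppr_lt0.
have contE s : ccontinuous (cexpN t s).
  by apply: (@ccontinuous_holo _ _ (fun x y => - t%:C * cexpN t x y)) => w; exact: holo_cexpN.
have contV s : - (sg / 2) < s -> ccontinuous (V s).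
  by move=> h; apply: (@ccontinuous_holo _ V V') => w; exact: holoV1.
have normV s w : - (sg / 2) < s -> Normc.normc (V s w) <= (sg / 2)^-1.
  move=> h; apply: normcV_le => //; apply: le_trans (normr_Re_le _).
  by rewrite /= mul1r (le_trans _ (ler_norm _))// ltW// shift_gt0.
apply: (@contour_shift _ (f t) (f' t) (- (sg / 2)) (Cf t)).
- by move=> s w; exact: holof.
- move=> s h; have cV := contV s h.
  have cV' : ccontinuous (V' s).
    by apply: ccontinuousN; apply: ccontinuousM; [exact: ccontinuous_cst|exact: ccontinuousM].
  have [] : ccontinuous (f' t s); last by [].
  apply: ccontinuousD; apply: ccontinuousM => //.
  + by apply: ccontinuousM => //; exact: ccontinuous_cst.
  + exact: ccontinuousM.
  + by apply: ccontinuousD; exact: ccontinuousM.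
- move=> s h; exists (- (sg / 2)).
  pose e := expR (t * (sg / 2)); pose v := (sg / 2)^-1.
  exists (t * e * (v * v) + e * (v * v * v + v * (v * v))); split=> // x w hx.
  apply: le_trans (normr_Re_le _) _.
  have e0 : 0 <= e by exact: expR_ge0.
  have v0 : 0 <= v by rewrite invr_ge0 ltW.
  have nV : Normc.normc (V x w) <= v := normV x w hx.
  have nE : Normc.normc (cexpN t x w) <= e := normE w t0 hx.
  have nV2 : Normc.normc (V x w * V x w) <= v * v.
    by rewrite Normc.normcM; apply: ler_pM => //; exact: normc_ge0.
  have nV' : Normc.normc (V' x w) <= v * v by rewrite normcN_eq mul1r.
  have nM (p q : R[i]) (p' q' : R) : Normc.normc p <= p' -> Normc.normc q <= q' ->
      Normc.normc (p * q) <= p' * q'.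
    by move=> h1 h2; rewrite Normc.normcM; apply: ler_pM => //; exact: normc_ge0.
  apply: le_trans (normcD_le _ _) _; apply: lerD.
    apply: (nM _ _ _ _) => //; apply: (nM _ _ _ _) => //.
    by rewrite normcN_eq normc_real ger0_norm.
  apply: (nM _ _ _ _) => //; apply: le_trans (normcD_le _ _) _.
  by apply: lerD; apply: (nM _ _ _ _).
- by move=> s w; exact: normf.
- apply: aeW => w; apply/cvgrPdist_le => e e0.
  near=> n; rewrite sub0r normrN; apply: le_trans (normr_Re_le _) _.
  have n1 : 1 <= n%:R :> R by rewrite ler1n; near: n; exists 1%N.
  have hn : - (sg / 2) < n%:R by apply: lt_le_trans n1; rewrite (lt_trans l0).
  rewrite /f Normc.normcM [Normc.normc (_ * V _ w)]Normc.normcM -expr2 normV2//.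
  rewrite Normc.normcM normc_expi mulr1 normc_real ger0_norm ?expR_ge0//.
  have e1 : expR (- (t * n%:R)) <= 1 by rewrite expR_le1 oppr_le0 mulr_ge0.
  have en : e^-1 <= n%:R by near: n; exact: nbhs_infty_ger.
  apply: (@le_trans _ _ (1 * n%:R^-1)).
    apply: ler_pM => //; rewrite ?expR_ge0 ?invr_ge0 ?addr_ge0 ?sqr_ge0//.
    have n0 : 0 < n%:R :> R by apply: lt_le_trans n1.
    have s0 := sg0; have w2 := sqr_ge0 w.
    have big : n%:R <= (n%:R + sg) ^+ 2 + w ^+ 2 by nra.
    by rewrite lef_pV2 ?posrE// (lt_le_trans n0).
  by rewrite mul1r -[leRHS]invrK lef_pV2 ?posrE ?invr_gt0// (lt_le_trans ltr01).
- by apply: integrable_EFinZ; exact: integrable_cauchy.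
- exact: l0.
Unshelve. all: by end_near. Qed.

(** The vanishing contour integral expresses the transform [J] by [Y] and its
    derivative [- Y1], and [Y2 = J - sg^2 Y]; together they form a first-order
    equation for [J]. The integral [J] itself cannot be differentiated under the
    integral sign. *)
Let J t := \int[leb]_w (cos (t * w) * cauchyd w).
Let Y t := \int[leb]_w (cos (t * w) * cauchyd w ^+ 2).
Let Y1 t := \int[leb]_w (w * sin (t * w) * cauchyd w ^+ 2).
Let Y2 t := \int[leb]_w (w ^+ 2 * cos (t * w) * cauchyd w ^+ 2).

Let mtrig (c : R -> R) t : continuous c -> measurable_fun setT (fun w => c (t * w)).
Proof.
move=> cc; apply: (@measurableT_comp _ _ _ _ _ _ c); first exact: continuous_measurable_fun.
by apply: measurable_funM.
Qed.

Let weight_le (p c : R) w : `|p| <= 1 + w ^+ 2 -> `|c| <= 1 ->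
  `|p * c * cauchyd w ^+ 2| <= B * cauchyd w.
Proof.
move=> p1 c1; rewrite expr2 !normrM (gtr0_norm (cauchy_gt0 w)) mulrA.
rewrite ler_wpM2r ?(ltW (cauchy_gt0 w))//.
apply: le_trans (cauchyM w); rewrite ler_wpM2r ?(ltW (cauchy_gt0 w))//.
by apply: le_trans p1; rewrite ler_piMr.
Qed.

Let integrable_weight (p c : R -> R) : measurable_fun setT p -> measurable_fun setT c ->
  (forall w, `|p w| <= 1 + w ^+ 2) -> (forall w, `|c w| <= 1) ->
  leb.-integrable setT (EFin \o (fun w => p w * c w * cauchyd w ^+ 2)).
Proof.
move=> mp mc p1 c1; apply: (@integrable_dom _ _ _ leb _ (fun w => B * cauchyd w)).
- by apply: measurable_funM; [exact: measurable_funM|exact: measurable_funX].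
- by apply: integrable_EFinZ; exact: integrable_cauchy_sg.
- by move=> w; exact: weight_le.
Qed.

Let w1 w : `|w| <= 1 + w ^+ 2.
Proof.
have := sqr_ge0 (`|w| - 1); rewrite sqrrB expr1n mulr1 real_normK ?num_real//.
by have := normr_ge0 w; have := sqr_ge0 w; rewrite -mulr_natr; lra.
Qed.

Let w2 w : `|w ^+ 2| <= 1 + w ^+ 2.
Proof. by rewrite ger0_norm ?sqr_ge0// lerDr. Qed.

Let w0 w : `|1 : R| <= 1 + w ^+ 2.
Proof. by rewrite normr1 lerDl sqr_ge0. Qed.

Let iY t : leb.-integrable setT (EFin \o (fun w => cos (t * w) * cauchyd w ^+ 2)).
Proof.
have := @integrable_weight (fun=> 1) (fun w => cos (t * w)) (@measurable_cst _ _ _ _ _ _)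
  (mtrig t (@continuous_cos R)) w0 (fun w => normr_cos_le1 _).
by under eq_fun do rewrite mul1r.
Qed.

Let iY1 t : leb.-integrable setT (EFin \o (fun w => w * sin (t * w) * cauchyd w ^+ 2)).
Proof.
apply: integrable_weight => //; first exact: (mtrig t (@continuous_sin R)).
by move=> w; exact: normr_sin_le1.
Qed.

Let iY2 t : leb.-integrable setT (EFin \o (fun w => w ^+ 2 * cos (t * w) * cauchyd w ^+ 2)).
Proof.
apply: integrable_weight => //; first exact: (mtrig t (@continuous_cos R)).
by move=> w; exact: normr_cos_le1.
Qed.

Let iJ t : leb.-integrable setT (EFin \o (fun w => cos (t * w) * cauchyd w)).
Proof.
apply: (@integrable_dom _ _ _ leb _ cauchyd); last 2 first.
- exact: integrable_cauchy_sg.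
- move=> w; rewrite normrM (gtr0_norm (cauchy_gt0 w)) ler_piMl ?normr_cos_le1//.
  exact: ltW (cauchy_gt0 w).
by apply: measurable_funM => //; exact: (mtrig t (@continuous_cos R)).
Qed.

Let dY t : is_derive t 1 Y (- Y1 t).
Proof.
have -> : - Y1 t = \int[leb]_w (-1 * (w * sin (t * w) * cauchyd w ^+ 2)).
  by rewrite RintegralZl ?mulN1r.
apply: (@is_derive_integral _ _ _ leb setT (fun t w => cos (t * w) * cauchyd w ^+ 2)
  (fun t w => -1 * (w * sin (t * w) * cauchyd w ^+ 2)) (fun w => B * cauchyd w) t (t - 1) (t + 1)) => //.
- by rewrite ltrBlDr ltrDl ltr01.
- move=> x w _ _; apply: is_derive_eq (is_deriveMx (is_derive_cosx
    (is_deriveMx (is_derive_idx x) (is_derive_cstx w x))) (is_derive_cstx _ x)) _.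
  by ring.
- by apply: integrable_EFinZ; exact: integrable_cauchy_sg.
- by move=> x w _ _; rewrite mulN1r normrN; apply: weight_le => //; exact: normr_sin_le1.
Qed.

Let dY1 t : is_derive t 1 Y1 (Y2 t).
Proof.
apply: (@is_derive_integral _ _ _ leb setT (fun t w => w * sin (t * w) * cauchyd w ^+ 2)
  (fun t w => w ^+ 2 * cos (t * w) * cauchyd w ^+ 2) (fun w => B * cauchyd w) t (t - 1) (t + 1)) => //.
- by rewrite ltrBlDr ltrDl ltr01.
- move=> x w _ _; apply: is_derive_eq (is_deriveMx (is_deriveZx w (is_derive_sinx
    (is_deriveMx (is_derive_idx x) (is_derive_cstx w x)))) (is_derive_cstx _ x)) _.
  by rewrite expr2; ring.
- by apply: integrable_EFinZ; exact: integrable_cauchy_sg.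
- by move=> x w _ _; apply: weight_le => //; exact: normr_cos_le1.
Qed.

Let Y2E t : Y2 t = J t - sg ^+ 2 * Y t.
Proof.
rewrite /J /Y -RintegralZl// -RintegralB//; last exact: integrable_EFinZ.
apply: eq_Rintegral => w _; rewrite /cauchyd; field.
by rewrite gt_eqF.
Qed.

Let JE t : 0 <= t -> J t = 2 * sg ^+ 2 * Y t - 2 * sg * Y1 t.
Proof.
move=> t0; have := integral_f0 t0.
have -> : \int[leb]_w complex.Re (f t 0 w) = \int[leb]_w
    (2 * sg ^+ 2 * (cos (t * w) * cauchyd w ^+ 2) -
     2 * sg * (w * sin (t * w) * cauchyd w ^+ 2) - cos (t * w) * cauchyd w).
  apply: eq_Rintegral => w _; rewrite /f cReM Re_cexpN Im_cexpN cReM cImM /V cReV cImV /=.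
  rewrite !mul1r add0r mulr0 oppr0 expR0 !mul1r cosN sinN -/(cauchyd w) /cauchyd.
  by field; rewrite gt_eqF.
rewrite RintegralB//; last first.
  rewrite (_ : _ \o _ = (fun w => (2 * sg ^+ 2 * (cos (t * w) * cauchyd w ^+ 2))%:E -
     (2 * sg * (w * sin (t * w) * cauchyd w ^+ 2))%:E)%E)//.
  by apply: integrableB => //; exact: integrable_EFinZ.
rewrite RintegralB//; try exact: integrable_EFinZ.
by rewrite !RintegralZl// -/(J t) -/(Y t) -/(Y1 t) => h; lra.
Qed.

(** The product [J (x) exp (sg x)] has zero derivative for [x >= 0]. *)
Lemma cauchy_cos t : 0 <= t -> \int[leb]_w (cos (t * w) * cauchyd w) =
  expR (- (sg * t)) * \int[leb]_w cauchyd w.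
Proof.
move=> t0; rewrite -/(J t).
have J0 : J 0 = \int[leb]_w cauchyd w.
  by apply: eq_Rintegral => w _; rewrite mul0r cos0 mul1r.
pose h x := (2 * sg ^+ 2 * Y x - 2 * sg * Y1 x) * expR (sg * x).
have dh (x : R) : 0 <= x -> is_derive x 1 h 0.
  move=> x0; apply: is_derive_eq (is_deriveMx (is_deriveBx (is_deriveZx _ (dY x))
    (is_deriveZx _ (dY1 x))) (is_derive_expx (is_deriveZx sg (is_derive_idx x)))) _.
  by rewrite Y2E (JE x0); ring.
have ht : h t = h 0.
  move: t0; rewrite le_eqVlt => /predU1P[<-//|t0].
  have dx x : x \in `]0, t[ -> is_derive x 1 h 0.
    by rewrite in_itv/= => /andP[x0 _]; apply: dh; exact: ltW.
  have ch : {within `[0, t], continuous h}.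
    apply: continuous_in_subspaceT => x; rewrite inE/= in_itv/= => /andP[x0 _].
    exact: is_derive_continuous (dh x x0).
  have [x _] := MVT t0 dx ch.
  by rewrite mul0r => /eqP; rewrite subr_eq0 => /eqP.
move: ht; rewrite /h -!JE// mulr0 expR0 mulr1 J0 => <-.
by rewrite [RHS]mulrC -mulrA -expRD subrr expR0 mulr1.
Qed.

End cauchy_density.

(** * Positivity of the damped cosine transform *)

Section boundary_transforms.
Context {R : realType}.
Notation leb := (@lebesgue_measure R).
Variables (k k' : R -> R) (C a : R).
Hypothesis sk : slow_kernel k k' C a.
Implicit Types (s w t : R) (c : R -> R).

(** The undamped transform, set to zero at the frequency where the improper
    integral may diverge. *)
Definition ktr c w : R := if w == 0 then 0 else transform k c 0 w.

Lemma ktrE c w : w != 0 -> ktr c w = transform k c 0 w.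
Proof. by move=> /negbTE w0; rewrite /ktr w0. Qed.

Lemma continuous_trunc_transform c s A : trigonometric c -> 0 <= s ->
  continuous (fun w => trunc_transform k c s w A).
Proof.
move=> tc s0 w; apply/(@cvg_nbhsP _ R^o) => u uw.
by apply: (trunc_transform_cvg sk tc (s_ := fun=> s)) => //; exact: cvg_cst.
Qed.

Lemma measurable_off0 (f : R -> R) : measurable_fun setT f ->
  measurable_fun setT (fun w => if w == 0 then 0 else f w).
Proof.
move=> mf; rewrite (_ : (fun w => _) = fun w => f w * \1_(~` [set 0]) w); last first.
  apply/funext => w; rewrite indicE; have [->|w0] := eqVneq w 0.
    by rewrite memNset ?mulr0//=; apply.
  by rewrite mem_set ?mulr1//=; apply/eqP.
apply: measurable_funM => //; apply: measurable_indic.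
by apply: measurableC; exact: measurable_set1.
Qed.

Lemma measurable_ktr c : trigonometric c -> measurable_fun setT (ktr c).
Proof.
move=> tc.
apply: (measurable_fun_cvg (h := fun n w =>
  if w == 0 then 0 else trunc_transform k c 0 w n%:R)).
  move=> n; apply: measurable_off0; apply: continuous_measurable_fun.
  exact: continuous_trunc_transform.
move=> w _; rewrite /ktr; have [w0|w0] := eqVneq w 0; first exact: cvg_cst.
exact: (cvgn_trunc_transform sk tc).
Qed.

Lemma ktr_dominated c w : trigonometric c -> `|ktr c w| <= dominator k C a w.
Proof.
move=> tc; rewrite /ktr; case: eqVneq => [_|w0].
  by rewrite normr0; exact: (dominator_ge0 sk).
exact: (transform_dominated sk tc).
Qed.

Lemma continuous_ktr c w : trigonometric c -> w != 0 -> {for w, continuous (ktr c)}.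
Proof.
move=> tc w0.
have cg : {for w, continuous (fun x => transform k c 0 x)}.
  apply/(@cvg_nbhsP _ R^o) => u uw.
  by apply: (transform_cvg sk tc (s_ := fun=> 0)) => //; exact: cvg_cst.
rewrite /prop_for /continuous_at (ktrE c w0); apply: cvg_trans cg.
apply: near_eq_cvg; near=> x; rewrite ktrE//.
near: x; apply: (cvgr_neq0 w) => //; exact: cvg_id.
Unshelve. all: by end_near. Qed.

Lemma dominator_even w : dominator k C a (- w) = dominator k C a w.
Proof. by rewrite /dominator /singularity opprK addrC [in RHS]addrC [half_singularity a (- w) + _]addrC. Qed.

Lemma dominator_ge1 w : 1 <= `|w| -> dominator k C a w <= 2 * transform_const k C a.
Proof.
move=> w1; rewrite /dominator mulrC ler_wpM2r ?(transform_const_ge0 sk)//.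
have -> : (2 : R) = 1 + 1 by ring.
rewrite lerD2l /singularity /half_singularity.
have [w0|w0|w0] := ltgtP w 0.
- rewrite oppr_gt0 w0 add0r/=; case: ifP => // h.
  have -> : - w = 1 by apply/eqP; rewrite eq_le h; move: w1; rewrite ltr0_norm.
  by rewrite powR1.
- rewrite oppr_gt0 (lt_gtF w0) /= addr0; case: ifP => // h.
  have -> : w = 1 by apply/eqP; rewrite eq_le h; move: w1; rewrite gtr0_norm.
  by rewrite powR1.
- by move: w1; rewrite w0 normr0 ler10.
Qed.

Section positivity.
Hypothesis kcos_ge0 : forall w, w != 0 -> 0 <= transform k cos 0 w.

Let tcos := @trigonometric_cos R.

Let T w (n : nat) := trunc_transform k cos 0 w n%:R.

(** The damping [exp (- s t)] is the cosine transform of the Cauchy density, so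
    that the damped transform is an average of undamped ones over frequencies;
    truncation makes the exchange of integrals legitimate. *)
Lemma trunc_transform_poisson s w (n : nat) : 0 < s ->
  trunc_transform k cos s w n%:R * \int[leb]_x cauchyd s x =
  \int[leb]_x (cauchyd s x * (2^-1 * (T (w + x) n + T (w - x) n))).
Proof.
move=> s0.
pose A t := (k \_ `[0, n%:R]%classic) t.
pose f (z : R * R) := A z.1 * cos (w * z.1) * (cos (z.1 * z.2) * cauchyd s z.2).
have mA : measurable_fun setT A.
  by apply/(measurable_restrictT _ _).1 => //; apply: measurable_funTS; exact: (sk_meas sk).
have iA : leb.-integrable setT (EFin \o A).
  rewrite /A -restrict_EFin; apply/integrable_restrict => //.
  by rewrite setTI; exact: (integrable_kernel sk).
have A0 t : 0 <= A t by rewrite /A patchE; case: ifP => // _; exact: (sk_ge0 sk).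
have mcos : measurable_fun setT (@cos R).
  by apply: continuous_measurable_fun; exact: continuous_cos.
have mf : measurable_fun setT f.
  apply: measurable_funM; apply: measurable_funM.
  - exact: (measurableT_comp mA measurable_fst).
  - by apply: (measurableT_comp mcos); apply: measurable_funM.
  - by apply: (measurableT_comp mcos); apply: measurable_funM.
  - apply: (measurableT_comp _ measurable_snd).
    by apply: continuous_measurable_fun; exact: continuous_cauchy.
have fAB t x : `|f (t, x)| <= A t * cauchyd s x.
  rewrite /f/= !normrM (ger0_norm (A0 t)) (gtr0_norm (cauchy_gt0 s0 x)).
  apply: ler_pM; rewrite ?mulr_ge0 ?(ltW (cauchy_gt0 s0 x))//.
    by rewrite ler_piMr// normr_cos_le1.
  by rewrite ler_piMl// ?normr_cos_le1// ltW// cauchy_gt0.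
have FF := Fubini_Rintegral (m1 := leb) (m2 := leb) mf iA (integrable_cauchy_sg s0) fAB.
have E1 : \int[leb]_t \int[leb]_x f (t, x) =
    trunc_transform k cos s w n%:R * \int[leb]_x cauchyd s x.
  have ios := integrable_osc sk tcos w n%:R (ltW s0).
  rewrite /trunc_transform mulrC -RintegralZl; [|exact: measurable_itv|exact: ios].
  rewrite [RHS]Rintegral_mkcond; apply: eq_Rintegral => t _; rewrite /f /=.
  have ic : leb.-integrable setT (EFin \o (fun x => cos (t * x) * cauchyd s x)).
    apply: (@integrable_dom _ _ _ leb _ (cauchyd s)).
    - apply: measurable_funM; first by apply: (measurableT_comp mcos); apply: measurable_funM.
      by apply: continuous_measurable_fun; exact: continuous_cauchy.
    - exact: integrable_cauchy_sg.
    - move=> x; rewrite normrM (gtr0_norm (cauchy_gt0 s0 x)).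
      by rewrite ler_piMl ?(ltW (cauchy_gt0 s0 x)) ?normr_cos_le1.
  rewrite RintegralZl; [|exact: measurableT|exact: ic].
  rewrite /A !patchE; case: ifPn => [|_]; last by rewrite !mul0r.
  rewrite inE/= in_itv/= => /andP[t0 _].
  by rewrite (cauchy_cos s0 t0) /osc; ring.
have E2 : \int[leb]_x \int[leb]_t f (t, x) =
    \int[leb]_x (cauchyd s x * (2^-1 * (T (w + x) n + T (w - x) n))).
  apply: eq_Rintegral => x _; rewrite /T /trunc_transform.
  have io v : leb.-integrable `[0, n%:R] (EFin \o osc k cos 0 v).
    exact: (integrable_osc sk tcos _ _ (lexx 0)).
  have ioD : leb.-integrable `[0, n%:R] (EFin \o (fun t => osc k cos 0 (w + x) t + osc k cos 0 (w - x) t)).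
    by apply: (integrableD _ (io (w + x)) (io (w - x))); exact: measurable_itv.
  have ioDZ : leb.-integrable `[0, n%:R] (EFin \o (fun t => 2^-1 * (osc k cos 0 (w + x) t + osc k cos 0 (w - x) t))).
    by apply: (integrableZl _ _ ioD); exact: measurable_itv.
  rewrite -RintegralD; [|exact: measurable_itv|exact: io|exact: io].
  rewrite -RintegralZl; [|exact: measurable_itv|exact: ioD].
  rewrite -RintegralZl; [|exact: measurable_itv|exact: ioDZ].
  rewrite [RHS]Rintegral_mkcond.
  apply: eq_Rintegral => t _; rewrite /f /A /= !patchE; case: ifP => _; last by rewrite !mul0r.
  rewrite /osc mul0r oppr0 expR0 mulr1 mulrDl mulrBl cosD cosB [x * t]mulrC.
  by field.
by rewrite -E1 FF E2.
Qed.

(** Letting the truncation grow in the Poisson average extends positivity from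
    the imaginary axis to the half-plane. *)
Lemma laplace_cos_ge0 s w : 0 < s -> 0 <= laplace k cos s w.
Proof.
move=> s0.
pose g x := cauchyd s x * (2^-1 * (ktr cos (w + x) + ktr cos (w - x))).
pose M x := 2^-1 * (cauchyd s x * dominator k C a (x + w) +
  cauchyd s x * dominator k C a (x + - w)).
have cb x : 0 <= cauchyd s x <= (s ^+ 2)^-1.
  rewrite (ltW (cauchy_gt0 s0 x))/= lef_pV2 ?posrE ?exprn_gt0//.
    by rewrite lerDl sqr_ge0.
  by rewrite ltr_pwDl ?exprn_gt0// sqr_ge0.
have iM : leb.-integrable setT (EFin \o M).
  have i1 := integrable_dominator_weight sk w (integrable_cauchy_sg s0) cb.
  have i2 := integrable_dominator_weight sk (- w) (integrable_cauchy_sg s0) cb.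
  exact: (integrable_EFinZ _ (integrable_EFinD i1 i2)).
have mc : measurable_fun setT (cauchyd s).
  by apply: continuous_measurable_fun; exact: continuous_cauchy.
have mg : measurable_fun setT g.
  have mk := measurable_ktr tcos.
  apply: measurable_funM => //; apply: measurable_funM => //; apply: measurable_funD.
    by apply: (measurableT_comp mk); apply: measurable_funD.
  by apply: (measurableT_comp mk); apply: measurable_funB.
have mT n : measurable_fun setT
    (fun x => cauchyd s x * (2^-1 * (T (w + x) n + T (w - x) n))).
  have mt : measurable_fun setT (fun v => T v n).
    by apply: continuous_measurable_fun; exact: continuous_trunc_transform.
  apply: measurable_funM => //; apply: measurable_funM => //; apply: measurable_funD.
    by apply: (measurableT_comp mt); apply: measurable_funD.
  by apply: (measurableT_comp mt); apply: measurable_funB.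
have h : {ae leb, forall x,
    (forall n, `|cauchyd s x * (2^-1 * (T (w + x) n + T (w - x) n))| <= M x) /\
    (cauchyd s x * (2^-1 * (T (w + x) n + T (w - x) n)) @[n --> \oo] --> g x)}.
  exists [set - w; w]; split.
  - by apply: measurableU; exact: measurable_set1.
  - apply: null_set_setU; try exact: measurable_set1; exact: lebesgue_measure_set1.
  - move=> x /= /not_andP H.
    apply: contrapT => /not_orP[/eqP x1 /eqP x2].
    have v1 : w + x != 0 by rewrite addrC addr_eq0.
    have v2 : w - x != 0 by rewrite subr_eq0 eq_sym.
    case: H => H; apply: H.
      move=> n; have /andP[c0 _] := cb x.
      have d1 : `|T (w + x) n| <= dominator k C a (x + w).
        by rewrite [x + w]addrC; exact: (trunc_transform_dominated sk n%:R tcos (lexx 0) v1).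
      have d2 : `|T (w - x) n| <= dominator k C a (x + - w).
        rewrite -dominator_even opprD opprK [- x + w]addrC.
        exact: (trunc_transform_dominated sk n%:R tcos (lexx 0) v2).
      have q0 : 0 <= 2^-1 :> R by rewrite invr_ge0.
      rewrite /M -mulrDr [leRHS]mulrCA normrM (ger0_norm c0) ler_wpM2l//.
      rewrite normrM (ger0_norm q0) ler_wpM2l//.
      by apply: le_trans (ler_normD _ _) _; exact: lerD.
    apply: cvgM; first exact: cvg_cst.
    apply: cvgM; first exact: cvg_cst.
    by rewrite !ktrE//; apply: cvgD; exact: (cvgn_trunc_transform sk tcos).
have [_ cv] := dominated_leb mT mg iM h.
have J0 := Rintegral_cauchy_gt0 s0.
have cv2 : trunc_transform k cos s w n%:R * \int[leb]_x cauchyd s x @[n --> \oo] -->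
    laplace k cos s w * \int[leb]_x cauchyd s x.
  by apply: cvgM; [exact: (cvgn_trunc_laplace sk tcos)|exact: cvg_cst].
have E : laplace k cos s w * \int[leb]_x cauchyd s x = \int[leb]_x g x.
  rewrite -(cvg_lim _ cv2)//; apply: cvg_lim => //.
  apply: cvg_trans cv; apply: near_eq_cvg; apply: nearW => n.
  by rewrite /= trunc_transform_poisson.
rewrite -(pmulr_lge0 _ J0) E; apply: Rintegral_ge0 => x _.
have /andP[c0 _] := cb x.
have kt v : 0 <= ktr cos v by rewrite /ktr; case: eqVneq => // v0; exact: kcos_ge0.
by rewrite mulr_ge0// mulr_ge0// addr_ge0.
Qed.

End positivity.

End boundary_transforms.

(** * The integral of the admittance *)

Lemma ae_neq0 {R : realType} : {ae @lebesgue_measure R, forall w : R, w != 0}.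
Proof.
exists [set 0]; split; first exact: measurable_set1.
- exact: lebesgue_measure_set1.
- by move=> w /= /negP; rewrite negbK => /eqP.
Qed.

Section response_function.
Context {R : realType}.
Notation leb := (@lebesgue_measure R).
Variables (k k' : R -> R) (C a : R).
Hypothesis sk : slow_kernel k k' C a.
Hypothesis kcos_ge0 : forall w, w != 0 -> 0 <= transform k cos 0 w.
Variables m lam beta : R.
Hypotheses (m0 : 0 < m) (lam0 : 0 < lam) (beta0 : 0 < beta).
Implicit Types (s w t : R).

Let tcos := @trigonometric_cos R.
Let tsin := @trigonometric_sin R.

Let tNsin : trigonometric (fun t : R => - sin t).
Proof.
split.
- by move=> t; apply: cvgN; exact: continuous_sin.
- by move=> t; rewrite normrN; exact: normr_sin_le1.
exists cos; split; last exact: normr_cos_le1.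
by move=> t; exact: is_derive_cos.
Qed.

(** The impedance [m z + lam + beta L (z)], where [L] is the Laplace transform
    of the kernel, at [z = s + i w] with [s > 0], and its derivative. *)
Definition impedance s w : R[i] :=
  (m * s + lam + beta * laplace k cos s w) +i* (m * w - beta * laplace k sin s w).

Definition impedance' s w : R[i] :=
  (m - beta * laplace1 k cos s w) +i* (beta * laplace1 k sin s w).

Lemma holo_impedance s w : 0 < s -> holo impedance impedance' s w.
Proof.
move=> s0.
have l1 : is_derive w 1 (laplace k cos s) (- laplace1 k sin s w).
  have dc (t : R) : is_derive t 1 (@cos R) (- sin t) by exact: is_derive_cos.
  apply: is_derive_eq (is_derive_laplace_w sk w tcos tNsin dc s0) _.
  rewrite /laplace1 -mulN1r -RintegralZl; [|exact: measurableT|exact: (integrable_tosc sk)].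
  by apply: eq_Rintegral => t _; rewrite /osc; ring.
have l2 : is_derive w 1 (laplace k sin s) (laplace1 k cos s w).
  have ds (t : R) : is_derive t 1 (@sin R) (cos t) by exact: is_derive_sin.
  exact: (is_derive_laplace_w sk w tsin tcos ds s0).
have l3 := is_derive_laplace_s sk tcos w s0.
have l4 := is_derive_laplace_s sk tsin w s0.
split; rewrite /impedance /impedance' /=.
- apply: is_derive_eq (is_deriveDx (is_deriveDx (is_deriveZx m (is_derive_idx s))
    (is_derive_cstx lam s)) (is_deriveZx beta l3)) _; ring.
- apply: is_derive_eq (is_deriveBx (is_derive_cstx (m * w) s) (is_deriveZx beta l4)) _; ring.
- apply: is_derive_eq (is_deriveDx (is_derive_cstx (m * s + lam) w) (is_deriveZx beta l1)) _; ring.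
- apply: is_derive_eq (is_deriveBx (is_deriveZx m (is_derive_idx w)) (is_deriveZx beta l2)) _; ring.
Qed.

Lemma Re_impedance_ge s w : 0 < s -> m * s + lam <= complex.Re (impedance s w).
Proof.
move=> s0; rewrite /impedance /= lerDl mulr_ge0 ?(ltW beta0)//.
exact: (laplace_cos_ge0 sk kcos_ge0).
Qed.

Let impedance_neq0 s w : 0 < s -> impedance s w != 0.
Proof.
move=> s0; apply: Re_gt0_neq0; apply: lt_le_trans (Re_impedance_ge w s0).
by rewrite addr_gt0// mulr_gt0.
Qed.

Let aff_neq0 s w : 0 <= s -> affine m lam s w != 0.
Proof.
by move=> s0; apply: Re_gt0_neq0; rewrite /= ltr_wpDl// mulr_ge0// ltW.
Qed.

(** The error made by dropping the memory term; it decays like [w ^ -2]. *)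
Let H s w : R[i] := (impedance s w)^-1 - (affine m lam s w)^-1.

Let H' s w : R[i] :=
  - (impedance' s w * ((impedance s w)^-1 * (impedance s w)^-1)) -
  - (m%:C * ((affine m lam s w)^-1 * (affine m lam s w)^-1)).

Let holoH s w : 0 < s -> holo H H' s w.
Proof.
move=> s0; apply: holoB; apply: holoV.
- exact: impedance_neq0.
- exact: holo_impedance.
- by apply: aff_neq0; exact: ltW.
- exact: holo_affine.
Qed.

Let kap := 2 * transform_const k C a.

Let kap0 : 0 <= kap.
Proof. by rewrite mulr_ge0// (transform_const_ge0 sk). Qed.

Let laplace_le c s w : trigonometric c -> 0 < s -> 1 <= `|w| ->
  `|laplace k c s w| <= kap.
Proof.
move=> tc s0 w1; have w0 : w != 0 by rewrite -normr_gt0 (lt_le_trans ltr01).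
rewrite (laplaceE sk tc s0 w0); apply: le_trans (transform_dominated sk tc (ltW s0) w0) _.
exact: (dominator_ge1 sk).
Qed.

Let W := 1 + 2 * beta * kap / m.

Let W1 : 1 <= W.
Proof. by rewrite lerDl divr_ge0 ?(ltW m0)// mulr_ge0// mulr_ge0// ltW. Qed.

(** Beyond [W], inertia dominates the imaginary part of the impedance. *)
Let inertia_dominates w (y : R) : W <= `|w| -> `|y| <= kap ->
  m * `|w| / 2 <= `|m * w - beta * y|.
Proof.
move=> wW yk.
have h1 : `|m * w| - `|beta * y| <= `|m * w - beta * y|.
  by apply: le_trans (ler_dist_dist _ _); rewrite ler_norm.
apply: le_trans h1; rewrite !normrM (gtr0_norm m0) (gtr0_norm beta0).
have h2 : beta * `|y| <= beta * kap by rewrite ler_wpM2l// ltW.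
have h3 : 2 * beta * kap <= m * `|w|.
  rewrite -ler_pdivrMl// mulrC; apply: le_trans wW.
  by rewrite /W lerDr.
lra.
Qed.

Definition resp_const := 1 + W ^+ 2.

(** [1 / |impedance|^2] and its variants decay like [1 / (1 + w^2)]: for small
    [w] by positivity of the real part, for large [w] by inertia. *)
Let inv_sqr_bound w (x y b : R) : lam <= x -> 0 < b ->
  (W <= `|w| -> b * `|w| <= `|y|) ->
  (x ^+ 2 + y ^+ 2)^-1 <= ((lam ^+ 2)^-1 * resp_const + 2 * (b ^+ 2)^-1) / (1 + w ^+ 2).
Proof.
move=> lx b0 wy.
have w2 := sqr_ge0 w; have y2 := sqr_ge0 y.
have x2 : lam ^+ 2 <= x ^+ 2 by rewrite ler_sqr ?nnegrE ?(ltW lam0)// (le_trans (ltW lam0)).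
have l2 : 0 < lam ^+ 2 by rewrite exprn_gt0.
have b2 : 0 < b ^+ 2 by rewrite exprn_gt0.
have d0 : 0 < x ^+ 2 + y ^+ 2 by rewrite ltr_pwDl// (lt_le_trans l2).
have p1 : 0 <= (lam ^+ 2)^-1 * resp_const.
  by rewrite mulr_ge0 ?invr_ge0 ?(ltW l2)// /resp_const addr_ge0// sqr_ge0.
have p2 : 0 <= 2 * (b ^+ 2)^-1 by rewrite mulr_ge0// invr_ge0 ltW.
rewrite ler_pdivlMr ?oneDsqr_gt0'//.
have [wW|wW] := leP W `|w|.
  have h := wy wW; have w1 : 1 <= `|w| := le_trans W1 wW.
  have q1 : (b * `|w|) ^+ 2 <= y ^+ 2.
    by rewrite -[leRHS]real_normK ?num_real// ler_sqr ?nnegrE// mulr_ge0// ltW.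
  have q2 : 1 <= w ^+ 2.
    by rewrite -real_normK ?num_real// expr_ge1.
  apply: (@le_trans _ _ (2 * (b ^+ 2)^-1)); last by rewrite lerDr.
  rewrite ler_pdivrMl// mulrA ler_pdivlMr//.
  move: q1; rewrite exprMn real_normK ?num_real// => q1.
  have q3 : b ^+ 2 <= b ^+ 2 * w ^+ 2 by rewrite ler_peMr// ltW.
  have x20 := sqr_ge0 x.
  by rewrite mulrDl mul1r [w ^+ 2 * _]mulrC; lra.
apply: (@le_trans _ _ ((lam ^+ 2)^-1 * resp_const)); last by rewrite lerDl.
apply: ler_pM.
- by rewrite invr_ge0 ltW.
- by rewrite ltW// oneDsqr_gt0'.
- by rewrite lef_pV2 ?posrE// (le_trans x2)// lerDl.
- rewrite /resp_const lerD2l -real_normK ?num_real// ler_sqr ?nnegrE ?normr_ge0 ?(le_trans ler01 W1)//.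
  exact: ltW.
Qed.

Definition decay_const (b : R) := (lam ^+ 2)^-1 * resp_const + 2 * (b ^+ 2)^-1.

Let inv_impedance_bound s w : 0 < s ->
  Normc.normc (impedance s w)^-1 ^+ 2 <= decay_const (m / 2) / (1 + w ^+ 2).
Proof.
move=> s0; rewrite Normc.normcV exprVn normc_sqrE.
apply: inv_sqr_bound.
- by apply: le_trans (Re_impedance_ge w s0); rewrite lerDr mulr_ge0// ltW.
- by rewrite divr_gt0.
- move=> wW; rewrite /= mulrAC; apply: inertia_dominates => //.
  by apply: laplace_le => //; exact: le_trans wW.
Qed.

Let inv_affine_bound s w : 0 <= s ->
  Normc.normc (affine m lam s w)^-1 ^+ 2 <= decay_const (m / 2) / (1 + w ^+ 2).
Proof.
move=> s0; rewrite Normc.normcV exprVn normc_sqrE.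
apply: inv_sqr_bound.
- by rewrite /= lerDr mulr_ge0// ltW.
- by rewrite divr_gt0.
- move=> wW; rewrite /= normrM (gtr0_norm m0) ler_wpM2r//.
  by rewrite ler_pdivrMr// mulr_natr mulr2n lerDl ltW.
Qed.

Let Kt s w : R[i] := laplace k cos s w +i* (- laplace k sin s w).

Let HE s w : 0 < s -> H s w =
  - (beta%:C * Kt s w * ((impedance s w)^-1 * (affine m lam s w)^-1)).
Proof.
move=> s0; have n1 := impedance_neq0 w s0; have n2 := aff_neq0 w (ltW s0).
have E : beta%:C * Kt s w = impedance s w - affine m lam s w.
  by apply: eq_ReIm; rewrite !ReImE /=; ring.
by rewrite E /H; field; rewrite n1 n2.
Qed.

Let Hc := decay_const (m / 2) * (2 * beta * kap) + 2 * lam^-1 * resp_const.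

Let H_bound s w : 0 < s -> Normc.normc (H s w) <= Hc / (1 + w ^+ 2).
Proof.
move=> s0; have w2 := oneDsqr_gt0' w.
have D1 := inv_impedance_bound w s0; have D2 := inv_affine_bound w (ltW s0).
have dc0 : 0 <= decay_const (m / 2) * (2 * beta * kap).
  rewrite mulr_ge0//; last by rewrite mulr_ge0// mulr_ge0// ltW.
  rewrite /decay_const addr_ge0// mulr_ge0 ?invr_ge0 ?sqr_ge0//.
  by rewrite /resp_const addr_ge0// sqr_ge0.
have rc0 : 0 <= 2 * lam^-1 * resp_const.
  by rewrite !mulr_ge0 ?invr_ge0 ?(ltW lam0)// /resp_const addr_ge0// sqr_ge0.
have [w1|w1] := leP 1 `|w|; last first.
  have b1 : Normc.normc (impedance s w)^-1 <= lam^-1.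
    apply: normcV_le => //; apply: le_trans (normr_Re_le _).
    apply: le_trans (ler_norm _); apply: le_trans (Re_impedance_ge w s0).
    by rewrite lerDr mulr_ge0// ltW.
  have b2 : Normc.normc (affine m lam s w)^-1 <= lam^-1.
    apply: normcV_le => //; apply: le_trans (normr_Re_le _).
    by apply: le_trans (ler_norm _); rewrite /= lerDr mulr_ge0// ltW.
  rewrite /H; apply: le_trans (normcD_le _ _) _; rewrite normcN_eq.
  apply: le_trans (lerD b1 b2) _; rewrite ler_pdivlMr// /Hc.
  apply: (@le_trans _ _ (2 * lam^-1 * resp_const)); last by rewrite lerDr.
  rewrite (_ : lam^-1 + lam^-1 = 2 * lam^-1); last by ring.
  rewrite ler_wpM2l//; first by rewrite mulr_ge0// invr_ge0 ltW.
  rewrite /resp_const lerD2l -(real_normK (num_real w)) ler_sqr ?nnegrE ?normr_ge0 ?(le_trans ler01 W1)//.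
  by apply: le_trans W1; exact: ltW.
rewrite HE// normcN_eq Normc.normcM Normc.normcM Normc.normcM normc_real (gtr0_norm beta0).
have K1 : Normc.normc (Kt s w) <= 2 * kap.
  apply: le_trans (normc_le_ReIm _) _; rewrite /= normrN mulr2n mulrDl mul1r.
  by apply: lerD; exact: laplace_le.
have P : Normc.normc (impedance s w)^-1 * Normc.normc (affine m lam s w)^-1 <=
    decay_const (m / 2) / (1 + w ^+ 2).
  move: D1 D2; set p := Normc.normc _^-1; set q := Normc.normc _^-1; set e := _ / _ => h1 h2.
  by have := sqr_ge0 (p - q); nra.
apply: (@le_trans _ _ ((2 * beta * kap) * (decay_const (m / 2) / (1 + w ^+ 2)))).
  apply: ler_pM => //.
  - by rewrite mulr_ge0 ?(ltW beta0)// normc_ge0.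
  - by rewrite mulr_ge0 ?normc_ge0.
  - apply: le_trans (ler_wpM2l (ltW beta0) K1) _.
    by rewrite le_eqVlt; apply/orP; left; apply/eqP; ring.
rewrite mulrA ler_wpM2r ?invr_ge0 ?(ltW w2)// /Hc mulrC.
by rewrite lerDl.
Qed.

(** The error is holomorphic in the right half-plane and decays there, so that
    its integrals over vertical lines vanish. *)
Let integral_H0 s : 0 < s -> \int[leb]_w complex.Re (H s w) = 0.
Proof.
have invl (z : R[i]) (l : R) : 0 < l -> l <= complex.Re z -> Normc.normc z^-1 <= l^-1.
  move=> l0 h; apply: normcV_le => //; apply: le_trans (normr_Re_le _).
  exact: le_trans (ler_norm _).
have nM (p q : R[i]) (p' q' : R) : Normc.normc p <= p' -> Normc.normc q <= q' ->
    Normc.normc (p * q) <= p' * q'.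
  by move=> h1 h2; rewrite Normc.normcM; apply: ler_pM => //; exact: normc_ge0.
apply: (@contour_shift _ H H' 0 Hc).
- by move=> x w; exact: holoH.
- move=> x x0.
  have cI : ccontinuous (fun w => (impedance x w)^-1).
    apply: ccontinuousV; first by move=> w; exact: impedance_neq0.
    by apply: (@ccontinuous_holo _ impedance impedance') => w; exact: holo_impedance.
  have cA : ccontinuous (fun w => (affine m lam x w)^-1).
    apply: ccontinuousV; first by move=> w; apply: aff_neq0; exact: ltW.
    by apply: (@ccontinuous_holo _ (affine m lam) (fun _ _ => m%:C)) => w; exact: holo_affine.
  have cI' : ccontinuous (impedance' x).
    split=> w /=.
      apply: cvgB; first exact: cvg_cst.
      by apply: cvgM; [exact: cvg_cst|exact: (continuous_laplace1 sk tcos)].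
    by apply: cvgM; [exact: cvg_cst|exact: (continuous_laplace1 sk tsin)].
  have [] : ccontinuous (H' x); last by [].
  apply: ccontinuousD; apply: ccontinuousN.
    by apply: ccontinuousM => //; exact: ccontinuousM.
  apply: ccontinuousN; apply: ccontinuousM; first exact: ccontinuous_cst.
  exact: ccontinuousM.
- move=> x x0; have x2 : 0 < x / 2 by rewrite divr_gt0.
  pose I := \int[leb]_t damped_kernel k (x / 2) t.
  pose l := lam^-1.
  exists (x / 2); exists (((m + beta * I) + beta * I) * (l * l) + m * (l * l)).
  split; [exact: ltW|by lra|].
  move=> y w hy; have y0 : 0 < y := lt_trans x2 hy.
  apply: le_trans (normr_Re_le _) _.
  have nI : Normc.normc (impedance y w)^-1 <= l.
    apply: invl => //; apply: le_trans (Re_impedance_ge w y0).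
    by rewrite lerDr mulr_ge0// ltW.
  have nA : Normc.normc (affine m lam y w)^-1 <= l.
    by apply: invl => //; rewrite /= lerDr mulr_ge0// ltW.
  have nI' : Normc.normc (impedance' y w) <= (m + beta * I) + beta * I.
    apply: le_trans (normc_le_ReIm _) _; rewrite /=.
    have i1 := laplace1_le sk tcos w x2 (ltW hy).
    have i2 := laplace1_le sk tsin w x2 (ltW hy).
    apply: lerD; last by rewrite normrM (gtr0_norm beta0) ler_wpM2l// ltW.
    apply: le_trans (ler_normB _ _) _; rewrite (gtr0_norm m0) lerD2l.
    by rewrite normrM (gtr0_norm beta0) ler_wpM2l// ltW.
  rewrite /H'; apply: le_trans (normcD_le _ _) _; rewrite !normcN_eq.
  apply: lerD; first by apply: (nM _ _ _ _) => //; apply: (nM _ _ _ _).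
  apply: (nM _ _ _ _); last by apply: (nM _ _ _ _).
  by rewrite normc_real gtr0_norm.
- by move=> x w; exact: H_bound.
- apply: aeW => w; apply/cvgrPdist_le => e e0.
  near=> n; rewrite sub0r normrN; apply: le_trans (normr_Re_le _) _.
  have n0 : 0 < n%:R :> R by rewrite ltr0n; near: n; exists 1%N.
  have mn : 0 < m * n%:R by rewrite mulr_gt0.
  have b1 : Normc.normc (impedance n%:R w)^-1 <= (m * n%:R)^-1.
    apply: invl => //; apply: le_trans (Re_impedance_ge w n0).
    by rewrite lerDl ltW.
  have b2 : Normc.normc (affine m lam n%:R w)^-1 <= (m * n%:R)^-1.
    by apply: invl => //; rewrite /= lerDl ltW.
  rewrite /H; apply: le_trans (normcD_le _ _) _; rewrite normcN_eq.
  apply: le_trans (lerD b1 b2) _.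
  have en : 2 / (e * m) <= n%:R by near: n; exact: nbhs_infty_ger.
  have em : 0 < e * m by rewrite mulr_gt0.
  rewrite (_ : _ + _ = 2 / (m * n%:R)); last by ring.
  rewrite ler_pdivrMr//; move: en; rewrite ler_pdivrMr// => en.
  by apply: le_trans en _; rewrite le_eqVlt; apply/orP; left; apply/eqP; ring.
- by apply: integrable_EFinZ; exact: integrable_cauchy.
Unshelve. all: by end_near. Qed.

(** The impedance on the imaginary axis. *)
Definition resistance w := lam + beta * ktr k cos w.
Definition reactance w := m * w - beta * ktr k sin w.
Definition impedance_sqr w := resistance w ^+ 2 + reactance w ^+ 2.

Lemma resistance_ge w : lam <= resistance w.
Proof.
rewrite lerDl mulr_ge0 ?(ltW beta0)// /ktr.
by case: eqVneq => // w0; exact: kcos_ge0.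
Qed.

Lemma impedance_sqr_gt0 w : 0 < impedance_sqr w.
Proof.
rewrite ltr_pwDl ?sqr_ge0// exprn_gt0//.
exact: lt_le_trans (resistance_ge w).
Qed.

Lemma measurable_resistance : measurable_fun setT resistance.
Proof.
apply: measurable_funD => //; apply: measurable_funM => //.
exact: (measurable_ktr sk tcos).
Qed.

Lemma measurable_impedance_sqr : measurable_fun setT impedance_sqr.
Proof.
apply: measurable_funD; apply: measurable_funX; first exact: measurable_resistance.
apply: measurable_funB; first by apply: measurable_funM.
by apply: measurable_funM => //; exact: (measurable_ktr sk tsin).
Qed.

Lemma measurable_inv_impedance_sqr : measurable_fun setT (fun w => (impedance_sqr w)^-1).
Proof.
rewrite (_ : (fun w => _) = fun w => impedance_sqr w `^ (-1)); last first.
  by apply/funext => w; rewrite powR_inv1// ltW// impedance_sqr_gt0.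
exact: (measurableT_comp (measurable_powR _) measurable_impedance_sqr).
Qed.

Lemma continuous_impedance_sqr w : w != 0 -> {for w, continuous impedance_sqr}.
Proof.
move=> w0; have kc := continuous_ktr sk tcos w0; have ks := continuous_ktr sk tsin w0.
have c1 : {for w, continuous resistance}.
  by apply: cvgD; [exact: cvg_cst|apply: cvgM; [exact: cvg_cst|exact: kc]].
have c2 : {for w, continuous reactance}.
  apply: cvgB; first by apply: cvgM; [exact: cvg_cst|exact: cvg_id].
  by apply: cvgM; [exact: cvg_cst|exact: ks].
rewrite /prop_for /continuous_at /impedance_sqr.
under eq_fun do rewrite !expr2; rewrite !expr2.
by apply: cvgD; apply: cvgM.
Qed.

Lemma inv_impedance_sqr_le w : (impedance_sqr w)^-1 <= decay_const (m / 2) / (1 + w ^+ 2).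
Proof.
apply: inv_sqr_bound; first exact: resistance_ge.
  by rewrite divr_gt0.
move=> wW; rewrite mulrAC; apply: inertia_dominates => //.
apply: le_trans (ktr_dominated sk w tsin) _; apply: (dominator_ge1 sk).
exact: le_trans wW.
Qed.

Lemma integrable_affine_inv : leb.-integrable setT
  (EFin \o (fun w => lam / (lam ^+ 2 + (m * w) ^+ 2))).
Proof.
apply: (@integrable_dom _ _ _ leb _ (fun w => decay_const (m / 2) * lam * (1 + w ^+ 2)^-1)).
- apply: measurable_funM => //; apply: continuous_measurable_fun => w.
  apply: cvgV; first by rewrite gt_eqF// ltr_pwDl ?exprn_gt0// sqr_ge0.
  by apply: cvgD; [exact: cvg_cst|apply: cvgM; apply: cvgM; [exact: cvg_cst|exact: cvg_id| exact: cvg_cst|exact: cvg_id]].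
- by apply: integrable_EFinZ; exact: integrable_cauchy.
- move=> w; have := inv_affine_bound w (lexx 0).
  rewrite Normc.normcV exprVn normc_sqrE /= mulr0 add0r => h.
  have d0 : 0 < lam ^+ 2 + (m * w) ^+ 2 by rewrite ltr_pwDl ?exprn_gt0// sqr_ge0.
  rewrite ger0_norm; last by rewrite divr_ge0// ltW.
  by rewrite mulrAC mulrC ler_wpM2r// ltW.
Qed.

Lemma integral_affine_inv :
  \int[leb]_w (lam / (lam ^+ 2 + (m * w) ^+ 2)) = pi / m.
Proof.
pose F (x : R) := (m / lam) * x.
have r0 : 0 < m / lam by rewrite divr_gt0.
have dF (x : R) : is_derive x 1 F (m / lam).
  by apply: is_derive_eq (is_deriveZx (m / lam) (is_derive_idx x)) _; rewrite mulr1.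
have F'E : F^`()%classic = cst (m / lam).
  by apply/funext => x; rewrite derive1E; case: (dF x).
have E := @increasing_ge0_integration_by_substitutionT R F (fun w => (1 + w ^+ 2)^-1).
have {E} : (\int[leb]_x ((1 + x ^+ 2)^-1)%:E)%E =
    (\int[leb]_x (m / lam * (1 + (F x) ^+ 2)^-1)%:E)%E.
  rewrite E.
  - by apply: eq_integral => x _; rewrite F'E /= mulrC.
  - by move=> x y xy; rewrite /F ltr_pM2l.
  - by rewrite F'E => x; exact: cvg_cst.
  - by rewrite F'E; exact: is_cvg_cst.
  - by rewrite F'E; exact: is_cvg_cst.
  - by move=> x; case: (dF x).
  - by apply: gt0_cvgMrNy => //; exact: cvg_id.
  - by apply: gt0_cvgMry => //; exact: cvg_id.
  - exact: continuous_oneDsqrV.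
  - by move=> x; rewrite invr_ge0 ltW// oneDsqr_gt0'.
rewrite integral_cauchy => h.
rewrite (_ : (fun w => _) = fun w => m^-1 * (m / lam * (1 + (F w) ^+ 2)^-1)).
  rewrite RintegralZl; last 2 first.
  - exact: measurableT.
  - rewrite (_ : _ \o _ = EFin \o fun w => m * (lam / (lam ^+ 2 + (m * w) ^+ 2))).
      by apply: integrable_EFinZ; exact: integrable_affine_inv.
    apply/funext => w /=; congr EFin; rewrite /F; have w2 := sqr_ge0 (m * w).
    have l2 := exprn_gt0 2 lam0; field.
    by rewrite !gt_eqF// ?ltr_pwDl.
  by rewrite /Rintegral -h /= mulrC.
apply/funext => w /=; rewrite /F; have w2 := sqr_ge0 (m * w).
have l2 := exprn_gt0 2 lam0; field.
by rewrite !gt_eqF// ?ltr_pwDl.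
Qed.

(** The integral of the real part of the admittance [1 / (r + i x)] is that of
    the memoryless system: the difference of the two admittances is a boundary
    value of the function whose integrals over vertical lines vanish, and
    dominated convergence lets these lines approach the imaginary axis. *)
Lemma integral_response :
  leb.-integrable setT (EFin \o (fun w => resistance w / impedance_sqr w)) /\
  \int[leb]_w (resistance w / impedance_sqr w) = pi / m.
Proof.
pose s_ (n : nat) : R := n.+1%:R^-1.
have s0 n : 0 < s_ n by rewrite invr_gt0.
have cs : s_ n @[n --> \oo] --> (0 : R) by exact: cvg_harmonic.
pose g w := lam / (lam ^+ 2 + (m * w) ^+ 2).
have mr : measurable_fun setT (fun w => resistance w / impedance_sqr w).
  apply: measurable_funM; first exact: measurable_resistance.
  exact: measurable_inv_impedance_sqr.
have ig := integrable_affine_inv.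
have [iH cH] : leb.-integrable setT (EFin \o fun w => resistance w / impedance_sqr w - g w) /\
    \int[leb]_w complex.Re (H (s_ n) w) @[n --> \oo] -->
    \int[leb]_w (resistance w / impedance_sqr w - g w).
  apply: (@dominated_leb _ (fun n w => complex.Re (H (s_ n) w)) _ (fun w => Hc * (1 + w ^+ 2)^-1)).
  - move=> n; apply: continuous_measurable_fun.
    by have [] := @ccontinuous_holo _ H H' (s_ n) (fun w => holoH w (s0 n)).
  - by apply: measurable_funB => //; apply: integrable_measurable ig.
  - by apply: integrable_EFinZ; exact: integrable_cauchy.
  apply: (ae_leb_imply (P := fun w => w != 0)).
    move=> w w0; split; first by move=> n; apply: le_trans (normr_Re_le _) _; exact: H_bound.
    have lc (c : R -> R) : trigonometric c -> laplace k c (s_ n) w @[n --> \oo] --> ktr k c w.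
      move=> tc; rewrite (_ : (fun n => _) = fun n => transform k c (s_ n) w); last first.
        by apply/funext => n; rewrite (laplaceE sk tc).
      rewrite ktrE//; apply: (transform_cvg sk tc) => //; last exact: cvg_cst.
      by move=> n; exact: ltW.
    have c1 : m * s_ n + lam @[n --> \oo] --> lam.
      rewrite -[X in _ --> X]add0r -[X in X + _](mulr0 m).
      by apply: cvgD; [apply: cvgM; [exact: cvg_cst|exact: cs]|exact: cvg_cst].
    have c2 : complex.Re (impedance (s_ n) w) @[n --> \oo] --> resistance w.
      by apply: cvgD => //; apply: cvgM; [exact: cvg_cst|exact: lc].
    have c3 : complex.Im (impedance (s_ n) w) @[n --> \oo] --> reactance w.
      by apply: cvgB; [exact: cvg_cst|apply: cvgM; [exact: cvg_cst|exact: lc]].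
    rewrite (_ : (fun n => _) = fun n =>
      complex.Re (impedance (s_ n) w) * (complex.Re (impedance (s_ n) w) ^+ 2 +
        complex.Im (impedance (s_ n) w) ^+ 2)^-1 -
      (m * s_ n + lam) * ((m * s_ n + lam) ^+ 2 + (m * w) ^+ 2)^-1); last first.
      by apply/funext => n; rewrite /H !ReImE !cReV.
    have sq (u : nat -> R) (l : R) : u n @[n --> \oo] --> l -> u n ^+ 2 @[n --> \oo] --> l ^+ 2.
      by move=> h; apply: cvgM; exact: h.
    apply: cvgB; apply: cvgM => //; apply: cvgV.
    - by rewrite gt_eqF// impedance_sqr_gt0.
    - by apply: cvgD; exact: sq.
    - by rewrite gt_eqF// ltr_pwDl ?exprn_gt0// sqr_ge0.
    - by apply: cvgD; [exact: sq|exact: cvg_cst].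
  exact: ae_neq0.
have {cH} H0 : \int[leb]_w (resistance w / impedance_sqr w - g w) = 0.
  rewrite -(cvg_lim _ cH)//; apply: cvg_lim => //.
  rewrite (_ : (fun n => _) = cst 0); first exact: cvg_cst.
  by apply/funext => n; exact: integral_H0.
have E : (fun w => resistance w / impedance_sqr w) =
    fun w => (resistance w / impedance_sqr w - g w) + g w.
  by apply/funext => w; rewrite subrK.
split; first by rewrite E; exact: integrable_EFinD.
by rewrite E RintegralD// H0 add0r; exact: integral_affine_inv.
Qed.

End response_function.

(** * Gaussian wave packets *)

Section schwartz_functions.
Context {R : realType}.
Notation leb := (@lebesgue_measure R).
Implicit Types (phi : R -> R[i]) (t : R).

Lemma schwartz_ccontinuous phi : schwartz phi -> ccontinuous phi.
Proof.
by case=> sm _; split=> t; apply: differentiable_continuous; apply/derivable1_diffP;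
  have [] := sm 0%N t.
Qed.

Lemma ccontinuous_cmeasurable phi : ccontinuous phi -> cmeasurable phi.
Proof. by case=> c1 c2; split; exact: continuous_measurable_fun. Qed.

Lemma schwartz_cmeasurable phi : schwartz phi -> cmeasurable phi.
Proof. by move=> /schwartz_ccontinuous; exact: ccontinuous_cmeasurable. Qed.

Lemma schwartz_decay phi : schwartz phi ->
  exists2 M : R, 0 <= M & forall t, Normc.normc (phi t) <= M * (1 + t ^+ 2)^-1.
Proof.
case=> _ dec; have [M0 H0] := dec 0%N 0%N; have [M2 H2] := dec 2 0%N.
have M00 : 0 <= M0 by apply: le_trans (H0 0); rewrite expr0 mul1r normc_ge0.
have M20 : 0 <= M2 by apply: le_trans (H2 0); rewrite mulr_ge0 ?normc_ge0// exprn_ge0.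
exists (M0 + M2); first exact: addr_ge0.
move=> t; rewrite ler_pdivlMr ?oneDsqr_gt0'// mulrDr mulr1.
have h0 := H0 t; have h2 := H2 t.
rewrite expr0 mul1r in h0; rewrite real_normK ?num_real// mulrC in h2.
exact: lerD.
Qed.

Lemma schwartz_cintegrable phi : schwartz phi -> cintegrable leb phi.
Proof.
move=> sp; have [M M0 hM] := schwartz_decay sp.
apply: (@cintegrable_dom _ _ _ leb phi (fun t => M * (1 + t ^+ 2)^-1)) => //.
  exact: schwartz_cmeasurable.
by apply: integrable_EFinZ; exact: integrable_cauchy.
Qed.

End schwartz_functions.

Section gaussian_schwartz.
Context {R : realType}.
Variables (b s a : R).
Hypothesis s0 : 0 < s.

Let N := normal_pdf b s.

(** The smallest space containing the modulated Gaussians and stable by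
    multiplication by the variable; it is stable by derivation, and its elements
    decay rapidly, which gives the Schwartz property without
    explicit formulas for the derivatives. *)
Inductive gaussian_span : (R -> R) -> Prop :=
| gaussian_span_cos : gaussian_span (fun t => N t * cos (a * t))
| gaussian_span_sin : gaussian_span (fun t => N t * sin (a * t))
| gaussian_spanD f g : gaussian_span f -> gaussian_span g ->
    gaussian_span (fun t => f t + g t)
| gaussian_spanZ c f : gaussian_span f -> gaussian_span (fun t => c * f t)
| gaussian_spanX f : gaussian_span f -> gaussian_span (fun t => t * f t).

Lemma gaussian_span_derive f : gaussian_span f ->
  exists2 f', gaussian_span f' & forall t : R, is_derive t 1 f (f' t).
Proof.
have da (t : R) : is_derive t 1 (fun u => a * u) a.
  by apply: is_derive_eq (is_deriveZx a (is_derive_idx t)) _; rewrite mulr1.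
elim=> [||g h _ [g' gg' dg] _ [h' gh' dh]|c g _ [g' gg' dg]|g gg [g' gg' dg]].
- exists (fun t => - (s ^+ 2)^-1 * (t * (N t * cos (a * t))) +
    (b * (s ^+ 2)^-1 * (N t * cos (a * t)) + - a * (N t * sin (a * t)))).
    apply: gaussian_spanD; first by apply: gaussian_spanZ; apply: gaussian_spanX; exact: gaussian_span_cos.
    apply: gaussian_spanD; apply: gaussian_spanZ; [exact: gaussian_span_cos|exact: gaussian_span_sin].
  move=> t; apply: is_derive_eq (is_deriveMx (is_derive_normal b t s0) (is_derive_cosx (da t))) _.
  by rewrite -/N; ring.
- exists (fun t => - (s ^+ 2)^-1 * (t * (N t * sin (a * t))) +
    (b * (s ^+ 2)^-1 * (N t * sin (a * t)) + a * (N t * cos (a * t)))).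
    apply: gaussian_spanD; first by apply: gaussian_spanZ; apply: gaussian_spanX; exact: gaussian_span_sin.
    apply: gaussian_spanD; apply: gaussian_spanZ; [exact: gaussian_span_sin|exact: gaussian_span_cos].
  move=> t; apply: is_derive_eq (is_deriveMx (is_derive_normal b t s0) (is_derive_sinx (da t))) _.
  by rewrite -/N; ring.
- by exists (fun t => g' t + h' t); [exact: gaussian_spanD|move=> t; exact: is_deriveDx].
- by exists (fun t => c * g' t); [exact: gaussian_spanZ|move=> t; exact: is_deriveZx].
- exists (fun t => g t + t * g' t).
    by apply: gaussian_spanD => //; exact: gaussian_spanX.
  move=> t; apply: is_derive_eq (is_deriveMx (is_derive_idx t) (dg t)) _.
  by rewrite mul1r.
Qed.

(** Each factor [t] is absorbed by doubling the width. *)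
Lemma normal_decay (k : nat) : forall s', 0 < s' ->
  exists M : R, forall t : R, `|t| ^+ k * normal_pdf b s' t <= M.
Proof.
elim: k => [|k IH] s' s'0.
  by exists (normal_peak s') => t; rewrite expr0 mul1r normal_pdf_ub// gt_eqF.
have [M1 H1] := IH _ s'0; have [M2 H2] := IH (2 * s') (mulr_gt0 (ltr0n _ 2) s'0).
exists (M1 + 8 * s' ^+ 2 * M2 + `|b| * M1) => t.
have h1 := H1 t; have h2 := H2 t; have h3 := normal_moment1 b t s'0.
have tk : 0 <= `|t| ^+ k by rewrite exprn_ge0.
have tb : `|t| <= `|t - b| + `|b| by apply: le_trans (ler_normD _ _); rewrite subrK.
have n0 := normal_pdf_ge0 b s' t; have b0 := normr_ge0 b.
have c0 : 0 <= 8 * s' ^+ 2 by rewrite mulr_ge0// sqr_ge0.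
have e1 := ler_wpM2l tk h3; have e2 := ler_wpM2l c0 h2; have e3 := ler_wpM2l b0 h1.
have e4 := ler_wpM2r n0 (ler_wpM2l tk tb).
rewrite exprSr; apply: le_trans e4 _.
rewrite mulrDr mulrDl; apply: lerD; last by apply: le_trans e3; rewrite le_eqVlt; apply/orP; left; apply/eqP; ring.
rewrite -mulrA; apply: le_trans e1 _; rewrite mulrDr; apply: lerD => //.
by apply: le_trans e2; rewrite le_eqVlt; apply/orP; left; apply/eqP; ring.
Qed.

Lemma gaussian_span_decay f : gaussian_span f ->
  forall k : nat, exists M : R, forall t : R, `|t| ^+ k * `|f t| <= M.
Proof.
have base (c : R -> R) : (forall t, `|c t| <= 1) -> forall k : nat,
    exists M : R, forall t : R, `|t| ^+ k * `|N t * c (a * t)| <= M.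
  move=> c1 k; have [M H] := normal_decay k s0; exists M => t.
  apply: le_trans (H t); rewrite ler_wpM2l ?exprn_ge0// normrM.
  by rewrite (ger0_norm (normal_pdf_ge0 _ _ _)) ler_piMr// normal_pdf_ge0.
elim=> [||g h _ Hg _ Hh|c g _ Hg|g _ Hg] k.
- by apply: base; exact: normr_cos_le1.
- by apply: base; exact: normr_sin_le1.
- have [M1 H1] := Hg k; have [M2 H2] := Hh k; exists (M1 + M2) => t.
  apply: le_trans (lerD (H1 t) (H2 t)); rewrite -mulrDr ler_wpM2l ?exprn_ge0//.
  exact: ler_normD.
- have [M H] := Hg k; exists (`|c| * M) => t.
  by rewrite normrM mulrCA ler_wpM2l.
- have [M H] := Hg k.+1; exists M => t.
  by rewrite normrM mulrA -exprSr.
Qed.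

Lemma gaussian_span_schwartz f g : gaussian_span f -> gaussian_span g ->
  schwartz (fun t => f t +i* g t).
Proof.
move=> gf gg.
have H n : exists f' g', [/\ gaussian_span f', gaussian_span g' &
    cderiven n (fun t => f t +i* g t) = fun t => f' t +i* g' t].
  elim: n => [|n [f' [g' [gf' gg' E]]]]; first by exists f, g.
  have [f1 gf1 df] := gaussian_span_derive gf'; have [g1 gg1 dg] := gaussian_span_derive gg'.
  exists f1, g1; split => //; rewrite /cderiven iterS -/(cderiven n _) E.
  by apply/funext => t; rewrite /cderive /= !derive1E; case: (df t) => _ ->; case: (dg t) => _ ->.
split=> [n t|k n]; have [f' [g' [gf' gg' ->]]] := H n.
  have [f1 _ df] := gaussian_span_derive gf'; have [g1 _ dg] := gaussian_span_derive gg'.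
  by split => /=; [case: (df t)|case: (dg t)].
have [M1 H1] := gaussian_span_decay gf' k; have [M2 H2] := gaussian_span_decay gg' k.
exists (M1 + M2) => t; apply: le_trans (lerD (H1 t) (H2 t)); rewrite -mulrDr.
by rewrite ler_wpM2l ?exprn_ge0//; exact: normc_le_ReIm.
Qed.

Definition wave_packet (t : R) : R[i] := (N t)%:C * cexpi (a * t).

Lemma wave_packetE t : wave_packet t = (N t * cos (a * t)) +i* (N t * sin (a * t)).
Proof. by apply: eq_ReIm; rewrite !ReImE /= mul0r ?subr0 ?addr0. Qed.

Lemma schwartz_wave_packet : schwartz wave_packet.
Proof.
rewrite (_ : wave_packet = fun t => (N t * cos (a * t)) +i* (N t * sin (a * t))).
  exact: gaussian_span_schwartz gaussian_span_cos gaussian_span_sin.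
by apply/funext => t; exact: wave_packetE.
Qed.

Lemma normc_wave_packet t : Normc.normc (wave_packet t) = N t.
Proof. by rewrite Normc.normcM normc_expi mulr1 normc_real ger0_norm// normal_pdf_ge0. Qed.

Lemma cderive_wave_packet t : cderive wave_packet t =
  (- (t - b) / s ^+ 2)%:C * wave_packet t + (0 +i* a) * wave_packet t.
Proof.
have da (u : R) : is_derive u 1 (fun u => a * u) a.
  by apply: is_derive_eq (is_deriveZx a (is_derive_idx u)) _; rewrite mulr1.
have d1 := is_deriveMx (is_derive_normal b t s0) (is_derive_cosx (da t)).
have d2 := is_deriveMx (is_derive_normal b t s0) (is_derive_sinx (da t)).
rewrite /cderive !derive1E.
rewrite (_ : (fun u => complex.Re _) = fun u => N u * cos (a * u)); last first.
  by apply/funext => u; rewrite wave_packetE.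
rewrite (_ : (fun u => complex.Im _) = fun u => N u * sin (a * u)); last first.
  by apply/funext => u; rewrite wave_packetE.
case: d1 => _ ->; case: d2 => _ ->; rewrite -/(N t) wave_packetE.
by apply: eq_ReIm; rewrite !ReImE /=; ring.
Qed.

End gaussian_schwartz.

Lemma gaussian_schwartz {R : realType} (b s : R) : 0 < s ->
  schwartz (fun t => (normal_pdf b s t)%:C).
Proof.
move=> s0; rewrite (_ : (fun t => _) = wave_packet b s 0); first exact: schwartz_wave_packet.
by apply/funext => t; rewrite /wave_packet mul0r cexpi0 mulr1.
Qed.

Section approximate_identity.
Context {R : realType}.
Notation leb := (@lebesgue_measure R).

(** A Gaussian of variance at most [8 s^2] concentrates near its center: the
    mass at distance [>= dl] is controlled by the second moment. *)
Lemma gaussian_average_near (f : R -> R) (M w e dl s : R) : 0 < s -> 0 < dl ->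
  measurable_fun setT f -> (forall x, `|f x| <= M) -> 0 <= e ->
  (forall x, `|x - w| < dl -> `|f x - f w| <= e) ->
  `|\int[leb]_x (f x * normal_pdf w s x) - f w| <= e + 2 * M / dl ^+ 2 * (8 * s ^+ 2).
Proof.
move=> s0 dl0 mf fM e0 fe.
have M0 : 0 <= M by apply: le_trans (fM 0).
have dl2 : 0 < dl ^+ 2 by rewrite exprn_gt0.
have iN := integrable_normal w s.
have if1 : leb.-integrable setT (EFin \o (fun x => f x * normal_pdf w s x)).
  apply: (@integrable_dom _ _ _ leb _ (fun x => M * normal_pdf w s x)).
  - by apply: measurable_funM => //; exact: integrable_measurable iN.
  - exact: integrable_EFinZ.
  - by move=> x; rewrite normrM (ger0_norm (normal_pdf_ge0 _ _ _)) ler_wpM2r// normal_pdf_ge0.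
have fN : f w = \int[leb]_x (f w * normal_pdf w s x).
  by rewrite RintegralZl// Rintegral_normal mulr1.
rewrite [X in _ - X]fN -RintegralB//; last exact: integrable_EFinZ.
set c := 2 * M / dl ^+ 2.
have c0 : 0 <= c by rewrite divr_ge0 ?(ltW dl2)// mulr_ge0.
have i2 : leb.-integrable setT (EFin \o (fun x => e * normal_pdf w s x +
    c * (8 * s ^+ 2) * normal_pdf w (2 * s) x)).
  by apply: integrable_EFinD; apply: integrable_EFinZ => //; exact: integrable_normal.
have i1 : leb.-integrable setT (EFin \o (fun x => f x * normal_pdf w s x - f w * normal_pdf w s x)).
  rewrite (_ : (fun x => _) = fun x => f x * normal_pdf w s x + - f w * normal_pdf w s x).
    by apply: integrable_EFinD => //; exact: integrable_EFinZ.
  by apply/funext => x; rewrite mulNr.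
apply: le_trans (le_normr_Rintegral measurableT i1) _.
apply: (@le_trans _ _ (\int[leb]_x (e * normal_pdf w s x +
    c * (8 * s ^+ 2) * normal_pdf w (2 * s) x))).
  apply: le_Rintegral => //; first exact: (integrable_norm i1).
  move=> x _; rewrite -mulrBl normrM (ger0_norm (normal_pdf_ge0 _ _ _)).
  have n0 := normal_pdf_ge0 w s x; have n2 := normal_moment2 w x s0.
  have [xw|xw] := ltP `|x - w| dl.
    apply: (@le_trans _ _ (e * normal_pdf w s x)); first by rewrite ler_wpM2r// fe.
    by rewrite lerDl mulr_ge0 ?normal_pdf_ge0// mulr_ge0// mulr_ge0// sqr_ge0.
  apply: (@le_trans _ _ (c * ((x - w) ^+ 2 * normal_pdf w s x))); last first.
    rewrite -[leLHS]add0r; apply: lerD; first by rewrite mulr_ge0.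
    by rewrite -mulrA ler_wpM2l.
  rewrite mulrA ler_wpM2r//; apply: (@le_trans _ _ (2 * M)).
    by apply: le_trans (ler_normB _ _) _; have := fM x; have := fM w; lra.
  rewrite /c mulrAC ler_pdivlMr// ler_wpM2l ?mulr_ge0//.
  by rewrite -[leRHS]real_normK ?num_real// ler_sqr ?nnegrE// ltW.
rewrite RintegralD//; last 2 first.
- exact: integrable_EFinZ.
- by apply: integrable_EFinZ; exact: integrable_normal.
rewrite RintegralZl// RintegralZl; [|exact: measurableT|exact: integrable_normal].
by rewrite !Rintegral_normal !mulr1.
Qed.

Lemma gaussian_average_cvg (f : R -> R) (M w : R) :
  measurable_fun setT f -> (forall x, `|f x| <= M) -> {for w, continuous f} ->
  \int[leb]_x (f x * normal_pdf w n.+1%:R^-1 x) @[n --> \oo] --> f w.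
Proof.
move=> mf fM cf; apply/cvgrPdist_le => e e0.
have e2 : 0 < e / 2 by rewrite divr_gt0.
have [dl /= dl0 H] := (cvgrPdist_lt _ _).1 cf _ e2.
have H' x : `|x - w| < dl / 2 -> `|f x - f w| <= e / 2.
  move=> xw; rewrite distrC ltW//; apply: H; rewrite /= distrC; apply: lt_le_trans xw _.
  by rewrite ler_pdivrMr// ler_peMr ?ler1n// ltW.
have dl2 : 0 < dl / 2 by rewrite divr_gt0.
have M0 : 0 <= M by apply: le_trans (fM 0).
set c := 2 * M / (dl / 2) ^+ 2 * 8.
have c0 : 0 <= c by rewrite mulr_ge0// divr_ge0 ?sqr_ge0// mulr_ge0.
near=> n; rewrite distrC; set s := n.+1%:R^-1 : R.
have s0 : 0 < s by rewrite invr_gt0.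
apply: le_trans (gaussian_average_near s0 dl2 mf fM (ltW e2) H') _.
rewrite [leRHS]splitr lerD2l mulrA -/c.
have s1 : s <= 1 by rewrite invf_le1// ler1n.
apply: (@le_trans _ _ (c * s)).
  by rewrite ler_wpM2l// expr2 ler_piMr// ltW.
rewrite /s ler_pdivrMr// mulrC -ler_pdivrMr//; apply: (@le_trans _ _ n%:R); last by rewrite ler_nat.
by near: n; exact: nbhs_infty_ger.
Unshelve. all: by end_near. Qed.

End approximate_identity.

(** * From the kernel assumptions to slow decay *)

Lemma completely_monotone_derive {R : realType} (f : R -> R) : completely_monotone f ->
  forall t : R, 0 < t ->
    [/\ is_derive t 1 f (f^`()%classic t), {for t, continuous f^`()%classic} & f^`()%classic t <= 0].
Proof.
move=> cm t t0; have [d0 _] := cm 0%N t t0; have [d1 s1] := cm 1%N t t0.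
rewrite derive1n0 in d0; rewrite derive1n1 in d1 s1; split.
- apply: DeriveDef; [exact: d0|symmetry; exact: derive1E].
- by apply: differentiable_continuous; exact/derivable1_diffP.
- by rewrite expr1 mulN1r oppr_ge0 in s1.
Qed.

Section kernel_assumptions.
Context {R : realType}.
Notation leb := (@lebesgue_measure R).
Variable K : R -> \bar R.
Hypotheses (Kr : kernel_range K) (K1 : kernel_I K) (K2 : kernel_II K) (K3 : kernel_III K).

(** The kernel cut off to the positive half-line, where the possibly
    infinite value at the origin has no effect. *)
Definition causal_kernel t : R := if 0 < t then rker K t else 0.

Let causal_kernel_pos t : 0 < t -> causal_kernel t = rker K t.
Proof. by rewrite /causal_kernel => ->. Qed.

(** Both monotonicity assumptions provide a continuous nonpositive derivative,
    in the second case by the chain rule. *)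
Lemma kernel_slope : exists k' : R -> R, forall t : R, 0 < t ->
  [/\ is_derive t 1 (rker K) (k' t), {for t, continuous k'} & k' t <= 0].
Proof.
case: K3 => [cm|[phi cm phiE]].
  by exists (rker K)^`()%classic => t; exact: completely_monotone_derive.
exists (fun t => phi^`()%classic (t * t) * (t + t)) => t t0.
have tt : 0 < t * t by rewrite mulr_gt0.
have [d c l] := completely_monotone_derive cm tt; split.
- have H : is_derive t 1 (fun t => phi (t * t)) (phi^`()%classic (t * t) * (t + t)).
    apply: (@is_derive_compx _ phi (fun t => t * t) t _ (t + t) d).
    by apply: is_derive_eq (is_deriveMx (is_derive_idx t) (is_derive_idx t)) _; rewrite mul1r mulr1.
  apply: (near_eq_is_derive _ H).
  near=> u; rewrite /rker phiE ?expr2//=.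
  rewrite gt_eqF//; near: u; exact: lt_nbhsr.
- apply: cvgM; last by apply: cvgD; exact: cvg_id.
  by apply: (cvg_comp (fun u : R => u * u) phi^`()%classic _ c); apply: cvgM; exact: cvg_id.
- by rewrite mulr_le0_ge0// addr_ge0// ltW.
Unshelve. all: by end_near. Qed.

Let rker_gt0 t : t != 0 -> 0 < rker K t.
Proof.
move=> t0; have [fK _] := Kr; have [[_ _ pK] _ _] := K1.
by rewrite /rker fine_gt0// pK//= ltey_eq fK.
Qed.

Let measurable_rker : measurable_fun setT (rker K).
Proof. by have [[[]]] := K1. Qed.

Lemma measurable_causal_kernel : measurable_fun setT causal_kernel.
Proof.
rewrite (_ : causal_kernel = fun t => rker K t * \1_(`]0, +oo[%classic) t).
  apply: measurable_funM => //; exact: measurable_indic.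
apply/funext => t; rewrite /causal_kernel indicE.
case: ifPn => t0; first by rewrite mem_set ?mulr1//= in_itv/= t0.
by rewrite memNset ?mulr0//= in_itv/= andbT; apply/negP.
Qed.

Lemma causal_kernel_ge0 t : 0 <= causal_kernel t.
Proof.
rewrite /causal_kernel; case: ifPn => // t0.
by rewrite ltW// rker_gt0// gt_eqF.
Qed.

Let rker_noninc s t : 0 < s -> s <= t -> rker K t <= rker K s.
Proof.
have [k' H] := kernel_slope; apply: (nonincreasing_is_derive (f' := k')).
- by move=> u u0; have [] := H u u0.
- by move=> u u0; have [] := H u u0.
Qed.

Lemma integrable_causal_kernel01 : leb.-integrable `[0, 1] (EFin \o causal_kernel).
Proof.
have [[[_ _ loc] _ _] _ _] := K1.
apply/integrableP; split.
  by apply/measurable_EFinP/measurable_funTS; exact: measurable_causal_kernel.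
apply: le_lt_trans (loc `[0, 1]%classic _ _) => //; last exact: segment_compact.
apply: ge0_le_integral => //.
- do 2 apply: measurableT_comp => //.
  by apply: measurable_funTS; exact: measurable_causal_kernel.
- do 2 apply: measurableT_comp => //.
  by apply: measurable_funTS.
- move=> t _; rewrite /= lee_fin /causal_kernel; case: ifPn => // _.
  by rewrite normr0.
Qed.

(** Each case of the integrability condition gives an algebraic bound. An
    integrable decreasing kernel is bounded by a multiple of [1 / t]. *)
Let eventual_tail : exists a C T : R, [/\ 0 < a < 1, 0 <= C, 1 <= T &
  forall t, T <= t -> rker K t <= C * t `^ (- a)].
Proof.
have half : 0 < (2^-1 : R) < 1 by rewrite invr_gt0 ltr0n /= invf_lt1 ?ltr0n// ltr1n.
have inv_le (t : R) : 1 <= t -> t^-1 <= t `^ (- 2^-1).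
  move=> t1; rewrite -powR_inv1; last exact: le_trans t1.
  by apply: ler_powR => //; rewrite lerN2 invf_le1 ?ltr0n// ler1n.
have ratio (g : R -> R) c : (forall t, 0 < t -> 0 < g t) ->
    rker K t / g t @[t --> +oo] --> c -> exists2 T, 1 <= T & forall t, T <= t -> rker K t <= (`|c| + 1) * g t.
  move=> g0 /cvgrPdist_le/(_ _ ltr01)[T [_ H]].
  exists (Num.max 1 (T + 1)); first by rewrite le_max lexx.
  move=> t; rewrite ge_max => /andP[t1 tT]; have t0 : 0 < t by exact: lt_le_trans t1.
  have /H : T < t by apply: lt_le_trans tT; rewrite ltrDl.
  move=> h; rewrite -ler_pdivrMr ?g0//.
  apply: le_trans (ler_norm _) _; rewrite addrC -lerBlDr; apply: le_trans h.
  by rewrite distrC; exact: lerB_dist.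
case: K2 => [iK|[c c0 cK]|[al al1 [c c0 cK]]].
- have if1 : leb.-integrable setT (EFin \o rker K).
    apply: (@le_integrable _ _ _ leb _ measurableT _ K) => //.
      exact/measurable_EFinP.
    move=> t _; rewrite /= /rker; case: (K t) => [r||] /=.
    - exact: lexx.
    - by rewrite normr0 leey.
    - by rewrite normr0 leey.
  pose I := \int[leb]_t `|rker K t|.
  have I0 : 0 <= I by apply: Rintegral_ge0 => t _; exact: normr_ge0.
  exists 2^-1, I, 1; split => // t t1; have t0 : 0 < t by exact: lt_le_trans t1.
  apply: (@le_trans _ _ (I / t)); last by rewrite ler_wpM2l// inv_le.
  rewrite ler_pdivlMr//.
  have iN := integrable_norm if1.
  have i1 : leb.-integrable setT (EFin \o (\1_(`]0, t]%classic) : R -> R)).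
    exact: integrable_indic_itv.
  have -> : rker K t * t = \int[leb]_x (rker K t * \1_(`]0, t]%classic) x).
    rewrite RintegralZl//; congr (_ * _).
    have L : leb `]0, t]%classic = t%:E by rewrite lebesgue_measure_itv/= lte_fin t0 -EFinD subr0.
    transitivity (fine (leb `]0, t]%classic)); first by rewrite L.
    by rewrite /Rintegral integral_indic// setIT.
  apply: le_Rintegral => //; first exact: integrable_EFinZ.
  move=> x _; rewrite indicE; have [xt|] := boolP (x \in _); last by rewrite mulr0.
  move: xt; rewrite inE/= in_itv/= mulr1 => /andP[x0 xt].
  by apply: le_trans (ler_norm _); exact: rker_noninc.
- have [T T1 H] := ratio (fun t => t^-1) c (fun t t0 => etrans (invr_gt0 t) t0) cK.
  exists 2^-1, (`|c| + 1), T; split => //.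
  move=> t tT; apply: le_trans (H _ tT) _; have c1 : 0 <= `|c| + 1 by rewrite addr_ge0.
  apply: (ler_wpM2l c1); apply: inv_le; exact: le_trans tT.
- have [T T1 H] := ratio (fun t => t `^ (- al)) c (fun t t0 => powR_gt0 _ t0) cK.
  by exists al, (`|c| + 1), T; split.
Qed.

Lemma kernel_tail : exists a C : R, [/\ 0 < a < 1, 0 <= C &
  forall t, 1 <= t -> causal_kernel t <= C * t `^ (- a)].
Proof.
have [a [C [T [a1 C0 T1 H]]]] := eventual_tail.
have k1 : 0 <= rker K 1 by rewrite ltW// rker_gt0.
exists a, (C + rker K 1 * T `^ a); split => //.
  by rewrite addr_ge0// mulr_ge0// powR_ge0.
move=> t t1; have t0 : 0 < t by exact: lt_le_trans t1.
rewrite causal_kernel_pos// mulrDl.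
have [tT|tT] := leP T t.
  by apply: le_trans (H _ tT) _; rewrite lerDl !mulr_ge0// powR_ge0.
apply: le_trans (rker_noninc ltr01 t1) _.
apply: (@le_trans _ _ (rker K 1 * T `^ a * t `^ (- a))).
  rewrite -mulrA ler_peMr// powRN -[X in _ <= X / _]mul1r.
  rewrite mul1r ler_pdivlMr ?powR_gt0// mul1r ge0_ler_powR ?nnegrE ?ltW//.
  - by case/andP: a1.
  - exact: lt_trans tT.
by rewrite lerDr mulr_ge0// powR_ge0.
Qed.

Lemma slow_causal_kernel : exists k' C a, slow_kernel causal_kernel k' C a.
Proof.
have [k' H] := kernel_slope; have [a [C [a1 C0 Ht]]] := kernel_tail.
exists k', C, a; split => //.
- exact: measurable_causal_kernel.
- by move=> t t0; rewrite /causal_kernel ltNge t0.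
- exact: causal_kernel_ge0.
- move=> t t0; have [d _ _] := H t t0.
  apply: (near_eq_is_derive _ d).
  near=> u; rewrite causal_kernel_pos//; near: u; exact: lt_nbhsr.
- by move=> t t0; have [] := H t t0.
- by move=> t t0; have [] := H t t0.
- exact: integrable_causal_kernel01.
- have [_ [c _] _] := K1; apply: cvg_trans c; apply: near_eq_cvg.
  near=> u; rewrite causal_kernel_pos//; near: u; exact: nbhs_pinfty_gt.
Unshelve. all: by end_near. Qed.

Lemma Rintegral_causal_kernel (D : set R) (g : R -> R) : measurable D ->
  D `<=` `[0, +oo[%classic -> measurable_fun setT g ->
  \int[leb]_(t in D) (rker K t * g t) = \int[leb]_(t in D) (causal_kernel t * g t).
Proof.
move=> mD D0 mg; rewrite /Rintegral; congr fine.
apply: ae_eq_integral => //.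
- by apply/measurable_EFinP/measurable_funTS; apply: measurable_funM.
- apply/measurable_EFinP/measurable_funTS; apply: measurable_funM => //.
  exact: measurable_causal_kernel.
have := @ae_neq0 R; apply: ae_leb_imply => t t0 Dt.
have := D0 _ Dt; rewrite /= in_itv/= andbT => t00.
by rewrite causal_kernel_pos// lt_neqAle eq_sym t0.
Qed.

Lemma KcosE w : w != 0 -> Kcos K w = transform causal_kernel cos 0 w.
Proof.
move=> w0; rewrite /Kcos /transform.
suff -> : Kcos_trunc K w = trunc_transform causal_kernel cos 0 w by [].
apply/funext => N; rewrite /Kcos_trunc /trunc_transform.
rewrite (Rintegral_causal_kernel (g := fun t => cos (w * t)))//.
- by apply: eq_Rintegral => t _; rewrite /osc mul0r oppr0 expR0 mulr1.
- by move=> t; rewrite /= !in_itv/= andbT => /andP[].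
- by apply: continuous_measurable_fun; apply: continuous_is_derive => t;
    apply: is_derive_cosx; apply: is_deriveZx; exact: is_derive_idx.
Qed.

Lemma causal_kernel_cos_ge0 w : w != 0 -> 0 <= transform causal_kernel cos 0 w.
Proof. by move=> w0; rewrite -KcosE//; have [_ _ /(_ w w0)[_ /ltW]] := K1. Qed.

(** The cutoff lets the memory integral run over the whole line. *)
Lemma cintegral_causal_kernel (g : R -> R[i]) : cmeasurable g ->
  cintegral leb `[0, +oo[ (fun s => (rker K s)%:C * g s) =
  cintegral leb setT (fun s => (causal_kernel s)%:C * g s).
Proof.
have H (f : R -> R) : measurable_fun setT f ->
    \int[leb]_(s in `[0, +oo[) (rker K s * f s) = \int[leb]_s (causal_kernel s * f s).
  move=> mf; rewrite Rintegral_causal_kernel// Rintegral_mkcond.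
  apply: eq_Rintegral => t _; rewrite patchE; case: ifPn => //.
  rewrite notin_setE/= in_itv/= andbT => /negP; rewrite -ltNge => t0.
  by rewrite /causal_kernel ltNge (ltW t0) mul0r.
move=> [m1 m2]; apply: eq_ReIm; rewrite /cintegral /=.
- rewrite (_ : (fun s => complex.Re _) = fun s => rker K s * complex.Re (g s)); last first.
    by apply/funext => s; rewrite !ReImE /= mul0r subr0.
  by rewrite H//; apply: eq_Rintegral => s _; rewrite !ReImE /= mul0r subr0.
- rewrite (_ : (fun s => complex.Im _) = fun s => rker K s * complex.Im (g s)); last first.
    by apply/funext => s; rewrite !ReImE /= mul0r addr0.
  by rewrite H//; apply: eq_Rintegral => s _; rewrite !ReImE /= mul0r addr0.
Qed.

End kernel_assumptions.

(** * Gaussians separate functions *)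

Section gaussian_separation.
Context {R : realType}.
Notation leb := (@lebesgue_measure R).
Implicit Types (b s w : R).

Lemma normal_pdf_sym b s w : 0 < s -> normal_pdf b s w = normal_pdf w s b.
Proof. by move=> s0; rewrite !normal_pdfEx// -opprB sqrrN. Qed.

Lemma measurable_normal b s : measurable_fun setT (normal_pdf b s).
Proof. exact: integrable_measurable (integrable_normal b s). Qed.

Lemma measurable_normal2 s : 0 < s ->
  measurable_fun setT (fun z : R * R => normal_pdf z.2 s z.1).
Proof.
move=> s0; rewrite (_ : (fun z => _) = fun z : R * R => normal_pdf 0 s (z.1 - z.2)).
  apply: (measurableT_comp (measurable_normal 0 s)).
  by apply: measurable_funB.
by apply/funext => z; rewrite !normal_pdfEx// subr0.
Qed.

(** Completing the square. *)
Lemma normal_mul b s : 0 < s -> exists c b' s', 0 < s' /\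
  forall w, normal_pdf 0 1 w * normal_pdf b s w = c * normal_pdf b' s' w.
Proof.
move=> s0; pose q := 1 + s ^+ 2; have q0 : 0 < q by rewrite ltr_pwDl// sqr_ge0.
have sq0 : 0 < Num.sqrt q by rewrite sqrtr_gt0.
have sq2 : Num.sqrt q ^+ 2 = q by rewrite sqr_sqrtr// ltW.
pose s' := s / Num.sqrt q; pose b' := b / q.
have s'0 : 0 < s' by rewrite divr_gt0.
have p0 : 0 < normal_peak s' by rewrite normal_peak_gt0// gt_eqF.
exists (normal_peak 1 * normal_peak s / normal_peak s' * expR (- (b ^+ 2 / (2 * q)))), b', s'.
split=> // x; rewrite !normal_pdfEx//.
have -> : - (x - 0) ^+ 2 / (1 ^+ 2 *+ 2) = - x ^+ 2 / 2 :> R by rewrite subr0 expr1n.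
have E : expR (- x ^+ 2 / 2) * expR (- (x - b) ^+ 2 / (s ^+ 2 *+ 2)) =
    expR (- (b ^+ 2 / (2 * q))) * expR (- (x - b') ^+ 2 / (s' ^+ 2 *+ 2)).
  rewrite -!expRD; congr expR; rewrite /s' /b' exprMn exprVn sq2 /q.
  have s2 : s != 0 by rewrite gt_eqF.
  have q2 : 1 + s ^+ 2 != 0 by rewrite gt_eqF.
  by field; rewrite s2 q2.
rewrite mulrACA E; have := lt0r_neq0 p0; move: (normal_peak s') => p p1.
by field.
Qed.

Variable u : R -> R.
Hypotheses
  (iu : forall b s, 0 < s -> leb.-integrable setT (EFin \o (fun w => u w * normal_pdf b s w)))
  (u0 : forall b s, 0 < s -> \int[leb]_w (u w * normal_pdf b s w) = 0).

(** Multiplication by a Gaussian makes the unknown function integrable, and the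
    product still has vanishing Gaussian integrals, by completing the square. *)
Let v w := u w * normal_pdf 0 1 w.

Let iv : leb.-integrable setT (EFin \o v). Proof. exact: iu. Qed.

Let v0 b s : 0 < s -> \int[leb]_w (v w * normal_pdf b s w) = 0.
Proof.
move=> s0; have [c [b' [s' [s'0 H]]]] := normal_mul b s0.
rewrite (_ : (fun w => _) = fun w => c * (u w * normal_pdf b' s' w)).
  by rewrite RintegralZl//; [rewrite u0// mulr0|exact: iu].
by apply/funext => w; rewrite /v -mulrA H mulrCA.
Qed.

(** Fubini turns the vanishing Gaussian integrals into vanishing averages over
    an interval of centers; then the width tends to zero. *)
Let integral_itv0 (x y : R) : \int[leb]_(w in `]x, y]) v w = 0.
Proof.
have mv := integrable_measurable iv.
pose J := `]x, y]%classic : set R.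
have iJ : leb.-integrable setT (EFin \o (\1_J : R -> R)) by exact: integrable_indic_itv.
have mJ : measurable_fun setT (\1_J : R -> R) by exact: integrable_measurable iJ.
have J0 w : 0 <= \1_J w :> R by rewrite indicE ler0n.
have J1 w : `|\1_J w| <= 1 :> R by rewrite indicE normr_nat lern1 leq_b1.
have iJN w s : leb.-integrable setT (EFin \o (fun b => \1_J b * normal_pdf w s b)).
  apply: (@integrable_dom _ _ _ leb _ (normal_pdf w s)).
  - by apply: measurable_funM => //; exact: measurable_normal.
  - exact: integrable_normal.
  - by move=> b; rewrite normrM (ger0_norm (normal_pdf_ge0 _ _ _)) ler_piMl// normal_pdf_ge0.
have avg0 s : 0 < s ->
    measurable_fun setT (fun w => v w * \int[leb]_b (\1_J b * normal_pdf w s b)) /\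
    \int[leb]_w (v w * \int[leb]_b (\1_J b * normal_pdf w s b)) = 0.
  move=> s0; pose f (z : R * R) := v z.1 * (\1_J z.2 * normal_pdf z.2 s z.1).
  have mf : measurable_fun setT f.
    apply: measurable_funM; first exact: (measurableT_comp mv measurable_fst).
    apply: measurable_funM; last exact: measurable_normal2.
    exact: (measurableT_comp mJ measurable_snd).
  have iB : leb.-integrable setT (EFin \o (fun b => normal_peak s * \1_J b)).
    exact: integrable_EFinZ.
  have fAB w b : `|f (w, b)| <= `|v w| * (normal_peak s * \1_J b).
    rewrite /f/= normrM ler_wpM2l// normrM (ger0_norm (J0 b)) (ger0_norm (normal_pdf_ge0 _ _ _)).
    by rewrite mulrC ler_wpM2r// normal_pdf_ub// gt_eqF.
  have E : (fun w => \int[leb]_b f (w, b)) =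
      fun w => v w * \int[leb]_b (\1_J b * normal_pdf w s b).
    apply/funext => w; rewrite -RintegralZl; [|exact: measurableT|exact: iJN].
    by apply: eq_Rintegral => b _; rewrite /f /= normal_pdf_sym.
  rewrite -E; split.
    apply: (@integrable_measurable _ _ _ leb).
    exact: (integrable_Rintegral1 (m1 := leb) (m2 := leb) mf (integrable_norm iv) iB fAB).
  rewrite (Fubini_Rintegral (m1 := leb) (m2 := leb) mf (integrable_norm iv) iB fAB).
  rewrite (_ : (fun b => \int[leb]_w f (w, b)) = cst 0).
    by rewrite Rintegral_cst// mul0r.
  apply/funext => b /=; rewrite -[RHS](mulr0 (\1_J b)) -(v0 b s0) -RintegralZl//.
    by apply: eq_Rintegral => w _; rewrite /f /= mulrCA.
  apply: (@integrable_dom _ _ _ leb _ (fun w => normal_peak s * `|v w|)).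
  - by apply: measurable_funM => //; exact: measurable_normal.
  - by apply: integrable_EFinZ; exact: integrable_norm iv.
  - move=> w; rewrite normrM mulrC (ger0_norm (normal_pdf_ge0 _ _ _)).
    by rewrite ler_wpM2r// normal_pdf_ub// gt_eqF.
pose s_ n : R := n.+1%:R^-1.
have s0 n : 0 < s_ n by rewrite invr_gt0.
pose A n w := \int[leb]_b (\1_J b * normal_pdf w (s_ n) b).
have A1 n w : `|A n w| <= 1.
  apply: le_trans (le_normr_Rintegral measurableT (iJN _ _)) _.
  rewrite -(Rintegral_normal w (s_ n)); apply: le_Rintegral => //.
  - exact: integrable_norm (iJN _ _).
  - exact: integrable_normal.
  - by move=> b _; rewrite normrM (ger0_norm (normal_pdf_ge0 _ _ _)) ler_piMl// normal_pdf_ge0.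
have [_] : leb.-integrable setT (EFin \o (fun w => v w * \1_J w)) /\
    \int[leb]_w (v w * A n w) @[n --> \oo] --> \int[leb]_w (v w * \1_J w).
  apply: (@dominated_leb _ _ _ (fun w => `|v w|)).
  - by move=> n; have [] := avg0 (s_ n) (s0 n).
  - exact: measurable_funM.
  - exact: integrable_norm iv.
  - exists [set x; y]; split.
    + by apply: measurableU; exact: measurable_set1.
    + by apply: null_set_setU; try exact: measurable_set1; exact: lebesgue_measure_set1.
    move=> w /= /not_andP H; apply: contrapT => /not_orP[/eqP wx /eqP wy].
    case: H => H; apply: H; first by move=> n; rewrite normrM ler_piMr.
    apply: cvgM; first exact: cvg_cst.
    apply: (@gaussian_average_cvg _ _ 1) => //.
    have near_cst (c : R) : (\forall z \near w, \1_J z = c) -> {for w, continuous (\1_J : R -> R)}.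
      move=> hc; have -> : {for w, continuous (\1_J : R -> R)} = (\1_J z @[z --> w] --> c).
        by rewrite /prop_for /continuous_at (nbhs_singleton hc).
      exact: cvg_near_cst.
    have [wx'|wx'] := ltP w x.
      apply: (near_cst 0); near=> z; rewrite indicE memNset// /J/= in_itv/= => /andP[xz _].
      have : z < x by near: z; exact: lt_nbhsl.
      by rewrite ltNge ltW.
    have xw : x < w by rewrite lt_neqAle wx' andbT eq_sym.
    have [yw|wy'] := ltP y w.
      apply: (near_cst 0); near=> z; rewrite indicE memNset// /J/= in_itv/= => /andP[_ zy].
      have : y < z by near: z; exact: lt_nbhsr.
      by rewrite ltNge zy.
    have wy2 : w < y by rewrite lt_neqAle wy' andbT.
    apply: (near_cst 1); near=> z; rewrite indicE mem_set// /J/= in_itv/=; apply/andP; split.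
      by near: z; exact: lt_nbhsr.
    by apply: ltW; near: z; exact: lt_nbhsl.
rewrite (_ : (fun n => _) = cst 0); last by apply/funext => n; have [_] := avg0 (s_ n) (s0 n).
move=> /(cvg_lim (@Rhausdorff R)); rewrite lim_cst// => E.
rewrite Rintegral_mkcond [RHS]E; apply: eq_Rintegral => w _; rewrite patchE indicE.
by case: ifPn => _; rewrite ?mulr1 ?mulr0.
Unshelve. all: by end_near. Qed.

(** All integrals over intervals vanish, and so does their derivative at the
    Lebesgue points. *)
Lemma gaussian_separation : {ae leb, forall w, u w = 0}.
Proof.
have locv : locally_integrable setT v.
  by apply: open_integrable_locally => //; exact: openT.
have := lebesgue_differentiation locv; apply: ae_leb_imply => w Hw.
have x1 : w < w + 1 by rewrite ltrDl.
have iv1 : leb.-integrable [set` Interval (BRight (w - 1)) (BRight (w + 1))] (EFin \o v).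
  exact: integrableS iv.
have xb : (BRight (w - 1) < BRight w)%O by rewrite bnd_simp ltrBlDr ltrDl.
have [_] := FTC1_lebesgue_pt x1 iv1 xb Hw.
rewrite (_ : (fun y => _) = cst 0); last by apply/funext => y; exact: integral_itv0.
rewrite derive1_cst => /esym/eqP; rewrite mulf_eq0 => /orP[/eqP//|].
by rewrite normal_pdfEx// gt_eqF// mulr_gt0 ?expR_gt0// normal_peak_gt0.
Qed.

End gaussian_separation.

(** * Fourier transforms of wave packets *)

Section complex_tools.
Context {d : measure_display} {T : measurableType d} {R : realType}.
Variable mu : {measure set T -> \bar R}.

Lemma cmeasurable_comp {d' : measure_display} {T' : measurableType d'} (f : T -> R[i]) (g : T' -> T) :
  cmeasurable f -> measurable_fun setT g -> cmeasurable (fun x => f (g x)).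
Proof. by move=> [f1 f2] mg; split; [exact: (measurableT_comp f1)|exact: (measurableT_comp f2)]. Qed.

Definition ccvg (u : nat -> R[i]) (l : R[i]) :=
  complex.Re (u n) @[n --> \oo] --> complex.Re l /\
  complex.Im (u n) @[n --> \oo] --> complex.Im l.

Lemma ccvg_unique u l l' : ccvg u l -> ccvg u l' -> l = l'.
Proof.
move=> [r1 i1] [r2 i2]; apply: eq_ReIm.
  exact: (cvg_unique _ r1 r2).
exact: (cvg_unique _ i1 i2).
Qed.

Lemma ccvgMl (z : R[i]) u l : ccvg u l -> ccvg (fun n => z * u n) (z * l).
Proof.
move=> [r i]; split.
  under eq_fun do rewrite cReM; rewrite cReM.
  by apply: cvgB; apply: cvgM => //; exact: cvg_cst.
under eq_fun do rewrite cImM; rewrite cImM.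
by apply: cvgD; apply: cvgM => //; exact: cvg_cst.
Qed.

Lemma ccvgMr (z : R[i]) u l : ccvg u l -> ccvg (fun n => u n * z) (l * z).
Proof.
rewrite mulrC (_ : (fun n => u n * z) = fun n => z * u n); first exact: ccvgMl.
by apply/funext => n; rewrite mulrC.
Qed.

Lemma dominated_cintegral (f_ : nat -> T -> R[i]) (f : T -> R[i]) (g : T -> R) :
  (forall n, cmeasurable (f_ n)) -> cmeasurable f ->
  mu.-integrable setT (EFin \o g) ->
  {ae mu, forall x, (forall n, Normc.normc (f_ n x) <= g x) /\ ccvg (f_ ^~ x) (f x)} ->
  cintegrable mu f /\
  ccvg (fun n => cintegral mu setT (f_ n)) (cintegral mu setT f).
Proof.
move=> mf_ [mr mi] ig H.
have [r1 r2] : mu.-integrable setT (EFin \o (fun x => complex.Re (f x))) /\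
    \int[mu]_x complex.Re (f_ n x) @[n --> \oo] --> \int[mu]_x complex.Re (f x).
  apply: (dominated_Rintegral (g := g)) => //; first by move=> n; have [] := mf_ n.
  apply: filterS H => x [h [hr _]]; split=> // n.
  exact: le_trans (normr_Re_le _) (h n).
have [i1 i2] : mu.-integrable setT (EFin \o (fun x => complex.Im (f x))) /\
    \int[mu]_x complex.Im (f_ n x) @[n --> \oo] --> \int[mu]_x complex.Im (f x).
  apply: (dominated_Rintegral (g := g)) => //; first by move=> n; have [] := mf_ n.
  apply: filterS H => x [h [_ hi]]; split=> // n.
  exact: le_trans (normr_Im_le _) (h n).
by split; split.
Qed.

End complex_tools.

Section fourier_calculus.
Context {R : realType}.
Notation leb := (@lebesgue_measure R).
Implicit Types (u v : R -> R[i]) (b s a t w : R).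

Let cintegrable_osc u t : cintegrable leb u ->
  cintegrable leb (fun w => u w * cexpi (- (w * t))).
Proof.
move=> iu; apply: (@cintegrable_dom _ _ _ leb _ (fun w => Normc.normc (u w))).
- apply: cmeasurableM; first exact: cintegrable_cmeasurable iu.
  by apply: cmeasurable_expi; apply: measurableT_comp => //; apply: measurable_funM.
- exact: integrable_normc.
- by move=> w; rewrite Normc.normcM normc_expi mulr1.
Qed.

(** The multiplication formula moves the Fourier transform from the test
    function to the density. *)
Lemma fourier_multiplication u v : cintegrable leb u -> cintegrable leb v ->
  cintegrable leb (fun t => u t * fourier v t) /\
  cintegral leb setT (fun t => u t * fourier v t) =
  cintegral leb setT (fun w => fourier u w * v w).
Proof.
move=> iu iv; pose f (z : R * R) := u z.1 * (v z.2 * cexpi (- (z.2 * z.1))).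
have mf : cmeasurable f.
  apply: cmeasurableM.
    by apply: cmeasurable_comp; [exact: cintegrable_cmeasurable iu|exact: measurable_fst].
  apply: cmeasurableM.
    by apply: cmeasurable_comp; [exact: cintegrable_cmeasurable iv|exact: measurable_snd].
  by apply: cmeasurable_expi; apply: measurableT_comp => //; apply: measurable_funM.
have dom t w : Normc.normc (f (t, w)) <= Normc.normc (u t) * Normc.normc (v w).
  by rewrite /f /= !Normc.normcM normc_expi mulr1.
have E : (fun t => u t * fourier v t) = fun t => cintegral leb setT (fun w => f (t, w)).
  by apply/funext => t; rewrite /fourier -cintegralZl//; exact: cintegrable_osc.
have I := cintegrable_cintegral1 (m1 := leb) (m2 := leb) mf (integrable_normc iu) (integrable_normc iv) dom.
have F := Fubini_cintegral (m1 := leb) (m2 := leb) mf (integrable_normc iu) (integrable_normc iv) dom.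
rewrite E; split; first exact: I.
rewrite F; apply: eq_cintegral => w.
rewrite mulrC -cintegralZl; last exact: cintegrable_osc.
by apply: eq_cintegral => t; rewrite /f /= [w * t]mulrC mulrCA mulrA.
Qed.

Lemma fourier_wave_packet b s a w : 0 < s ->
  fourier (wave_packet b s a) w =
  cexpi ((a - w) * b) * (expR (- (s ^+ 2 * (a - w) ^+ 2 / 2)))%:C.
Proof.
move=> s0; rewrite /fourier; set x := a - w.
have mx (c : R -> R) : continuous c -> measurable_fun setT (fun t => c (x * (t - b))).
  move=> cc; apply: (measurableT_comp (continuous_measurable_fun cc)).
  by apply: measurable_funM => //; apply: measurable_funB.
have ic := integrable_normal_bounded b s (mx cos (@continuous_cos R)) (fun t => normr_cos_le1 _).
have is_ := integrable_normal_bounded b s (mx sin (@continuous_sin R)) (fun t => normr_sin_le1 _).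
transitivity (cintegral leb setT (fun t => cexpi (x * b) *
    ((normal_pdf b s t * cos (x * (t - b))) +i* (normal_pdf b s t * sin (x * (t - b)))))).
  apply: eq_cintegral => t; rewrite /wave_packet -mulrA -cexpiD.
  rewrite (_ : a * t + - (t * w) = x * b + x * (t - b)); last by rewrite /x; ring.
  rewrite cexpiD mulrCA; congr (_ * _).
  by apply: eq_ReIm; rewrite !ReImE /= mul0r ?subr0 ?addr0.
rewrite cintegralZl; last by split.
congr (_ * _); apply: eq_ReIm => /=.
  exact: normal_cos.
exact: normal_sin.
Qed.

Lemma fourier_derive_wave_packet s a w : 0 < s ->
  cintegrable leb (cderive (wave_packet 0 s a)) /\
  fourier (cderive (wave_packet 0 s a)) w = (0 +i* w) * fourier (wave_packet 0 s a) w.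
Proof.
move=> s0; set phi := wave_packet 0 s a; pose x := a - w.
have s2 : s ^+ 2 != 0 by rewrite gt_eqF// exprn_gt0.
have iphi : cintegrable leb phi by apply: schwartz_cintegrable; exact: schwartz_wave_packet.
have mom (c : R -> R) y : continuous c -> (forall t, `|c t| <= 1) ->
    leb.-integrable setT (EFin \o (fun t => (t - 0) * normal_pdf 0 s t * c (y * (t - 0)))).
  move=> cc c1; apply: integrable_normal_moment => //.
  apply: (measurableT_comp (continuous_measurable_fun cc)).
  by apply: measurable_funM => //; apply: measurable_funB.
have cM y : cintegrable leb (fun t => (t * normal_pdf 0 s t * cos (y * t)) +i*
    (t * normal_pdf 0 s t * sin (y * t))).
  have h1 := mom cos y (@continuous_cos R) (@normr_cos_le1 R).
  have h2 := mom sin y (@continuous_sin R) (@normr_sin_le1 R).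
  split=> /=.
    rewrite (_ : (fun t => _) = EFin \o (fun t => (t - 0) * normal_pdf 0 s t * cos (y * (t - 0)))) //.
    by apply/funext => t; rewrite /= !subr0.
  rewrite (_ : (fun t => _) = EFin \o (fun t => (t - 0) * normal_pdf 0 s t * sin (y * (t - 0)))) //.
  by apply/funext => t; rewrite /= !subr0.
have dE : cderive phi = fun t => (- (s ^+ 2)^-1)%:C * ((t * normal_pdf 0 s t * cos (a * t)) +i*
    (t * normal_pdf 0 s t * sin (a * t))) + (0 +i* a) * phi t.
  apply/funext => t; rewrite cderive_wave_packet// /phi wave_packetE//.
  by apply: eq_ReIm; rewrite !ReImE /=; ring.
have iD : cintegrable leb (cderive phi).
  by rewrite dE; apply: cintegrableD; apply: cintegrableZl.
split=> //; rewrite /fourier.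
transitivity (cintegral leb setT (fun t =>
   (- (s ^+ 2)^-1)%:C * ((t * normal_pdf 0 s t * cos (x * t)) +i* (t * normal_pdf 0 s t * sin (x * t))) +
   (0 +i* a) * (phi t * cexpi (- (t * w))))).
  apply: eq_cintegral => t; rewrite dE mulrDl; congr (_ + _); last by rewrite mulrA.
  rewrite -[LHS]mulrA; congr (_ * _).
  have h (y : R) : (t * normal_pdf 0 s t * cos y) +i* (t * normal_pdf 0 s t * sin y) =
      (t * normal_pdf 0 s t)%:C * cexpi y.
    by apply: eq_ReIm; rewrite !ReImE /= mul0r ?subr0 ?addr0.
  rewrite !h -mulrA -cexpiD; congr (_ * cexpi _).
  by rewrite /x; ring.
rewrite cintegralD; last 2 first.
- exact: cintegrableZl.
- by apply: cintegrableZl; exact: cintegrable_osc.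
rewrite cintegralZl// cintegralZl; last exact: cintegrable_osc.
rewrite -/(fourier phi w) fourier_wave_packet// mulr0 cexpi0 mul1r.
set g := expR _.
have -> : cintegral leb setT (fun t => (t * normal_pdf 0 s t * cos (x * t)) +i*
    (t * normal_pdf 0 s t * sin (x * t))) = 0 +i* (s ^+ 2 * x * g).
  apply: eq_ReIm => /=.
    rewrite -[RHS](normal_moment_cos 0 s0 x); apply: eq_Rintegral => t _.
    by rewrite !subr0.
  rewrite /g -(normal_moment_sin 0 s0 x); apply: eq_Rintegral => t _.
  by rewrite !subr0.
apply: eq_ReIm; rewrite !ReImE /=; first by ring.
by rewrite /x; field; rewrite gt_eqF.
Qed.

Lemma fourier_gaussian b s t : 0 < s ->
  fourier (fun w => (normal_pdf b s w)%:C) t =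
  cexpi (- (t * b)) * (expR (- (s ^+ 2 * t ^+ 2 / 2)))%:C.
Proof.
move=> s0; rewrite (_ : (fun w => _) = wave_packet b s 0); last first.
  by apply/funext => w; rewrite /wave_packet mul0r cexpi0 mulr1.
by rewrite fourier_wave_packet// sub0r sqrrN mulNr.
Qed.

Lemma integrable_expsqr c : 0 < c ->
  leb.-integrable setT (EFin \o (fun t => expR (- (c ^+ 2 * t ^+ 2 / 2)))).
Proof.
move=> c0; have c1 : 0 < c^-1 by rewrite invr_gt0.
have p0 : normal_peak c^-1 != 0 by rewrite gt_eqF// normal_peak_gt0// gt_eqF.
rewrite (_ : (fun t => _) = fun t => (normal_peak c^-1)^-1 * normal_pdf 0 c^-1 t).
  by apply: integrable_EFinZ; exact: integrable_normal.
apply/funext => t; rewrite normal_pdfEx// mulKf//; congr expR.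
have c2 : c != 0 by rewrite gt_eqF.
by rewrite subr0; field.
Qed.

End fourier_calculus.

(** * Fourier transform of the memory term *)

Lemma cmeasurable_ccvg {d : measure_display} {T : measurableType d} {R : realType}
    (f_ : nat -> T -> R[i]) (f : T -> R[i]) :
  (forall n, cmeasurable (f_ n)) -> (forall x, ccvg (f_ ^~ x) (f x)) -> cmeasurable f.
Proof.
move=> mf H; split.
  apply: (measurable_fun_cvg (h := fun n x => complex.Re (f_ n x))) => [n|x _].
    by have [] := mf n.
  by have [] := H x.
apply: (measurable_fun_cvg (h := fun n x => complex.Im (f_ n x))) => [n|x _].
  by have [] := mf n.
by have [] := H x.
Qed.

Section memory_symbol.
Context {R : realType}.
Notation leb := (@lebesgue_measure R).
Variables (k k' : R -> R) (C al : R).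
Hypothesis sk : slow_kernel k k' C al.
Variables (s a b r : R).
Hypotheses (s0 : 0 < s) (r0 : 0 < r).
Implicit Types (t u w : R).

Let phi := wave_packet 0 s a.
Let psi w : R[i] := (normal_pdf b r w)%:C.
Let psih := fourier psi.
Let ghat w := expR (- (s ^+ 2 * (a - w) ^+ 2 / 2)).
Let tcos := @trigonometric_cos R.
Let tsin := @trigonometric_sin R.

Definition memory (g : R -> R[i]) t := cintegral leb setT (fun u => (k u)%:C * g (t + u)).

Lemma fourier_shift_wave_packet u w :
  fourier (fun t => wave_packet 0 s a (t + u)) w = cexpi (w * u) * (ghat w)%:C.
Proof.
have E : (fun t => wave_packet 0 s a (t + u)) = fun t => cexpi (a * u) * wave_packet (- u) s a t.
  apply/funext => t; rewrite /wave_packet mulrDr cexpiD [RHS]mulrC -mulrA; congr (_%:C * _).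
  by rewrite !normal_pdfEx// subr0 opprK.
rewrite E /fourier.
transitivity (cintegral leb setT (fun t => cexpi (a * u) * (wave_packet (- u) s a t * cexpi (- (t * w))))).
  by apply: eq_cintegral => t; rewrite mulrA.
rewrite cintegralZl; last first.
  apply: (@cintegrable_dom _ _ _ leb _ (normal_pdf (- u) s)).
  - apply: cmeasurableM; first by apply: schwartz_cmeasurable; exact: schwartz_wave_packet.
    by apply: cmeasurable_expi; apply: measurableT_comp => //; apply: measurable_funM.
  - exact: integrable_normal.
  - by move=> t; rewrite Normc.normcM normc_expi mulr1 normc_wave_packet.
rewrite -/(fourier _ w) fourier_wave_packet// mulrA -cexpiD; congr (cexpi _ * _).
ring.
Qed.

Let ipsi : cintegrable leb psi.
Proof. by apply: schwartz_cintegrable; exact: gaussian_schwartz. Qed.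

Let mpsih : cmeasurable psih.
Proof.
rewrite (_ : psih = fun t => cexpi (- (t * b)) * (expR (- (r ^+ 2 * t ^+ 2 / 2)))%:C).
  apply: cmeasurableM.
    by apply: cmeasurable_expi; apply: measurableT_comp => //; apply: measurable_funM.
  by apply: cmeasurable_real; apply: integrable_measurable (integrable_expsqr r0).
by apply/funext => t; exact: fourier_gaussian.
Qed.

Let E t := expR (- (r ^+ 2 * t ^+ 2 / 2)).

Let iE : leb.-integrable setT (EFin \o E). Proof. exact: integrable_expsqr. Qed.

Let normc_psih t : Normc.normc (psih t) = E t.
Proof.
by rewrite /psih fourier_gaussian// Normc.normcM normc_expi mul1r normc_real ger0_norm// expR_ge0.
Qed.

Let mphi : cmeasurable phi.
Proof. by apply: schwartz_cmeasurable; exact: schwartz_wave_packet. Qed.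

Let nphi t : Normc.normc (phi t) = normal_pdf 0 s t.
Proof. exact: normc_wave_packet. Qed.

Let peak0 : 0 <= normal_peak s :> R.
Proof. by rewrite ltW// normal_peak_gt0// gt_eqF. Qed.

Let kn (n : nat) u := k u * \1_(`[0, n%:R]%classic) u.

Let kn_ge0 n u : 0 <= kn n u.
Proof. by rewrite mulr_ge0 ?(sk_ge0 sk)// indicE ler0n. Qed.

Let kn_le n u : kn n u <= k u.
Proof. by rewrite ler_piMr ?(sk_ge0 sk)// indicE lern1 leq_b1. Qed.

Let kn_patch n : kn n = k \_ `[0, n%:R].
Proof.
apply/funext => u; rewrite /kn patchE indicE; case: ifPn => _; first by rewrite mulr1.
by rewrite mulr0.
Qed.

Let ikn n : leb.-integrable setT (EFin \o kn n).
Proof.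
rewrite kn_patch -restrict_EFin; apply/integrable_restrict => //.
by rewrite setTI; exact: (integrable_kernel sk).
Qed.

Let mkn n : measurable_fun setT (kn n).
Proof. exact: integrable_measurable (ikn n). Qed.

Let kn_cvg u : kn n u @[n --> \oo] --> k u.
Proof.
apply: cvg_near_cst; have [u0|u0] := leP u 0.
  by apply: nearW => n; rewrite /kn (sk_neg sk u0) mul0r.
near=> n; rewrite /kn indicE mem_set ?mulr1//= in_itv/= (ltW u0)/=.
by near: n; exact: nbhs_infty_ger.
Unshelve. all: by end_near. Qed.

(** The integrand of the memory term is dominated uniformly in the shift: the
    singularity of the kernel meets a bounded function, its tail meets an
    integrable one. *)
Let dom t u := normal_peak s * (k \_ `[0, 1]%classic) u + k 1 * normal_pdf (- t) s u.

Let idom t : leb.-integrable setT (EFin \o dom t).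
Proof.
apply: integrable_EFinD; apply: integrable_EFinZ; last exact: integrable_normal.
rewrite -restrict_EFin; apply/integrable_restrict => //.
by rewrite setTI; exact: (sk_int sk).
Qed.

Let B := normal_peak s * kint k 1 + k 1.

Let integral_dom t : \int[leb]_u dom t u = B.
Proof.
have i1 : leb.-integrable setT (EFin \o (k \_ `[0, 1]%classic)).
  rewrite -restrict_EFin; apply/integrable_restrict => //.
  by rewrite setTI; exact: (sk_int sk).
rewrite RintegralD; [|exact: measurableT|exact: integrable_EFinZ|].
  rewrite RintegralZl; [|exact: measurableT|exact: integrable_normal].
  rewrite RintegralZl; [|exact: measurableT|exact: i1].
  by rewrite Rintegral_normal mulr1 -Rintegral_mkcond.
by apply: integrable_EFinZ; exact: integrable_normal.
Qed.

Let k_dom t u : k u * Normc.normc (phi (t + u)) <= dom t u.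
Proof.
have Nu : normal_pdf 0 s (t + u) = normal_pdf (- t) s u.
  by rewrite !normal_pdfEx// subr0 opprK addrC.
have n0 : 0 <= normal_pdf (- t) s u := normal_pdf_ge0 _ _ _.
have n1 : normal_pdf (- t) s u <= normal_peak s by rewrite normal_pdf_ub// gt_eqF.
have k10 := sk_ge0 sk 1; have ku := sk_ge0 sk u.
rewrite nphi Nu /dom patchE; case: ifPn => [_|].
  apply: (@le_trans _ _ (normal_peak s * k u)); first by rewrite mulrC ler_wpM2r.
  by rewrite lerDl mulr_ge0.
rewrite notin_setE/= in_itv/= => /negP; rewrite negb_and -!ltNge => /orP[u0|u1].
  by rewrite (sk_neg sk (ltW u0)) mul0r mulr0 add0r mulr_ge0.
by rewrite mulr0 add0r ler_wpM2r// (kernel_nonincreasing sk)// ltW.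
Qed.

Let mem_n n t := cintegral leb setT (fun u => (kn n u)%:C * phi (t + u)).

Let mphi_shift t : cmeasurable (fun u => phi (t + u)).
Proof. by apply: cmeasurable_comp => //; apply: measurable_funD. Qed.

Let kn_dom n t u : Normc.normc ((kn n u)%:C * phi (t + u)) <= dom t u.
Proof.
rewrite Normc.normcM normc_real ger0_norm//; apply: le_trans (k_dom t u).
by rewrite ler_wpM2r// normc_ge0.
Qed.

Let mem_n_cvg t : ccvg (fun n => mem_n n t) (memory phi t).
Proof.
suff [] : cintegrable leb (fun u => (k u)%:C * phi (t + u)) /\
  ccvg (fun n => mem_n n t) (memory phi t) by [].
apply: (@dominated_cintegral _ _ _ leb (fun n u => (kn n u)%:C * phi (t + u)) _ (dom t)).
- by move=> n; apply: cmeasurableM; [apply: cmeasurable_real; exact: mkn|exact: mphi_shift].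
- by apply: cmeasurableM; [apply: cmeasurable_real; exact: (sk_meas sk)|exact: mphi_shift].
- exact: idom.
- apply: aeW => u; split=> [n|]; first exact: kn_dom.
  apply: ccvgMr.
  by split => /=; [exact: kn_cvg|exact: cvg_cst].
Qed.

Let mem_n_bound n t : Normc.normc (mem_n n t) <= 2 * B.
Proof.
have ci : cintegrable leb (fun u => (kn n u)%:C * phi (t + u)).
  apply: (@cintegrable_dom _ _ _ leb _ (dom t)) => //.
  by apply: cmeasurableM; [apply: cmeasurable_real; exact: mkn|exact: mphi_shift].
apply: le_trans (normc_cintegral ci) _; rewrite ler_wpM2l// -(integral_dom t).
by apply: le_Rintegral => //; exact: integrable_normc.
Qed.

Let Kt_n n w : R[i] := trunc_transform k cos 0 w n%:R +i* trunc_transform k sin 0 w n%:R.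

Let kn_transform n w : cintegral leb setT (fun u => (kn n u)%:C * cexpi (w * u)) = Kt_n n w.
Proof.
have H (c : R -> R) : \int[leb]_u (kn n u * c (w * u)) = trunc_transform k c 0 w n%:R.
  rewrite /trunc_transform [RHS]Rintegral_mkcond; apply: eq_Rintegral => u _.
  rewrite kn_patch !patchE; case: ifPn => _; last by rewrite mul0r.
  by rewrite /osc mul0r oppr0 expR0 mulr1.
apply: eq_ReIm => /=; rewrite -H; apply: eq_Rintegral => u _; rewrite mul0r.
  by rewrite subr0.
by rewrite addr0.
Qed.

Let mgh : measurable_fun setT ghat.
Proof.
apply: measurableT_comp => //; apply: measurableT_comp => //; apply: measurable_funM => //.
by apply: measurable_funM => //; apply: measurable_funX; apply: measurable_funB.
Qed.

Let gh1 w : 0 <= ghat w <= 1.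
Proof. by rewrite expR_ge0/= expR_le1 oppr_le0 divr_ge0// mulr_ge0// sqr_ge0. Qed.

(** For the truncated kernel two exchanges of integrals are legitimate: memory
    time with test time, then memory time with frequency. *)
Let mem_nE n :
  cmeasurable (fun t => mem_n n t * psih t) /\
  cintegral leb setT (fun t => mem_n n t * psih t) =
  cintegral leb setT (fun w => Kt_n n w * ((ghat w)%:C * psi w)).
Proof.
pose f (z : R * R) := (kn n z.2)%:C * phi (z.1 + z.2) * psih z.1.
have fE t u : f (t, u) = (kn n u)%:C * phi (t + u) * psih t by [].
have mf : cmeasurable f.
  apply: cmeasurableM; last exact: (cmeasurable_comp mpsih measurable_fst).
  apply: cmeasurableM; first by apply: cmeasurable_real; exact: (measurableT_comp (mkn n) measurable_snd).
  by apply: cmeasurable_comp => //; apply: measurable_funD.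
have iA : leb.-integrable setT (EFin \o (fun t => normal_peak s * E t)) by exact: integrable_EFinZ.
have fAB t u : Normc.normc (f (t, u)) <= normal_peak s * E t * kn n u.
  rewrite fE Normc.normcM Normc.normcM normc_real ger0_norm// normc_psih nphi [leRHS]mulrC mulrA.
  rewrite ler_wpM2r ?expR_ge0// ler_wpM2l//.
  by rewrite normal_pdf_ub// gt_eqF.
have F1 : (fun t => mem_n n t * psih t) = fun t => cintegral leb setT (fun u => f (t, u)).
  apply/funext => t; rewrite mulrC -cintegralZl.
    by apply: eq_cintegral => u; rewrite mulrC.
  apply: (@cintegrable_dom _ _ _ leb _ (dom t)) => //.
  by apply: cmeasurableM; [apply: cmeasurable_real; exact: mkn|exact: mphi_shift].
have I := cintegrable_cintegral1 (m1 := leb) (m2 := leb) mf iA (ikn n) fAB.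
rewrite F1; split; first exact: cintegrable_cmeasurable I.
rewrite (Fubini_cintegral (m1 := leb) (m2 := leb) mf iA (ikn n) fAB).
pose g (z : R * R) := (kn n z.1)%:C * (cexpi (z.2 * z.1) * (ghat z.2)%:C * psi z.2).
have gE u w : g (u, w) = (kn n u)%:C * (cexpi (w * u) * (ghat w)%:C * psi w) by [].
have mg : cmeasurable g.
  apply: cmeasurableM; first by apply: cmeasurable_real; exact: (measurableT_comp (mkn n) measurable_fst).
  apply: cmeasurableM; first apply: cmeasurableM.
  - by apply: cmeasurable_expi; apply: measurable_funM.
  - by apply: cmeasurable_real; exact: (measurableT_comp mgh measurable_snd).
  - by apply: cmeasurable_comp; [exact: cintegrable_cmeasurable ipsi|exact: measurable_snd].
have gAB u w : Normc.normc (g (u, w)) <= kn n u * normal_pdf b r w.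
  have /andP[g0 g1] := gh1 w.
  rewrite gE !Normc.normcM !normc_real normc_expi mul1r (ger0_norm (kn_ge0 n u)) ler_wpM2l//.
  by rewrite (ger0_norm g0) (ger0_norm (normal_pdf_ge0 _ _ _)) ler_piMl// normal_pdf_ge0.
transitivity (cintegral leb setT (fun u => cintegral leb setT (fun w => g (u, w)))).
  apply: eq_cintegral => u.
  have ip : cintegrable leb (fun t => phi (t + u)).
    apply: (@cintegrable_dom _ _ _ leb _ (normal_pdf (- u) s)).
    - by apply: cmeasurable_comp => //; apply: measurable_funD.
    - exact: integrable_normal.
    - by move=> t; rewrite nphi !normal_pdfEx// subr0 opprK.
  have [M1 M2] := fourier_multiplication ip ipsi.
  transitivity ((kn n u)%:C * cintegral leb setT (fun t => phi (t + u) * psih t)).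
    by rewrite -cintegralZl//; apply: eq_cintegral => t; rewrite fE mulrA.
  have FE : fourier (fun t => phi (t + u)) = fun w => cexpi (w * u) * (ghat w)%:C.
    by apply/funext => w; exact: fourier_shift_wave_packet.
  rewrite M2 FE -cintegralZl.
    by apply: eq_cintegral.
  apply: (@cintegrable_dom _ _ _ leb _ (normal_pdf b r)).
  - apply: cmeasurableM; last exact: cintegrable_cmeasurable ipsi.
    apply: cmeasurableM; last by apply: cmeasurable_real; exact: mgh.
    by apply: cmeasurable_expi; apply: measurable_funM.
  - exact: integrable_normal.
  - move=> w; have /andP[g0 g1] := gh1 w.
    rewrite !Normc.normcM !normc_real normc_expi mul1r (ger0_norm g0).
    by rewrite (ger0_norm (normal_pdf_ge0 _ _ _)) ler_piMl// normal_pdf_ge0.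
rewrite (Fubini_cintegral (m1 := leb) (m2 := leb) mg (ikn n) (integrable_normal b r) gAB).
apply: eq_cintegral => w; rewrite -kn_transform mulrC -cintegralZl.
  by apply: eq_cintegral => u; rewrite gE; ring.
apply: (@cintegrable_dom _ _ _ leb _ (kn n)) => //.
  apply: cmeasurableM; first by apply: cmeasurable_real; exact: mkn.
  by apply: cmeasurable_expi; apply: measurable_funM.
by move=> u; rewrite Normc.normcM normc_expi mulr1 normc_real ger0_norm.
Qed.

(** The Fourier transform of the memory term is that of the wave packet times
    the conjugate of the boundary value of the Laplace transform of the kernel;
    the conjugation comes from the shift to later times. *)
Lemma memory_symbol :
  cintegrable leb (fun t => memory phi t * psih t) /\
  cintegrable leb (fun w => (ktr k cos w +i* ktr k sin w) * ((ghat w)%:C * psi w)) /\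
  cintegral leb setT (fun t => memory phi t * psih t) =
  cintegral leb setT (fun w => (ktr k cos w +i* ktr k sin w) * ((ghat w)%:C * psi w)).
Proof.
have [L1 L2] : cintegrable leb (fun t => memory phi t * psih t) /\
    ccvg (fun n => cintegral leb setT (fun t => mem_n n t * psih t))
      (cintegral leb setT (fun t => memory phi t * psih t)).
  have cv t : ccvg (fun n => mem_n n t * psih t) (memory phi t * psih t).
    by apply: ccvgMr; exact: mem_n_cvg.
  apply: (@dominated_cintegral _ _ _ leb _ _ (fun t => 2 * B * E t)).
  - by move=> n; have [] := mem_nE n.
  - by apply: (cmeasurable_ccvg (f_ := fun n t => mem_n n t * psih t)) => // n; have [] := mem_nE n.
  - exact: integrable_EFinZ.
  - apply: aeW => t; split => // n.
    by rewrite Normc.normcM normc_psih ler_wpM2r// expR_ge0.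
have mgp : cmeasurable (fun w => (ghat w)%:C * psi w).
  by apply: cmeasurableM; [apply: cmeasurable_real; exact: mgh|exact: cintegrable_cmeasurable ipsi].
have [R1 R2] : cintegrable leb (fun w => (ktr k cos w +i* ktr k sin w) * ((ghat w)%:C * psi w)) /\
    ccvg (fun n => cintegral leb setT (fun w => Kt_n n w * ((ghat w)%:C * psi w)))
      (cintegral leb setT (fun w => (ktr k cos w +i* ktr k sin w) * ((ghat w)%:C * psi w))).
  apply: (@dominated_cintegral _ _ _ leb _ _ (fun w => 2 * (normal_pdf b r w * dominator k C al (w + 0)))).
  - move=> n; apply: cmeasurableM => //.
    by split; apply: continuous_measurable_fun; exact: (continuous_trunc_transform sk).
  - by apply: cmeasurableM => //; split; exact: (measurable_ktr sk).
  - apply: integrable_EFinZ; apply: (@integrable_dominator_weight _ _ _ _ _ sk _ (normal_peak r)).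
      exact: integrable_normal.
    by move=> w; rewrite normal_pdf_ge0 normal_pdf_ub// gt_eqF.
  - have := @ae_neq0 R; apply: ae_leb_imply => w w0; split=> [n|].
      have /andP[g0 g1] := gh1 w.
      rewrite addr0 !Normc.normcM !normc_real (ger0_norm g0) (ger0_norm (normal_pdf_ge0 _ _ _)).
      have dn c : trigonometric c -> `|trunc_transform k c 0 w n%:R| <= dominator k C al w.
        by move=> tc; exact: (trunc_transform_dominated sk).
      have h1 : Normc.normc (Kt_n n w) <= 2 * dominator k C al w.
        apply: le_trans (normc_le_ReIm _) _; rewrite mulr2n mulrDl mul1r.
        by apply: lerD; exact: dn.
      have n0 : 0 <= normal_pdf b r w := normal_pdf_ge0 _ _ _.
      apply: (@le_trans _ _ (2 * dominator k C al w * normal_pdf b r w)).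
        apply: ler_pM => //; [exact: normc_ge0|exact: mulr_ge0|].
        by rewrite ler_piMl.
      by rewrite le_eqVlt; apply/orP; left; apply/eqP; ring.
    apply: ccvgMr; split => /=; rewrite ktrE//.
      exact: (cvgn_trunc_transform sk).
    exact: (cvgn_trunc_transform sk).
split=> //; split=> //; apply: ccvg_unique L2 _.
rewrite (_ : (fun n => _) = fun n => cintegral leb setT (fun w => Kt_n n w * ((ghat w)%:C * psi w))) //.
by apply/funext => n; have [] := mem_nE n.
Qed.

End memory_symbol.

(** * Total mass from Gaussian tests *)

Section gaussian_average.
Context {R : realType}.
Notation leb := (@lebesgue_measure R).
Implicit Types (f : R -> R) (s w a : R).

Definition gaussian_average s f w := \int[leb]_a (f a * normal_pdf w s a).

Lemma integrable_average s f w M : measurable_fun setT f -> (forall x, 0 <= f x <= M) ->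
  leb.-integrable setT (EFin \o (fun a => f a * normal_pdf w s a)).
Proof.
move=> mf fM; apply: (@integrable_dom _ _ _ leb _ (fun a => M * normal_pdf w s a)).
- by apply: measurable_funM => //; exact: measurable_normal.
- by apply: integrable_EFinZ; exact: integrable_normal.
- move=> a; have /andP[f0 f1] := fM a.
  by rewrite normrM (ger0_norm f0) (ger0_norm (normal_pdf_ge0 _ _ _)) ler_wpM2r// normal_pdf_ge0.
Qed.

Lemma gaussian_average_ge0 s f w : (forall x, 0 <= f x) -> 0 <= gaussian_average s f w.
Proof. by move=> f0; apply: Rintegral_ge0 => a _; rewrite mulr_ge0// normal_pdf_ge0. Qed.

(** By Tonelli, averaging the test function is dual to averaging the weight.
    The map [p] transports points between the two measurable structures on the
    line. *)
Lemma integral_gaussian_average {d} {T : measurableType d}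
    (m : {sigma_finite_measure set T -> \bar R}) (p : T -> R) s f (G : T -> R) M :
  measurable_fun setT p -> 0 < s -> measurable_fun setT f -> (forall x, 0 <= f x <= M) ->
  measurable_fun setT G -> (forall x, 0 <= G x) ->
  (\int[m]_w (G w * gaussian_average s f (p w))%:E =
   \int[leb]_a ((f a)%:E * \int[m]_w (G w * normal_pdf a s (p w))%:E))%E.
Proof.
move=> mp s0 mf fM mG G0.
have f0 x : 0 <= f x by have /andP[] := fM x.
pose h (z : R * T) := (f z.1 * (G z.2 * normal_pdf z.1 s (p z.2)))%:E.
have mh : measurable_fun setT h.
  apply/measurable_EFinP; apply: measurable_funM; first exact: (measurableT_comp mf measurable_fst).
  apply: measurable_funM; first exact: (measurableT_comp mG measurable_snd).
  rewrite (_ : (fun z : R * T => _) = fun z : R * T => normal_pdf 0 s (p z.2 - z.1)).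
    apply: (measurableT_comp (measurable_normal 0 s)); apply: measurable_funB => //.
    exact: (measurableT_comp mp measurable_snd).
  by apply/funext => z; rewrite !normal_pdfEx// subr0.
have h0 z : (0 <= h z)%E by rewrite lee_fin !mulr_ge0// normal_pdf_ge0.
have TF := @fubini_tonelli _ _ _ _ R leb m h mh h0.
transitivity (\int[m]_w \int[leb]_a h (a, w))%E; last first.
  rewrite -TF; apply: eq_integral => a _.
  have mN : measurable_fun setT (fun w : T => (G w * normal_pdf a s (p w))%:E).
    apply/measurable_EFinP; apply: measurable_funM => //.
    exact: (measurableT_comp (measurable_normal a s) mp).
  rewrite -(@ge0_integralZl _ _ _ m _ measurableT _ mN (f a)%:E) ?lee_fin//.
  by move=> w _; rewrite lee_fin mulr_ge0// normal_pdf_ge0.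
apply: eq_integral => w _.
rewrite EFinM /gaussian_average /Rintegral fineK; last first.
  exact: integrable_fin_num (integrable_average s (p w) mf fM).
have mN : measurable_fun setT (fun a => (f a * normal_pdf (p w) s a)%:E).
  by apply/measurable_EFinP; apply: measurable_funM => //; exact: measurable_normal.
rewrite -(@ge0_integralZl _ _ _ leb _ measurableT _ mN (G w)%:E).
- by apply: eq_integral => a _; rewrite /h /= -EFinM (normal_pdf_sym a (p w) s0) mulrCA.
- by move=> a _; rewrite lee_fin mulr_ge0// normal_pdf_ge0.
- by rewrite lee_fin.
Qed.

Lemma measurable_average s f M : 0 < s -> measurable_fun setT f -> (forall x, 0 <= f x <= M) ->
  measurable_fun setT (gaussian_average s f).
Proof.
move=> s0 mf fM; have f0 x : 0 <= f x by have /andP[] := fM x.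
pose h (z : R * R) := (f z.2 * normal_pdf z.1 s z.2)%:E.
have mh : measurable_fun setT h.
  apply/measurable_EFinP; apply: measurable_funM; first exact: (measurableT_comp mf measurable_snd).
  rewrite (_ : (fun z : R * R => _) = fun z : R * R => normal_pdf z.2 s z.1).
    exact: measurable_normal2.
  by apply/funext => z; exact: normal_pdf_sym.
have h0 z : (0 <= h z)%E by rewrite lee_fin mulr_ge0// normal_pdf_ge0.
apply/measurable_EFinP; rewrite (_ : _ \o _ = fun w => (\int[leb]_a h (w, a))%E).
  exact: (measurable_fun_fubini_tonelli_F (m2 := leb) h mh h0).
apply/funext => w; rewrite /= /gaussian_average /Rintegral fineK//.
exact: integrable_fin_num (integrable_average s w mf fM).
Qed.

Let c1 (w : R) := (1 + w ^+ 2)^-1.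

Let c1_ge0 w : 0 <= c1 w. Proof. by rewrite invr_ge0 ltW// oneDsqr_gt0'. Qed.

Lemma cauchy_le1 w : 0 <= (1 + w ^+ 2)^-1 <= 1.
Proof. by rewrite c1_ge0 invf_le1 ?oneDsqr_gt0'// lerDl sqr_ge0. Qed.

(** Peetre's inequality. *)
Lemma cauchy_peetre a w : (1 + a ^+ 2)^-1 <= 2 * (1 + (a - w) ^+ 2) * (1 + w ^+ 2)^-1.
Proof.
rewrite ler_pdivlMr ?oneDsqr_gt0'// mulrC ler_pdivrMr ?oneDsqr_gt0'//.
have := sqr_ge0 (2 * a - w); have := sqr_ge0 (a * (a - w)); nra.
Qed.

Let integrable_moment_dom (c0 c2 s w : R) : leb.-integrable setT (EFin \o
  (fun a => c0 * normal_pdf w s a + c2 * normal_pdf w (2 * s) a)).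
Proof. by apply: integrable_EFinD; apply: integrable_EFinZ; exact: integrable_normal. Qed.

Let integral_moment_dom (c0 c2 s w : R) :
  \int[leb]_a (c0 * normal_pdf w s a + c2 * normal_pdf w (2 * s) a) = c0 + c2.
Proof.
rewrite RintegralD; [|exact: measurableT|by apply: integrable_EFinZ; exact: integrable_normal|
  by apply: integrable_EFinZ; exact: integrable_normal].
rewrite RintegralZl; [|exact: measurableT|exact: integrable_normal].
rewrite RintegralZl; [|exact: measurableT|exact: integrable_normal].
by rewrite !Rintegral_normal !mulr1.
Qed.

(** The Cauchy weight is comparable to its averages: the upper bound provides
    domination, the lower bound below integrability. *)
Lemma cauchy_average_le s w : 0 < s -> s <= 1 ->
  gaussian_average s (fun a => (1 + a ^+ 2)^-1) w <= 18 * (1 + w ^+ 2)^-1.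
Proof.
move=> s0 s1; have cw := c1_ge0 w; rewrite -/(c1 w).
apply: (@le_trans _ _ (2 * c1 w + 2 * c1 w * (8 * s ^+ 2))); last first.
  have : s ^+ 2 <= 1 by rewrite expr_le1// ltW.
  by move=> h; have := ler_wpM2l cw h; lra.
rewrite -(integral_moment_dom _ _ s w); apply: le_Rintegral => //.
- by apply: (@integrable_average _ _ _ 1); [exact: measurable_cauchy|exact: cauchy_le1].
move=> a _; have n0 := normal_pdf_ge0 w s a; have n2 := normal_moment2 w a s0.
apply: le_trans (ler_wpM2r n0 (cauchy_peetre a w)) _; rewrite -/(c1 w).
have := ler_wpM2l cw n2; lra.
Qed.

Lemma cauchy_average_ge w :
  (1 + w ^+ 2)^-1 / 4 <= gaussian_average (4^-1) (fun a => (1 + a ^+ 2)^-1) w.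
Proof.
have s0 : 0 < 4^-1 :> R by rewrite invr_gt0.
have cw := c1_ge0 w; rewrite -/(c1 w).
have -> : c1 w / 4 = c1 w / 2 + - (c1 w / 2) * (8 * (4^-1) ^+ 2) by field.
rewrite -(integral_moment_dom _ _ 4^-1 w); apply: le_Rintegral => //.
- by apply: (@integrable_average _ _ _ 1); [exact: measurable_cauchy|exact: cauchy_le1].
move=> a _; have n0 := normal_pdf_ge0 w 4^-1 a; have n2 := normal_moment2 w a s0.
have p := cauchy_peetre w a; rewrite -/(c1 w) -/(c1 a) in p *.
have ca := c1_ge0 a; have x2 := sqr_ge0 (w - a).
rewrite -sqrrN opprB in n2.
have p' : c1 w / 2 - c1 w / 2 * (w - a) ^+ 2 <= c1 a.
  have q : 0 <= c1 a * (w - a) ^+ 2 := mulr_ge0 ca x2.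
  have q4 : 0 <= c1 a * (w - a) ^+ 2 * (w - a) ^+ 2 := mulr_ge0 q x2.
  have [x1|x1] := leP ((w - a) ^+ 2) 1; last by nra.
  have : 0 <= 1 - (w - a) ^+ 2 by rewrite subr_ge0.
  by move=> y0; have := ler_wpM2r y0 p; lra.
have h := ler_wpM2r n0 p'; have cw2 : 0 <= c1 w / 2 by rewrite divr_ge0.
have h2 := ler_wpM2l cw2 n2; lra.
Qed.

End gaussian_average.

Section sigma_finite_instance.
Context {d : measure_display} {T : measurableType d} {R : realType}.
Variable mu : {measure set T -> \bar R}.

(** The proof argument lets the sigma-finite structure be inferred. *)
Definition sigma_finite_copy (h : sigma_finite setT mu) : set T -> \bar R := mu.

HB.instance Definition _ h := Measure.on (sigma_finite_copy h).

HB.instance Definition _ h :=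
  @Measure_isSigmaFinite.Build d T R (sigma_finite_copy h) h.

End sigma_finite_instance.

Section spectral_mass.
Context {R : realType}.
Notation leb := (@lebesgue_measure R).
Variables (nu : {measure set R -> \bar R}) (D tau : R -> R) (l c : R).
Hypotheses (l0 : 0 < l) (lD : forall w, l <= D w) (mD : measurable_fun setT D)
  (cD : forall w, w != 0 -> {for w, continuous D})
  (Dc : forall w, (D w)^-1 <= c * (1 + w ^+ 2)^-1)
  (mtau : measurable_fun setT tau) (tau0 : forall w, 0 <= tau w)
  (itau : leb.-integrable setT (EFin \o (fun w => tau w * (1 + w ^+ 2)^-1)))
  (iN : forall a s, 0 < s -> leb.-integrable setT (EFin \o (fun w => tau w * normal_pdf a s w)))
  (ac : nu `<< leb)
  (H : forall a s, 0 < s -> (\int[nu]_w (D w * normal_pdf a s w)%:E)%E =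
    (\int[leb]_w (tau w * normal_pdf a s w))%:E).

Let D0 w : 0 < D w. Proof. exact: lt_le_trans (lD w). Qed.

Let c1 (w : R) := (1 + w ^+ 2)^-1.

Let mc1 : measurable_fun setT c1. Proof. exact: measurable_cauchy. Qed.

Let c1_ge0 w : 0 <= c1 w. Proof. by have /andP[] := cauchy_le1 w. Qed.

Let c_ge0 : 0 <= c.
Proof.
have := Dc 0; rewrite expr0n /= addr0 invr1 mulr1; apply: le_trans.
by rewrite invr_ge0 ltW.
Qed.

Let mDV : measurable_fun setT (fun w => (D w)^-1).
Proof.
rewrite (_ : (fun w => _) = fun w => D w `^ (-1)); last first.
  by apply/funext => w; rewrite powR_inv1// ltW.
exact: (measurableT_comp (measurable_powR _) mD).
Qed.

(** The Gaussian integrals themselves bound the mass of bounded intervals. *)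
Let sigma_finite_nu : sigma_finite setT nu.
Proof.
exists (fun n : nat => `[- n%:R, n%:R]%classic).
  apply/seteqP; split=> // x _; have [n _ h] := near_symmetric_itv x.
  by exists n => //; apply: h => /=; exact: leqnn.
move=> n; split; first exact: measurable_itv.
pose e := l * normal_pdf 0 1 n%:R.
have e0 : 0 < e.
  by rewrite /e normal_pdfEx// mulr_gt0// mulr_gt0 ?expR_gt0// normal_peak_gt0// oner_neq0.
pose J := `[- n%:R, n%:R]%classic : set R.
have mJ : measurable J by exact: measurable_itv.
change (nu J < +oo)%E.
have h : (e%:E * nu J <= (\int[leb]_w (tau w * normal_pdf 0 1 w))%:E)%E.
  rewrite -H//.
  have mF : measurable_fun setT (fun w => (D w * normal_pdf 0 1 w)%:E).
    by apply/measurable_EFinP; apply: measurable_funM => //; exact: measurable_normal.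
  have F0 w : (0 <= (D w * normal_pdf 0 1 w)%:E)%E.
    by rewrite lee_fin mulr_ge0 ?normal_pdf_ge0// ltW.
  apply: (@le_trans _ _ (\int[nu]_(w in J) (D w * normal_pdf 0 1 w)%:E)%E); last first.
    by apply: ge0_subset_integral => //; exact: mJ.
  rewrite -integral_cst; last exact: mJ.
  apply: ge0_le_integral => //.
  - by move=> w _; rewrite lee_fin ltW.
  - exact: measurable_funTS.
  - move=> w; rewrite /J/= in_itv/= -ler_norml => wn; rewrite lee_fin /e.
    apply: ler_pM => //; [exact: ltW|exact: normal_pdf_ge0|].
    rewrite !normal_pdfEx// ler_wpM2l//; first by rewrite ltW// normal_peak_gt0// oner_neq0.
    rewrite ler_expR !subr0 !mulNr lerN2 ler_wpM2r ?invr_ge0//.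
    by rewrite -(real_normK (num_real w)) ler_sqr ?nnegrE.
rewrite ltNge; apply/negP => /(le_trans _) hy; move: h.
have -> : nu J = +oo%E by apply/eqP; rewrite -leye_eq; exact: hy.
by rewrite gt0_muley// ?leye_eq// lte_fin.
Qed.

Let nus := sigma_finite_copy sigma_finite_nu.

Let duality s (f : R -> R) (M : R) : 0 < s -> measurable_fun setT f -> (forall x, 0 <= f x <= M) ->
  (\int[nu]_w (D w * gaussian_average s f w)%:E =
   \int[leb]_w (tau w * gaussian_average s f w)%:E)%E.
Proof.
move=> s0 mf fM.
have H1 := @integral_gaussian_average R _ _ leb id s f tau M (@measurable_id _ _ _) s0 mf fM mtau tau0.
have H2 := @integral_gaussian_average R _ _ nus id s f D M (@measurable_id _ _ _) s0 mf fM mD (fun w => ltW (D0 w)).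
rewrite [RHS]H1 [LHS]H2; apply: eq_integral => a _; congr (_ * _)%E; rewrite [LHS]H// fineK//.
exact: integrable_fin_num (iN a s0).
Qed.

Let cauchy01 w : 0 <= c1 w <= 1. Proof. exact: cauchy_le1. Qed.

(** One average of width [1 / 4] suffices, because the Cauchy weight is at most
    four times this average. *)
Let integrable_Dcauchy : nu.-integrable setT (EFin \o (fun w => D w * c1 w)).
Proof.
have s0 : 0 < 4^-1 :> R by rewrite invr_gt0.
have s1 : 4^-1 <= 1 :> R by rewrite invf_le1 ?ler1n.
have mA := measurable_average s0 mc1 cauchy01.
have A0 w : 0 <= gaussian_average 4^-1 c1 w by exact: gaussian_average_ge0.
apply/integrableP; split; first by apply/measurable_EFinP; exact: measurable_funM.
apply: (@le_lt_trans _ _ (\int[nu]_w (4%:E * (D w * gaussian_average 4^-1 c1 w)%:E))%E).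
  apply: ge0_le_integral => //.
  - by apply: measurableT_comp => //; apply/measurable_EFinP; exact: measurable_funM.
  - apply/measurable_EFinP; apply: measurable_funM => //; exact: measurable_funM.
  - move=> w _; rewrite /= lee_fin ger0_norm; last by rewrite mulr_ge0// ltW.
    rewrite mulrCA ler_wpM2l//; first exact: ltW.
    by rewrite -ler_pdivrMl// mulrC; exact: cauchy_average_ge.
rewrite ge0_integralZl//; last 2 first.
- by apply/measurable_EFinP; exact: measurable_funM.
- by move=> w _; rewrite lee_fin mulr_ge0// ltW.
rewrite (duality s0 mc1 cauchy01) lte_mul_pinfty//.
have iT : leb.-integrable setT (EFin \o (fun w => tau w * gaussian_average 4^-1 c1 w)).
  apply: (@integrable_dom _ _ _ leb _ (fun w => 18 * (tau w * c1 w))).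
  - exact: measurable_funM.
  - exact: integrable_EFinZ.
  - move=> w; rewrite ger0_norm ?mulr_ge0// mulrCA ler_wpM2l//.
    exact: cauchy_average_le.
by have /integrable_fin_num := iT; rewrite fin_numE ltey => /(_ measurableT)/andP[].
Qed.

Let f2 w := (D w)^-1.

Let f2_bound w : 0 <= f2 w <= c.
Proof.
rewrite invr_ge0 (ltW (D0 w))/=; apply: le_trans (Dc w) _.
by rewrite ler_piMr//; have /andP[] := cauchy01 w.
Qed.

Let average_f2_le s w : 0 < s -> s <= 1 -> gaussian_average s f2 w <= 18 * c * c1 w.
Proof.
move=> s0 s1; rewrite mulrAC mulrC; apply: le_trans (ler_wpM2l c_ge0 (cauchy_average_le w s0 s1)).
rewrite /gaussian_average -RintegralZl; [|exact: measurableT|exact: (integrable_average _ _ mc1 cauchy01)].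
apply: le_Rintegral => //.
- exact: (integrable_average _ _ mDV f2_bound).
- by apply: integrable_EFinZ; exact: (integrable_average _ _ mc1 cauchy01).
- by move=> a _; rewrite mulrA ler_wpM2r ?normal_pdf_ge0//; exact: Dc.
Qed.

(** The Gaussian tests determine the total mass: averaging [1 / D] against
    narrow Gaussians recovers it [nu]-almost everywhere. *)
Lemma spectral_mass : nu setT = (\int[leb]_w (tau w / D w))%:E.
Proof.
pose s_ (n : nat) : R := n.+1%:R^-1.
have s0 n : 0 < s_ n by rewrite invr_gt0.
have s1 n : s_ n <= 1 by rewrite invf_le1// ler1n.
have A0 n w : 0 <= gaussian_average (s_ n) f2 w.
  by apply: gaussian_average_ge0 => x; have /andP[] := f2_bound x.
have mA n := measurable_average (s0 n) mDV f2_bound.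
have cA w : w != 0 -> gaussian_average (s_ n) f2 w @[n --> \oo] --> f2 w.
  move=> w0; apply: (@gaussian_average_cvg _ f2 c) => //.
    by move=> x; have /andP[h1 h2] := f2_bound x; rewrite ger0_norm.
  by apply: cvgV; [rewrite gt_eqF|exact: cD].
have [i1 cv1] : nu.-integrable setT (EFin \o (fun=> 1 : R)) /\
    \int[nu]_w (D w * gaussian_average (s_ n) f2 w) @[n --> \oo] --> \int[nu]_w (1 : R).
  apply: (@dominated_Rintegral _ _ _ nu _ _ (fun w => 18 * c * (D w * c1 w))).
  - by move=> n; exact: measurable_funM.
  - exact: measurable_cst.
  - exact: integrable_EFinZ.
  - exists [set 0]; split; first exact: measurable_set1.
      have N0 : nu.-null_set [set 0].
        apply: ac => A _ /subset_set1[] ->; first exact: measure0.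
        exact: lebesgue_measure_set1.
      by apply: N0 => //; exact: measurable_set1.
    move=> w /=; apply: contra_notP => /eqP w0; split=> [n|].
      rewrite ger0_norm; last by rewrite mulr_ge0// ltW.
      by rewrite mulrCA ler_wpM2l ?average_f2_le// ltW.
    rewrite -[X in _ --> X](mulfV (lt0r_neq0 (D0 w))).
    by apply: cvgM; [exact: cvg_cst|exact: cA].
have [_ cv2] : leb.-integrable setT (EFin \o (fun w => tau w * f2 w)) /\
    \int[leb]_w (tau w * gaussian_average (s_ n) f2 w) @[n --> \oo] --> \int[leb]_w (tau w * f2 w).
  apply: (@dominated_leb _ _ _ (fun w => 18 * c * (tau w * c1 w))).
  - by move=> n; exact: measurable_funM.
  - exact: measurable_funM.
  - exact: integrable_EFinZ.
  - have := @ae_neq0 R; apply: ae_leb_imply => w w0; split=> [n|].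
      rewrite ger0_norm ?mulr_ge0//.
      by rewrite mulrCA ler_wpM2l ?average_f2_le.
    by apply: cvgM; [exact: cvg_cst|exact: cA].
have E : (fun n => \int[nu]_w (D w * gaussian_average (s_ n) f2 w)) =
    (fun n => \int[leb]_w (tau w * gaussian_average (s_ n) f2 w)).
  by apply/funext => n; rewrite /Rintegral (duality (s0 n) mDV f2_bound).
rewrite E in cv1; have <- := cvg_unique _ cv1 cv2; last by [].
rewrite /Rintegral fineK; last exact: integrable_fin_num i1.
by rewrite integral_cst// mul1e.
Qed.

End spectral_mass.

(** * The symbol of the velocity equation *)

(** Two densities with the same integrals against all Gaussians agree almost
    everywhere; this makes the Fourier transform of a functional a well defined
    function class. *)
Lemma gaussian_separation_complex {R : realType} (f g : R -> R[i]) :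
  cmeasurable f -> cmeasurable g ->
  (forall b r : R, 0 < r ->
    [/\ cintegrable (@lebesgue_measure R) (fun w => f w * (normal_pdf b r w)%:C),
        cintegrable (@lebesgue_measure R) (fun w => g w * (normal_pdf b r w)%:C) &
        cintegral (@lebesgue_measure R) setT (fun w => f w * (normal_pdf b r w)%:C) =
        cintegral (@lebesgue_measure R) setT (fun w => g w * (normal_pdf b r w)%:C)]) ->
  {ae @lebesgue_measure R, forall w, f w = g w}.
Proof.
move=> [f1 f2] [g1 g2] H.
have key (F G : R -> R) : measurable_fun setT F -> measurable_fun setT G ->
    (forall b r : R, 0 < r ->
      [/\ lebesgue_measure.-integrable setT (EFin \o (fun w : R => F w * normal_pdf b r w)),
        lebesgue_measure.-integrable setT (EFin \o (fun w : R => G w * normal_pdf b r w)) &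
        \int[lebesgue_measure]_w (F w * normal_pdf b r w) =
        \int[lebesgue_measure]_w (G w * normal_pdf b r w)]) ->
    {ae @lebesgue_measure R, forall w, F w = G w}.
  move=> mF mG h.
  have dE b r : (fun w => (F w - G w) * normal_pdf b r w) =
      fun w => F w * normal_pdf b r w - G w * normal_pdf b r w.
    by apply/funext => w; rewrite mulrBl.
  have i0 b r : 0 < r -> lebesgue_measure.-integrable setT
      (EFin \o (fun w : R => (F w - G w) * normal_pdf b r w)).
    move=> r0; have [i1 i2 e] := h b r r0; rewrite dE.
    rewrite (_ : (fun w => _) = fun w => F w * normal_pdf b r w + (-1) * (G w * normal_pdf b r w)).
      by apply: integrable_EFinD => //; exact: integrable_EFinZ.
    by apply/funext => w; rewrite mulN1r.
  have z0 b r : 0 < r -> \int[lebesgue_measure]_w ((F w - G w) * normal_pdf b r w) = 0.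
    by move=> r0; have [i1 i2 e] := h b r r0; rewrite dE RintegralB// e subrr.
  have s : {ae @lebesgue_measure R, forall w, F w - G w = 0}.
    exact: gaussian_separation i0 z0.
  move: s.
  by apply: ae_leb_imply => w /eqP; rewrite subr_eq0 => /eqP.
have hRe (h : R -> R[i]) b r : (fun w => complex.Re (h w * (normal_pdf b r w)%:C)) =
    fun w => complex.Re (h w) * normal_pdf b r w.
  by apply/funext => w; rewrite !ReImE /= mulr0 subr0.
have hIm (h : R -> R[i]) b r : (fun w => complex.Im (h w * (normal_pdf b r w)%:C)) =
    fun w => complex.Im (h w) * normal_pdf b r w.
  by apply/funext => w; rewrite !ReImE /= mulr0 add0r.
have h1 : {ae @lebesgue_measure R, forall w, complex.Re (f w) = complex.Re (g w)}.
  apply: (key _ _ f1 g1) => b r r0; have [[i1 _] [i2 _] e] := H b r r0.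
  split.
  - by move: i1; rewrite (_ : (fun w => _) = EFin \o (fun w => complex.Re (f w) * normal_pdf b r w))// -hRe.
  - by move: i2; rewrite (_ : (fun w => _) = EFin \o (fun w => complex.Re (g w) * normal_pdf b r w))// -hRe.
  - by move/(congr1 (@complex.Re R)) : e; rewrite /cintegral /= !hRe.
have h2 : {ae @lebesgue_measure R, forall w, complex.Im (f w) = complex.Im (g w)}.
  apply: (key _ _ f2 g2) => b r r0; have [[_ i1] [_ i2] e] := H b r r0.
  split.
  - by move: i1; rewrite (_ : (fun w => _) = EFin \o (fun w => complex.Im (f w) * normal_pdf b r w))// -hIm.
  - by move: i2; rewrite (_ : (fun w => _) = EFin \o (fun w => complex.Im (g w) * normal_pdf b r w))// -hIm.
  - by move/(congr1 (@complex.Im R)) : e; rewrite /cintegral /= !hIm.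
move: h2; apply: (@filterS2 _ _ (ae_filter_ringOfSetsType _) _ _ _ _ h1) => w e1 e2.
exact: eq_ReIm.
Qed.

Section symbol.
Context {R : realType}.
Notation leb := (@lebesgue_measure R).
Variables (m lam beta : R) (K : R -> \bar R) (k' : R -> R) (C al : R).
Let k := causal_kernel K.
Hypotheses (K1 : kernel_I K) (sk : slow_kernel k k' C al).
Implicit Types (s a b r w t : R).

(** The Fourier multiplier of [Psi] is the conjugate of the boundary impedance,
    because [Psi] is the adjoint of the operator of the velocity equation. *)
Definition symbol w : R[i] := resistance k lam beta w +i* - reactance k m beta w.

Let tcos := @trigonometric_cos R.
Let tsin := @trigonometric_sin R.

Lemma cmeasurable_symbol : cmeasurable symbol.
Proof.
split=> /=; first exact: (measurable_resistance sk).
apply: measurableT_comp => //; apply: measurable_funB; first exact: measurable_funM.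
by apply: measurable_funM => //; exact: (measurable_ktr sk tsin).
Qed.

Lemma normc_symbol_sqr w : Normc.normc (symbol w) ^+ 2 = impedance_sqr k m lam beta w.
Proof. by rewrite normc_sqrE /= sqrrN. Qed.

Section wave_packet_test.
Variables s a : R.
Hypothesis s0 : 0 < s.

Let phi := wave_packet 0 s a.

Definition packet_hat w := expR (- (s ^+ 2 * (a - w) ^+ 2 / 2)).

Lemma measurable_packet_hat : measurable_fun setT packet_hat.
Proof.
apply: measurableT_comp => //; apply: measurableT_comp => //; apply: measurable_funM => //.
by apply: measurable_funM => //; apply: measurable_funX; apply: measurable_funB.
Qed.

Lemma fourier_packet w : fourier phi w = (packet_hat w)%:C.
Proof. by rewrite fourier_wave_packet// mulr0 cexpi0 mul1r. Qed.

Lemma Psi_wave_packet t : Psi m lam beta K phi t =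
  - m%:C * cderive phi t + lam%:C * phi t + beta%:C * memory k phi t.
Proof.
rewrite /Psi; congr (_ + _ * _).
apply: (cintegral_causal_kernel K1 (g := fun u => phi (t + u))).
apply: (cmeasurable_comp (f := phi)); last exact: measurable_funD.
by apply: schwartz_cmeasurable; exact: schwartz_wave_packet.
Qed.

(** The three terms of [Psi] are transformed one by one; against Gaussian
    test functions all integrals converge absolutely. *)
Lemma Psi_symbol b r : 0 < r ->
  cintegrable leb (fun w => symbol w * (packet_hat w)%:C * (normal_pdf b r w)%:C) /\
  fourier_dist (Psi_dist m lam beta K phi) (fun w => (normal_pdf b r w)%:C) =
  cintegral leb setT (fun w => symbol w * (packet_hat w)%:C * (normal_pdf b r w)%:C).
Proof.
move=> r0; set psi : R -> R[i] := fun w => (normal_pdf b r w)%:C.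
have iphi : cintegrable leb phi by apply: schwartz_cintegrable; exact: schwartz_wave_packet.
have ipsi : cintegrable leb psi by apply: schwartz_cintegrable; exact: gaussian_schwartz.
have [idphi _] := fourier_derive_wave_packet a 0 s0.
have [I1 E1] := fourier_multiplication idphi ipsi; have [J1 _] := fourier_multiplication ipsi idphi.
have [I2 E2] := fourier_multiplication iphi ipsi; have [J2 _] := fourier_multiplication ipsi iphi.
have [I3 [J3 E3]] := memory_symbol sk a b s0 r0.
have SE : (fun w => symbol w * (packet_hat w)%:C * psi w) = fun w =>
    (- m%:C * (psi w * fourier (cderive phi) w) + lam%:C * (psi w * fourier phi w)) +
    beta%:C * ((ktr k cos w +i* ktr k sin w) * ((packet_hat w)%:C * psi w)).
  apply/funext => w; have [_ ->] := fourier_derive_wave_packet a w s0.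
  rewrite -/phi fourier_packet; apply: eq_ReIm; rewrite !ReImE /= /resistance /reactance; ring.
have IS : cintegrable leb (fun w => - m%:C * (psi w * fourier (cderive phi) w) +
    lam%:C * (psi w * fourier phi w)).
  by apply: cintegrableD; exact: cintegrableZl.
rewrite SE; split.
  by apply: cintegrableD => //; exact: cintegrableZl.
rewrite /fourier_dist /Psi_dist /regular_dist.
transitivity (cintegral leb setT (fun t =>
    (- m%:C * (cderive phi t * fourier psi t) + lam%:C * (phi t * fourier psi t)) +
    beta%:C * (memory k phi t * fourier psi t))).
  by apply: eq_cintegral => t; rewrite Psi_wave_packet; ring.
rewrite cintegralD; last 2 first.
- by apply: cintegrableD; exact: cintegrableZl.
- exact: cintegrableZl.
rewrite cintegralD; last 2 first.
- exact: cintegrableZl.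
- exact: cintegrableZl.
rewrite cintegralZl// cintegralZl// cintegralZl// E1 E2 E3.
rewrite cintegralD; last 2 first.
- exact: IS.
- exact: cintegrableZl.
rewrite cintegralD; last 2 first.
- exact: cintegrableZl.
- exact: cintegrableZl.
rewrite !cintegralZl//; congr (_ * _ + _ * _ + _); apply: eq_cintegral => w; exact: mulrC.
Qed.

Lemma Psi_fourier_unique h : is_function (fourier_dist (Psi_dist m lam beta K phi)) h ->
  {ae leb, forall w, h w = symbol w * (packet_hat w)%:C}.
Proof.
move=> [mh H]; apply: gaussian_separation_complex => //.
  apply: cmeasurableM; first exact: cmeasurable_symbol.
  apply: cmeasurable_real; exact: measurable_packet_hat.
move=> b r r0; have [i1 E1] := Psi_symbol b r0.
have [i2 E2] := H _ (gaussian_schwartz b r0).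
by split=> //; rewrite -E1 E2.
Qed.

End wave_packet_test.
End symbol.

(** * The spectral mass of the weak solution *)

Section almost_everywhere.
Context {R : realType}.
Notation leb := (@lebesgue_measure R).

Lemma ae_dominates (nu : {measure set R -> \bar R}) (Q : R -> Prop) : nu `<< leb ->
  {ae leb, forall x, Q x} -> {ae nu, forall x, Q x}.
Proof.
move=> ac [A [mA A0 QA]]; exists A; split=> //.
have : nu.-null_set A.
  apply: ac => B mB BA; apply/eqP; rewrite -measure_le0 -A0.
  by apply: le_measure => //; rewrite inE.
by apply.
Qed.

Lemma ae_eq_Rintegral (f g : R -> R) : measurable_fun setT f -> measurable_fun setT g ->
  {ae leb, forall x, f x = g x} -> \int[leb]_x f x = \int[leb]_x g x.
Proof.
move=> mf mg fg; rewrite /Rintegral; congr fine; apply: ae_eq_integral => //; try exact/measurable_EFinP.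
by move: fg; apply: ae_leb_imply => x -> _.
Qed.

Lemma cintegral_real (f : R -> R) : cintegral leb setT (fun x => (f x)%:C) = (\int[leb]_x f x)%:C.
Proof.
apply: eq_ReIm => //=; rewrite /Rintegral.
by under eq_integral do rewrite /=; rewrite integral0.
Qed.

End almost_everywhere.

Section equipartition.
Context {d : measure_display} {Omega : measurableType d} {R : realType}.
Notation leb := (@lebesgue_measure R).
Variable P : probability Omega R.
Variables (m lam beta kBT : R) (K : R -> \bar R)
  (F Wdot : (R -> R[i]) -> Omega -> R[i]) (V : stationary_operator P).
Hypotheses (m0 : 0 < m) (lam0 : 0 < lam) (beta0 : 0 < beta) (kBT0 : 0 < kBT).
Hypothesis K1 : kernel_I K.
Hypotheses (W_density : has_spectral_density P Wdot (fun _ => 1))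
  (F_density : has_spectral_density P F (fun w => 2 * Kcos K w))
  (weak : weak_stationary_solution m lam beta kBT K F Wdot V).
Variables (k' : R -> R) (C al : R).
Let k := causal_kernel K.
Hypothesis sk : slow_kernel k k' C al.

Let kcos_ge0 : forall w, w != 0 -> 0 <= transform k cos 0 w.
Proof. by move=> w; exact: causal_kernel_cos_ge0. Qed.

Let nu := spectral_measure V.
Let tcos := @trigonometric_cos R.

Let ac : nu `<< leb. Proof. exact: spectral_measure_ac. Qed.

Let res w := resistance k lam beta w.
Let imp w := impedance_sqr k m lam beta w.

Let mres : measurable_fun setT res. Proof. exact: (measurable_resistance sk). Qed.

Let res_ge w : lam <= res w. Proof. exact: (resistance_ge kcos_ge0). Qed.

Lemma integrable_ktr_weight (g : R -> R) B : leb.-integrable setT (EFin \o g) ->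
  (forall w, 0 <= g w <= B) -> leb.-integrable setT (EFin \o (fun w => ktr k cos w * g w)).
Proof.
move=> ig gB; have i := integrable_dominator_weight sk 0 ig gB.
apply: (@integrable_dom _ _ _ leb _ _ _ i).
- by apply: measurable_funM; [exact: (measurable_ktr sk)|exact: integrable_measurable ig].
- move=> w; have /andP[g0 _] := gB w.
  by rewrite normrM (ger0_norm g0) mulrC addr0 ler_wpM2l//; exact: (ktr_dominated sk).
Qed.

Lemma integrable_resistance_weight (g : R -> R) B : leb.-integrable setT (EFin \o g) ->
  (forall w, 0 <= g w <= B) -> leb.-integrable setT (EFin \o (fun w => res w * g w)).
Proof.
move=> ig gB.
rewrite (_ : (fun w => _) = fun w => lam * g w + beta * (ktr k cos w * g w)).
  by apply: integrable_EFinD; apply: integrable_EFinZ => //; exact: integrable_ktr_weight gB.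
by apply/funext => w; rewrite /res /resistance mulrDl mulrA.
Qed.

Let measurable_Kcos : measurable_fun setT (Kcos K).
Proof.
have -> : Kcos K = fun w => ktr k cos w + Kcos K 0 * \1_[set 0] w.
  apply/funext => w; rewrite indicE; have [->|w0] := eqVneq w 0.
    by rewrite mem_set// mulr1 /ktr eqxx add0r.
  rewrite memNset ?mulr0 ?addr0; first by rewrite ktrE// KcosE.
  by move=> /= /eqP; rewrite (negbTE w0).
apply: measurable_funD; first exact: (measurable_ktr sk).
by apply: measurable_funM => //; apply: measurable_indic; exact: measurable_set1.
Qed.

Section one_packet.
Variables s a : R.
Hypothesis s0 : 0 < s.

Let phi := wave_packet 0 s a.
Let g w := packet_hat s a w ^+ 2.

Let mg : measurable_fun setT g.
Proof. by apply: measurable_funX; exact: measurable_packet_hat. Qed.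

Let gE w : g w = expR (- ((Num.sqrt 2 * s) ^+ 2 * (w - a) ^+ 2 / 2)).
Proof.
rewrite /g /packet_hat expr2 -expRD exprMn sqr_sqrtr// -(opprB a w) sqrrN.
by congr expR; field.
Qed.

Lemma integrable_packet_sqr : leb.-integrable setT (EFin \o (fun w => packet_hat s a w ^+ 2)).
Proof.
have c0 : 0 < Num.sqrt 2 * s by rewrite mulr_gt0// sqrtr_gt0.
have := integrable_translate (- a) (integrable_expsqr c0).
rewrite -/g (_ : g = fun w => expR (- ((Num.sqrt 2 * s) ^+ 2 * (w + - a) ^+ 2 / 2)))//.
by apply/funext => w; rewrite gE.
Qed.

Lemma packet_sqr01 w : 0 <= packet_hat s a w ^+ 2 <= 1.
Proof.
rewrite exprn_ge0 ?expR_ge0//= exprn_ile1 ?expR_ge0// expR_le1 oppr_le0.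
by rewrite divr_ge0// mulr_ge0// sqr_ge0.
Qed.

(** The isometry turns the variance of the left side of the weak equation into
    an integral against the spectral measure. *)
Lemma weak_solution_packet : (\int[nu]_w (imp w * g w)%:E =
  (kBT / pi * \int[leb]_w (res w * g w))%:E)%E.
Proof.
have sphi : schwartz phi by exact: schwartz_wave_packet.
have [dom _] := weak.1 phi sphi.
have [h [hf lh] si] := pairingP dom.
set X := pairing V _ in si.
have cov : correl P X X = (\int[nu]_w Normc.normc (h w) ^+ 2)%:C.
  rewrite -(stochastic_integral_norm (random_measureP V) lh si).
  exact: inner_sqnorm si.1.
have sqE : (\int[nu]_w (imp w * g w)%:E)%E = (\int[nu]_w Normc.normc (h w) ^+ 2)%:E.
  rewrite -L2_sqnormE// /sqnorm; apply: ae_eq_integral => //.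
  - apply/measurable_EFinP; apply: measurable_funM => //.
    exact: (measurable_impedance_sqr sk m lam beta).
  - by apply/measurable_EFinP; apply: measurable_sqr_normc; case: lh.
  - have := ae_dominates ac (Psi_fourier_unique K1 sk s0 hf).
    apply: filterS => w -> _; rewrite Normc.normcM exprMn normc_symbol_sqr normc_real.
    by rewrite ger0_norm// expR_ge0.
rewrite sqE; congr EFin.
have [_ /(_ phi phi sphi sphi)] := weak; rewrite -/X cov F_density// W_density//.
have FE (f : R -> R) : cintegral leb setT (fun w => (f w)%:C * (fourier phi w * (fourier phi w)^*)) =
    (\int[leb]_w (f w * g w))%:C.
  rewrite -cintegral_real; apply: eq_cintegral => w; rewrite /phi fourier_packet//.
  by apply: eq_ReIm; rewrite !ReImE /= /g; ring.
rewrite !FE => /(congr1 (@complex.Re R)).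
have -> : \int[leb]_w (2 * Kcos K w * g w) = \int[leb]_w (2 * (ktr k cos w * g w)).
  apply: ae_eq_Rintegral.
  - by apply: measurable_funM => //; exact: measurable_funM.
  - by apply: measurable_funM => //; apply: measurable_funM => //; exact: (measurable_ktr sk).
  - by have := @ae_neq0 R; apply: ae_leb_imply => w w0; rewrite ktrE// KcosE// mulrA.
have ig : leb.-integrable setT (EFin \o g) := integrable_packet_sqr.
have iK := integrable_ktr_weight ig packet_sqr01.
have -> : (fun w => 1 * g w) = g by apply/funext => w; rewrite mul1r.
rewrite RintegralZl; [|exact: measurableT|exact: iK].
have -> : \int[leb]_w (res w * g w) = lam * \int[leb]_w g w + beta * \int[leb]_w (ktr k cos w * g w).
  rewrite -RintegralZl; [|exact: measurableT|exact: ig].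
  rewrite -RintegralZl; [|exact: measurableT|exact: iK].
  rewrite -RintegralD; [|exact: measurableT|exact: integrable_EFinZ|exact: integrable_EFinZ].
  by apply: eq_Rintegral => w _; rewrite /res /resistance mulrDl mulrA.
move=> /= ->; set I1 := \int[leb]_w _; set I2 := \int[leb]_w _.
have p0 : (pi : R) != 0 by rewrite gt_eqF// pi_gt0.
by move: (pi : R) p0 => p p0; field.
Qed.

End one_packet.

(** Up to a constant, the squared transform of a wave packet is a normal density
    of arbitrary center and width. *)
Let weak_solution_gaussian a sg : 0 < sg ->
  (\int[nu]_w (imp w * normal_pdf a sg w)%:E)%E =
  (\int[leb]_w (kBT / pi * res w * normal_pdf a sg w))%:E.
Proof.
move=> sg0; pose s := (Num.sqrt 2 * sg)^-1.
have s2 : 0 < Num.sqrt 2 :> R by rewrite sqrtr_gt0.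
have s0 : 0 < s by rewrite invr_gt0 mulr_gt0.
have NE w : normal_pdf a sg w = normal_peak sg * packet_hat s a w ^+ 2.
  rewrite normal_pdfEx// /packet_hat [in RHS]expr2 -expRD; congr (_ * expR _).
  have sq : s ^+ 2 = (2 * sg ^+ 2)^-1 by rewrite exprVn exprMn sqr_sqrtr.
  rewrite sq -(opprB w a) sqrrN; have g0 : sg != 0 by rewrite gt_eqF.
  by field.
have W := weak_solution_packet a s0.
have p0 : 0 <= normal_peak sg :> R by rewrite ltW// normal_peak_gt0// gt_eqF.
have imp0 w : 0 <= imp w * packet_hat s a w ^+ 2.
  by rewrite mulr_ge0 ?exprn_ge0 ?expR_ge0// addr_ge0// sqr_ge0.
transitivity ((normal_peak sg)%:E * \int[nu]_w (imp w * packet_hat s a w ^+ 2)%:E)%E.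
  rewrite -ge0_integralZl//.
  - by apply: eq_integral => w _; rewrite -EFinM NE mulrCA.
  - apply/measurable_EFinP; apply: measurable_funM.
      exact: (measurable_impedance_sqr sk m lam beta).
    by apply: measurable_funX; exact: measurable_packet_hat.
  - by move=> w _; rewrite lee_fin.
rewrite W -EFinM; congr EFin.
have iR := integrable_resistance_weight (integrable_packet_sqr a s0) (packet_sqr01 s a).
rewrite mulrA -RintegralZl; [|exact: measurableT|exact: iR].
by apply: eq_Rintegral => w _; rewrite NE; ring.
Qed.

(** The noise density is proportional to the resistance, by fluctuation and
    dissipation, so that the mass is a multiple of the integral of the real part
    of the admittance. *)
Lemma spectral_mass_weak_solution : nu setT = (kBT / m)%:E.
Proof.
have p0 : 0 < (pi : R) := pi_gt0 R.
have c0 : 0 <= kBT / pi by rewrite divr_ge0// ltW.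
have [ir rE] := integral_response sk kcos_ge0 m0 lam0 beta0.
have iw (g : R -> R) B : leb.-integrable setT (EFin \o g) -> (forall w, 0 <= g w <= B) ->
    leb.-integrable setT (EFin \o (fun w => kBT / pi * res w * g w)).
  move=> ig gB; rewrite (_ : (fun w => _) = fun w => kBT / pi * (res w * g w)).
    by apply: integrable_EFinZ; exact: integrable_resistance_weight gB.
  by apply/funext => w; rewrite mulrA.
rewrite (@spectral_mass R nu imp (fun w => kBT / pi * res w) (lam ^+ 2)
  (decay_const k C al m lam beta (m / 2))).
- congr EFin; rewrite (_ : (fun w => _) = fun w => kBT / pi * (res w / imp w)); last first.
    by apply/funext => w; rewrite mulrA.
  rewrite RintegralZl; [|exact: measurableT|exact: ir].
  have Hq (p : R) : 0 < p -> kBT / p * (p / m) = kBT / m.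
    by move=> pp; field; rewrite !gt_eqF.
  by rewrite rE; exact: Hq.
- by rewrite exprn_gt0.
- move=> w; apply: (@le_trans _ _ (res w ^+ 2)); last by rewrite lerDl sqr_ge0.
  by rewrite ler_sqr ?nnegrE ?(ltW lam0)// (le_trans (ltW lam0)).
- exact: (measurable_impedance_sqr sk m lam beta).
- by move=> w w0; exact: (continuous_impedance_sqr sk w0).
- by move=> w; exact: (inv_impedance_sqr_le sk kcos_ge0 m0 lam0 beta0).
- exact: measurable_funM.
- by move=> w; rewrite mulr_ge0// (le_trans (ltW lam0)).
- by apply: (iw _ 1); [exact: integrable_cauchy|exact: cauchy_le1].
- move=> a s s0; apply: (iw _ (normal_peak s)); first exact: integrable_normal.
  by move=> w; rewrite normal_pdf_ge0 normal_pdf_ub// gt_eqF.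
- exact: ac.
- by move=> a s s0; exact: weak_solution_gaussian.
Qed.

End equipartition.

(** * The velocity at time zero *)

Section point_evaluation.
Context {R : realType}.
Notation leb := (@lebesgue_measure R).
Implicit Types (t : R) (phi psi : R -> R[i]).

Lemma fourier_function_unique (g : functional) (h1 h2 : R -> R[i]) :
  is_function (fourier_dist g) h1 -> is_function (fourier_dist g) h2 ->
  {ae leb, forall w, h1 w = h2 w}.
Proof.
move=> [m1 H1] [m2 H2]; apply: gaussian_separation_complex => // b r r0.
have [i1 E1] := H1 _ (gaussian_schwartz b r0); have [i2 E2] := H2 _ (gaussian_schwartz b r0).
by split=> //; rewrite -/(regular_dist h1 _) -E1 E2.
Qed.

Lemma tempered_delta t : tempered (delta_dist t).
Proof.
split; first by [].
exists 0%N, 1 => phi M _ /(_ 0%N 0%N isT isT t).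
by rewrite expr0 !mul1r.
Qed.

Lemma fourier_delta t : is_function (fourier_dist (delta_dist t)) (fun w => cexpi (- (t * w))).
Proof.
have mc : cmeasurable (fun w : R => cexpi (- (t * w))).
  by apply: cmeasurable_expi; apply: measurableT_comp => //; apply: measurable_funM.
split=> // psi sp; have ip := schwartz_cintegrable sp.
split; last by apply: eq_cintegral => w; rewrite mulrC [w * t]mulrC.
apply: (@cintegrable_dom _ _ _ leb _ (fun w => Normc.normc (psi w))).
- by apply: cmeasurableM => //; exact: schwartz_cmeasurable.
- exact: integrable_normc.
- by move=> w; rewrite Normc.normcM normc_expi mul1r.
Qed.

Variable r : R.
Hypothesis r0 : 0 < r.

Let phi : R -> R[i] := fun t => (normal_pdf 0 r t)%:C.

Let iphi : cintegrable leb phi.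
Proof. by apply: schwartz_cintegrable; exact: gaussian_schwartz. Qed.

Let integrable_gaussian_test psi : schwartz psi -> cintegrable leb (fun t => phi t * psi t).
Proof.
move=> sp; have [M M0 HM] := schwartz_decay sp.
apply: (@cintegrable_dom _ _ _ leb _ (fun t => M * normal_pdf 0 r t)).
- by apply: cmeasurableM; [exact: cintegrable_cmeasurable iphi|exact: schwartz_cmeasurable].
- by apply: integrable_EFinZ; exact: integrable_normal.
- move=> t; rewrite Normc.normcM normc_real (ger0_norm (normal_pdf_ge0 _ _ _)) mulrC.
  rewrite ler_wpM2r ?normal_pdf_ge0//; apply: le_trans (HM t) _.
  by rewrite ler_piMr//; have /andP[] := cauchy_le1 t.
Qed.

Lemma tempered_gaussian : tempered (regular_dist phi).
Proof.
split=> [c f g sf sg|].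
  rewrite /regular_dist -cintegralZl; last exact: integrable_gaussian_test.
  rewrite -cintegralD; [|apply: cintegrableZl; exact: integrable_gaussian_test|exact: integrable_gaussian_test].
  by apply: eq_cintegral => t; ring.
exists 0%N, 2 => psi M sp /(_ 0%N 0%N isT isT) HM.
have ip := integrable_gaussian_test sp.
apply: le_trans (normc_cintegral ip) _; rewrite ler_wpM2l//.
rewrite -[M]mulr1 -(Rintegral_normal 0 r) -RintegralZl; [|exact: measurableT|exact: integrable_normal].
apply: le_Rintegral => //.
- exact: integrable_normc.
- by apply: integrable_EFinZ; exact: integrable_normal.
- move=> t _; rewrite Normc.normcM normc_real (ger0_norm (normal_pdf_ge0 _ _ _)) mulrC.
  by rewrite ler_wpM2r ?normal_pdf_ge0//; have := HM t; rewrite expr0 mul1r.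
Qed.

Definition gaussian_hat t := expR (- (r ^+ 2 * t ^+ 2 / 2)).

Lemma gaussian_hat01 t : 0 <= gaussian_hat t <= 1.
Proof. by rewrite expR_ge0/= expR_le1 oppr_le0 divr_ge0// mulr_ge0// sqr_ge0. Qed.

Lemma measurable_gaussian_hat : measurable_fun setT gaussian_hat.
Proof. exact: integrable_measurable (integrable_expsqr r0). Qed.

Lemma fourier_dist_gaussian :
  is_function (fourier_dist (regular_dist phi)) (fun t => (gaussian_hat t)%:C).
Proof.
have FE : fourier phi = fun t => (gaussian_hat t)%:C.
  by apply/funext => t; rewrite fourier_gaussian// mulr0 oppr0 cexpi0 mul1r.
split; first by apply: cmeasurable_real; exact: measurable_gaussian_hat.
move=> psi sp; have ip := schwartz_cintegrable sp.
have [_ E1] := fourier_multiplication iphi ip; have [I2 _] := fourier_multiplication ip iphi.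
split; last by rewrite /fourier_dist /regular_dist E1 FE.
rewrite (_ : (fun t => _) = fun t => psi t * fourier phi t)//.
by apply/funext => t; rewrite FE mulrC.
Qed.

End point_evaluation.

Section finite_spectral_measure.
Context {d : measure_display} {Omega : measurableType d} {R : realType}.
Notation leb := (@lebesgue_measure R).
Variable P : probability Omega R.
Variable V : stationary_operator P.
Let nu := spectral_measure V.
Variable e : R.
Hypotheses (nuE : nu setT = e%:E) (Vreal : real_operator V).

Let ac : nu `<< leb. Proof. exact: spectral_measure_ac. Qed.

Let i1 : nu.-integrable setT (EFin \o (fun=> 1 : R)).
Proof.
apply/integrableP; split; first exact/measurable_EFinP.
rewrite (_ : (\int[nu]_x _)%E = nu setT) ?nuE ?ltry//.
by under eq_integral do rewrite /= normr1; rewrite integral_cst// mul1e.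
Qed.

Let E1 : \int[nu]_w (1 : R) = e.
Proof. by rewrite /Rintegral integral_cst// mul1e nuE. Qed.

Lemma L2_bounded (h : R -> R[i]) : cmeasurable h -> (forall w, Normc.normc (h w) <= 1) -> L2 nu h.
Proof.
move=> mh h1; apply/L2P; split=> //.
apply: (@integrable_dom _ _ _ nu _ (fun=> 1)) => //; first exact: measurable_sqr_normc.
by move=> w; rewrite ger0_norm ?sqr_ge0// exprn_ile1 ?normc_ge0.
Qed.

(** Point evaluation is admissible because the spectral mass is finite. *)
Lemma domain_delta t : domain V (delta_dist t).
Proof.
split; first exact: tempered_delta.
exists (fun w => cexpi (- (t * w))); split; first exact: fourier_delta.
apply: L2_bounded; first by have [] := fourier_delta t.
by move=> w; rewrite normc_expi.
Qed.

Let s_ (n : nat) : R := n.+1%:R^-1.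
Let s0 n : 0 < s_ n. Proof. by rewrite invr_gt0. Qed.
Let phi_ n : R -> R[i] := fun t => (normal_pdf 0 (s_ n) t)%:C.

Let domain_gaussian n : domain V (regular_dist (phi_ n)).
Proof.
split; first exact: tempered_gaussian.
exists (fun w => (gaussian_hat (s_ n) w)%:C); split; first exact: fourier_dist_gaussian.
apply: L2_bounded; first by apply: cmeasurable_real; exact: measurable_gaussian_hat.
by move=> w; rewrite normc_real; have /andP[h1 h2] := gaussian_hat01 (s_ n) w; rewrite ger0_norm.
Qed.

Let X := pairing V (delta_dist 0).
Let X_ n := pairing V (regular_dist (phi_ n)).

Let LX : L2 P X. Proof. by have [h _ [lX _]] := pairingP (domain_delta 0). Qed.

Lemma variance_delta : \int[P]_x Normc.normc (X x) ^+ 2 = e.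
Proof.
have [h [hf lh] si] := pairingP (domain_delta 0).
rewrite (stochastic_integral_norm (random_measureP V) lh si) -E1.
rewrite /Rintegral; congr fine; apply: ae_eq_integral => //.
- by apply/measurable_EFinP; apply: measurable_sqr_normc; case: lh.
- have := ae_dominates ac (fourier_function_unique hf (fourier_delta 0)).
  by apply: filterS => w -> _; rewrite mul0r oppr0 cexpi0 normc_real normr1 expr1n.
Qed.

Let distance_delta n : \int[P]_x Normc.normc (X x - X_ n x) ^+ 2 =
  \int[nu]_w (1 - gaussian_hat (s_ n) w) ^+ 2.
Proof.
have [h [hf lh] si] := pairingP (domain_delta 0).
have [g [gf lg] sj] := pairingP (domain_gaussian n).
have sB := stochastic_integralB (random_measureP V) lh lg si sj.
rewrite (stochastic_integral_norm (random_measureP V) (L2B lh lg) sB).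
rewrite /Rintegral; congr fine; apply: ae_eq_integral => //.
- by apply/measurable_EFinP; apply: measurable_sqr_normc; case: (L2B lh lg).
- apply/measurable_EFinP; apply: measurable_funX; apply: measurable_funB => //.
  exact: measurable_gaussian_hat.
- have a1 := ae_dominates ac (fourier_function_unique hf (fourier_delta 0)).
  have a2 := ae_dominates ac (fourier_function_unique gf (fourier_dist_gaussian (s0 n))).
  move: a2; apply: (@filterS2 _ _ (ae_filter_ringOfSetsType _) _ _ _ _ a1) => w -> -> _.
  rewrite mul0r oppr0 cexpi0 -[1 in LHS]/((1 : R)%:C) -rmorphB normc_real.
  by rewrite real_normK ?num_real.
Qed.

Let distance_cvg0 : \int[nu]_w (1 - gaussian_hat (s_ n) w) ^+ 2 @[n --> \oo] --> (0 : R).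
Proof.
have [_] : nu.-integrable setT (EFin \o (fun=> 0 : R)) /\
    \int[nu]_w (1 - gaussian_hat (s_ n) w) ^+ 2 @[n --> \oo] --> \int[nu]_w (0 : R).
  apply: (@dominated_Rintegral _ _ _ nu _ _ (fun=> 1)).
  - move=> n; apply: measurable_funX; apply: measurable_funB => //.
    exact: measurable_gaussian_hat.
  - exact: measurable_cst.
  - exact: i1.
  - apply: aeW => w; split=> [n|].
      have /andP[h1 h2] := gaussian_hat01 (s_ n) w.
      by rewrite ger0_norm ?sqr_ge0// exprn_ile1 ?subr_ge0// gerBl.
    have cs : s_ n @[n --> \oo] --> (0 : R) by exact: cvg_harmonic.
    have cg : gaussian_hat (s_ n) w @[n --> \oo] --> (1 : R).
      rewrite -(expR0 R); apply: continuous_cvg; first exact: continuous_expR.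
      rewrite (_ : 0 = - (0 * 0 * w ^+ 2 / 2) :> R); last by ring.
      apply: cvgN; apply: cvgM; last exact: cvg_cst.
      apply: cvgM; last exact: cvg_cst.
      by apply: cvgM; exact: cs.
    rewrite (_ : 0 = (1 - 1) * (1 - 1) :> R); last by ring.
    by apply: cvgM; apply: cvgB => //; exact: cvg_cst.
by rewrite /Rintegral integral0.
Qed.

(** The process is real because point evaluation is a limit of real Gaussian
    test functions in the mean square. *)
Lemma velocity_real : {ae P, forall x, complex.Im (X x) = 0}.
Proof.
have [mX iX] := (L2P _ _).1 LX.
have mI : measurable_fun setT (fun x => complex.Im (X x) ^+ 2).
  by apply: measurable_funX; case: mX.
have iI : P.-integrable setT (EFin \o (fun x => complex.Im (X x) ^+ 2)).
  apply: (@integrable_dom _ _ _ P _ _ mI iX) => x.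
  by rewrite ger0_norm ?sqr_ge0// normc_sqrE lerDr sqr_ge0.
have le n : \int[P]_x complex.Im (X x) ^+ 2 <= \int[nu]_w (1 - gaussian_hat (s_ n) w) ^+ 2.
  have LXn : L2 P (X_ n) by have [h _ [lX _]] := pairingP (domain_gaussian n).
  have [mD iD] := (L2P _ _).1 (L2B LX LXn).
  rewrite -distance_delta.
  have -> : \int[P]_x complex.Im (X x) ^+ 2 = \int[P]_x complex.Im (X x - X_ n x) ^+ 2.
    rewrite /Rintegral; congr fine; apply: ae_eq_integral => //.
    - exact/measurable_EFinP.
    - by apply/measurable_EFinP; apply: measurable_funX; case: mD.
    - have := Vreal (gaussian_schwartz 0 (s0 n)) (fun t => erefl).
      by apply: filterS => x xr _; rewrite ImD ImN xr oppr0 addr0.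
  apply: le_Rintegral => //.
  - apply: (@integrable_dom _ _ _ P _ _ _ iD).
      by apply: measurable_funX; case: mD.
    by move=> x; rewrite ger0_norm ?sqr_ge0// normc_sqrE lerDr sqr_ge0.
  - by move=> x _; rewrite normc_sqrE lerDr sqr_ge0.
have I0 : \int[P]_x complex.Im (X x) ^+ 2 = 0.
  apply/eqP; rewrite eq_le Rintegral_ge0 ?andbT; last by move=> x _; exact: sqr_ge0.
  rewrite -(cvg_lim _ distance_cvg0)//; apply: limr_ge; first exact: cvgP distance_cvg0.
  exact: nearW.
have : (\int[P]_x `|(complex.Im (X x) ^+ 2)%:E| = 0)%E.
  under eq_integral do rewrite gee0_abs ?lee_fin ?sqr_ge0//.
  by rewrite -[LHS]fineK; [exact: (congr1 EFin I0)|exact: integrable_fin_num iI].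
have mIe : measurable_fun setT (fun x => (complex.Im (X x) ^+ 2)%:E) by exact/measurable_EFinP.
move/(ae_eq_integral_abs P measurableT mIe).1 => [A [mA A0 HA]].
exists A; split=> // x /= h; apply: HA => /= H; apply: h.
by have [/eqP] := H I; rewrite sqrf_eq0 => /eqP.
Qed.

Lemma mean_square_velocity (m : R) :
  cexpect P (fun x => m%:C * velocity V 0 x ^+ 2) = (m * e)%:C.
Proof.
have [mX iX] := (L2P _ _).1 LX.
rewrite /cexpect (@ae_eq_cintegral _ _ _ P _ (fun x => (m * Normc.normc (X x) ^+ 2)%:C)).
- apply: eq_ReIm => /=; last by rewrite /Rintegral integral0.
  rewrite RintegralZl; [|exact: measurableT|exact: iX].
  by rewrite variance_delta.
- rewrite /velocity -/X; apply: cmeasurableM; first exact: cmeasurable_cst.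
  by under eq_fun do rewrite expr2; exact: cmeasurableM.
- apply: cmeasurable_real; apply: measurable_funM => //; exact: measurable_sqr_normc.
- have := velocity_real; apply: filterS => x xr.
  rewrite /velocity -/X normc_sqrE xr; apply: eq_ReIm; rewrite expr2 !ReImE /= xr; ring.
Qed.

End finite_spectral_measure.

Theorem theorem3p4 (R : realType) (d : measure_display)
    (Omega : measurableType d) (P : probability Omega R)
    (m lambda beta kBT : R) (K : R -> \bar R)
    (F Wdot : (R -> R[i]) -> Omega -> R[i]) (V : stationary_operator P) :
  0 < m -> 0 < lambda -> 0 < beta -> 0 < kBT ->
  kernel_range K -> kernel_I K -> kernel_II K -> kernel_III K ->
  stationary_random_distribution P F ->
  stationary_random_distribution P Wdot ->
  has_spectral_density P Wdot (fun _ => 1) ->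
  has_spectral_density P F (fun w => 2 * Kcos K w) ->
  uncorrelated P Wdot F ->
  real_operator V ->
  weak_stationary_solution m lambda beta kBT K F Wdot V ->
  (forall t : R, domain V (delta_dist t)) /\
  cexpect P (fun w => m%:C * velocity V 0 w ^+ 2) = kBT%:C.
Proof.
move=> m0 lam0 beta0 kBT0 Kr K1 K2 K3 _ _ Wd Fd _ Vreal weak.
have [k' [C [al sk]]] := slow_causal_kernel Kr K1 K2 K3.
have nuE := spectral_mass_weak_solution m0 lam0 beta0 kBT0 K1 Wd Fd weak sk.
split; first exact: domain_delta nuE.
by rewrite (mean_square_velocity nuE Vreal) mulrC divfK// gt_eqF.
Qed.
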